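(* (i) If $r\in\mathbb{C}\setminus\mathbb{Z}_{\ge2}$, the restriction morphism of sheaves $\rho_r:\mathcal{W}^\omega_r\to\mathcal{V}^\omega_{2-r}$ on $\mathbb{P}^1(\mathbb{R})$ is an isomorphism. (ii) Let $r\in\mathbb{Z}_{\ge1}$ and let $\mathcal{W}^{\omega,\mathrm{hol}}_r$ be the subsheaf of $\mathcal{W}^\omega_r$ given by $\mathcal{W}^{\omega,\mathrm{hol}}_r(I)=\varinjlim_U\mathcal{H}^{\mathrm{hol}}_r(U)$, $U$ running over the open neighbourhoods in $\mathbb{P}^1(\mathbb{C})$ of the open set $I\subset\mathbb{P}^1(\mathbb{R})$. (a) If $r=1$, then $\mathcal{W}^{\omega,\mathrm{hol}}_1=\mathcal{W}^\omega_1$. (b) If $r\in\mathbb{Z}_{\ge2}$, the sequence of sheaves $0\to\mathcal{W}^{\omega,\mathrm{hol}}_r\to\mathcal{W}^\omega_r\xrightarrow{\mathrm{res}_r}\mathcal{D}^{\mathrm{pol}}_{2-r}\to0$ is exact, where $\mathcal{D}^{\mathrm{pol}}_{2-r}$ is the space of polynomials of degree at most $r-2$, viewed as a constant sheaf on $\mathbb{P}^1(\mathbb{R})$.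
   Context: $\mathbb{H}$ upper half-plane, $z=x+iy$. For open $V\subset\mathbb{H}$, $\mathcal{H}_r(V)$ is the space of $C^2$ functions $F$ on $V$ with $-4y^2\partial_z\partial_{\bar z}F+2iry\partial_{\bar z}F=0$ ($r$-harmonic). Put $f_r(z)=\frac{2i}{z-i}\left(\frac{\bar z-i}{\bar z-z}\right)^{r-1}$ on $\mathbb{H}\setminus\{i\}$ (power defined by a continuous branch on $\mathbb{H}$). For open $U\subset\mathbb{P}^1(\mathbb{C})$: $\mathcal{H}^b_r(U)=\{F\in\mathcal{H}_r(U\cap\mathbb{H}):F/f_r$ has a real-analytic continuation to $U\}$; $\mathcal{H}^{\mathrm{hol}}_r(U)=\{F\in\mathcal{H}^b_r(U): F$ holomorphic on $U\cap\mathbb{H}$ with a holomorphic extension to $U\}$. For open $I\subset\mathbb{P}^1(\mathbb{R})$: $\mathcal{W}^\omega_r(I)=\varinjlim_U\mathcal{H}^b_r(U)$ and $\mathcal{V}^\omega_{2-r}(I)=\varinjlim_U\mathcal{O}(U)$ ($\mathcal{O}$ = holomorphic functions), $U$ over open neighbourhoods of $I$ in $\mathbb{P}^1(\mathbb{C})$ (i.e. $\mathcal{V}^\omega_{2-r}$ is the sheaf of real-analytic functions on $\mathbb{P}^1(\mathbb{R})$). The restriction morphism $\rho_r$ sends the germ of $F\in\mathcal{H}^b_r(U)$ to the germ along $I$ of the real-analytic function on $I$ obtained by restricting to $I$ the real-analytic continuation of $F/f_r$. $\mathrm{res}_r f(t)=(i-t)^{r-2}(\rho_rf)(t)$. *)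

(* Defs.v *)
From Stdlib Require Export Reals.
From Coquelicot Require Export Coquelicot.
Export Complex.
Open Scope R_scope.

Definition Cexp' (w : C) : C := (exp (Re w) * cos (Im w), exp (Re w) * sin (Im w)).

(** Principal logarithm, valid (and used only) on the right half-plane Re w > 0. *)
Definition Clog_rhp (w : C) : C := (ln (Cmod w), atan (Im w / Re w)).

Definition Cpow_rhp (w s : C) : C := Cexp' (Cmult s (Clog_rhp w)).

Fixpoint Cpown (w : C) (n : nat) : C :=
  match n with O => RtoC 1 | S k => Cmult w (Cpown w k) end.

Fixpoint peval (c : nat -> C) (n : nat) (t : R) : C :=
  match n with
  | O => c O
  | S k => Cplus (peval c k t) (Cmult (c (S k)) (Cpown (RtoC t) (S k)))
  end.

(** f_r(z) = 2i/(z-i) * ((zbar - i)/(zbar - z))^(r-1).  On H the base has positive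
    real part, so the principal branch is a continuous branch on H. *)
Definition f_r (r : C) (z : C) : C :=
  Cmult (Cdiv (Cmult (RtoC 2) Ci) (Cminus z Ci))
        (Cpow_rhp (Cdiv (Cminus (Cconj z) Ci) (Cminus (Cconj z) z)) (Cminus r (RtoC 1))).

Definition is_derive_RC (g : R -> C) (t : R) (l : C) : Prop :=
  is_derive (fun s => Re (g s)) t (Re l) /\ is_derive (fun s => Im (g s)) t (Im l).

Definition pdx (F : C -> C) (z : C) (l : C) : Prop :=
  is_derive_RC (fun t => F (t, Im z)) (Re z) l.
Definition pdy (F : C -> C) (z : C) (l : C) : Prop :=
  is_derive_RC (fun t => F (Re z, t)) (Im z) l.

Definition ccont (F : C -> C) (z : C) : Prop :=
  @continuous C_UniformSpace C_UniformSpace F z.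

Definition C2_with (V : C -> Prop) (F Fx Fy Fxx Fxy Fyx Fyy : C -> C) : Prop :=
  forall z, V z ->
    pdx F z (Fx z) /\ pdy F z (Fy z) /\
    pdx Fx z (Fxx z) /\ pdy Fx z (Fxy z) /\
    pdx Fy z (Fyx z) /\ pdy Fy z (Fyy z) /\
    ccont F z /\ ccont Fx z /\ ccont Fy z /\
    ccont Fxx z /\ ccont Fxy z /\ ccont Fyx z /\ ccont Fyy z.

(** r-harmonic on an open set V of H:
    -4 y^2 d_z d_zbar F + 2 i r y d_zbar F = 0, with
    d_zbar F = (F_x + i F_y)/2 and d_z G = (G_x - i G_y)/2. *)
Definition r_harmonic (r : C) (V : C -> Prop) (F : C -> C) : Prop :=
  open V /\ (forall z, V z -> 0 < Im z) /\
  exists Fx Fy Fxx Fxy Fyx Fyy : C -> C,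
    C2_with V F Fx Fy Fxx Fxy Fyx Fyy /\
    forall z, V z ->
      let dzb := Cdiv (Cplus (Fx z) (Cmult Ci (Fy z))) (RtoC 2) in
      let dzb_x := Cdiv (Cplus (Fxx z) (Cmult Ci (Fyx z))) (RtoC 2) in
      let dzb_y := Cdiv (Cplus (Fxy z) (Cmult Ci (Fyy z))) (RtoC 2) in
      let dz_dzb := Cdiv (Cminus dzb_x (Cmult Ci dzb_y)) (RtoC 2) in
      Cplus (Cmult (RtoC (- 4 * (Im z) ^ 2)) dz_dzb)
            (Cmult (Cmult (Cmult (RtoC 2) Ci) (Cmult r (RtoC (Im z)))) dzb) = RtoC 0.

(** * The Riemann sphere P^1(C) = C + {oo} (None = oo) and P^1(R) = R + {oo} *)

Definition P1C := option C.
Definition P1R := option R.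

Definition C_eq_dec (a b : C) : {a = b} + {a <> b}.
Proof.
  destruct a as [a1 a2], b as [b1 b2].
  destruct (Req_dec_T a1 b1) as [e1|n1]; [|right; intro H; inversion H; auto].
  destruct (Req_dec_T a2 b2) as [e2|n2]; [left; subst; reflexivity|right; intro H; inversion H; auto].
Defined.

Definition chart_inf (w : C) : P1C :=
  if C_eq_dec w (RtoC 0) then None else Some (Cinv w).

Definition open_P1C (U : P1C -> Prop) : Prop :=
  open (fun z : C => U (Some z)) /\
  (U None -> exists M : R, forall z : C, M < Cmod z -> U (Some z)).

Definition open_P1R (I : P1R -> Prop) : Prop :=
  open (fun x : R => I (Some x)) /\
  (I None -> exists M : R, forall x : R, M < Rabs x -> I (Some x)).

Definition P1R_to_P1C (p : P1R) : P1C :=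
  match p with Some x => Some (RtoC x) | None => None end.

Definition nbhd (U : P1C -> Prop) (I : P1R -> Prop) : Prop :=
  open_P1C U /\ forall p, I p -> U (P1R_to_P1C p).

Definition dseries (b : nat -> nat -> R) (s : R) : Prop :=
  (forall m, ex_series (fun n => Rabs (b m n))) /\
  ex_series (fun m => Series (fun n => Rabs (b m n))) /\
  s = Series (fun m => Series (fun n => b m n)).

Definition pseries2 (a : nat -> nat -> C) (u v : R) (g : C) : Prop :=
  dseries (fun m n => Re (a m n) * u ^ m * v ^ n) (Re g) /\
  dseries (fun m n => Im (a m n) * u ^ m * v ^ n) (Im g).

Definition ra_chart (G : P1C -> C) (phi : C -> P1C) : Prop :=
  exists (rho : R) (a : nat -> nat -> C), 0 < rho /\
    forall u v : R, Rabs u < rho -> Rabs v < rho -> pseries2 a u v (G (phi (u, v))).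

Definition real_analytic_P1 (U : P1C -> Prop) (G : P1C -> C) : Prop :=
  (forall z : C, U (Some z) -> ra_chart G (fun w => Some (Cplus z w))) /\
  (U None -> ra_chart G chart_inf).

Definition holo_P1 (U : P1C -> Prop) (h : P1C -> C) : Prop :=
  (forall z : C, U (Some z) ->
     @ex_derive C_AbsRing C_NormedModule (fun w => h (Some w)) z) /\
  (U None -> @ex_derive C_AbsRing C_NormedModule (fun w => h (chart_inf w)) (RtoC 0)).

Definition UH (U : P1C -> Prop) : C -> Prop := fun z => U (Some z) /\ 0 < Im z.

Definition continuation (r : C) (U : P1C -> Prop) (F : C -> C) (G : P1C -> C) : Prop :=
  real_analytic_P1 U G /\
  forall z, UH U z -> z <> Ci -> G (Some z) = Cdiv (F z) (f_r r z).

Definition Hb (r : C) (U : P1C -> Prop) (F : C -> C) : Prop :=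
  open_P1C U /\ r_harmonic r (UH U) F /\ exists G, continuation r U F G.

Definition Hhol (r : C) (U : P1C -> Prop) (F : C -> C) : Prop :=
  Hb r U F /\
  (forall z, UH U z -> @ex_derive C_AbsRing C_NormedModule F z) /\
  exists Fh : P1C -> C, holo_P1 U Fh /\ forall z, UH U z -> Fh (Some z) = F z.

(** * Germs along an open I of P^1(R) (sections of the direct-limit sheaves) *)

Definition Wsec (r : C) (I : P1R -> Prop) (F : C -> C) : Prop :=
  exists U, nbhd U I /\ Hb r U F.

Definition Wholsec (r : C) (I : P1R -> Prop) (F : C -> C) : Prop :=
  exists U, nbhd U I /\ Hhol r U F.

Definition Wgerm_eq (I : P1R -> Prop) (F1 F2 : C -> C) : Prop :=
  exists U, nbhd U I /\ forall z, UH U z -> F1 z = F2 z.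

Definition Vsec (I : P1R -> Prop) (h : P1C -> C) : Prop :=
  exists U, nbhd U I /\ holo_P1 U h.

Definition cont_germ (r : C) (I : P1R -> Prop) (F : C -> C) (G : P1C -> C) : Prop :=
  exists U, nbhd U I /\ Hb r U F /\ continuation r U F G.

Definition rho_eq (r : C) (I : P1R -> Prop) (F : C -> C) (h : P1C -> C) : Prop :=
  exists G, cont_germ r I F G /\ forall p, I p -> G (P1R_to_P1C p) = h (P1R_to_P1C p).

(** res_r F(t) = (i - t)^(r-2) (rho_r F)(t), at real t *)
Definition res_val (r : nat) (G : P1C -> C) (t : R) : C :=
  Cmult (Cpown (Cminus Ci (RtoC t)) (r - 2)) (G (Some (RtoC t))).

(* Main.v *)
(** In the coordinates a = 1/(z-i), b = 1/(conj z - i), in which infinity is an ordinary point, the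
    equation for F = f_r G says that e = (b-a) G_b + (1-r) G satisfies e_a = 0. Near a real point G extends
    to a holomorphic function of two independent variables a, b; there e depends on b only, and the diagonal
    a = b, which contains the real points, gives (b-a) G_b + (1-r) G = (1-r) h(b) with h(t) = G(t,t) the
    boundary value. Expanding in powers of b - a, this reads (n+1-r) g_n(a) = (1-r) h_n(a). If r is not an
    integer >= 2 it determines G from h, and solves for G: this is (i). If r >= 2 is an integer, the
    coefficient n = r-1 forces h_(r-1) = 0, so that h is a polynomial of degree at most r-2 in a, and every
    such h occurs; if h = 0, then G = d(a) (b-a)^(r-1), which means that F is holomorphic up to the
    boundary. Conversely f_r tends to infinity at the real points, so that G = F/f_r vanishes there for
    F holomorphic up to the boundary. *)

Require Import Defs.
From Stdlib Require Import Lra Lia Psatz ClassicalEpsilon FunctionalExtensionality.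
Open Scope R_scope.
Open Scope C_scope.

(** Real analyticity of G in a real chart becomes holomorphy in (a, b): the double power series in u
    = (w + conj w)/2, v = (w - conj w)/(2i) keeps its meaning when w and conj w are made
    independent. Functions of two variables are only required to be separately holomorphic and
    bounded; Cauchy's formula and uniform limits then give joint differentiability and the double
    expansion. The obstacle is the sheaf language: a section is one function on one neighbourhood of
    I, whereas the equation is solved near each point of I, with radii and representatives that
    depend on the point. Nothing is glued. Each object to be produced (the boundary value [bdry],
    the solution [bvp], the extension [hext]) is a formula that does not mention the chosen point,
    so that only pointwise properties have to be checked locally, and a union of small
    neighbourhoods does the rest. The value r = 1 stands apart: the boundary term drops out of the
    equation, which says (b - a) G_b = 0, and G itself is holomorphic in a. *)

(** * Elementary estimates for the modulus *)

Lemma lt_min {x a b : R} : x < Rmin a b -> x < a /\ x < b.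
Proof. apply Rmin_Rgt. Qed.

Lemma div_nonneg (a b : R) : 0 <= a -> 0 < b -> 0 <= a / b.
Proof. intros Ha Hb. apply Rmult_le_pos; [auto|]. left. apply Rinv_0_lt_compat; auto. Qed.

Lemma div_lt_1 (a b : R) : 0 < b -> a < b -> a / b < 1.
Proof.
  intros Hb H. apply Rmult_lt_reg_r with b; [auto|]. unfold Rdiv. rewrite Rmult_assoc, Rinv_l; lra.
Qed.

Lemma Cmod_tri3 (a b c : C) : Cmod (a - c) <= Cmod (a - b) + Cmod (b - c).
Proof. replace (a - c) with ((a - b) + (b - c)) by ring. apply Cmod_triangle. Qed.

Lemma Cmod_sym (a b : C) : Cmod (a - b) = Cmod (b - a).
Proof. replace (a - b) with (- (b - a)) by ring. apply Cmod_opp. Qed.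

Lemma Cmod_sub_le (a b : C) : Cmod (a - b) <= Cmod a + Cmod b.
Proof. unfold Cminus. rewrite <- (Cmod_opp b). apply Cmod_triangle. Qed.

Lemma Cmod_rev (a b : C) : (Cmod a - Cmod b <= Cmod (a - b))%R.
Proof.
  assert (H := Cmod_triangle (a - b) b). replace (a - b + b) with a in H by ring. lra.
Qed.

Lemma Cmod_le_sum (z : C) : Cmod z <= Rabs (Re z) + Rabs (Im z).
Proof.
  destruct z as [x y]; simpl.
  replace ((x, y) : C) with ((RtoC x + Ci * RtoC y)%C).
  2:{ apply injective_projections; simpl; ring. }
  eapply Rle_trans; [apply Cmod_triangle|].
  rewrite Cmod_mult, Cmod_Ci, !Cmod_R. lra.
Qed.

Lemma Re_le_Cmod (z : C) : Rabs (Re z) <= Cmod z.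
Proof. apply re_le_Cmod. Qed.

Lemma Im_le_Cmod (z : C) : Rabs (Im z) <= Cmod z.
Proof.
  eapply Rle_trans; [apply Rmax_r|]. apply (Rmax_Cmod z).
Qed.

Lemma Cmod_lt_nz (a b : C) : Cmod (a - b) < Cmod b -> a <> 0.
Proof.
  intros H E. subst a. replace (0 - b) with (- b) in H by ring. rewrite Cmod_opp in H. lra.
Qed.

Lemma C_eq_lim (a b : C) : (forall e, 0 < e -> Cmod (a - b) <= e) -> a = b.
Proof.
  intros H. apply Ceq_minus. apply Cmod_eq_0. apply Rle_antisym; [|apply Cmod_ge_0].
  apply le_epsilon. intros e He. rewrite Rplus_0_l. auto.
Qed.

(** * Complex derivatives *)

(** The filter-free form of complex differentiability; the non-strict inequality allows w = z.
    [is_derive_cd] identifies it with the notion used in the definitions. *)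
Definition cd (f : C -> C) (z l : C) : Prop :=
  forall eps, 0 < eps -> exists d, 0 < d /\ forall w, Cmod (w - z) < d ->
    Cmod (f w - f z - l * (w - z)) <= eps * Cmod (w - z).

Definition cct (f : C -> C) (z : C) : Prop :=
  forall eps, 0 < eps -> exists d, 0 < d /\ forall w, Cmod (w - z) < d -> Cmod (f w - f z) < eps.

Lemma ball_of_Cmod (z w : C) (e : posreal) : Cmod (w - z) < e -> @ball C_UniformSpace z e w.
Proof. intros H. apply C_NormedModule_mixin_compat1. exact H. Qed.

(** The uniform structure on [C] is that of a product, so its balls are squares; the factor 2 pays
    for the passage to discs. *)
Lemma Cmod_of_ball (z w : C) (e : posreal) : @ball C_UniformSpace z e w -> Cmod (w - z) < 2 * e.
Proof.
  intros [H1 H2]. eapply Rle_lt_trans; [apply Cmod_le_sum|].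
  assert (Rabs (Re (w - z)) < e) by exact H1.
  assert (Rabs (Im (w - z)) < e) by exact H2. lra.
Qed.

Lemma locally_C (z : C) (P : C -> Prop) :
  @locally C_UniformSpace z P <-> exists d, 0 < d /\ forall w, Cmod (w - z) < d -> P w.
Proof.
  split.
  - intros [e He]. exists e. split; [apply cond_pos|]. intros w Hw. apply He, ball_of_Cmod, Hw.
  - intros [d [Hd H]]. exists (mkposreal (d / 2) ltac:(lra)). intros w Hw. apply H.
    apply Cmod_of_ball in Hw. simpl in Hw. lra.
Qed.

Lemma open_C (P : C -> Prop) : @open C_UniformSpace P <->
  forall z, P z -> exists d, 0 < d /\ forall w, Cmod (w - z) < d -> P w.
Proof. unfold open. split; intros H z Hz; apply locally_C, H, Hz. Qed.

Lemma cct_ccont (f : C -> C) z : cct f z <-> ccont f z.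
Proof.
  split; intros H.
  - intros P HP. apply locally_C in HP. destruct HP as [d [Hd HP]].
    destruct (H d Hd) as [d' [Hd' H']]. apply locally_C. exists d'. split; auto.
  - intros e He. assert (HP : @locally C_UniformSpace (f z) (fun w => Cmod (w - f z) < e)).
    { apply locally_C. exists e. auto. }
    apply H in HP. apply locally_C in HP. exact HP.
Qed.

Lemma is_derive_cd (f : C -> C) z l :
  @is_derive C_AbsRing C_NormedModule f z l <-> cd f z l.
Proof.
  split.
  - intros [_ H] e He.
    specialize (H z (fun P HP => HP)).
    specialize (H (mkposreal e He)).
    destruct H as [d H]. exists d. split; [apply cond_pos|].
    intros w Hw. specialize (H w Hw).
    change (Cmod ((f w - f z) - (w - z) * l) <= e * Cmod (w - z)) in H.
    replace (f w - f z - l * (w - z)) with ((f w - f z) - (w - z) * l) by ring. exact H.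
  - intros H. split.
    + apply is_linear_scal_l.
    + intros x Hx. assert (x = z) by (symmetry; apply (is_filter_lim_locally_unique (K:=C_AbsRing) (V:=AbsRing_NormedModule C_AbsRing) z x Hx)). subst x.
      intros e. destruct (H e (cond_pos e)) as [d [Hd H']].
      exists (mkposreal d Hd). intros w Hw. specialize (H' w Hw).
      change (Cmod ((f w - f z) - (w - z) * l) <= e * Cmod (w - z)).
      replace (f w - f z - (w - z) * l) with ((f w - f z) - l * (w - z)) by ring. exact H'.
Qed.

Lemma ex_derive_cd (f : C -> C) z :
  @ex_derive C_AbsRing C_NormedModule f z <-> exists l, cd f z l.
Proof. split; intros [l H]; exists l; apply is_derive_cd, H. Qed.

Lemma cd_cct (f : C -> C) z l : cd f z l -> cct f z.
Proof.
  intros H e He. destruct (H 1%R Rlt_0_1) as [d [Hd H1]].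
  assert (Hc : (0 < 1 + Cmod l)%R) by (assert (A := Cmod_ge_0 l); lra).
  exists (Rmin d (e / (2 * (1 + Cmod l)))). split.
  { apply Rmin_case; [lra|]. apply Rdiv_lt_0_compat; lra. }
  intros w Hw. assert (Hw1 : Cmod (w - z) < d) by (eapply Rlt_le_trans; [exact Hw|apply Rmin_l]).
  assert (Hw2 : Cmod (w - z) < e / (2 * (1 + Cmod l))) by (eapply Rlt_le_trans; [exact Hw|apply Rmin_r]).
  specialize (H1 w Hw1).
  replace (f w - f z) with ((f w - f z - l * (w - z)) + l * (w - z)) by ring.
  eapply Rle_lt_trans; [apply Cmod_triangle|]. rewrite Cmod_mult.
  apply Rle_lt_trans with ((1 + Cmod l) * Cmod (w - z))%R; [lra|].
  apply Rle_lt_trans with ((1 + Cmod l) * (e / (2 * (1 + Cmod l))))%R.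
  - apply Rmult_le_compat_l; lra.
  - replace ((1 + Cmod l) * (e / (2 * (1 + Cmod l))))%R with (e / 2)%R by (field; lra). lra.
Qed.

Lemma cd_ext_loc (f g : C -> C) z l d : 0 < d -> (forall w, Cmod (w - z) < d -> f w = g w) -> cd f z l -> cd g z l.
Proof.
  intros Hd He H e e0. destruct (H e e0) as [d1 [Hd1 H1]].
  exists (Rmin d d1). split; [apply Rmin_case; lra|]. intros w Hw.
  rewrite <- He by (eapply Rlt_le_trans; [exact Hw|apply Rmin_l]).
  rewrite <- (He z) by (replace (z - z) with (RtoC 0) by ring; rewrite Cmod_0; lra).
  apply H1. eapply Rlt_le_trans; [exact Hw|apply Rmin_r].
Qed.

Lemma cd_ext (f g : C -> C) z l : (forall w, f w = g w) -> cd f z l -> cd g z l.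
Proof. intros H. apply (cd_ext_loc f g z l 1%R); auto. lra. Qed.

Lemma cct_ext_loc (f g : C -> C) z d : 0 < d -> (forall w, Cmod (w - z) < d -> f w = g w) -> cct f z -> cct g z.
Proof.
  intros Hd He H e e0. destruct (H e e0) as [d1 [Hd1 H1]].
  exists (Rmin d d1). split; [apply Rmin_case; lra|]. intros w Hw.
  rewrite <- He by (eapply Rlt_le_trans; [exact Hw|apply Rmin_l]).
  rewrite <- (He z) by (replace (z - z) with (RtoC 0) by ring; rewrite Cmod_0; lra).
  apply H1. eapply Rlt_le_trans; [exact Hw|apply Rmin_r].
Qed.

Lemma cd_val (f : C -> C) z l l' : l = l' -> cd f z l -> cd f z l'.
Proof. intros ->; auto. Qed.

Lemma cd_const (c z : C) : cd (fun _ => c) z 0.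
Proof.
  intros e He. exists 1%R. split; [lra|]. intros w _.
  replace (c - c - 0 * (w - z)) with (RtoC 0) by ring. rewrite Cmod_0.
  apply Rmult_le_pos; [lra|apply Cmod_ge_0].
Qed.

Lemma cd_id (z : C) : cd (fun w => w) z 1.
Proof.
  intros e He. exists 1%R. split; [lra|]. intros w _.
  replace (w - z - 1 * (w - z)) with (RtoC 0) by ring. rewrite Cmod_0.
  apply Rmult_le_pos; [lra|apply Cmod_ge_0].
Qed.

Lemma cd_plus (f g : C -> C) z l m : cd f z l -> cd g z m -> cd (fun w => f w + g w) z (l + m).
Proof.
  intros Hf Hg e He. destruct (Hf (e/2)%R ltac:(lra)) as [d1 [Hd1 H1]].
  destruct (Hg (e/2)%R ltac:(lra)) as [d2 [Hd2 H2]].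
  exists (Rmin d1 d2). split; [apply Rmin_case; lra|]. intros w Hw.
  specialize (H1 w (proj1 (lt_min Hw))).
  specialize (H2 w (proj2 (lt_min Hw))).
  replace (f w + g w - (f z + g z) - (l + m) * (w - z)) with
    ((f w - f z - l * (w - z)) + (g w - g z - m * (w - z))) by ring.
  eapply Rle_trans; [apply Cmod_triangle|]. lra.
Qed.

Lemma cct_mult (f g : C -> C) z : cct f z -> cct g z -> cct (fun w => f w * g w) z.
Proof.
  intros Hf Hg e He.
  set (K := (1 + Cmod (f z) + Cmod (g z))%R).
  assert (HK : 1 <= K) by (unfold K; assert (A := Cmod_ge_0 (f z)); assert (B := Cmod_ge_0 (g z)); lra).
  set (e' := Rmin 1 (e / (2 * K))).
  assert (He' : 0 < e') by (apply Rmin_case; [lra|apply Rdiv_lt_0_compat; lra]).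
  destruct (Hf e' He') as [d1 [Hd1 H1]]. destruct (Hg e' He') as [d2 [Hd2 H2]].
  exists (Rmin d1 d2). split; [apply Rmin_case; lra|]. intros w Hw.
  specialize (H1 w (proj1 (lt_min Hw))).
  specialize (H2 w (proj2 (lt_min Hw))).
  replace (f w * g w - f z * g z) with
    ((f w - f z) * (g w - g z) + f z * (g w - g z) + (f w - f z) * g z) by ring.
  eapply Rle_lt_trans; [apply Cmod_triangle|].
  eapply Rle_lt_trans; [apply Rplus_le_compat_r, Cmod_triangle|]. rewrite !Cmod_mult.
  assert (A0 := Cmod_ge_0 (f w - f z)). assert (B0 := Cmod_ge_0 (g w - g z)).
  assert (A := Cmod_ge_0 (f z)); assert (B := Cmod_ge_0 (g z)).
  assert (e' <= 1) by apply Rmin_l.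
  assert (E2 : e' <= e / (2 * K)) by apply Rmin_r.
  apply Rle_lt_trans with (e' * K)%R.
  - unfold K.
    assert (Cmod (f w - f z) * Cmod (g w - g z) <= e' * 1)%R by (apply Rmult_le_compat; lra).
    assert (Cmod (f z) * Cmod (g w - g z) <= Cmod (f z) * e')%R by (apply Rmult_le_compat_l; lra).
    assert (Cmod (f w - f z) * Cmod (g z) <= e' * Cmod (g z))%R by (apply Rmult_le_compat_r; lra).
    lra.
  - apply Rle_lt_trans with (e / (2 * K) * K)%R; [apply Rmult_le_compat_r; lra|].
    replace (e / (2 * K) * K)%R with (e / 2)%R by (field; lra). lra.
Qed.

Lemma cct_const (c z : C) : cct (fun _ => c) z.
Proof. eapply cd_cct, cd_const. Qed.

Lemma cct_id (z : C) : cct (fun w => w) z.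
Proof. eapply cd_cct, cd_id. Qed.

Lemma cct_plus (f g : C -> C) z : cct f z -> cct g z -> cct (fun w => f w + g w) z.
Proof.
  intros Hf Hg e He. destruct (Hf (e/2)%R ltac:(lra)) as [d1 [Hd1 H1]].
  destruct (Hg (e/2)%R ltac:(lra)) as [d2 [Hd2 H2]].
  exists (Rmin d1 d2). split; [apply Rmin_case; lra|]. intros w Hw.
  specialize (H1 w (proj1 (lt_min Hw))).
  specialize (H2 w (proj2 (lt_min Hw))).
  replace (f w + g w - (f z + g z)) with ((f w - f z) + (g w - g z)) by ring.
  eapply Rle_lt_trans; [apply Cmod_triangle|]. lra.
Qed.

Lemma cct_comp (f g : C -> C) z : cct g z -> cct f (g z) -> cct (fun w => f (g w)) z.
Proof.
  intros Hg Hf e He. destruct (Hf e He) as [d [Hd H]]. destruct (Hg d Hd) as [d2 [Hd2 H2]].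
  exists d2. split; auto.
Qed.

(* Caratheodory's form of differentiability: the rules below reduce to continuity of the slope. *)
Lemma cd_slope (f : C -> C) z l : cd f z l <->
  exists s, s z = l /\ cct s z /\ forall w, f w = f z + s w * (w - z).
Proof.
  split.
  - intros H. exists (fun w => if C_eq_dec w z then l else (f w - f z) / (w - z)).
    split; [|split].
    + destruct (C_eq_dec z z); congruence.
    + intros e He. destruct (H (e/2)%R ltac:(lra)) as [d [Hd H']]. exists d. split; auto.
      intros w Hw. destruct (C_eq_dec z z) as [_|]; [|congruence].
      destruct (C_eq_dec w z) as [->|n].
      { replace (l - l) with (RtoC 0) by ring. rewrite Cmod_0. lra. }
      assert (n' : w - z <> 0) by (apply Cminus_eq_contra; auto).
      specialize (H' w Hw).
      replace ((f w - f z) / (w - z) - l) with ((f w - f z - l * (w - z)) / (w - z)) by (field; auto).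
      rewrite Cmod_div by auto. assert (P := proj1 (Cmod_gt_0 _) n').
      apply Rle_lt_trans with (e / 2)%R; [|lra].
      apply Rmult_le_reg_r with (Cmod (w - z)); auto.
      replace (Cmod (f w - f z - l * (w - z)) / Cmod (w - z) * Cmod (w - z))%R
        with (Cmod (f w - f z - l * (w - z))) by (field; lra). lra.
    + intros w. destruct (C_eq_dec w z) as [->|n]; [ring|].
      field. apply Cminus_eq_contra; auto.
  - intros [s [Hs [Hc Hf]]] e He. destruct (Hc e He) as [d [Hd H]]. exists d. split; auto.
    intros w Hw. specialize (H w Hw). rewrite Hs in H. rewrite (Hf w).
    replace (f z + s w * (w - z) - f z - l * (w - z)) with ((s w - l) * (w - z)) by ring.
    rewrite Cmod_mult. apply Rmult_le_compat_r; [apply Cmod_ge_0|lra].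
Qed.

Lemma cd_mult (f g : C -> C) z l m : cd f z l -> cd g z m ->
  cd (fun w => f w * g w) z (l * g z + f z * m).
Proof.
  intros Hf Hg. assert (Cf := cd_cct _ _ _ Hf).
  apply cd_slope in Hf. apply cd_slope in Hg.
  destruct Hf as [s [Hs [Cs Fs]]]. destruct Hg as [t [Ht [Ct Ft]]].
  apply cd_slope. exists (fun w => s w * g z + f w * t w). split; [|split].
  - rewrite Hs, Ht. reflexivity.
  - apply cct_plus; apply cct_mult; auto. apply cct_const.
  - intros w. rewrite (Ft w). rewrite (Fs w). ring.
Qed.

Lemma cd_comp (f g : C -> C) z l m : cd g z m -> cd f (g z) l -> cd (fun w => f (g w)) z (l * m).
Proof.
  intros Hg Hf. assert (Cg := cd_cct _ _ _ Hg).
  apply cd_slope in Hf. apply cd_slope in Hg.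
  destruct Hf as [s [Hs [Cs Fs]]]. destruct Hg as [t [Ht [Ct Ft]]].
  apply cd_slope. exists (fun w => s (g w) * t w). split; [|split].
  - rewrite Hs, Ht. reflexivity.
  - apply cct_mult; auto. apply (cct_comp s g); auto.
  - intros w. rewrite (Fs (g w)). rewrite (Ft w) at 2. ring.
Qed.

Lemma cct_inv (z : C) : z <> 0 -> cct Cinv z.
Proof.
  intros Hz e He. assert (P := proj1 (Cmod_gt_0 _) Hz).
  exists (Rmin (Cmod z / 2) (e * (Cmod z * Cmod z) / 4)). split.
  { apply Rmin_case; [lra|]. apply Rdiv_lt_0_compat; [|lra]. repeat apply Rmult_lt_0_compat; lra. }
  intros w Hw.
  destruct (lt_min Hw) as [H1 H2].
  assert (H3 : Cmod z / 2 <= Cmod w).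
  { assert (A := Cmod_rev z w). rewrite Cmod_sym in A. lra. }
  assert (Hw0 : w <> 0) by (apply Cmod_gt_0; lra).
  replace (/ w - / z) with ((z - w) / (w * z)) by (field; auto).
  rewrite Cmod_div by (apply Cmult_neq_0; auto). rewrite Cmod_mult, Cmod_sym.
  apply Rle_lt_trans with (Cmod (w - z) / (Cmod z / 2 * Cmod z))%R.
  - apply Rmult_le_compat_l; [apply Cmod_ge_0|]. apply Rinv_le_contravar.
    + apply Rmult_lt_0_compat; lra.
    + apply Rmult_le_compat_r; lra.
  - apply Rmult_lt_reg_r with (Cmod z / 2 * Cmod z)%R; [apply Rmult_lt_0_compat; lra|].
    replace (Cmod (w - z) / (Cmod z / 2 * Cmod z) * (Cmod z / 2 * Cmod z))%R with (Cmod (w - z)) by (field; lra).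
    eapply Rlt_le_trans; [exact H2|]. assert (0 < e * (Cmod z * Cmod z))%R by (repeat apply Rmult_lt_0_compat; lra). lra.
Qed.

Lemma cd_inv (z : C) : z <> 0 -> cd Cinv z (- / (z * z)).
Proof.
  intros Hz. assert (P := proj1 (Cmod_gt_0 _) Hz).
  (* Only w near z matters; the conventional value of the inverse at 0 is replaced by that of the
     tangent, so that one slope formula covers all w. *)
  assert (K : cd (fun w => if C_eq_dec w 0 then / z - / (z*z) * (w - z) else / w) z (- / (z * z))).
  { apply cd_slope. exists (fun w => if C_eq_dec w 0 then - / (z * z) else - (/ w * / z)).
    split; [|split].
    - destruct (C_eq_dec z 0); [contradiction|]. field; auto.
    - apply (cct_ext_loc (fun w => (- / z) * / w) _ z (Cmod z)); auto.
      + intros w Hw. assert (w <> 0) by (apply (Cmod_lt_nz w z); auto).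
        destruct (C_eq_dec w 0); [contradiction|]. field; auto.
      + apply cct_mult; [apply cct_const|apply cct_inv; auto].
    - intros w. destruct (C_eq_dec z 0); [contradiction|].
      destruct (C_eq_dec w 0) as [->|]; field; auto. }
  eapply cd_ext_loc; [exact P| |exact K].
  intros w Hw. assert (w <> 0) by (apply (Cmod_lt_nz w z); auto).
  simpl. destruct (C_eq_dec w 0); [contradiction|reflexivity].
Qed.

Lemma cd_opp (f : C -> C) z l : cd f z l -> cd (fun w => - f w) z (- l).
Proof.
  intros H. apply (cd_ext (fun w => (-1) * f w)); [intros; ring|].
  apply cd_val with (0 * f z + (-1) * l); [ring|]. apply cd_mult; auto. apply cd_const.
Qed.

Lemma cd_minus (f g : C -> C) z l m : cd f z l -> cd g z m -> cd (fun w => f w - g w) z (l - m).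
Proof. intros. apply cd_plus; auto. apply cd_opp; auto. Qed.

Lemma cd_scal (c : C) (f : C -> C) z l : cd f z l -> cd (fun w => c * f w) z (c * l).
Proof.
  intros H. apply cd_val with (0 * f z + c * l); [ring|]. apply cd_mult; auto. apply cd_const.
Qed.

Lemma cd_invf (f : C -> C) z l : f z <> 0 -> cd f z l -> cd (fun w => / f w) z (- l / (f z * f z)).
Proof.
  intros Hz H. apply cd_val with (- / (f z * f z) * l); [field; auto|].
  apply (cd_comp Cinv f); auto. apply cd_inv; auto.
Qed.

Lemma cd_unique (f : C -> C) z l m : cd f z l -> cd f z m -> l = m.
Proof.
  intros H1 H2. apply C_eq_lim. intros e He.
  destruct (H1 (e/2)%R ltac:(lra)) as [d1 [Hd1 K1]]. destruct (H2 (e/2)%R ltac:(lra)) as [d2 [Hd2 K2]].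
  set (h := (Rmin d1 d2 / 2)%R). assert (Hm : 0 < Rmin d1 d2) by (apply Rmin_case; lra).
  assert (Hh : 0 < h) by (unfold h; lra).
  assert (E : Cmod (z + RtoC h - z) = h).
  { replace (z + RtoC h - z) with (RtoC h) by ring. rewrite Cmod_R. apply Rabs_pos_eq. lra. }
  specialize (K1 (z + RtoC h)). specialize (K2 (z + RtoC h)). rewrite E in K1, K2.
  assert (A1 := Rmin_l d1 d2). assert (A2 := Rmin_r d1 d2).
  specialize (K1 ltac:(unfold h; lra)). specialize (K2 ltac:(unfold h; lra)).
  apply Rmult_le_reg_r with h; auto.
  replace (Cmod (l - m) * h)%R with (Cmod ((l - m) * (z + RtoC h - z))) by (rewrite Cmod_mult, E; reflexivity).
  replace ((l - m) * (z + RtoC h - z)) with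
    ((f (z + RtoC h) - f z - m * (z + RtoC h - z)) - (f (z + RtoC h) - f z - l * (z + RtoC h - z))) by ring.
  eapply Rle_trans; [apply Cmod_sub_le|]. lra.
Qed.

Lemma cd_pow (n : nat) (z : C) : cd (fun w => w ^ n) z (RtoC (INR n) * z ^ (pred n)).
Proof.
  induction n as [|n IH].
  - simpl. apply cd_val with (RtoC 0); [ring|]. apply cd_const.
  - apply (cd_ext (fun w => w * w ^ n)); [reflexivity|].
    eapply cd_val; [|apply cd_mult; [apply cd_id|apply IH]].
    rewrite S_INR, RtoC_plus. simpl pred. destruct n; simpl; ring.
Qed.

(** * Integrals of complex functions of a real variable *)

(* Continuity at t of a curve, phrased on the plane so that the rules for cct apply. *)
Definition rct (g : R -> C) (t : R) : Prop := cct (fun z => g (Re z)) t.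

Lemma rct_eps (g : R -> C) (t : R) : rct g t ->
  forall e, 0 < e -> exists d, 0 < d /\ forall s : R, Rabs (s - t) < d -> Cmod (g s - g t) < e.
Proof.
  intros H e He. destruct (H e He) as [d [Hd K]]. exists d. split; auto. intros s Hs.
  apply (K (RtoC s)). rewrite <- RtoC_minus, Cmod_R. exact Hs.
Qed.

Definition rcti (g : R -> C) (a b : R) : Prop := forall t : R, a <= t <= b -> rct g t.

Definition CI (g : R -> C) (a b : R) : C :=
  (RInt (fun t => Re (g t)) a b, RInt (fun t => Im (g t)) a b).

Lemma continuous_of_lip (g : R -> C) (p : C -> R) t :
  (forall z w : C, Rabs (p z - p w) <= Cmod (z - w)) -> rct g t -> continuous (fun s => p (g s)) t.
Proof.
  intros Hp Hg P [e HP]. destruct (rct_eps g t Hg e (cond_pos e)) as [d [Hd H]].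
  exists (mkposreal d Hd). intros s Hs. apply HP.
  change (Rabs (p (g s) - p (g t)) < e)%R. eapply Rle_lt_trans; [apply Hp|]. apply H, Hs.
Qed.

Lemma rct_Re (g : R -> C) t : rct g t -> continuous (fun s => Re (g s)) t.
Proof. apply continuous_of_lip. intros z w. apply (Re_le_Cmod (z - w)). Qed.

Lemma rct_Im (g : R -> C) t : rct g t -> continuous (fun s => Im (g s)) t.
Proof. apply continuous_of_lip. intros z w. apply (Im_le_Cmod (z - w)). Qed.

Lemma rcti_ex_Re (g : R -> C) (a b : R) : a <= b -> rcti g a b -> ex_RInt (fun s => Re (g s)) a b.
Proof.
  intros Hab Hg. apply (ex_RInt_continuous (V := R_CompleteNormedModule)).
  intros z Hz. rewrite Rmin_left, Rmax_right in Hz by auto. apply rct_Re, Hg, Hz.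
Qed.

Lemma rcti_ex_Im (g : R -> C) (a b : R) : a <= b -> rcti g a b -> ex_RInt (fun s => Im (g s)) a b.
Proof.
  intros Hab Hg. apply (ex_RInt_continuous (V := R_CompleteNormedModule)).
  intros z Hz. rewrite Rmin_left, Rmax_right in Hz by auto. apply rct_Im, Hg, Hz.
Qed.

Lemma CI_ext (f g : R -> C) (a b : R) : a <= b -> (forall t : R, a <= t <= b -> f t = g t) -> CI f a b = CI g a b.
Proof.
  intros Hab H. unfold CI. f_equal; apply RInt_ext; intros x Hx;
  rewrite Rmin_left, Rmax_right in Hx by auto; rewrite H by lra; reflexivity.
Qed.

Lemma CI_plus (f g : R -> C) (a b : R) : a <= b -> rcti f a b -> rcti g a b ->
  CI (fun t => f t + g t) a b = CI f a b + CI g a b.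
Proof.
  intros Hab Hf Hg. unfold CI.
  apply injective_projections; simpl.
  - apply (RInt_plus (V := R_CompleteNormedModule) (fun t => Re (f t)) (fun t => Re (g t))); apply rcti_ex_Re; auto.
  - apply (RInt_plus (V := R_CompleteNormedModule) (fun t => Im (f t)) (fun t => Im (g t))); apply rcti_ex_Im; auto.
Qed.

Lemma CI_scal (c : C) (f : R -> C) (a b : R) : a <= b -> rcti f a b ->
  CI (fun t => c * f t) a b = c * CI f a b.
Proof.
  intros Hab Hf.
  assert (H1 := rcti_ex_Re f a b Hab Hf). assert (H2 := rcti_ex_Im f a b Hab Hf).
  destruct c as [p q]. unfold CI.
  apply injective_projections; simpl.
  - transitivity (minus (scal p (RInt (fun t => Re (f t)) a b)) (scal q (RInt (fun t => Im (f t)) a b))).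
    2: reflexivity.
    rewrite <- (RInt_scal (V := R_CompleteNormedModule)) by auto.
    rewrite <- (RInt_scal (V := R_CompleteNormedModule)) by auto.
    rewrite <- (RInt_minus (V := R_CompleteNormedModule)).
    2,3: apply (ex_RInt_scal (V := R_CompleteNormedModule)); auto.
    apply RInt_ext. intros; reflexivity.
  - transitivity (plus (scal p (RInt (fun t => Im (f t)) a b)) (scal q (RInt (fun t => Re (f t)) a b))).
    2: reflexivity.
    rewrite <- (RInt_scal (V := R_CompleteNormedModule)) by auto.
    rewrite <- (RInt_scal (V := R_CompleteNormedModule)) by auto.
    rewrite <- (RInt_plus (V := R_CompleteNormedModule)).
    2,3: apply (ex_RInt_scal (V := R_CompleteNormedModule)); auto.
    apply RInt_ext. intros; reflexivity.
Qed.

Lemma CI_Chasles (f : R -> C) (a b c : R) : a <= b -> b <= c -> rcti f a c ->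
  CI f a b + CI f b c = CI f a c.
Proof.
  intros Hab Hbc Hf.
  assert (F1 : rcti f a b) by (intros t Ht; apply Hf; lra).
  assert (F2 : rcti f b c) by (intros t Ht; apply Hf; lra).
  unfold CI. apply injective_projections; simpl.
  - apply (RInt_Chasles (V := R_CompleteNormedModule)); apply rcti_ex_Re; auto.
  - apply (RInt_Chasles (V := R_CompleteNormedModule)); apply rcti_ex_Im; auto.
Qed.

(* The factor 2 comes from integrating both components separately. *)
Lemma CI_bound (f : R -> C) (a b M : R) : a <= b -> rcti f a b ->
  (forall t : R, a <= t <= b -> Cmod (f t) <= M) -> Cmod (CI f a b) <= 2 * M * (b - a).
Proof.
  intros Hab Hf HM.
  eapply Rle_trans; [apply Cmod_le_sum|]. unfold CI; simpl.
  assert (A : Rabs (RInt (fun t => Re (f t)) a b) <= (b - a) * M).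
  { apply abs_RInt_le_const; auto. apply rcti_ex_Re; auto.
    intros t Ht. eapply Rle_trans; [apply Re_le_Cmod|auto]. }
  assert (B : Rabs (RInt (fun t => Im (f t)) a b) <= (b - a) * M).
  { apply abs_RInt_le_const; auto. apply rcti_ex_Im; auto.
    intros t Ht. eapply Rle_trans; [apply Im_le_Cmod|auto]. }
  lra.
Qed.

Lemma CI_const (c : C) (a b : R) : CI (fun _ => c) a b = RtoC (b - a) * c.
Proof.
  unfold CI. rewrite !(RInt_const (V := R_CompleteNormedModule)).
  apply injective_projections; simpl; unfold scal; simpl; unfold mult; simpl; unfold Re, Im; ring.
Qed.

Lemma CI_id (a b : R) : CI (fun t => RtoC t) a b = (RtoC b * RtoC b - RtoC a * RtoC a) * / RtoC 2.
Proof.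
  assert (E : RInt (fun t : R => t) a b = ((b * b - a * a) / 2)%R).
  { apply is_RInt_unique.
    replace ((b * b - a * a) / 2)%R with (minus (b * b / 2) (a * a / 2))%R.
    2:{ unfold minus, plus, opp; simpl. field. }
    apply (is_RInt_derive (fun t => t * t / 2)%R).
    - intros x _. auto_derive; auto. field.
    - intros x _. apply continuous_id. }
  unfold CI. simpl. unfold Re, Im. simpl.
  rewrite E. rewrite (RInt_const (V := R_CompleteNormedModule)).
  rewrite <- RtoC_inv by lra. rewrite <- !RtoC_mult, <- RtoC_minus, <- RtoC_mult.
  unfold scal; simpl; unfold mult; simpl. unfold RtoC. f_equal; unfold Rdiv; ring.
Qed.

Lemma rct_comp (f : C -> C) (g : R -> C) t : rct g t -> cct f (g t) -> rct (fun s => f (g s)) t.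
Proof. apply (cct_comp f (fun z => g (Re z))). Qed.

Lemma rct_ext (f g : R -> C) t : (forall s, f s = g s) -> rct f t -> rct g t.
Proof. intros E H. apply (cct_ext_loc (fun z => f (Re z)) _ t 1); auto. lra. Qed.

Lemma rct_lip (g : R -> C) (K : R) (t : R) : 0 <= K -> (forall s : R, Cmod (g s - g t) <= K * Rabs (s - t)) -> rct g t.
Proof.
  intros HK H e He. exists (e / (K + 1))%R. split; [apply Rdiv_lt_0_compat; lra|].
  intros z Hz. assert (A := Re_le_Cmod (z - RtoC t)). change (Re (z - RtoC t)) with (Re z - t)%R in A.
  eapply Rle_lt_trans; [apply (H (Re z))|].
  apply Rle_lt_trans with ((K) * (e / (K + 1)))%R; [apply Rmult_le_compat_l; lra|].
  apply Rmult_lt_reg_r with (K + 1)%R; [lra|]. field_simplify; [|lra]. nra.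
Qed.

Lemma rct_const (c : C) t : rct (fun _ => c) t.
Proof. apply cct_const. Qed.

Lemma rct_mult (f g : R -> C) t : rct f t -> rct g t -> rct (fun s => f s * g s) t.
Proof. apply cct_mult. Qed.

Lemma rct_plus (f g : R -> C) t : rct f t -> rct g t -> rct (fun s => f s + g s) t.
Proof. apply cct_plus. Qed.

Lemma rct_scal (c : C) (f : R -> C) t : rct f t -> rct (fun s => c * f s) t.
Proof. apply rct_mult. apply rct_const. Qed.

Lemma rct_RtoC t : rct (fun s => RtoC s) t.
Proof. apply (rct_lip _ 1); [lra|]. intros s. rewrite <- RtoC_minus, Cmod_R. lra. Qed.

(** * Goursat's lemma *)

(** The height comes first, so that [hpath y] parametrises a horizontal line; vertical lines vary
    the first argument. *)
Definition hpath (y : R) (x : R) : C := RtoC x + Ci * RtoC y.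

Lemma rct_h (y t : R) : rct (fun x => hpath y x) t.
Proof. apply rct_plus; [apply rct_RtoC|apply rct_const]. Qed.

Lemma rct_v (x t : R) : rct (fun y => hpath y x) t.
Proof. apply rct_plus; [apply rct_const|apply rct_scal, rct_RtoC]. Qed.

Definition HI (g : C -> C) (y a b : R) : C := CI (fun x => g (hpath y x)) a b.
Definition VI (g : C -> C) (x a b : R) : C := CI (fun y => g (hpath y x)) a b.

(** The contour integral of g along the boundary of the rectangle, counterclockwise. *)
Definition rectI (g : C -> C) (x1 x2 y1 y2 : R) : C :=
  HI g y1 x1 x2 - HI g y2 x1 x2 + Ci * (VI g x2 y1 y2 - VI g x1 y1 y2).

Definition rectP (P : C -> Prop) (x1 x2 y1 y2 : R) : Prop :=
  forall x y : R, x1 <= x <= x2 -> y1 <= y <= y2 -> P (hpath y x).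

Lemma rcti_H (g : C -> C) (x1 x2 y1 y2 y : R) : rectP (cct g) x1 x2 y1 y2 -> y1 <= y <= y2 ->
  rcti (fun x => g (hpath y x)) x1 x2.
Proof. intros H Hy t Ht. apply (rct_comp g (fun x => hpath y x)); [apply rct_h|apply H; auto]. Qed.

Lemma rcti_V (g : C -> C) (x1 x2 y1 y2 x : R) : rectP (cct g) x1 x2 y1 y2 -> x1 <= x <= x2 ->
  rcti (fun y => g (hpath y x)) y1 y2.
Proof. intros H Hy t Ht. apply (rct_comp g (fun y => hpath y x)); [apply rct_v|apply H; auto]. Qed.

Lemma rectI_split (g : C -> C) (x1 x2 x3 y1 y2 y3 : R) : x1 <= x2 -> x2 <= x3 -> y1 <= y2 -> y2 <= y3 ->
  rectP (cct g) x1 x3 y1 y3 ->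
  rectI g x1 x3 y1 y3 = rectI g x1 x2 y1 y2 + rectI g x2 x3 y1 y2 + rectI g x1 x2 y2 y3 + rectI g x2 x3 y2 y3.
Proof.
  intros A1 A2 B1 B2 H. unfold rectI.
  assert (HH : forall y : R, y1 <= y <= y3 -> HI g y x1 x3 = HI g y x1 x2 + HI g y x2 x3).
  { intros y Hy. symmetry. apply CI_Chasles; auto. eapply rcti_H; eauto. }
  assert (VV : forall x : R, x1 <= x <= x3 -> VI g x y1 y3 = VI g x y1 y2 + VI g x y2 y3).
  { intros x Hx. symmetry. apply CI_Chasles; auto. eapply rcti_V; eauto. }
  rewrite !HH, !VV by lra. ring.
Qed.

Lemma rectI_plus (f g : C -> C) (x1 x2 y1 y2 : R) : x1 <= x2 -> y1 <= y2 ->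
  rectP (cct f) x1 x2 y1 y2 -> rectP (cct g) x1 x2 y1 y2 ->
  rectI (fun z => f z + g z) x1 x2 y1 y2 = rectI f x1 x2 y1 y2 + rectI g x1 x2 y1 y2.
Proof.
  intros Hx Hy Hf Hg. unfold rectI, HI, VI.
  rewrite !CI_plus; auto; try (eapply rcti_H; eauto; lra); try (eapply rcti_V; eauto; lra). ring.
Qed.

Lemma rectI_bound (g : C -> C) (x1 x2 y1 y2 M : R) : x1 <= x2 -> y1 <= y2 ->
  rectP (cct g) x1 x2 y1 y2 -> rectP (fun z => Cmod (g z) <= M) x1 x2 y1 y2 ->
  Cmod (rectI g x1 x2 y1 y2) <= 4 * M * ((x2 - x1) + (y2 - y1)).
Proof.
  intros Hx Hy Hg HM. unfold rectI.
  assert (HH : forall y : R, y1 <= y <= y2 -> Cmod (HI g y x1 x2) <= 2 * M * (x2 - x1)).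
  { intros y Hy'. apply CI_bound; auto. eapply rcti_H; eauto. }
  assert (VV : forall x : R, x1 <= x <= x2 -> Cmod (VI g x y1 y2) <= 2 * M * (y2 - y1)).
  { intros x Hx'. apply CI_bound; auto. eapply rcti_V; eauto. }
  eapply Rle_trans; [apply Cmod_triangle|]. rewrite Cmod_mult, Cmod_Ci.
  assert (K1 := Cmod_sub_le (HI g y1 x1 x2) (HI g y2 x1 x2)).
  assert (K2 := Cmod_sub_le (VI g x2 y1 y2) (VI g x1 y1 y2)).
  assert (h1 := HH y1 ltac:(lra)). assert (h2 := HH y2 ltac:(lra)).
  assert (v1 := VV x1 ltac:(lra)). assert (v2 := VV x2 ltac:(lra)). lra.
Qed.

Lemma rectI_affine (c l : C) (x1 x2 y1 y2 : R) : x1 <= x2 -> y1 <= y2 ->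
  rectI (fun z => c + l * z) x1 x2 y1 y2 = 0.
Proof.
  intros Hx Hy.
  assert (HH : forall y : R, HI (fun z => c + l * z) y x1 x2 =
    RtoC (x2 - x1) * (c + l * (Ci * RtoC y)) + l * ((RtoC x2 * RtoC x2 - RtoC x1 * RtoC x1) * / RtoC 2)).
  { intros y. unfold HI.
    rewrite (CI_ext _ (fun x => (c + l * (Ci * RtoC y)) + l * RtoC x)).
    2: auto. 2: intros; unfold hpath; ring.
    rewrite CI_plus, CI_scal, CI_const, CI_id; auto; intros t Ht;
    try apply rct_const; try apply rct_scal; apply rct_RtoC. }
  assert (VV : forall x : R, VI (fun z => c + l * z) x y1 y2 =
    RtoC (y2 - y1) * (c + l * RtoC x) + (l * Ci) * ((RtoC y2 * RtoC y2 - RtoC y1 * RtoC y1) * / RtoC 2)).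
  { intros x. unfold VI.
    rewrite (CI_ext _ (fun y => (c + l * RtoC x) + (l * Ci) * RtoC y)).
    2: auto. 2: intros; unfold hpath; ring.
    rewrite CI_plus, CI_scal, CI_const, CI_id; auto; intros t Ht;
    try apply rct_const; try apply rct_scal; apply rct_RtoC. }
  unfold rectI. rewrite !HH, !VV. rewrite !RtoC_minus. ring.
Qed.

Lemma quarter_bound (a b c d : C) (K : R) : 4 * K <= Cmod (a + b + c + d) ->
  K <= Cmod a \/ K <= Cmod b \/ K <= Cmod c \/ K <= Cmod d.
Proof.
  intros H. destruct (Rle_dec K (Cmod a)); auto. destruct (Rle_dec K (Cmod b)); auto.
  destruct (Rle_dec K (Cmod c)); auto. destruct (Rle_dec K (Cmod d)); auto. exfalso.
  assert (A := Cmod_triangle (a + b + c) d). assert (B := Cmod_triangle (a + b) c). assert (D := Cmod_triangle a b).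
  lra.
Qed.

(** The intervals [x n, x n + A/2^n] are nested, so the supremum of their left ends lies in all of
    them. *)
Lemma nested_sup (x : nat -> R) (A : R) : 0 <= A ->
  (forall n, x n <= x (S n) <= x n + A / 2 ^ (S n))%R ->
  exists s : R, forall n, (x n <= s <= x n + A / 2 ^ n)%R.
Proof.
  intros HA H.
  assert (D : forall n, (x (S n) + A / 2 ^ (S n) <= x n + A / 2 ^ n)%R).
  { intros n. specialize (H n). assert (0 < 2 ^ n)%R by (apply pow_lt; lra).
    replace (A / 2 ^ n)%R with (A / 2 ^ S n + A / 2 ^ S n)%R by (simpl; field; lra). lra. }
  assert (Hpos : forall n, (0 <= A / 2 ^ n)%R).
  { intros n. apply Rmult_le_pos; auto. left. apply Rinv_0_lt_compat, pow_lt. lra. }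
  assert (M1 : forall n m, (x n <= x (n + m)%nat)%R).
  { intros n m. induction m; [rewrite Nat.add_0_r; lra|]. rewrite Nat.add_succ_r. specialize (H (n + m)%nat). lra. }
  assert (M2 : forall n m, (x (n + m)%nat + A / 2 ^ (n + m) <= x n + A / 2 ^ n)%R).
  { intros n m. induction m; [rewrite Nat.add_0_r; lra|]. rewrite Nat.add_succ_r. specialize (D (n + m)%nat). lra. }
  assert (Ub : forall n m, (x m <= x n + A / 2 ^ n)%R).
  { intros n m. destruct (Nat.le_ge_cases n m) as [L|L].
    - destruct (Nat.le_exists_sub n m L) as [k [-> _]]. rewrite Nat.add_comm.
      eapply Rle_trans; [|apply (M2 n k)]. specialize (Hpos (n + k)%nat). lra.
    - destruct (Nat.le_exists_sub m n L) as [k [-> _]]. rewrite (Nat.add_comm k m).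
      eapply Rle_trans; [apply (M1 m k)|]. specialize (Hpos (m + k)%nat). lra. }
  destruct (completeness (fun r => exists n, r = x n)) as [s [S1 S2]].
  - exists (x 0%nat + A / 2 ^ 0)%R. intros r [n ->]. apply Ub.
  - exists (x 0%nat). exists 0%nat. reflexivity.
  - exists s. intros n. split; [apply S1; exists n; auto|]. apply S2. intros r [m ->]. apply Ub.
Qed.

(** Bisection: if the integral had modulus beta > 0, one quarter at every stage would keep at least
    a fourth of the previous modulus. The quarters shrink to a point z, and near z the affine part
    of g integrates to 0, while the remainder is small compared with the diameter; this makes the
    n-th integral smaller than beta/4^n. *)
Lemma goursat (g : C -> C) (x1 x2 y1 y2 : R) : x1 <= x2 -> y1 <= y2 ->
  rectP (fun z => exists l, cd g z l) x1 x2 y1 y2 -> rectI g x1 x2 y1 y2 = 0.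
Proof.
  intros Hx Hy Hd.
  assert (Hc : rectP (cct g) x1 x2 y1 y2).
  { intros x y H1 H2. destruct (Hd x y H1 H2) as [l Hl]. eapply cd_cct; eauto. }
  apply Cmod_eq_0. destruct (Rle_lt_or_eq_dec 0 _ (Cmod_ge_0 (rectI g x1 x2 y1 y2))) as [Hb|<-]; [exfalso|reflexivity].
  set (beta := Cmod (rectI g x1 x2 y1 y2)) in *.
  set (A := (x2 - x1)%R). set (B := (y2 - y1)%R).
  assert (HA : 0 <= A) by (unfold A; lra). assert (HB : 0 <= B) by (unfold B; lra).
  (* p is the lower left corner of a rectangle of stage n which lies in the original one and carries
     at least beta/4^n. *)
  set (good := fun (n : nat) (p : R * R) => (x1 <= fst p /\ fst p + A / 2 ^ n <= x2 /\ y1 <= snd p /\ snd p + B / 2 ^ n <= y2 /\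
     beta / 4 ^ n <= Cmod (rectI g (fst p) (fst p + A / 2 ^ n) (snd p) (snd p + B / 2 ^ n)))%R).
  assert (step : forall n p, good n p -> exists q, good (S n) q /\
     (fst p <= fst q <= fst p + A / 2 ^ (S n))%R /\ (snd p <= snd q <= snd p + B / 2 ^ (S n))%R).
  { intros n [x y] [G1 [G2 [G3 [G4 G5]]]]. simpl fst in *. simpl snd in *.
    assert (P2 : (0 < 2 ^ n)%R) by (apply pow_lt; lra).
    assert (EA : (A / 2 ^ n = A / 2 ^ S n + A / 2 ^ S n)%R) by (simpl; field; lra).
    assert (EB : (B / 2 ^ n = B / 2 ^ S n + B / 2 ^ S n)%R) by (simpl; field; lra).
    assert (QA : (0 <= A / 2 ^ S n)%R).
    { apply Rmult_le_pos; auto. left. apply Rinv_0_lt_compat, pow_lt. lra. }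
    assert (QB : (0 <= B / 2 ^ S n)%R).
    { apply Rmult_le_pos; auto. left. apply Rinv_0_lt_compat, pow_lt. lra. }
    rewrite (rectI_split g x (x + A / 2 ^ S n) (x + A / 2 ^ n) y (y + B / 2 ^ S n) (y + B / 2 ^ n)) in G5; try lra.
    2:{ intros u v Hu Hv. apply Hc; lra. }
    assert (P4 : (0 < 4 ^ n)%R) by (apply pow_lt; lra).
    replace (beta / 4 ^ n)%R with (4 * (beta / 4 ^ S n))%R in G5 by (simpl; field; lra).
    set (a := (A / 2 ^ S n)%R) in *. set (b := (B / 2 ^ S n)%R) in *.
    assert (EX : (x + A / 2 ^ n = x + a + a)%R) by lra.
    assert (EY : (y + B / 2 ^ n = y + b + b)%R) by lra.
    rewrite EX, EY in G5.
    apply quarter_bound in G5. destruct G5 as [G|[G|[G|G]]].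
    - exists (x, y). unfold good; simpl fst; simpl snd. fold a; fold b. repeat split; try lra. 
    - exists ((x + a)%R, y). unfold good; simpl fst; simpl snd. fold a; fold b. repeat split; try lra.
    - exists (x, (y + b)%R). unfold good; simpl fst; simpl snd. fold a; fold b. repeat split; try lra.
    - exists ((x + a)%R, (y + b)%R). unfold good; simpl fst; simpl snd. fold a; fold b. repeat split; try lra. }
  assert (G0 : good 0%nat (x1, y1)).
  { unfold good; simpl fst; simpl snd.
    replace (x1 + A / 2 ^ 0)%R with x2 by (unfold A; simpl; field).
    replace (y1 + B / 2 ^ 0)%R with y2 by (unfold B; simpl; field).
    repeat split; try lra. fold beta. simpl. lra. }
  (* One of the four quarters is selected by choice; [step] guarantees that a suitable one
     exists. *)
  set (nx := fun (n : nat) (p : R * R) => epsilon (inhabits p) (fun q => good (S n) q /\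
     (fst p <= fst q <= fst p + A / 2 ^ (S n))%R /\ (snd p <= snd q <= snd p + B / 2 ^ (S n))%R)).
  set (sq := fix sq n := match n with O => (x1, y1) | S k => nx k (sq k) end).
  assert (Gs : forall n, good n (sq n)).
  { induction n; [exact G0|]. simpl. unfold nx. apply (epsilon_spec (inhabits (sq n)) (fun q => good (S n) q /\
     (fst (sq n) <= fst q <= fst (sq n) + A / 2 ^ (S n))%R /\ (snd (sq n) <= snd q <= snd (sq n) + B / 2 ^ (S n))%R)).
    apply step, IHn. }
  assert (Ss : forall n, (fst (sq n) <= fst (sq (S n)) <= fst (sq n) + A / 2 ^ (S n))%R /\
                         (snd (sq n) <= snd (sq (S n)) <= snd (sq n) + B / 2 ^ (S n))%R).
  { intros n. simpl sq. apply (epsilon_spec (inhabits (sq n)) (fun q => good (S n) q /\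
     (fst (sq n) <= fst q <= fst (sq n) + A / 2 ^ (S n))%R /\ (snd (sq n) <= snd q <= snd (sq n) + B / 2 ^ (S n))%R)).
    apply step, Gs. }
  destruct (nested_sup (fun n => fst (sq n)) A HA (fun n => proj1 (Ss n))) as [xs Hxs].
  destruct (nested_sup (fun n => snd (sq n)) B HB (fun n => proj2 (Ss n))) as [ys Hys].
  set (z := hpath ys xs).
  assert (Hz : exists l, cd g z l).
  { apply Hd.
    - destruct (Gs 0%nat) as [? [? _]]. specialize (Hxs 0%nat). simpl in Hxs. simpl in *. lra.
    - destruct (Gs 0%nat) as [_ [_ [? [? _]]]]. specialize (Hys 0%nat). simpl in Hys. simpl in *. lra. }
  destruct Hz as [l Hl].
  set (L := (A + B)%R).
  (* With this e the bound 4 e L^2 obtained at the end is at most beta/2; the summand 1 covers the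
     degenerate case L = 0. *)
  set (e := (beta / (8 * (L * L + 1)))%R).
  assert (HL : 0 <= L) by (unfold L; lra).
  assert (HL2 : 0 <= L * L) by (apply Rmult_le_pos; auto).
  assert (He : 0 < e) by (apply Rdiv_lt_0_compat; lra).
  destruct (Hl e He) as [d [Hd0 Hd1]].
  assert (Hn : exists n, (L / 2 ^ n < d)%R).
  { destruct (pow_lt_1_zero (/2) ltac:(rewrite Rabs_pos_eq; lra) (d / (L + 1)) ltac:(apply Rdiv_lt_0_compat; lra)) as [n Hn].
    exists n. specialize (Hn n (le_n n)). rewrite Rabs_pos_eq in Hn by (apply pow_le; lra).
    rewrite pow_inv in Hn by lra.
    assert (0 < / 2 ^ n)%R by (apply Rinv_0_lt_compat, pow_lt; lra).
    unfold Rdiv at 1. apply Rle_lt_trans with ((L + 1) * / 2 ^ n)%R; [nra|].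
    apply Rlt_le_trans with ((L + 1) * (d / (L + 1)))%R; [apply Rmult_lt_compat_l; lra|].
    right. field. lra. }
  destruct Hn as [n Hn].
  destruct (Gs n) as [G1 [G2 [G3 [G4 G5]]]]. specialize (Hxs n). specialize (Hys n). simpl in Hxs, Hys.
  destruct (sq n) as [x y]. simpl fst in *. simpl snd in *.
  set (a := (A / 2 ^ n)%R) in *. set (b := (B / 2 ^ n)%R) in *.
  assert (Ha : 0 <= a) by (apply Rmult_le_pos; [auto|]; left; apply Rinv_0_lt_compat, pow_lt; lra).
  assert (Hb' : 0 <= b) by (apply Rmult_le_pos; [auto|]; left; apply Rinv_0_lt_compat, pow_lt; lra).
  assert (Eab : (a + b = L / 2 ^ n)%R) by (unfold a, b, L, Rdiv; ring).
  assert (Near : forall u v : R, x <= u <= x + a -> y <= v <= y + b -> Cmod (hpath v u - z) <= a + b).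
  { intros u v Hu Hv. eapply Rle_trans; [apply Cmod_le_sum|]. unfold z, hpath. simpl.
    replace (u + (0 * v - 1 * 0) + - (xs + (0 * ys - 1 * 0)))%R with (u - xs)%R by ring.
    replace (0 + (0 * 0 + 1 * v) + - (0 + (0 * 0 + 1 * ys)))%R with (v - ys)%R by ring.
    apply Rplus_le_compat; apply Rabs_le; lra. }
  (* Subtracting the tangent at z does not change the integral, because affine functions integrate
     to 0. *)
  set (rr := fun w => g w - ((g z - l * z) + l * w)).
  assert (Cr : rectP (cct rr) x (x + a) y (y + b)).
  { intros u v Hu Hv. destruct (Hd u v ltac:(lra) ltac:(lra)) as [m Hm].
    eapply cd_cct. apply cd_minus; [exact Hm|]. apply cd_plus; [apply cd_const|]. apply cd_scal, cd_id. }
  assert (Caff : rectP (cct (fun w => (g z - l * z) + l * w)) x (x + a) y (y + b)).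
  { intros u v Hu Hv. eapply cd_cct. apply cd_plus; [apply cd_const|]. apply cd_scal, cd_id. }
  assert (E : rectI g x (x + a) y (y + b) = rectI rr x (x + a) y (y + b)).
  { assert (E1 := rectI_plus rr (fun w => (g z - l * z) + l * w) x (x + a) y (y + b) ltac:(lra) ltac:(lra) Cr Caff).
    rewrite rectI_affine in E1 by lra. rewrite Cplus_0_r in E1. rewrite <- E1.
    unfold rectI, HI, VI, rr.
    rewrite !(fun y0 => CI_ext (fun x0 => g (hpath y0 x0)) (fun x0 => g (hpath y0 x0) - (g z - l * z + l * hpath y0 x0) + (g z - l * z + l * hpath y0 x0)) x (x + a)) by (intros; try ring; lra).
    rewrite !(fun x0 => CI_ext (fun y0 => g (hpath y0 x0)) (fun y0 => g (hpath y0 x0) - (g z - l * z + l * hpath y0 x0) + (g z - l * z + l * hpath y0 x0)) y (y + b)) by (intros; try ring; lra).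
    reflexivity. }
  rewrite E in G5.
  assert (Bd := rectI_bound rr x (x + a) y (y + b) (e * (a + b)) ltac:(lra) ltac:(lra) Cr).
  assert (Hbd : rectP (fun z0 => Cmod (rr z0) <= e * (a + b)) x (x + a) y (y + b)).
  { intros u v Hu Hv. specialize (Near u v Hu Hv).
    specialize (Hd1 (hpath v u) ltac:(lra)). unfold rr.
    replace (g (hpath v u) - (g z - l * z + l * hpath v u)) with (g (hpath v u) - g z - l * (hpath v u - z)) by ring.
    eapply Rle_trans; [exact Hd1|]. apply Rmult_le_compat_l; lra. }
  specialize (Bd Hbd).
  replace (x + a - x + (y + b - y))%R with (a + b)%R in Bd by ring.
  assert (F : (beta / 4 ^ n <= 4 * (e * (a + b)) * (a + b))%R) by lra.
  rewrite Eab in F.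
  assert (P4 : (0 < 2 ^ n)%R) by (apply pow_lt; lra).
  replace (4 ^ n)%R with (2 ^ n * 2 ^ n)%R in F by (rewrite <- Rpow_mult_distr; f_equal; ring).
  apply (Rmult_le_compat_r (2 ^ n * 2 ^ n)) in F; [|nra].
  replace (beta / (2 ^ n * 2 ^ n) * (2 ^ n * 2 ^ n))%R with beta in F by (field; lra).
  replace (4 * (e * (L / 2 ^ n)) * (L / 2 ^ n) * (2 ^ n * 2 ^ n))%R with (4 * e * (L * L))%R in F by (field; lra).
  unfold e in F.
  replace (4 * (beta / (8 * (L * L + 1))) * (L * L))%R with (beta / 2 * (L * L / (L * L + 1)))%R in F by (field; lra).
  assert (L * L / (L * L + 1) <= 1)%R.
  { apply Rmult_le_reg_r with (L * L + 1)%R; [lra|]. unfold Rdiv. rewrite Rmult_assoc, Rinv_l; lra. }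
  nra.
Qed.

(** * Cauchy's formula on a disc *)

Definition cis (t : R) : C := (cos t, sin t).

Lemma Cmod_cis t : Cmod (cis t) = 1%R.
Proof.
  transitivity (sqrt 1); [|apply sqrt_1]. unfold Cmod, cis. f_equal.
  assert (A := sin2_cos2 t). unfold Rsqr in A. simpl. lra.
Qed.

Lemma sin_lip x y : Rabs (sin x - sin y) <= Rabs (x - y).
Proof.
  destruct (MVT_gen sin y x cos) as [c [_ ->]].
  - intros t _. auto_derive; auto. ring.
  - intros t _. apply continuity_sin.
  - rewrite Rabs_mult. assert (Rabs (cos c) <= 1) by (apply Rabs_le, COS_bound).
    assert (A := Rabs_pos (x - y)). nra.
Qed.

Lemma cos_lip x y : Rabs (cos x - cos y) <= Rabs (x - y).
Proof.
  destruct (MVT_gen cos y x (fun t => - sin t)%R) as [c [_ ->]].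
  - intros t _. auto_derive; auto. ring.
  - intros t _. apply continuity_cos.
  - rewrite Rabs_mult, Rabs_Ropp. assert (Rabs (sin c) <= 1) by (apply Rabs_le, SIN_bound).
    assert (A := Rabs_pos (x - y)). nra.
Qed.

Lemma cis_lip x y : Cmod (cis x - cis y) <= 2 * Rabs (x - y).
Proof.
  eapply Rle_trans; [apply Cmod_le_sum|].
  change (Rabs (cos x - cos y) + Rabs (sin x - sin y) <= 2 * Rabs (x - y)).
  assert (A := sin_lip x y). assert (B := cos_lip x y). lra.
Qed.

Lemma rct_cis (r t : R) : rct (fun s => RtoC r * cis s) t.
Proof.
  apply rct_scal. apply (rct_lip _ 2); [lra|]. intros s. apply cis_lip.
Qed.

Lemma Cmod_circ (r t : R) : 0 <= r -> Cmod (RtoC r * cis t) = r.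
Proof. intros H. rewrite Cmod_mult, Cmod_cis, Cmod_R, Rabs_pos_eq; lra. Qed.

Lemma Cexp'_hpath (x y : R) : Cexp' (hpath y x) = RtoC (exp x) * cis y.
Proof.
  unfold Cexp', hpath, cis. simpl.
  replace (x + (0 * y - 1 * 0))%R with x by ring.
  replace (0 + (0 * 0 + 1 * y))%R with y by ring.
  apply injective_projections; simpl; ring.
Qed.

Lemma hpath_eta (z : C) : hpath (Im z) (Re z) = z.
Proof. destruct z; unfold hpath; apply injective_projections; simpl; ring. Qed.

Lemma Cexp'_plus (z w : C) : Cexp' (z + w) = Cexp' z * Cexp' w.
Proof.
  unfold Cexp'. simpl. rewrite exp_plus, cos_plus, sin_plus.
  apply injective_projections; unfold Re, Im; simpl; unfold Re, Im; ring.
Qed.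

Lemma Cexp'_0 : Cexp' 0 = 1.
Proof. unfold Cexp', RtoC, Re, Im; simpl. rewrite exp_0, cos_0, sin_0. f_equal; ring. Qed.

Lemma deriv_est (f : R -> R) (l : R) e : derivable_pt_lim f 0 l -> 0 < e ->
  exists d, 0 < d /\ forall h : R, Rabs h < d -> Rabs (f h - f 0 - l * h) <= e * Rabs h.
Proof.
  intros H He. destruct (H e He) as [d Hd]. exists d. split; [apply cond_pos|].
  intros h Hh. destruct (Req_dec h 0) as [->|n].
  - replace (f 0 - f 0 - l * 0)%R with 0%R by ring. rewrite Rabs_R0. lra.
  - specialize (Hd h n Hh). rewrite Rplus_0_l in Hd.
    replace (f h - f 0 - l * h)%R with (((f h - f 0) / h - l) * h)%R by (field; auto).
    rewrite Rabs_mult. apply Rmult_le_compat_r; [apply Rabs_pos|lra].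
Qed.

Lemma cd_Cexp'_0 : cd Cexp' 0 1.
Proof.
  (* Each component of the remainder is at most 3 e1 |w|; the requirement |w| < e1 <= 1 turns
     products of two small terms into such bounds. *)
  intros e He. set (e1 := Rmin 1 (e / 9)).
  assert (He1 : 0 < e1) by (apply Rmin_case; lra).
  assert (e1 <= 1) by apply Rmin_l. assert (e1 <= e / 9) by apply Rmin_r.
  destruct (deriv_est exp 1 e1) as [d1 [P1 D1]]; auto.
  { rewrite <- exp_0. apply derivable_pt_lim_exp. }
  destruct (deriv_est cos 0 e1) as [d2 [P2 D2]]; auto.
  { assert (A := derivable_pt_lim_cos 0). rewrite sin_0, Ropp_0 in A. exact A. }
  destruct (deriv_est sin 1 e1) as [d3 [P3 D3]]; auto.
  { rewrite <- cos_0. apply derivable_pt_lim_sin. }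
  exists (Rmin e1 (Rmin d1 (Rmin d2 d3))). split; [repeat apply Rmin_case; lra|].
  intros w Hw. replace (w - 0) with w in * by ring.
  destruct (lt_min Hw) as [B0 B].
  destruct (lt_min B) as [B1 B'].
  destruct (lt_min B') as [B2 B3].
  assert (Lx := Re_le_Cmod w). assert (Ly := Im_le_Cmod w).
  rewrite Cexp'_0. eapply Rle_trans; [apply Cmod_le_sum|].
  destruct w as [x y]. unfold Cexp'. simpl in *.
  specialize (D1 x ltac:(lra)). specialize (D2 y ltac:(lra)). specialize (D3 y ltac:(lra)).
  rewrite exp_0 in D1. rewrite cos_0 in D2. rewrite sin_0 in D3.
  set (m := Cmod (x, y)) in *.
  assert (m0 : 0 <= m) by apply Cmod_ge_0.
  assert (C1 : Rabs (cos y) <= 1) by (apply Rabs_le, COS_bound).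
  replace (exp x * cos y + - (1) + - (1 * x - 0 * y))%R with
    ((exp x - 1 - 1 * x) * cos y + (1 + x) * (cos y - 1 - 0 * y))%R by ring.
  replace (exp x * sin y + - 0 + - (1 * y + 0 * x))%R with
    (((exp x - 1 - 1 * x) + x) * sin y + (sin y - 0 - 1 * y))%R by ring.
  assert (Sy : Rabs (sin y) <= Rabs y).
  { assert (A := sin_lip y 0). rewrite sin_0 in A. unfold Rminus in A. rewrite Ropp_0, !Rplus_0_r in A. exact A. }
  set (X := (exp x - 1 - 1 * x)%R) in *. set (Y := (cos y - 1 - 0 * y)%R) in *. set (Z := (sin y - 0 - 1 * y)%R) in *.
  assert (T1 : Rabs (X * cos y + (1 + x) * Y) <= Rabs X * Rabs (cos y) + (1 + Rabs x) * Rabs Y).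
  { eapply Rle_trans; [apply Rabs_triang|]. rewrite !Rabs_mult. apply Rplus_le_compat_l.
    apply Rmult_le_compat_r; [apply Rabs_pos|]. eapply Rle_trans; [apply Rabs_triang|]. rewrite Rabs_R1. lra. }
  assert (T2 : Rabs ((X + x) * sin y + Z) <= (Rabs X + Rabs x) * Rabs (sin y) + Rabs Z).
  { eapply Rle_trans; [apply Rabs_triang|]. rewrite !Rabs_mult. apply Rplus_le_compat_r.
    apply Rmult_le_compat_r; [apply Rabs_pos|]. apply Rabs_triang. }
  assert (X0 := Rabs_pos X). assert (Y0 := Rabs_pos Y). assert (x0 := Rabs_pos x). assert (y0 := Rabs_pos y). assert (c0 := Rabs_pos (cos y)). assert (s0 := Rabs_pos (sin y)).
  assert (XX : Rabs X <= e1 * m) by nra. assert (YY : Rabs Y <= e1 * m) by nra. assert (ZZ : Rabs Z <= e1 * m) by nra.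
  assert (U1 : Rabs X * Rabs (cos y) <= e1 * m) by nra.
  assert (U2 : (1 + Rabs x) * Rabs Y <= 2 * (e1 * m)) by nra.
  assert (U3 : (Rabs X + Rabs x) * Rabs (sin y) <= 2 * (e1 * m)) by nra.
  nra.
Qed.

Lemma cd_Cexp' (z : C) : cd Cexp' z (Cexp' z).
Proof.
  apply (cd_ext (fun w => Cexp' z * Cexp' (w - z))).
  { intros w. rewrite <- Cexp'_plus. f_equal. ring. }
  apply cd_val with (Cexp' z * (1 * (1 - 0))); [ring|]. apply cd_scal.
  apply (cd_comp Cexp' (fun w => w - z)).
  - apply cd_minus; [apply cd_id|apply cd_const].
  - replace (z - z) with (RtoC 0) by ring. apply cd_Cexp'_0.
Qed.

Lemma exp_mono (x y : R) : x <= y -> exp x <= exp y.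
Proof. intros [H| ->]; [left; apply exp_increasing; auto|right; reflexivity]. Qed.

(** The integral with respect to the angle, that is, 2 pi times the mean value over the circle of
    radius r. *)
Definition cmean (f : C -> C) (r : R) : C := CI (fun t => f (RtoC r * cis t)) 0 (2 * PI).

Lemma two_pi_pos : 0 < 2 * PI.
Proof. assert (A := PI_RGT_0). lra. Qed.

(** The exponential maps the rectangle [ln r1, ln r2] x [0, 2 pi] onto the annulus. In Goursat's
    lemma for f o exp the two horizontal sides cancel by periodicity, and the vertical sides are the
    two circle integrals. *)
Lemma cmean_annulus (f : C -> C) (r1 r2 : R) : 0 < r1 -> r1 <= r2 ->
  (forall z, r1 <= Cmod z <= r2 -> exists l, cd f z l) -> cmean f r1 = cmean f r2.
Proof.
  intros H1 H2 Hf.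
  assert (L : ln r1 <= ln r2) by (destruct H2 as [H2| ->]; [left; apply ln_increasing; auto|lra]).
  assert (G : rectI (fun w => f (Cexp' w)) (ln r1) (ln r2) 0 (2 * PI) = 0).
  { apply goursat; auto. left; apply two_pi_pos. intros x y Hx Hy.
    destruct (Hf (Cexp' (hpath y x))) as [l Hl].
    - rewrite Cexp'_hpath, Cmod_circ by (left; apply exp_pos).
      rewrite <- (exp_ln r1), <- (exp_ln r2) by lra.
      split; apply exp_mono; tauto.
    - eexists. apply (cd_comp f Cexp'); [apply cd_Cexp'|exact Hl]. }
  unfold rectI in G.
  assert (E : HI (fun w => f (Cexp' w)) 0 (ln r1) (ln r2) = HI (fun w => f (Cexp' w)) (2 * PI) (ln r1) (ln r2)).
  { unfold HI. f_equal. apply functional_extensionality. intros x. rewrite !Cexp'_hpath.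
    unfold cis. rewrite cos_2PI, sin_2PI, cos_0, sin_0. reflexivity. }
  rewrite E in G.
  assert (VE : forall r : R, 0 < r -> VI (fun w => f (Cexp' w)) (ln r) 0 (2 * PI) = cmean f r).
  { intros r Hr. unfold VI, cmean. f_equal. apply functional_extensionality. intros y.
    rewrite Cexp'_hpath, exp_ln; auto. }
  rewrite !VE in G by lra.
  symmetry. apply Ceq_minus.
  replace (cmean f r2 - cmean f r1) with
    ((HI (fun w : C => f (Cexp' w)) (2 * PI) (ln r1) (ln r2) - HI (fun w : C => f (Cexp' w)) (2 * PI) (ln r1) (ln r2) +
      Ci * (cmean f r2 - cmean f r1)) * / Ci) by (field; apply Ci_nz).
  rewrite G. ring.
Qed.

Lemma cmean_rcti (f : C -> C) (r : R) : 0 <= r -> (forall z, Cmod z = r -> cct f z) ->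
  rcti (fun t => f (RtoC r * cis t)) 0 (2 * PI).
Proof.
  intros Hr H t Ht. apply (rct_comp f (fun s => RtoC r * cis s)); [apply rct_cis|].
  apply H, Cmod_circ, Hr.
Qed.

Lemma CI_minus (f g : R -> C) (a b : R) : a <= b -> rcti f a b -> rcti g a b ->
  CI (fun t => f t - g t) a b = CI f a b - CI g a b.
Proof.
  intros Hab Hf Hg.
  rewrite (CI_ext _ (fun t => f t + (-1) * g t)) by (auto; intros; ring).
  rewrite CI_plus, CI_scal; auto. ring.
  intros t Ht. apply rct_scal; auto.
Qed.

Lemma cmean_cont (f : C -> C) (R0 r0 : R) : 0 <= r0 < R0 -> (forall z, Cmod z < R0 -> cct f z) ->
  forall e, 0 < e -> exists d, 0 < d /\ forall r : R, 0 <= r < R0 -> Rabs (r - r0) < d ->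
    Cmod (cmean f r - cmean f r0) <= e.
Proof.
  intros Hr0 Hf e He.
  assert (PP := two_pi_pos).
  set (e1 := (e / (8 * PI))%R). assert (He1 : 0 < e1) by (apply Rdiv_lt_0_compat; lra).
  assert (Ex : forall t, exists d : posreal, forall w, Cmod (w - RtoC r0 * cis t) < d -> Cmod (f w - f (RtoC r0 * cis t)) < e1).
  { intros t. destruct (Hf (RtoC r0 * cis t)) with (eps := e1) as [d [Hd H]]; auto.
    { rewrite Cmod_circ; lra. } exists (mkposreal d Hd). exact H. }
  set (D := fun t => proj1_sig (constructive_indefinite_description _ (Ex t))).
  assert (HD : forall t w, Cmod (w - RtoC r0 * cis t) < D t -> Cmod (f w - f (RtoC r0 * cis t)) < e1).
  { intros t. exact (proj2_sig (constructive_indefinite_description _ (Ex t))). }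
  assert (K0 : 0 < 2 * (1 + 2 * r0)) by lra.
  (* Moving the angle by delta and the radius by delta displaces the point by at most (1 + 2 r0)
     delta = D t / 2. *)
  set (delta := fun t => mkposreal (D t / (2 * (1 + 2 * r0))) (Rdiv_lt_0_compat _ _ (cond_pos (D t)) K0)).
  destruct (compactness_value_1d 0 (2 * PI) delta) as [d Hd].
  exists d. split; [apply cond_pos|]. intros r Hr Hrr.
  unfold cmean. rewrite <- CI_minus; try lra.
  2,3: apply cmean_rcti; [lra|]; intros z Hz; apply Hf; lra.
  replace e with (2 * (2 * e1) * (2 * PI - 0))%R by (unfold e1; field; lra).
  apply CI_bound; [lra| |].
  { intros t Ht. unfold Cminus. apply rct_plus; [apply (cmean_rcti f r); auto; [lra|intros z Hz; apply Hf; lra]|].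
    apply (rct_ext (fun s => (-1) * f (RtoC r0 * cis s))); [intros; ring|].
    apply rct_scal. apply (cmean_rcti f r0); auto; [lra|intros z Hz; apply Hf; lra]. }
  (* The compactness principle provides the centre t only under a double negation. *)
  intros x Hx. apply NNPP. intros Hn. apply (Hd x Hx). intros [t [Ht1 [Ht2 Ht3]]]. apply Hn. clear Hn.
  unfold delta in Ht2, Ht3; simpl in Ht2, Ht3.
  assert (Dt := cond_pos (D t)).
  assert (Q : (D t / (2 * (1 + 2 * r0)) * (1 + 2 * r0) = D t / 2)%R) by (field; lra).
  assert (L1 : Cmod (RtoC r0 * cis x - RtoC r0 * cis t) <= 2 * r0 * Rabs (x - t)).
  { replace (RtoC r0 * cis x - RtoC r0 * cis t) with (RtoC r0 * (cis x - cis t)) by ring.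
    rewrite Cmod_mult, Cmod_R, Rabs_pos_eq by lra. assert (A := cis_lip x t). nra. }
  assert (L2 : Cmod (RtoC r * cis x - RtoC r0 * cis x) = Rabs (r - r0)).
  { replace (RtoC r * cis x - RtoC r0 * cis x) with (RtoC (r - r0) * cis x) by (rewrite RtoC_minus; ring).
    rewrite Cmod_mult, Cmod_cis, Cmod_R. ring. }
  assert (L3 : 2 * r0 * Rabs (x - t) <= 2 * r0 * (D t / (2 * (1 + 2 * r0)))).
  { apply Rmult_le_compat_l; lra. }
  assert (L4 : (2 * r0 * (D t / (2 * (1 + 2 * r0))) + D t / (2 * (1 + 2 * r0)) = D t / 2)%R) by (rewrite <- Q; ring).
  assert (L5 : 0 < D t / (2 * (1 + 2 * r0))) by (apply Rdiv_lt_0_compat; lra).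
  assert (M1 := HD t (RtoC r0 * cis x) ltac:(lra)).
  assert (L6 := Cmod_tri3 (RtoC r * cis x) (RtoC r0 * cis x) (RtoC r0 * cis t)).
  assert (M2 := HD t (RtoC r * cis x) ltac:(lra)).
  assert (M3 := Cmod_tri3 (f (RtoC r * cis x)) (f (RtoC r0 * cis t)) (f (RtoC r0 * cis x))).
  rewrite (Cmod_sym (f (RtoC r0 * cis t))) in M3. lra.
Qed.

(* Continuity bridges the circle [Cmod z = c], on which differentiability may fail. *)
Lemma cmean_center (f : C -> C) (R0 c r : R) : 0 < r < R0 ->
  (forall z, Cmod z < R0 -> cct f z) ->
  (forall z, Cmod z < R0 -> Cmod z <> c -> exists l, cd f z l) ->
  cmean f r = RtoC (2 * PI) * f 0.
Proof.
  intros Hr Hc Hd.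
  assert (Z : cmean f 0 = RtoC (2 * PI) * f 0).
  { unfold cmean. rewrite (CI_ext _ (fun _ => f 0)).
    - rewrite CI_const, Rminus_0_r. reflexivity.
    - left; apply two_pi_pos.
    - intros t _. f_equal. ring. }
  rewrite <- Z.
  assert (step : forall r, 0 < r < R0 -> r < c \/ c <= 0 -> cmean f r = cmean f 0).
  { intros s Hs Hsc. apply C_eq_lim. intros e He.
    destruct (cmean_cont f R0 0 ltac:(lra) Hc e He) as [d [Hd0 H]].
    set (s' := Rmin s (d / 2)). assert (s'p : 0 < s') by (apply Rmin_case; lra).
    assert (s' <= s) by apply Rmin_l. assert (s' <= d / 2) by apply Rmin_r.
    rewrite <- (cmean_annulus f s' s); auto.
    - apply H; [lra|]. rewrite Rminus_0_r, Rabs_pos_eq; lra.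
    - intros z Hz. apply Hd; lra. }
  assert (atc : 0 <= c < R0 -> cmean f c = cmean f 0).
  { intros Hc0. destruct (Req_dec c 0) as [->|n]; auto. apply C_eq_lim. intros e He.
    destruct (cmean_cont f R0 c Hc0 Hc e He) as [d [Hd0 H]].
    set (s := Rmax (c / 2) (c - d / 2)).
    assert (c / 2 <= s) by apply Rmax_l. assert (c - d / 2 <= s) by apply Rmax_r.
    assert (s < c) by (apply Rmax_case; lra).
    rewrite <- (step s) by lra. rewrite Cmod_sym. apply H; [lra|]. apply Rabs_lt_between; lra. }
  destruct (Rlt_le_dec r c) as [L|L]; [apply step; lra|].
  destruct (Rle_dec c 0) as [N|N]; [apply step; lra|].
  rewrite <- atc by lra. apply C_eq_lim. intros e He.
  destruct (cmean_cont f R0 c ltac:(lra) Hc e He) as [d [Hd0 H]].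
  destruct L as [L| ->]; [|replace (cmean f r - cmean f r) with (RtoC 0) by ring; rewrite Cmod_0; lra].
  set (s := Rmin r (c + d / 2)).
  assert (s <= r) by apply Rmin_l. assert (s <= c + d / 2) by apply Rmin_r.
  assert (c < s) by (apply Rmin_case; lra).
  rewrite <- (cmean_annulus f s r); try lra.
  - apply H; [lra|]. apply Rabs_lt_between; lra.
  - intros z Hz. apply Hd; lra.
Qed.

Lemma CI_conj (f : R -> C) (a b : R) : a <= b -> rcti f a b -> CI (fun t => Cconj (f t)) a b = Cconj (CI f a b).
Proof.
  intros Hab Hf. unfold CI. apply injective_projections; simpl; [reflexivity|].
  rewrite <- (RInt_opp (V := R_CompleteNormedModule)); [reflexivity|]. apply rcti_ex_Im; auto.
Qed.

Definition cctc (f : C -> C) (r : R) : Prop := forall z, Cmod z = r -> cct f z.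

Lemma cmean_plus (f g : C -> C) (r : R) : 0 <= r -> cctc f r -> cctc g r ->
  cmean (fun z => f z + g z) r = cmean f r + cmean g r.
Proof.
  intros Hr Hf Hg. unfold cmean. apply CI_plus; [left; apply two_pi_pos| |]; apply cmean_rcti; auto.
Qed.

Lemma cmean_scal (c : C) (f : C -> C) (r : R) : 0 <= r -> cctc f r ->
  cmean (fun z => c * f z) r = c * cmean f r.
Proof.
  intros Hr Hf. unfold cmean. apply CI_scal; [left; apply two_pi_pos|]; apply cmean_rcti; auto.
Qed.

Lemma cmean_ext (f g : C -> C) (r : R) : 0 <= r -> (forall z, Cmod z = r -> f z = g z) -> cmean f r = cmean g r.
Proof.
  intros Hr H. apply CI_ext; [left; apply two_pi_pos|]. intros t _. apply H, Cmod_circ, Hr.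
Qed.

Lemma cmean_bound (f : C -> C) (r M : R) : 0 <= r -> cctc f r -> (forall z, Cmod z = r -> Cmod (f z) <= M) ->
  Cmod (cmean f r) <= 2 * M * (2 * PI).
Proof.
  intros Hr Hf HM. unfold cmean. assert (P := two_pi_pos).
  replace (2 * M * (2 * PI))%R with (2 * M * (2 * PI - 0))%R by ring.
  apply CI_bound; [lra| |]. apply cmean_rcti; auto. intros t _. apply HM, Cmod_circ, Hr.
Qed.

Lemma two_pi_nz : RtoC (2 * PI) <> 0.
Proof. intros E. apply RtoC_inj in E. assert (A := two_pi_pos). lra. Qed.

Lemma Cmod_nz_of_lt (w z : C) : Cmod w < Cmod z -> z - w <> 0.
Proof. intros H E. apply Ceq_minus in E. subst. lra. Qed.

Lemma cd_kernel (w z : C) : Cmod w < Cmod z -> exists l, cd (fun z => z / (z - w)) z l.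
Proof.
  intros H. eexists. apply cd_mult; [apply cd_id|]. apply cd_invf. apply Cmod_nz_of_lt; auto.
  apply cd_minus; [apply cd_id|apply cd_const].
Qed.

(** On the circle z conj z = r^2, so z/(z - w) is the conjugate of g(z) = 1/(1 - conj w z/r^2). This
    g is holomorphic on a larger disc, and its mean value is g(0) = 1. *)
Lemma cmean_kernel (w : C) (r : R) : Cmod w < r -> cmean (fun z => z / (z - w)) r = RtoC (2 * PI).
Proof.
  intros Hw. assert (Hw0 := Cmod_ge_0 w). assert (Hr : 0 < r) by lra.
  set (g := fun z => / (1 - (Cconj w / RtoC (r * r)) * z)).
  assert (rr : RtoC (r * r) <> 0) by (intros E; apply RtoC_inj in E; nra).
  assert (Hrr : Cmod (RtoC (r * r)) = (r * r)%R) by (rewrite Cmod_R, Rabs_pos_eq; nra).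
  assert (P1 : 0 < (r - Cmod w) / (Cmod w + r)) by (apply Rdiv_lt_0_compat; lra).
  (* 2 r^2/(|w|+r) lies strictly between r and r^2/|w|. *)
  set (R1 := (2 * (r * r) / (Cmod w + r))%R).
  assert (HR1 : (R1 = r + r * ((r - Cmod w) / (Cmod w + r)))%R) by (unfold R1; field; lra).
  assert (HR1' : r < R1) by nra.
  assert (HR2 : (Cmod w * R1 < r * r)%R).
  { unfold R1. apply Rmult_lt_reg_r with (Cmod w + r)%R; [lra|].
    replace (Cmod w * (2 * (r * r) / (Cmod w + r)) * (Cmod w + r))%R with (2 * Cmod w * (r * r))%R by (field; lra).
    assert (0 < r * r)%R by nra. nra. }
  assert (den : forall z, Cmod z < R1 -> 1 - (Cconj w / RtoC (r * r)) * z <> 0).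
  { intros z Hz E. apply Ceq_minus in E.
    assert (E2 : Cmod (Cconj w / RtoC (r * r) * z) = 1%R) by (rewrite <- E; apply Cmod_1).
    rewrite Cmod_mult, Cmod_div, Cmod_conj, Hrr in E2 by auto.
    assert (Cmod w * Cmod z = r * r)%R.
    { replace (Cmod w * Cmod z)%R with (Cmod w / (r * r) * Cmod z * (r * r))%R by (field; lra). rewrite E2; ring. }
    assert (Zz := Cmod_ge_0 z). nra. }
  assert (gd : forall z, Cmod z < R1 -> exists l, cd g z l).
  { intros z Hz. eexists. apply (cd_invf (fun z => 1 - (Cconj w / RtoC (r * r)) * z)). auto.
    apply cd_minus; [apply cd_const|]. apply cd_scal, cd_id. }
  assert (gm : cmean g r = RtoC (2 * PI) * g 0).
  (* No modulus equals -1: there is no exceptional circle here. *)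
  { apply (cmean_center g R1 (-1)); [lra| |].
    - intros z Hz. destruct (gd z Hz) as [l Hl]. eapply cd_cct; eauto.
    - intros z Hz _. auto. }
  assert (g0 : g 0 = 1) by (unfold g; field; auto).
  rewrite g0, Cmult_1_r in gm.
  transitivity (cmean (fun z => Cconj (g z)) r).
  - apply cmean_ext; [lra|]. intros z Hz.
    assert (zz : z <> 0) by (apply Cmod_gt_0; lra).
    assert (zc : z * Cconj z = RtoC (r * r)).
    { rewrite <- Cmod2_conj, Hz. f_equal. ring. }
    unfold g. rewrite Cinv_conj by (apply den; lra).
    rewrite Cminus_conj, Cmult_conj, Cdiv_conj, Cconj_conj by auto.
    assert (c1 : forall x : R, Cconj (RtoC x) = RtoC x) by (intros x; unfold Cconj, RtoC; simpl; f_equal; ring).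
    rewrite !c1. rewrite <- zc.
    assert (z - w <> 0) by (apply Cmod_nz_of_lt; lra).
    assert (Cconj z <> 0) by (apply Cmod_gt_0; rewrite Cmod_conj; lra).
    field. auto.
  - unfold cmean. rewrite CI_conj.
    + fold (cmean g r). rewrite gm. unfold Cconj, RtoC; simpl. f_equal. ring.
    + left; apply two_pi_pos.
    + apply cmean_rcti; [lra|]. intros z Hz. destruct (gd z) as [l Hl]; [lra|]. eapply cd_cct; eauto.
Qed.

(** Write f(z) z/(z - w) = z s(z) + f(w) z/(z - w), with s the slope of f at w. The function z s(z)
    is continuous, differentiable except perhaps at w, and vanishes at 0, so its mean is 0; the
    circle through w is the exceptional one in [cmean_center]. *)
Lemma cauchy_formula (f : C -> C) (R0 r : R) (w : C) : 0 < r < R0 -> Cmod w < r ->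
  (forall z, Cmod z < R0 -> exists l, cd f z l) ->
  cmean (fun z => f z * (z / (z - w))) r = RtoC (2 * PI) * f w.
Proof.
  intros Hr Hw Hf.
  assert (Hfc : forall z, Cmod z < R0 -> cct f z).
  { intros z Hz. destruct (Hf z Hz) as [l Hl]. eapply cd_cct; eauto. }
  destruct (Hf w) as [l Hl]; [lra|]. apply cd_slope in Hl. destruct Hl as [s [Hs [Cs Es]]].
  assert (Sd : forall z, Cmod z < R0 -> z <> w -> exists l, cd s z l).
  { intros z Hz n. destruct (Hf z Hz) as [m Hm]. eexists.
    apply (cd_ext_loc (fun z => (f z - f w) / (z - w)) s z _ (Cmod (z - w))).
    - apply Cmod_gt_0, Cminus_eq_contra; auto.
    - intros v Hv. assert (v - w <> 0).
      { intros E. apply Ceq_minus in E. subst v. rewrite Cmod_sym in Hv. lra. }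
      rewrite (Es v). field. auto.
    - apply cd_mult; [apply cd_minus; [exact Hm|apply cd_const]|].
      apply cd_invf. apply Cminus_eq_contra; auto. apply cd_minus; [apply cd_id|apply cd_const]. }
  assert (Z : cmean (fun z => z * s z) r = RtoC (2 * PI) * (0 * s 0)).
  { apply (cmean_center (fun z => z * s z) R0 (Cmod w)); auto.
    - intros z Hz. apply cct_mult; [apply cct_id|].
      destruct (C_eq_dec z w) as [->|n]; auto. destruct (Sd z Hz n) as [m Hm]. eapply cd_cct; eauto.
    - intros z Hz Hn. destruct (Sd z Hz) as [m Hm]. congruence. eexists. apply cd_mult; [apply cd_id|exact Hm]. }
  assert (K : forall z, Cmod z = r -> cct (fun z => z / (z - w)) z).
  { intros z Hz. destruct (cd_kernel w z) as [m Hm]; [lra|]. eapply cd_cct; eauto. }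
  rewrite (cmean_ext _ (fun z => z * s z + f w * (z / (z - w)))).
  - rewrite cmean_plus, cmean_scal, Z, cmean_kernel; auto; try lra; try ring.
    + intros z Hz. apply cct_mult; [apply cct_id|]. destruct (Sd z) as [m Hm]; [lra|intros ->; lra|]. eapply cd_cct; eauto.
    + intros z Hz. apply cct_mult; [apply cct_const|auto].
  - lra.
  - intros z Hz. rewrite (Es z). assert (z - w <> 0) by (apply Cmod_nz_of_lt; lra). field. auto.
Qed.

(** * Power series *)

(** The sum has n terms, with indices below n; hence the tail after [psum c n] starts with q^n. *)
Fixpoint psum (c : nat -> C) (n : nat) : C :=
  match n with O => 0 | S k => psum c k + c k end.

Definition csum (c : nat -> C) : C := (Series (fun k => Re (c k)), Series (fun k => Im (c k))).

Definition ps (c : nat -> C) (w : C) : C := csum (fun k => c k * w ^ k).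

Lemma Series_tail (a : nat -> R) (M q : R) (n : nat) : 0 <= q < 1 -> (forall k, (Rabs (a k) <= M * q ^ k)%R) ->
  (Rabs (Series a - match n with O => 0 | S m => sum_f_R0 a m end) <= M * q ^ n / (1 - q))%R.
Proof.
  intros Hq Ha.
  assert (G : forall b K, (forall k, (Rabs (b k) <= K * q ^ k)%R) -> ex_series (fun k => Rabs (b k)) /\ (Rabs (Series b) <= K / (1 - q))%R).
  { intros b K Hb. 
    assert (Eg : is_series (fun k => K * q ^ k)%R (K * / (1 - q))%R).
    { apply (is_series_scal K (fun k => q ^ k)%R). apply is_series_geom. rewrite Rabs_pos_eq; lra. }
    assert (X : ex_series (fun k => Rabs (b k))).
    { apply (ex_series_le (V := R_CompleteNormedModule) _ (fun k => K * q ^ k)%R).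
      - intros k. simpl. change (Rabs (Rabs (b k)) <= K * q ^ k)%R. rewrite Rabs_Rabsolu. auto.
      - eexists; exact Eg. }
    split; auto. eapply Rle_trans; [apply Series_Rabs; auto|].
    unfold Rdiv. rewrite <- (is_series_unique _ _ Eg). apply Series_le; [|eexists; exact Eg].
    intros k. split; [apply Rabs_pos|auto]. }
  assert (Xa : ex_series a) by (apply ex_series_Rabs; apply (G a M Ha)).
  destruct n as [|m].
  - rewrite Rminus_0_r. replace (M * q ^ 0 / (1 - q))%R with (M / (1 - q))%R by (simpl; unfold Rdiv; ring). apply (G a M Ha).
  - rewrite (Series_incr_n a (S m)) by (auto; lia). simpl pred.
    replace (sum_f_R0 a m + Series (fun k => a (S m + k)%nat) - sum_f_R0 a m)%R with (Series (fun k => a (S m + k)%nat)) by ring.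
    apply (G (fun k => a (S m + k)%nat) (M * q ^ S m)%R).
    intros k. eapply Rle_trans; [apply Ha|]. rewrite pow_add. right; ring.
Qed.

Lemma psum_Re c n : Re (psum c n) = match n with O => 0%R | S m => sum_f_R0 (fun k => Re (c k)) m end.
Proof.
  destruct n as [|n]; [reflexivity|]. induction n as [|n IH]; [simpl; unfold Re; simpl; ring|].
  change (psum c (S (S n))) with (psum c (S n) + c (S n)).
  transitivity (Re (psum c (S n)) + Re (c (S n)))%R; [reflexivity|]. rewrite IH. reflexivity.
Qed.

Lemma psum_Im c n : Im (psum c n) = match n with O => 0%R | S m => sum_f_R0 (fun k => Im (c k)) m end.
Proof.
  destruct n as [|n]; [reflexivity|]. induction n as [|n IH]; [simpl; unfold Im; simpl; ring|].
  change (psum c (S (S n))) with (psum c (S n) + c (S n)).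
  transitivity (Im (psum c (S n)) + Im (c (S n)))%R; [reflexivity|]. rewrite IH. reflexivity.
Qed.

Lemma csum_tail (c : nat -> C) (M q : R) (n : nat) : 0 <= q < 1 -> (forall k, (Cmod (c k) <= M * q ^ k)%R) ->
  (Cmod (csum c - psum c n) <= 2 * M * q ^ n / (1 - q))%R.
Proof.
  intros Hq Hc. eapply Rle_trans; [apply Cmod_le_sum|].
  change (Re (csum c - psum c n)) with (Series (fun k => Re (c k)) - Re (psum c n))%R.
  change (Im (csum c - psum c n)) with (Series (fun k => Im (c k)) - Im (psum c n))%R.
  rewrite psum_Re, psum_Im.
  assert (A := Series_tail (fun k => Re (c k)) M q n Hq (fun k => Rle_trans _ _ _ (Re_le_Cmod (c k)) (Hc k))).
  assert (B := Series_tail (fun k => Im (c k)) M q n Hq (fun k => Rle_trans _ _ _ (Im_le_Cmod (c k)) (Hc k))).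
  replace (2 * M * q ^ n / (1 - q))%R with (M * q ^ n / (1 - q) + M * q ^ n / (1 - q))%R by (unfold Rdiv; ring).
  apply Rplus_le_compat; assumption.
Qed.

(** The shape of Cauchy's estimates; it makes the power series converge geometrically for |w| < r
    and is the form in which convergence is carried around. *)
Definition cbd (c : nat -> C) (M r : R) : Prop := forall n, (Cmod (c n) <= M / r ^ n)%R.

Lemma cbd_nonneg c M r : cbd c M r -> 0 <= M.
Proof. intros H. specialize (H O). simpl in H. unfold Rdiv in H. rewrite Rinv_1 in H. assert (A := Cmod_ge_0 (c O)). lra. Qed.

Lemma cbd_term c M r (w : C) : 0 < r -> cbd c M r -> forall k, (Cmod (c k * w ^ k) <= M * (Cmod w / r) ^ k)%R.
Proof.
  intros Hr H k. rewrite Cmod_mult, Cmod_pow. unfold Rdiv. rewrite Rpow_mult_distr, pow_inv by lra.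
  specialize (H k). replace (M * (Cmod w ^ k * / r ^ k))%R with (M / r ^ k * Cmod w ^ k)%R by (unfold Rdiv; ring).
  apply Rmult_le_compat_r; auto. apply pow_le, Cmod_ge_0.
Qed.

Lemma quot_lt1 (w : C) (r : R) : 0 < r -> Cmod w < r -> 0 <= Cmod w / r < 1.
Proof.
  intros Hr Hw. assert (A := Cmod_ge_0 w). split.
  - apply Rmult_le_pos; [auto|]. left; apply Rinv_0_lt_compat; auto.
  - apply Rmult_lt_reg_r with r; auto. unfold Rdiv. rewrite Rmult_assoc, Rinv_l; lra.
Qed.

Lemma ps_tail c M r (w : C) (n : nat) : 0 < r -> cbd c M r -> Cmod w < r ->
  (Cmod (ps c w - psum (fun k => c k * w ^ k) n)%C <= 2 * M * (Cmod w / r) ^ n / (1 - Cmod w / r))%R.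
Proof. intros Hr H Hw. apply csum_tail; [apply quot_lt1; auto|]. apply cbd_term; auto. Qed.

Lemma geom_small (K q e : R) : 0 <= q < 1 -> 0 < e -> exists N, forall n, (N <= n)%nat -> (K * q ^ n < e)%R.
Proof.
  intros Hq He.
  destruct (pow_lt_1_zero q ltac:(rewrite Rabs_pos_eq; lra) (e / (Rabs K + 1))) as [N HN].
  { apply Rdiv_lt_0_compat; [auto|]. assert (A := Rabs_pos K). lra. }
  exists N. intros n Hn. specialize (HN n Hn). assert (Q : (0 <= q ^ n)%R) by (apply pow_le; lra).
  rewrite Rabs_pos_eq in HN by auto. assert (A := Rabs_pos K). assert (B := Rle_abs K).
  apply Rle_lt_trans with ((Rabs K + 1) * q ^ n)%R; [nra|].
  apply Rlt_le_trans with ((Rabs K + 1) * (e / (Rabs K + 1)))%R; [apply Rmult_lt_compat_l; lra|].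
  right; field; lra.
Qed.

Lemma csum_unique (c : nat -> C) (M q K : R) (l : C) : 0 <= q < 1 -> (forall k, (Cmod (c k) <= M * q ^ k)%R) ->
  (forall n, (Cmod (l - psum c n)%C <= K * q ^ n)%R) -> l = csum c.
Proof.
  intros Hq Hc Hl. apply C_eq_lim. intros e He.
  destruct (geom_small (K + 2 * M / (1 - q)) q e Hq He) as [N HN]. specialize (HN N (le_n N)).
  left. eapply Rle_lt_trans; [apply (Cmod_tri3 l (psum c N) (csum c))|].
  rewrite (Cmod_sym (psum c N)). assert (A := csum_tail c M q N Hq Hc). specialize (Hl N).
  eapply Rle_lt_trans; [apply Rplus_le_compat; [exact Hl|exact A]|].
  eapply Rle_lt_trans; [|exact HN]. right. field. lra.
Qed.

(** The bound belongs to the notion because all later constants must depend on M and the radii only,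
    never on f. *)
Definition bh (f : C -> C) (a : C) (r M : R) : Prop :=
  forall z, Cmod (z - a) < r -> (exists l, cd f z l) /\ Cmod (f z) <= M.

(** Cauchy's formula is a hypothesis here, and not holomorphy, because a uniform limit of
    holomorphic functions inherits the formula before it is known to be differentiable. The factor 2
    in the coefficient bound is that of [CI_bound]. *)
Lemma taylor_of_cauchy (f : C -> C) (r M : R) : 0 < r -> cctc f r ->
  (forall z, Cmod z = r -> Cmod (f z) <= M) ->
  (forall w, Cmod w < r -> cmean (fun z => f z * (z / (z - w))) r = RtoC (2 * PI) * f w) ->
  exists c, cbd c (2 * M) r /\ forall w, Cmod w < r -> f w = ps c w.
Proof.
  intros Hr Fc F2 Hcf. assert (PP := two_pi_pos).
  assert (Ic : forall n, cctc (fun z => (/ z) ^ n) r).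
  { intros n z Hz. eapply cd_cct. apply (cd_comp (fun w => w ^ n) Cinv); [apply cd_inv|apply cd_pow]. apply Cmod_gt_0; lra. }
  assert (FI : forall n, cctc (fun z => f z * (/ z) ^ n) r) by (intros n z Hz; apply cct_mult; [apply Fc|apply Ic]; auto).
  set (c := fun n => / RtoC (2 * PI) * cmean (fun z => f z * (/ z) ^ n) r).
  assert (Mi : forall z n, Cmod z = r -> Cmod ((/ z) ^ n) = (/ r ^ n)%R).
  { intros z n Hz. rewrite Cmod_pow, Cmod_inv, Hz, pow_inv; auto; apply Cmod_gt_0; lra. }
  assert (Mp : Cmod (/ RtoC (2 * PI)) = (/ (2 * PI))%R).
  { rewrite Cmod_inv by apply two_pi_nz. rewrite Cmod_R, Rabs_pos_eq; lra. }
  exists c. assert (Hc : cbd c (2 * M) r).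
  { intros n. unfold c. rewrite Cmod_mult, Mp.
    assert (B := cmean_bound (fun z => f z * (/ z) ^ n) r (M / r ^ n) ltac:(lra) (FI n)).
    assert (P : (0 < r ^ n)%R) by (apply pow_lt; lra).
    apply Rle_trans with (/ (2 * PI) * (2 * (M / r ^ n) * (2 * PI)))%R.
    - apply Rmult_le_compat_l; [left; apply Rinv_0_lt_compat; lra|]. apply B.
      intros z Hz. rewrite Cmod_mult, Mi by auto. apply Rmult_le_compat_r; [left; apply Rinv_0_lt_compat; lra|].
      apply F2; lra.
    - right. field. split; lra. }
  split; auto. intros w Hw.
  assert (Kc : cctc (fun z => z / (z - w)) r).
  { intros z Hz. destruct (cd_kernel w z) as [m Hm]; [lra|]. eapply cd_cct; eauto. }
  assert (Kn : forall n, cctc (fun z => f z * (/ z) ^ n * (z / (z - w))) r).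
  { intros n z Hz. apply cct_mult; [apply FI|apply Kc]; auto. }
  (* The remainder after n terms of the expansion of the kernel, by z^-n z/(z - w) = z^-n + w
     z^-(n+1) z/(z - w). *)
  assert (Rem : forall n, RtoC (2 * PI) * (f w - psum (fun k => c k * w ^ k) n) = w ^ n * cmean (fun z => f z * (/ z) ^ n * (z / (z - w))) r).
  { induction n as [|n IH].
    - simpl. rewrite Cmult_1_l. replace (f w - 0) with (f w) by ring.
      rewrite <- (Hcf w) by auto. apply cmean_ext; [lra|]. intros; ring.
    - simpl psum. replace (RtoC (2 * PI) * (f w - (psum (fun k => c k * w ^ k) n + c n * w ^ n))) with
        (RtoC (2 * PI) * (f w - psum (fun k => c k * w ^ k) n) - RtoC (2 * PI) * c n * w ^ n) by ring.
      rewrite IH. unfold c. replace (RtoC (2 * PI) * (/ RtoC (2 * PI) * cmean (fun z => f z * (/ z) ^ n) r)) with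
        (cmean (fun z => f z * (/ z) ^ n) r) by (field; apply two_pi_nz).
      rewrite (cmean_ext (fun z => f z * (/ z) ^ n * (z / (z - w))) (fun z => f z * (/ z) ^ n + w * (f z * (/ z) ^ S n * (z / (z - w))))).
      + rewrite cmean_plus, cmean_scal; auto; try lra; try (simpl; ring).
        intros z Hz; apply cct_mult; [apply cct_const|apply Kn; auto].
      + lra.
      + intros z Hz. assert (z <> 0) by (apply Cmod_gt_0; lra). assert (z - w <> 0) by (apply Cmod_nz_of_lt; lra).
        simpl. field. auto. }
  assert (Q := quot_lt1 w r ltac:(lra) Hw).
  apply (csum_unique _ (2 * M) (Cmod w / r) (2 * M * (r / (r - Cmod w))) (f w) Q).
  - apply cbd_term; auto; lra.
  - intros n. specialize (Rem n).
    replace (f w - psum (fun k => c k * w ^ k) n) with (/ RtoC (2 * PI) * (RtoC (2 * PI) * (f w - psum (fun k => c k * w ^ k) n))) by (field; apply two_pi_nz).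
    rewrite Rem, !Cmod_mult, Cmod_pow, Mp.
    assert (B := cmean_bound (fun z => f z * (/ z) ^ n * (z / (z - w))) r (M / r ^ n * (r / (r - Cmod w))) ltac:(lra) (Kn n)).
    assert (P : (0 < r ^ n)%R) by (apply pow_lt; lra).
    assert (Wn : (0 <= Cmod w ^ n)%R) by (apply pow_le, Cmod_ge_0).
    apply Rle_trans with (/ (2 * PI) * (Cmod w ^ n * (2 * (M / r ^ n * (r / (r - Cmod w))) * (2 * PI))))%R.
    + apply Rmult_le_compat_l; [left; apply Rinv_0_lt_compat; lra|]. apply Rmult_le_compat_l; auto. apply B.
      intros z Hz. rewrite !Cmod_mult, Mi, Cmod_div, Hz by (auto; apply Cmod_nz_of_lt; lra).
      assert (D := Cmod_rev z w). rewrite Hz in D.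
      apply Rmult_le_compat; [| | |].
      * apply div_nonneg; [apply Cmod_ge_0|lra].
      * apply div_nonneg; [lra|lra].
      * apply Rmult_le_compat_r; [left; apply Rinv_0_lt_compat; lra|apply F2; lra].
      * apply Rmult_le_compat_l; [lra|]. apply Rinv_le_contravar; lra.
    + right. unfold Rdiv. rewrite Rpow_mult_distr, pow_inv by lra. field. repeat split; lra.
Qed.

Lemma taylor0 (f : C -> C) (R0 r M : R) : 0 < r < R0 -> bh f 0 R0 M ->
  exists c, cbd c (2 * M) r /\ forall w, Cmod w < r -> f w = ps c w.
Proof.
  intros Hr Hf.
  assert (F1 : forall z, Cmod z < R0 -> exists l, cd f z l).
  { intros z Hz. apply Hf. replace (z - 0) with z by ring. auto. }
  apply taylor_of_cauchy; [lra| | |].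
  - intros z Hz. destruct (F1 z) as [l Hl]; [lra|]. eapply cd_cct; eauto.
  - intros z Hz. apply Hf. replace (z - 0) with z by ring. lra.
  - intros w Hw. apply (cauchy_formula f R0); auto.
Qed.

Lemma bh_shift (f : C -> C) (a : C) (r M : R) : bh f a r M -> bh (fun z => f (a + z)) 0 r M.
Proof.
  intros H z Hz. destruct (H (a + z)) as [[l Hl] Hm].
  - replace (a + z - a) with (z - 0) by ring. auto.
  - split; auto. exists (l * (0 + 1)). apply (cd_comp f (fun z => a + z)); auto.
    apply cd_plus; [apply cd_const|apply cd_id].
Qed.

Lemma taylor (f : C -> C) (a : C) (R0 r M : R) : 0 < r < R0 -> bh f a R0 M ->
  exists c, cbd c (2 * M) r /\ forall w, Cmod (w - a) < r -> f w = ps c (w - a).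
Proof.
  intros Hr Hf. destruct (taylor0 _ R0 r M Hr (bh_shift _ _ _ _ Hf)) as [c [H1 H2]].
  exists c. split; auto. intros w Hw. rewrite <- H2 by auto. f_equal. ring.
Qed.

Lemma Cpow_S' (z : C) n : z ^ S n = z * z ^ n.
Proof. reflexivity. Qed.

Lemma Cmod_pow_le (z : C) s n : Cmod z <= s -> (Cmod (z ^ n) <= s ^ n)%R.
Proof. intros H. rewrite Cmod_pow. apply pow_incr. split; [apply Cmod_ge_0|auto]. Qed.

(** The second order remainder of the power function is at most n^2 s^(n-2) |z - w|^2; multiplying
    by s^2 avoids the exponent n - 2. The induction multiplies the previous remainder by z. *)
Lemma pow_second (z w : C) (s : R) (n : nat) : 0 < s -> Cmod z <= s -> Cmod w <= s ->
  (Cmod (z ^ n - w ^ n - RtoC (INR n) * w ^ (pred n) * (z - w))%C * (s * s) <= INR n * INR n * s ^ n * (Cmod (z - w) * Cmod (z - w)))%R.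
Proof.
  intros Hs Hz Hw. set (h := Cmod (z - w)). assert (h0 : 0 <= h) by apply Cmod_ge_0.
  induction n as [|n IH].
  - simpl. replace (1 - 1 - 0 * 1 * (z - w)) with (RtoC 0) by ring. rewrite Cmod_0. lra.
  - simpl pred.
    replace (z ^ S n - w ^ S n - RtoC (INR (S n)) * w ^ n * (z - w)) with
      (z * (z ^ n - w ^ n - RtoC (INR n) * w ^ (pred n) * (z - w)) + RtoC (INR n) * w ^ (pred n) * ((z - w) * (z - w))).
    2:{ rewrite S_INR, RtoC_plus. destruct n; simpl pred; simpl INR; [simpl; ring|]. rewrite !Cpow_S'. ring. }
    set (E := z ^ n - w ^ n - RtoC (INR n) * w ^ (pred n) * (z - w)) in *.
    apply Rle_trans with ((s * Cmod E + INR n * s ^ (pred n) * (h * h)) * (s * s))%R.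
    { apply Rmult_le_compat_r; [nra|]. eapply Rle_trans; [apply Cmod_triangle|].
      rewrite !Cmod_mult. fold h. rewrite Cmod_R, (Rabs_pos_eq (INR n)) by apply pos_INR.
      apply Rplus_le_compat; [apply Rmult_le_compat_r; [apply Cmod_ge_0|auto]|].
      apply Rmult_le_compat_r; [nra|]. apply Rmult_le_compat_l; [apply pos_INR|]. apply Cmod_pow_le; auto. }
    assert (Q : (INR n * s ^ pred n * s = INR n * s ^ n)%R) by (destruct n; simpl; ring).
    replace ((s * Cmod E + INR n * s ^ pred n * (h * h)) * (s * s))%R with (s * (Cmod E * (s * s)) + (INR n * s ^ pred n * s) * s * (h * h))%R by ring.
    rewrite Q. rewrite S_INR. simpl pow.
    assert (P : (0 <= s ^ n)%R) by (apply pow_le; lra). assert (N0 := pos_INR n).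
    apply Rle_trans with (s * (INR n * INR n * s ^ n * (h * h)) + INR n * s ^ n * s * (h * h))%R.
    + apply Rplus_le_compat_r. apply Rmult_le_compat_l; [lra|exact IH].
    + assert (0 <= s * s ^ n * (h * h))%R by (repeat apply Rmult_le_pos; auto; lra). nra.
Qed.

(** For t < 1 each of the n terms of 1 + t + ... + t^(n-1) is at least t^n, so n t^n (1 - t) <= 1 -
    t^n. *)
Lemma n_geom (n : nat) (t : R) : 0 <= t < 1 -> (INR n * t ^ n <= / (1 - t))%R.
Proof.
  intros Ht.
  assert (H : (INR n * t ^ n * (1 - t) <= 1 - t ^ n)%R).
  { induction n as [|n IH]; [simpl; lra|]. rewrite S_INR. simpl pow.
    assert (P : (0 <= t ^ n)%R) by (apply pow_le; lra).
    assert (L : (t ^ n <= 1)%R) by (rewrite <- (pow1 n); apply pow_incr; lra).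
    set (x := (t ^ n)%R) in *. set (m := INR n) in *.
    assert (A : (t * (m * x * (1 - t)) <= t * (1 - x))%R) by (apply Rmult_le_compat_l; lra).
    assert (B : (t * x <= 1)%R) by nra.
    assert (D : (0 <= (1 - t) * (1 - t * x))%R) by (apply Rmult_le_pos; lra). lra. }
  assert (P : (0 <= t ^ n)%R) by (apply pow_le; lra).
  apply Rmult_le_reg_r with (1 - t)%R; [lra|]. rewrite Rinv_l by lra. lra.
Qed.

(** A factor n is absorbed by a slightly larger ratio; two applications absorb the n^2 of
    [pow_second]. *)
Lemma n_geom2 (q p : R) : 0 <= q < p -> exists K, 0 < K /\ forall n, (INR n * q ^ n <= K * p ^ n)%R.
Proof.
  intros H. exists (/ (1 - q / p))%R.
  assert (T : 0 <= q / p < 1).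
  { split; [apply div_nonneg; [lra|lra]|].
    apply div_lt_1; lra. }
  split; [apply Rinv_0_lt_compat; lra|]. intros n.
  assert (A := n_geom n _ T). unfold Rdiv in A. rewrite Rpow_mult_distr, pow_inv in A.
  assert (P : (0 < p ^ n)%R) by (apply pow_lt; lra).
  replace (INR n * q ^ n)%R with (INR n * (q ^ n * / p ^ n) * p ^ n)%R by (field; lra).
  apply Rmult_le_compat_r; [lra|exact A].
Qed.

Definition dcoef (c : nat -> C) (n : nat) : C := RtoC (INR (S n)) * c (S n).

Lemma dcoef_cbd c M r r' : 0 < r' < r -> cbd c M r -> exists M', cbd (dcoef c) M' r'.
Proof.
  intros Hr Hc. assert (HM := cbd_nonneg _ _ _ Hc).
  destruct (n_geom2 (/ r) (/ r')) as [K [HK H]].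
  { split; [left; apply Rinv_0_lt_compat; lra|apply Rinv_lt_contravar; [nra|lra]]. }
  exists (M * K * / r')%R. intros n. unfold dcoef. rewrite Cmod_mult, Cmod_R, Rabs_pos_eq by apply pos_INR.
  specialize (H (S n)). specialize (Hc (S n)). rewrite !pow_inv in H.
  assert (P := pos_INR (S n)).
  apply Rle_trans with (INR (S n) * (M / r ^ S n))%R; [apply Rmult_le_compat_l; auto|].
  replace (INR (S n) * (M / r ^ S n))%R with (M * (INR (S n) * / r ^ S n))%R by (unfold Rdiv; ring).
  apply Rle_trans with (M * (K * / r' ^ S n))%R; [apply Rmult_le_compat_l; auto|].
  right. simpl pow. field. repeat split; try (apply pow_nonzero); lra.
Qed.

Lemma psum_plus (c d : nat -> C) n : psum (fun k => c k + d k) n = psum c n + psum d n.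
Proof. induction n; simpl; [ring|rewrite IHn; ring]. Qed.

Lemma psum_scal (a : C) (c : nat -> C) n : psum (fun k => a * c k) n = a * psum c n.
Proof. induction n; simpl; [ring|rewrite IHn; ring]. Qed.

Lemma psum_ext (c d : nat -> C) n : (forall k, c k = d k) -> psum c n = psum d n.
Proof. intros H. f_equal. apply functional_extensionality, H. Qed.

Lemma ps_plus c d M N r (w : C) : 0 < r -> cbd c M r -> cbd d N r -> Cmod w < r ->
  ps (fun k => c k + d k) w = ps c w + ps d w.
Proof.
  intros Hr Hc Hd Hw. symmetry. assert (Q := quot_lt1 w r Hr Hw).
  apply (csum_unique _ (M + N) (Cmod w / r) (2 * M / (1 - Cmod w / r) + 2 * N / (1 - Cmod w / r)) _ Q).
  - intros k. replace ((c k + d k) * w ^ k) with (c k * w ^ k + d k * w ^ k) by ring.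
    eapply Rle_trans; [apply Cmod_triangle|]. rewrite Rmult_plus_distr_r.
    apply Rplus_le_compat; apply cbd_term; auto.
  - intros n. rewrite (psum_ext _ (fun k => c k * w ^ k + d k * w ^ k)) by (intros; ring).
    rewrite psum_plus.
    replace (ps c w + ps d w - (psum (fun k => c k * w ^ k) n + psum (fun k => d k * w ^ k) n)) with
      ((ps c w - psum (fun k => c k * w ^ k) n) + (ps d w - psum (fun k => d k * w ^ k) n)) by ring.
    eapply Rle_trans; [apply Cmod_triangle|].
    assert (A := ps_tail c M r w n Hr Hc Hw). assert (B := ps_tail d N r w n Hr Hd Hw).
    replace ((2 * M / (1 - Cmod w / r) + 2 * N / (1 - Cmod w / r)) * (Cmod w / r) ^ n)%R with
      (2 * M * (Cmod w / r) ^ n / (1 - Cmod w / r) + 2 * N * (Cmod w / r) ^ n / (1 - Cmod w / r))%R by (unfold Rdiv; ring).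
    lra.
Qed.

Lemma ps_scal (a : C) c M r (w : C) : 0 < r -> cbd c M r -> Cmod w < r ->
  ps (fun k => a * c k) w = a * ps c w.
Proof.
  intros Hr Hc Hw. symmetry. assert (Q := quot_lt1 w r Hr Hw). assert (A0 := Cmod_ge_0 a).
  apply (csum_unique _ (Cmod a * M) (Cmod w / r) (Cmod a * (2 * M / (1 - Cmod w / r))) _ Q).
  - intros k. replace (a * c k * w ^ k) with (a * (c k * w ^ k)) by ring.
    rewrite Cmod_mult, Rmult_assoc. apply Rmult_le_compat_l; auto. apply cbd_term; auto.
  - intros n. rewrite (psum_ext _ (fun k => a * (c k * w ^ k))) by (intros; ring).
    rewrite psum_scal.
    replace (a * ps c w - a * psum (fun k => c k * w ^ k) n) with (a * (ps c w - psum (fun k => c k * w ^ k) n)) by ring.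
    rewrite Cmod_mult, Rmult_assoc. apply Rmult_le_compat_l; auto.
    eapply Rle_trans; [apply (ps_tail c M r w n Hr Hc Hw)|]. right; unfold Rdiv; ring.
Qed.

Lemma cbd_scal (a : C) c M r : cbd c M r -> cbd (fun k => a * c k) (Cmod a * M) r.
Proof.
  intros H n. rewrite Cmod_mult. unfold Rdiv. rewrite Rmult_assoc. apply Rmult_le_compat_l; [apply Cmod_ge_0|apply H].
Qed.

Lemma cbd_plus c d M N r : cbd c M r -> cbd d N r -> cbd (fun k => c k + d k) (M + N) r.
Proof.
  intros H K n. eapply Rle_trans; [apply Cmod_triangle|]. specialize (H n). specialize (K n).
  unfold Rdiv in *. rewrite Rmult_plus_distr_r. lra.
Qed.

Lemma cbd_shrink c M r r' : 0 < r' <= r -> cbd c M r -> cbd c M r'.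
Proof.
  intros Hr H n. assert (HM := cbd_nonneg _ _ _ H). eapply Rle_trans; [apply H|]. apply Rmult_le_compat_l; auto.
  apply Rinv_le_contravar; [apply pow_lt; lra|]. apply pow_incr. lra.
Qed.

Lemma cbd_shift c M r : 0 < r -> cbd c M r -> cbd (fun k => c (S k)) (M / r) r.
Proof. intros Hr H n. eapply Rle_trans; [apply H|]. right. simpl. field. repeat split; try (apply pow_nonzero); lra. Qed.

Lemma ps_shift c M r (w : C) : 0 < r -> cbd c M r -> Cmod w < r ->
  ps c w = c O + w * ps (fun k => c (S k)) w.
Proof.
  intros Hr Hc Hw. symmetry. assert (Q := quot_lt1 w r Hr Hw). assert (HM := cbd_nonneg _ _ _ Hc).
  assert (Hs := cbd_shift _ _ _ Hr Hc).
  assert (D : (1 - Cmod w / r)%R <> 0%R) by lra.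
  apply (csum_unique _ M (Cmod w / r) (2 * M / (1 - Cmod w / r)) _ Q).
  - apply cbd_term; auto.
  - intros [|n].
    + simpl. replace (c O + w * ps (fun k => c (S k)) w - 0) with (c O + w * ps (fun k => c (S k)) w) by ring.
      eapply Rle_trans; [apply Cmod_triangle|]. rewrite Cmod_mult.
      assert (A := ps_tail _ _ r w 0 Hr Hs Hw). simpl in A.
      replace (ps (fun k => c (S k)) w - 0) with (ps (fun k => c (S k)) w) in A by ring.
      assert (B := Hc O). simpl in B. unfold Rdiv at 1 in B. rewrite Rinv_1, Rmult_1_r in B.
      assert (W := Cmod_ge_0 w).
      apply Rle_trans with (M + Cmod w * (2 * (M / r) * 1 / (1 - Cmod w / r)))%R.
      * apply Rplus_le_compat; auto. apply Rmult_le_compat_l; auto.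
      * set (q := (Cmod w / r)%R) in *. replace (Cmod w * (2 * (M / r) * 1 / (1 - q)))%R with (2 * M * q / (1 - q))%R by (unfold q; field; split; [fold q|]; lra).
        apply Rmult_le_reg_r with (1 - q)%R; [lra|].
        replace ((M + 2 * M * q / (1 - q)) * (1 - q))%R with (M * (1 - q) + 2 * M * q)%R by (field; lra).
        replace (2 * M / (1 - q) * 1 * (1 - q))%R with (2 * M)%R by (field; lra). nra.
    + assert (E : forall m, psum (fun k => c k * w ^ k) (S m) = c O + w * psum (fun k => c (S k) * w ^ k) m).
      { induction m as [|m IH]; [simpl; ring|]. 
        change (psum (fun k => c k * w ^ k) (S (S m))) with (psum (fun k => c k * w ^ k) (S m) + c (S m) * w ^ S m).
        rewrite IH. simpl. ring. }
      rewrite E.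
      replace (c O + w * ps (fun k => c (S k)) w - (c O + w * psum (fun k => c (S k) * w ^ k) n)) with
        (w * (ps (fun k => c (S k)) w - psum (fun k => c (S k) * w ^ k) n)) by ring.
      rewrite Cmod_mult.
      eapply Rle_trans; [apply Rmult_le_compat_l; [apply Cmod_ge_0|apply (ps_tail _ _ r w n Hr Hs Hw)]|].
      right. simpl pow. unfold Rdiv. ring.
Qed.

Lemma psum_bound (c : nat -> C) (M q : R) n : 0 <= q < 1 -> (forall k, (Cmod (c k) <= M * q ^ k)%R) ->
  (Cmod (psum c n) <= M / (1 - q))%R.
Proof.
  intros Hq Hc. assert (HM : 0 <= M). { specialize (Hc O). simpl in Hc. assert (A := Cmod_ge_0 (c O)). lra. }
  assert (H : (Cmod (psum c n) <= M * (1 - q ^ n) / (1 - q))%R).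
  { induction n as [|n IH]; simpl.
    - rewrite Cmod_0. right. field. lra.
    - eapply Rle_trans; [apply Cmod_triangle|]. specialize (Hc n).
      replace (M * (1 - q * q ^ n) / (1 - q))%R with (M * (1 - q ^ n) / (1 - q) + M * q ^ n)%R by (field; lra). lra. }
  eapply Rle_trans; [exact H|]. apply Rmult_le_compat_r; [left; apply Rinv_0_lt_compat; lra|].
  assert (P : (0 <= q ^ n)%R) by (apply pow_le; lra). nra.
Qed.

Lemma ps_bound c M r r' (w : C) : 0 < r' < r -> cbd c M r -> Cmod w <= r' -> (Cmod (ps c w) <= 2 * M / (1 - r' / r))%R.
Proof.
  intros Hr Hc Hw. assert (HM := cbd_nonneg _ _ _ Hc).
  assert (A := ps_tail c M r w 0 ltac:(lra) Hc ltac:(lra)). simpl in A.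
  replace (ps c w - 0) with (ps c w) in A by ring.
  eapply Rle_trans; [exact A|]. rewrite Rmult_1_r. apply Rmult_le_compat_l; [lra|].
  assert (Cmod w / r <= r' / r) by (apply Rmult_le_compat_r; [left; apply Rinv_0_lt_compat; lra|auto]).
  assert (r' / r < 1). { apply div_lt_1; lra. }
  apply Rinv_le_contravar; lra.
Qed.

Lemma psum_lim_bound (c : nat -> C) (M q B : R) : 0 <= q < 1 -> (forall k, (Cmod (c k) <= M * q ^ k)%R) ->
  (forall n, Cmod (psum c n) <= B) -> Cmod (csum c) <= B.
Proof.
  intros Hq Hc HB. apply le_epsilon. intros e He.
  destruct (geom_small (2 * M / (1 - q)) q e Hq He) as [N HN]. specialize (HN N (le_n N)).
  assert (A := csum_tail c M q N Hq Hc). specialize (HB N).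
  assert (T := Cmod_triangle (psum c N) (csum c - psum c N)).
  replace (psum c N + (csum c - psum c N)) with (csum c) in T by ring.
  replace (2 * M * q ^ N / (1 - q))%R with (2 * M / (1 - q) * q ^ N)%R in A by (unfold Rdiv; ring). lra.
Qed.

(** The termwise remainders of [pow_second] are summed: the remainder of the series is O(|z - w|^2),
    with a constant valid for all |z| <= s. *)
Lemma ps_cd c M r (w : C) : 0 < r -> cbd c M r -> Cmod w < r -> cd (ps c) w (ps (dcoef c) w).
Proof.
  intros Hr Hc Hw. assert (HM := cbd_nonneg _ _ _ Hc). assert (W := Cmod_ge_0 w).
  (* The points z stay in |z| <= s; the two further radii p and p' below r absorb the two factors
     n. *)
  set (s := ((Cmod w + r) / 2)%R). set (p := ((s + r) / 2)%R). set (p' := ((p + r) / 2)%R).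
  assert (s1 : 0 < s) by (unfold s; lra). assert (s2 : Cmod w < s) by (unfold s; lra). assert (s3 : s < p) by (unfold p, s; lra).
  assert (p1 : p < p') by (unfold p', p, s; lra). assert (p2 : p' < r) by (unfold p', p, s; lra).
  destruct (n_geom2 s p) as [K1 [HK1 G1]]; [lra|]. destruct (n_geom2 p p') as [K2 [HK2 G2]]; [lra|].
  destruct (dcoef_cbd c M r s) as [M' Hd]; [lra|auto|].
  set (B := (M * (K1 * K2) / (s * s) / (1 - p' / r))%R).
  assert (Pr : 0 <= p' / r < 1).
  { split; [apply div_nonneg; [lra|lra]|].
    apply div_lt_1; lra. }
  assert (HB : 0 <= B).
  { unfold B. apply div_nonneg; [|lra].
    apply div_nonneg; [|nra]. apply Rmult_le_pos; [auto|nra]. }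
  assert (Main : forall z, Cmod z <= s -> (Cmod (ps c z - ps c w - ps (dcoef c) w * (z - w))%C <= B * (Cmod (z - w) * Cmod (z - w)))%R).
  { intros z Hz. set (h := Cmod (z - w)). assert (h0 : 0 <= h) by apply Cmod_ge_0.
    set (t := fun k => c k * (z ^ k - w ^ k - RtoC (INR k) * w ^ (pred k) * (z - w))).
    assert (T : forall k, (Cmod (t k) <= (M * (K1 * K2) / (s * s) * (h * h)) * (p' / r) ^ k)%R).
    { intros k. unfold t. rewrite Cmod_mult.
      assert (A := pow_second z w s k s1 Hz ltac:(lra)). fold h in A.
      set (E := Cmod (z ^ k - w ^ k - RtoC (INR k) * w ^ (pred k) * (z - w))) in *. assert (E0 : 0 <= E) by apply Cmod_ge_0.
      assert (N0 := pos_INR k). assert (rk : (0 < r ^ k)%R) by (apply pow_lt; lra).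
      assert (X : (INR k * INR k * s ^ k <= K1 * K2 * p' ^ k)%R).
      { apply Rle_trans with (INR k * (K1 * p ^ k))%R; [rewrite Rmult_assoc; apply Rmult_le_compat_l; auto|].
        replace (INR k * (K1 * p ^ k))%R with (K1 * (INR k * p ^ k))%R by ring. rewrite (Rmult_assoc K1).
        apply Rmult_le_compat_l; [lra|auto]. }
      assert (Y : (E <= K1 * K2 * p' ^ k * (h * h) / (s * s))%R).
      { apply Rmult_le_reg_r with (s * s)%R; [nra|]. eapply Rle_trans; [exact A|].
        replace (K1 * K2 * p' ^ k * (h * h) / (s * s) * (s * s))%R with (K1 * K2 * p' ^ k * (h * h))%R by (field; lra).
        apply Rmult_le_compat_r; [nra|auto]. }
      eapply Rle_trans; [apply Rmult_le_compat; [apply Cmod_ge_0|auto|apply Hc|exact Y]|].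
      right. unfold Rdiv. rewrite Rpow_mult_distr, pow_inv. field. split; lra. }
    assert (Z : ps c z - ps c w - ps (dcoef c) w * (z - w) = csum t).
    { set (q := (Rmax (s / r) (Cmod w / s))%R).
      assert (q1 : s / r < 1). { apply div_lt_1; lra. }
      assert (q2 := proj2 (quot_lt1 w s s1 s2)).
      assert (q0 : 0 <= s / r) by (apply div_nonneg; [lra|lra]).
      assert (Q : 0 <= q < 1).
      { split; [eapply Rle_trans; [exact q0|apply Rmax_l]|apply Rmax_case; auto]. }
      set (Q' := Rmax q (p' / r)). assert (HQ' : 0 <= Q' < 1).
      { split; [eapply Rle_trans; [apply Q|apply Rmax_l]|apply Rmax_case; tauto]. }
      assert (qQ : q <= Q') by apply Rmax_l. assert (pQ : p' / r <= Q') by apply Rmax_r.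
      set (t1 := fun k => c k * z ^ k). set (t2 := fun k => c k * w ^ k). set (t3 := fun k => dcoef c k * w ^ k).
      apply C_eq_lim. intros e He.
      assert (X1 : forall n, (Cmod (ps c z - psum t1 (S n))%C <= 2 * M / (1 - q) * q ^ (S n))%R).
      { intros n. replace (2 * M / (1 - q) * q ^ S n)%R with (2 * M * q ^ S n / (1 - q))%R by (unfold Rdiv; ring).
        apply csum_tail; auto. intros k. eapply Rle_trans; [apply cbd_term; [exact Hr|exact Hc]|].
        apply Rmult_le_compat_l; auto. apply pow_incr. split; [apply div_nonneg; [apply Cmod_ge_0|lra]|].
        eapply Rle_trans; [|apply Rmax_l]. apply Rmult_le_compat_r; [left; apply Rinv_0_lt_compat; lra|auto]. }
      assert (X2 : forall n, (Cmod (ps c w - psum t2 (S n))%C <= 2 * M / (1 - q) * q ^ (S n))%R).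
      { intros n. replace (2 * M / (1 - q) * q ^ S n)%R with (2 * M * q ^ S n / (1 - q))%R by (unfold Rdiv; ring).
        apply csum_tail; auto. intros k. eapply Rle_trans; [apply cbd_term; [exact Hr|exact Hc]|].
        apply Rmult_le_compat_l; auto. apply pow_incr. split; [apply div_nonneg; [apply Cmod_ge_0|lra]|].
        eapply Rle_trans; [|apply Rmax_l]. apply Rmult_le_compat_r; [left; apply Rinv_0_lt_compat; lra|lra]. }
      assert (X3 : forall n, (Cmod (ps (dcoef c) w - psum t3 n)%C <= 2 * M' / (1 - q) * q ^ n)%R).
      { intros n. replace (2 * M' / (1 - q) * q ^ n)%R with (2 * M' * q ^ n / (1 - q))%R by (unfold Rdiv; ring).
        apply csum_tail; auto. intros k. eapply Rle_trans; [apply cbd_term; [exact s1|exact Hd]|].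
        apply Rmult_le_compat_l; [apply (cbd_nonneg _ _ _ Hd)|]. apply pow_incr. split; [apply div_nonneg; [apply Cmod_ge_0|lra]|]. apply Rmax_r. }
      set (Bt := (M * (K1 * K2) / (s * s) * (h * h))%R) in *.
      assert (X4 : forall n, (Cmod (csum t - psum t (S n))%C <= 2 * Bt / (1 - p' / r) * (p' / r) ^ (S n))%R).
      { intros n. replace (2 * Bt / (1 - p' / r) * (p' / r) ^ S n)%R with (2 * Bt * (p' / r) ^ S n / (1 - p' / r))%R by (unfold Rdiv; ring).
        apply csum_tail; auto. }
      (* Differentiation removes the constant term, so n terms of the derived series match n + 1
         terms of the others. *)
      assert (PE : forall n, psum t (S n) = psum t1 (S n) - psum t2 (S n) - psum t3 n * (z - w)).
      { induction n as [|n IH].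
        - unfold t, t1, t2; simpl. ring.
        - change (psum t (S (S n))) with (psum t (S n) + t (S n)). rewrite IH.
          change (psum t1 (S (S n))) with (psum t1 (S n) + t1 (S n)). change (psum t2 (S (S n))) with (psum t2 (S n) + t2 (S n)).
          change (psum t3 (S n)) with (psum t3 n + t3 n). generalize (psum t1 (S n)) (psum t2 (S n)) (psum t3 n). intros p1' p2' p3'. unfold t, t1, t2, t3, dcoef. simpl pred. ring. }
      destruct (geom_small (2 * M / (1 - q)) q (e / 4) Q ltac:(lra)) as [N1 L1].
      destruct (geom_small (2 * M' / (1 - q) * h) q (e / 4) Q ltac:(lra)) as [N3 L3].
      destruct (geom_small (2 * Bt / (1 - p' / r)) (p' / r) (e / 4) Pr ltac:(lra)) as [N4 L4].
      set (n := (N1 + N3 + N4)%nat).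
      specialize (L1 (S n) ltac:(lia)). specialize (L3 n ltac:(lia)). specialize (L4 (S n) ltac:(lia)).
      specialize (X1 n). specialize (X2 n). specialize (X3 n). specialize (X4 n). specialize (PE n).
      replace (ps c z - ps c w - ps (dcoef c) w * (z - w) - csum t) with
        ((ps c z - psum t1 (S n)) + (psum t (S n) - csum t) - ((ps c w - psum t2 (S n)) + (ps (dcoef c) w - psum t3 n) * (z - w))) by (rewrite PE; ring).
      eapply Rle_trans; [apply Cmod_sub_le|].
      eapply Rle_trans; [apply Rplus_le_compat; apply Cmod_triangle|]. rewrite Cmod_mult. fold h.
      rewrite (Cmod_sym (psum t (S n))).
      assert (X5 : (Cmod (ps (dcoef c) w - psum t3 n)%C * h <= 2 * M' / (1 - q) * q ^ n * h)%R) by (apply Rmult_le_compat_r; auto).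
      lra. }
    rewrite Z. eapply psum_lim_bound; [exact Pr|exact T|]. intros n.
    eapply Rle_trans; [apply psum_bound; [exact Pr|exact T]|]. right. unfold B, Rdiv. ring. }
  intros e He. exists (Rmin (s - Cmod w) (e / (B + 1))). split; [apply Rmin_case; [lra|apply Rdiv_lt_0_compat; lra]|].
  intros z Hz. destruct (lt_min Hz) as [Z1 Z2].
  assert (Z3 := Cmod_rev z w). specialize (Main z ltac:(lra)).
  eapply Rle_trans; [exact Main|]. rewrite <- Rmult_assoc. apply Rmult_le_compat_r; [apply Cmod_ge_0|].
  apply Rle_trans with (B * (e / (B + 1)))%R; [apply Rmult_le_compat_l; lra|].
  apply Rmult_le_reg_r with (B + 1)%R; [lra|]. replace (B * (e / (B + 1)) * (B + 1))%R with (B * e)%R by (field; lra). nra.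
Qed.

(** * Consequences of the Taylor expansion *)

(** If the coefficients below n vanish, then at a small zero w the term c_n w^n equals minus the
    tail, which is O(|w|^(n+1)); letting w tend to 0 gives c_n = 0. *)
Lemma ps_zero c M r : 0 < r -> cbd c M r ->
  (forall e, 0 < e -> exists w : C, w <> 0 /\ Cmod w < e /\ ps c w = 0) -> forall n, c n = 0.
Proof.
  intros Hr Hc Hz. assert (HM := cbd_nonneg _ _ _ Hc).
  assert (H : forall n k, (k < n)%nat -> c k = 0).
  { induction n as [|n IH]; [lia|]. intros k Hk.
    destruct (Nat.eq_dec k n) as [->|Hn]; [|apply IH; lia].
    apply C_eq_lim. intros e He. replace (c n - 0) with (c n) by ring.
    assert (P : (0 < r ^ S n)%R) by (apply pow_lt; lra).
    set (K := (4 * M / r ^ S n)%R). assert (HK : 0 <= K) by (apply div_nonneg; [lra|lra]).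
    destruct (Hz (Rmin (r / 2) (e / (K + 1)))) as [w [W0 [W1 W2]]].
    { apply Rmin_case; [lra|apply Rdiv_lt_0_compat; lra]. }
    destruct (lt_min W1) as [W3 W4].
    assert (Wp := proj1 (Cmod_gt_0 _) W0).
    assert (T := ps_tail c M r w (S n) Hr Hc ltac:(lra)). rewrite W2 in T.
    assert (E : psum (fun k => c k * w ^ k) n = 0).
    { clear - IH. induction n as [|n IHn]; [reflexivity|]. simpl. rewrite IHn by (intros; apply IH; lia).
      rewrite (IH n) by lia. ring. }
    simpl psum in T. rewrite E in T. replace (0 - (0 + c n * w ^ n)) with (- (c n * w ^ n)) in T by ring.
    rewrite Cmod_opp, Cmod_mult, Cmod_pow in T.
    assert (Wn : (0 < Cmod w ^ n)%R) by (apply pow_lt; auto).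
    assert (Q : (1 / 2 <= 1 - Cmod w / r)%R).
    { assert (Cmod w / r <= 1 / 2). { apply Rmult_le_reg_r with r; [lra|]. unfold Rdiv at 1. rewrite Rmult_assoc, Rinv_l; lra. } lra. }
    assert (T2 : (2 * M * (Cmod w / r) ^ S n / (1 - Cmod w / r) <= 4 * M * (Cmod w / r) ^ S n)%R).
    { replace (4 * M * (Cmod w / r) ^ S n)%R with (2 * M * (Cmod w / r) ^ S n * / (1 / 2))%R by field.
      apply Rmult_le_compat_l; [|apply Rinv_le_contravar; lra].
      apply Rmult_le_pos; [lra|]. apply pow_le. apply div_nonneg; [lra|lra]. }
    apply Rle_trans with (K * Cmod w)%R.
    - apply Rmult_le_reg_r with (Cmod w ^ n)%R; auto. eapply Rle_trans; [exact T|]. eapply Rle_trans; [exact T2|].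
      right. unfold K, Rdiv. rewrite Rpow_mult_distr, pow_inv. simpl pow. ring.
    - apply Rle_trans with (K * (e / (K + 1)))%R; [apply Rmult_le_compat_l; lra|].
      apply Rmult_le_reg_r with (K + 1)%R; [lra|]. replace (K * (e / (K + 1)) * (K + 1))%R with (K * e)%R by (field; lra). nra. }
  intros n. apply (H (S n)). lia.
Qed.

Lemma real_small (e : R) : 0 < e -> exists w : C, w <> 0 /\ Cmod w < e.
Proof.
  intros He. exists (RtoC (e / 2)). assert (Cmod (RtoC (e / 2)) = e / 2)%R by (rewrite Cmod_R, Rabs_pos_eq; lra).
  split; [apply Cmod_gt_0; lra|lra].
Qed.

Lemma ps_unique c d M N r s : 0 < r -> 0 < s -> cbd c M r -> cbd d N s ->
  (forall e, 0 < e -> exists w : C, w <> 0 /\ Cmod w < e /\ ps c w = ps d w) -> forall n, c n = d n.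
Proof.
  intros Hr Hs Hc Hd H. set (t := Rmin r s). assert (Ht : 0 < t) by (apply Rmin_case; lra).
  assert (Hc' : cbd c M t) by (apply (cbd_shrink c M r); auto; split; auto; apply Rmin_l).
  assert (Hd' : cbd d N t) by (apply (cbd_shrink d N s); auto; split; auto; apply Rmin_r).
  assert (Hd2 := cbd_scal (-1) _ _ _ Hd').
  assert (Z : forall n, c n + (-1) * d n = 0).
  { apply (ps_zero (fun n => c n + (-1) * d n) _ t Ht (cbd_plus _ _ _ _ _ Hc' Hd2)).
    intros e He. destruct (H (Rmin e t)) as [w [W0 [W1 W2]]]; [apply Rmin_case; lra|].
    exists w. destruct (lt_min W1) as [W3 W4].
    split; [auto|split; [auto|]].
    rewrite (ps_plus c _ _ _ t w Ht Hc' Hd2 W4), (ps_scal _ _ _ t w Ht Hd' W4), W2. ring. }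
  intros n. specialize (Z n). apply Ceq_minus. rewrite <- Z. ring.
Qed.

Lemma ps_at0 c M r : 0 < r -> cbd c M r -> ps c 0 = c O.
Proof. intros Hr Hc. rewrite (ps_shift c M r); [ring|auto|auto|rewrite Cmod_0; auto]. Qed.

Lemma ps_null (c : nat -> C) (w : C) : (forall n, c n = 0) -> ps c w = 0.
Proof.
  intros H. symmetry. apply (csum_unique _ 0 0 0); [lra| |].
  - intros k. rewrite H. replace (0 * w ^ k) with (RtoC 0) by ring. rewrite Cmod_0. lra.
  - intros n. replace (psum (fun k => c k * w ^ k) n) with (RtoC 0).
    + replace (0 - 0) with (RtoC 0) by ring. rewrite Cmod_0. lra.
    + induction n; simpl; [reflexivity|]. rewrite <- IHn, H. ring.
Qed.

Lemma identity_thm (f : C -> C) (a : C) (R0 M : R) : bh f a R0 M ->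
  (forall e, 0 < e -> exists z : C, z <> a /\ Cmod (z - a) < e /\ f z = 0) ->
  forall z, Cmod (z - a) < R0 -> f z = 0.
Proof.
  intros Hf Hz z Hlt. assert (Z0 := Cmod_ge_0 (z - a)).
  destruct (taylor f a R0 ((Cmod (z - a) + R0) / 2) M) as [c [Hc Hp]]; auto; [lra|].
  rewrite Hp by lra. apply ps_null.
  apply (ps_zero c (2 * M) ((Cmod (z - a) + R0) / 2)); auto; [lra|].
  intros e He. destruct (Hz (Rmin e ((Cmod (z - a) + R0) / 2))) as [w [W0 [W1 W2]]]; [apply Rmin_case; lra|].
  exists (w - a). split; [apply Cminus_eq_contra; auto|].
  destruct (lt_min W1) as [W3 W4].
  split; auto. rewrite <- Hp; auto.
Qed.

(** A total derivative function, with an arbitrary value where f is not differentiable; this allows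
    derivatives to be iterated without carrying proofs. *)
Definition Dc (f : C -> C) (z : C) : C := epsilon (inhabits (RtoC 0)) (fun l => cd f z l).

Lemma Dc_spec (f : C -> C) z : (exists l, cd f z l) -> cd f z (Dc f z).
Proof. apply epsilon_spec. Qed.

Lemma Dc_eq (f : C -> C) z l : cd f z l -> Dc f z = l.
Proof. intros H. apply (cd_unique f z); auto. apply Dc_spec. eauto. Qed.

Lemma cd_ps_at (f : C -> C) (a : C) c M r (z : C) : 0 < r -> cbd c M r ->
  (forall w, Cmod (w - a) < r -> f w = ps c (w - a)) -> Cmod (z - a) < r ->
  cd f z (ps (dcoef c) (z - a)).
Proof.
  intros Hr Hc Hf Hz.
  apply (cd_ext_loc (fun w => ps c (w - a)) f z _ (r - Cmod (z - a))); [lra| |].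
  - intros w Hw. symmetry. apply Hf. assert (A := Cmod_tri3 w z a). lra.
  - apply cd_val with (ps (dcoef c) (z - a) * (1 - 0)); [ring|].
    apply (cd_comp (ps c) (fun w => w - a)).
    + apply cd_minus; [apply cd_id|apply cd_const].
    + apply (ps_cd c M r); auto.
Qed.

Lemma bh_Dc (f : C -> C) a R0 r M : 0 < r < R0 -> bh f a R0 M -> exists M', bh (Dc f) a r M'.
Proof.
  intros Hr Hf. set (r1 := ((r + R0) / 2)%R). set (r2 := ((r + r1) / 2)%R).
  assert (A1 : r < r2) by (unfold r2, r1; lra). assert (A2 : r2 < r1) by (unfold r2, r1; lra).
  assert (A3 : r1 < R0) by (unfold r1; lra).
  destruct (taylor f a R0 r1 M) as [c [Hc Hp]]; auto; [lra|].
  destruct (dcoef_cbd c _ r1 r2 ltac:(lra) Hc) as [M1 Hd].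
  destruct (dcoef_cbd (dcoef c) _ r2 ((r + r2) / 2) ltac:(lra) Hd) as [M2 Hdd].
  assert (E : forall w, Cmod (w - a) < r2 -> Dc f w = ps (dcoef c) (w - a)).
  { intros w Hw. apply Dc_eq. apply (cd_ps_at f a c (2 * M) r1); auto; lra. }
  exists (2 * M1 / (1 - r / r2))%R. intros z Hz. split.
  - eexists. apply (cd_ps_at (Dc f) a (dcoef c) M1 r2); auto; lra.
  - rewrite E by lra. apply ps_bound; auto; lra.
Qed.

Lemma bh_cd (f : C -> C) a R0 M z : bh f a R0 M -> Cmod (z - a) < R0 -> cd f z (Dc f z).
Proof. intros Hf Hz. apply Dc_spec. apply Hf, Hz. Qed.

Lemma bh_cct (f : C -> C) a R0 M z : bh f a R0 M -> Cmod (z - a) < R0 -> cct f z.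
Proof. intros Hf Hz. eapply cd_cct, bh_cd; eauto. Qed.

(* K and d do not depend on f: difference quotients converge uniformly in a parameter. *)
Lemma taylor2 (R0 r M : R) : 0 < r < R0 -> exists K d : R, 0 < K /\ 0 < d /\
  forall (f : C -> C) (a : C), bh f a R0 M -> forall w z, Cmod (w - a) < r -> Cmod (z - w) < d ->
    Cmod (f z - f w) <= K * Cmod (z - w) /\
    Cmod (f z - f w - Dc f w * (z - w)) <= K * (Cmod (z - w) * Cmod (z - w)) /\
    Cmod (Dc f w) <= K.
Proof.
  intros Hr. set (p := ((R0 - r) / 2)%R). assert (Hp : 0 < p) by (unfold p; lra).
  set (M0 := Rmax M 0).
  assert (HM0 : 0 <= M0) by apply Rmax_r.
  exists (2 * M0 / p + 8 * M0 / p + 8 * M0 / (p * p) + 1)%R, (p / 2)%R.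
  assert (Q1 : 0 <= M0 / p) by (apply div_nonneg; [lra|lra]).
  assert (Q2 : 0 <= M0 / (p * p)) by (apply div_nonneg; [lra|nra]).
  assert (E1 : (2 * M0 / p = 2 * (M0 / p))%R) by (unfold Rdiv; ring).
  assert (E2 : (8 * M0 / p = 8 * (M0 / p))%R) by (unfold Rdiv; ring).
  assert (E3 : (8 * M0 / (p * p) = 8 * (M0 / (p * p)))%R) by (unfold Rdiv; ring).
  split; [lra|]. split; [lra|].
  intros f a Hf w z Hw Hz.
  assert (Hfw : bh f w (R0 - r) M0).
  { intros v Hv. destruct (Hf v) as [H1 H2].
    - assert (A := Cmod_tri3 v w a). lra.
    - split; auto. eapply Rle_trans; [exact H2|apply Rmax_l]. }
  destruct (taylor f w (R0 - r) p M0) as [c [Hc Ht]]; auto; [unfold p; lra|].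
  assert (W0 : Cmod (w - w) < p) by (replace (w - w) with (RtoC 0) by ring; rewrite Cmod_0; auto).
  assert (F0 : f w = c O).
  { rewrite (Ht w W0). replace (w - w) with (RtoC 0) by ring. apply (ps_at0 c (2 * M0) p); auto. }
  assert (F1 : Dc f w = c 1%nat).
  { apply Dc_eq. eapply cd_val; [|apply (cd_ps_at f w c (2 * M0) p w); auto].
    destruct (dcoef_cbd c (2 * M0) p (p / 2) ltac:(lra) Hc) as [M1 Hd].
    replace (w - w) with (RtoC 0) by ring. rewrite (ps_at0 _ M1 (p / 2)); auto; [|lra].
    unfold dcoef. simpl. ring. }
  set (h := Cmod (z - w)) in *. assert (h0 : 0 <= h) by apply Cmod_ge_0.
  assert (q : h / p <= 1 / 2).
  { apply Rmult_le_reg_r with p; auto. unfold Rdiv at 1. rewrite Rmult_assoc, Rinv_l; lra. }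
  assert (Qi : / (1 - h / p) <= 2).
  { replace 2%R with (/ (1 / 2))%R by field. apply Rinv_le_contravar; lra. }
  assert (qz : 0 <= h / p) by (apply div_nonneg; [lra|lra]).
  assert (T1 := ps_tail c (2 * M0) p (z - w) 1 Hp Hc ltac:(fold h; lra)).
  assert (T2 := ps_tail c (2 * M0) p (z - w) 2 Hp Hc ltac:(fold h; lra)).
  rewrite <- Ht in T1, T2 by (fold h; lra). fold h in T1, T2. simpl in T1, T2.
  replace (f z - (0 + c O * 1)) with (f z - f w) in T1 by (rewrite F0; ring).
  replace (f z - (0 + c O * 1 + c 1%nat * ((z - w) * 1))) with (f z - f w - Dc f w * (z - w)) in T2 by (rewrite F0, F1; ring).
  assert (U1 : (2 * (2 * M0) * (h / p * 1) / (1 - h / p) <= 8 * M0 / p * h)%R).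
  { apply Rle_trans with (2 * (2 * M0) * (h / p * 1) * 2)%R.
    - apply Rmult_le_compat_l; [|exact Qi]. apply Rmult_le_pos; lra.
    - right. unfold Rdiv; ring. }
  assert (U2 : (2 * (2 * M0) * (h / p * (h / p * 1)) / (1 - h / p) <= 8 * M0 / (p * p) * (h * h))%R).
  { apply Rle_trans with (2 * (2 * M0) * (h / p * (h / p * 1)) * 2)%R.
    - apply Rmult_le_compat_l; [|exact Qi]. apply Rmult_le_pos; [lra|]. nra.
    - right. field. lra. }
  split; [|split].
  - eapply Rle_trans; [exact T1|]. eapply Rle_trans; [exact U1|]. apply Rmult_le_compat_r; lra.
  - eapply Rle_trans; [exact T2|]. eapply Rle_trans; [exact U2|]. apply Rmult_le_compat_r; [nra|lra].
  - rewrite F1. specialize (Hc 1%nat). simpl in Hc. rewrite Rmult_1_r in Hc. lra.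
Qed.

Lemma cctc_of_lim (f : C -> C) (R0 : R) :
  (forall e, 0 < e -> exists g, (forall z, Cmod z < R0 -> cct g z) /\ forall z, Cmod z < R0 -> Cmod (f z - g z) <= e) ->
  forall z, Cmod z < R0 -> cct f z.
Proof.
  intros H z Hz e He. destruct (H (e / 4)%R ltac:(lra)) as [g [G1 G2]].
  destruct (G1 z Hz (e / 4)%R ltac:(lra)) as [d [Hd K]].
  exists (Rmin d (R0 - Cmod z)). split; [apply Rmin_case; lra|]. intros w Hw.
  destruct (lt_min Hw) as [W1 W2].
  assert (W3 : Cmod w < R0). { assert (A := Cmod_tri3 w z 0). replace (w - 0) with w in A by ring. replace (z - 0) with z in A by ring. lra. }
  specialize (K w W1). assert (A := G2 z Hz). assert (B := G2 w W3).
  assert (T1 := Cmod_tri3 (f w) (g w) (f z)). assert (T2 := Cmod_tri3 (g w) (g z) (f z)).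
  rewrite (Cmod_sym (g z)) in T2. lra.
Qed.

(** Weierstrass: Cauchy's formula passes to the uniform limit, and by [taylor_of_cauchy] it already
    implies a power series expansion. *)
Lemma unif_lim0 (f : C -> C) (R0 M : R) : (forall z, Cmod z < R0 -> Cmod (f z) <= M) ->
  (forall e, 0 < e -> exists g, (forall z, Cmod z < R0 -> exists l, cd g z l) /\ forall z, Cmod z < R0 -> Cmod (f z - g z) <= e) ->
  forall z, Cmod z < R0 -> exists l, cd f z l.
Proof.
  intros HM H z Hz. assert (Z0 := Cmod_ge_0 z). set (r := ((Cmod z + R0) / 2)%R).
  assert (Fc : forall z, Cmod z < R0 -> cct f z).
  { apply cctc_of_lim. intros e He. destruct (H e He) as [g [G1 G2]]. exists g. split; auto.
    intros v Hv. destruct (G1 v Hv) as [l Hl]. eapply cd_cct; eauto. }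
  assert (Hr : 0 < r < R0) by (unfold r; lra). assert (Hzr : Cmod z < r) by (unfold r; lra).
  destruct (taylor_of_cauchy f r M) as [c [Hc Hp]]; [lra| | | |].
  - intros v Hv. apply Fc. lra.
  - intros v Hv. apply HM. lra.
  - intros w Hw. apply C_eq_lim. intros e He.
    assert (PP := two_pi_pos). assert (W := Cmod_ge_0 w).
    set (k := (r / (r - Cmod w))%R). assert (Hk : 0 < k) by (apply Rdiv_lt_0_compat; lra).
    (* On the circle the kernel is at most k; the two terms of the denominator pay for the error in
       the integral and for the error in the value at w. *)
    set (e1 := (e / (2 * (2 * PI) * k + 2 * PI))%R).
    assert (Hden : (0 < 2 * (2 * PI) * k + 2 * PI)%R) by nra.
    assert (He1 : 0 < e1) by (apply Rdiv_lt_0_compat; auto).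
    destruct (H e1 He1) as [g [G1 G2]].
    assert (Gc : forall z, Cmod z < R0 -> cct g z).
    { intros v Hv. destruct (G1 v Hv) as [l Hl]. eapply cd_cct; eauto. }
    assert (Kc : cctc (fun z => z / (z - w)) r).
    { intros v Hv. destruct (cd_kernel w v) as [m Hm]; [lra|]. eapply cd_cct; eauto. }
    assert (CF := cauchy_formula g R0 r w Hr Hw G1).
    rewrite (cmean_ext _ (fun v => g v * (v / (v - w)) + (f v + (-1) * g v) * (v / (v - w)))); [|lra|intros; ring].
    rewrite cmean_plus, CF; [|lra| |].
    + replace (RtoC (2 * PI) * g w + cmean (fun v => (f v + -1 * g v) * (v / (v - w))) r - RtoC (2 * PI) * f w) with
        (cmean (fun v => (f v + -1 * g v) * (v / (v - w))) r - RtoC (2 * PI) * (f w - g w)) by ring.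
      eapply Rle_trans; [apply Cmod_sub_le|]. rewrite Cmod_mult, Cmod_R, (Rabs_pos_eq (2 * PI)) by lra.
      assert (B : Cmod (cmean (fun v => (f v + -1 * g v) * (v / (v - w))) r) <= 2 * (e1 * k) * (2 * PI)).
      { apply cmean_bound; [lra| |].
        - intros v Hv. apply cct_mult; [|apply Kc; auto]. apply cct_plus; [apply Fc; lra|]. apply cct_mult; [apply cct_const|apply Gc; lra].
        - intros v Hv. rewrite Cmod_mult, Cmod_div, Hv by (apply Cmod_nz_of_lt; lra).
          apply Rmult_le_compat; [apply Cmod_ge_0| | |].
          + apply Rmult_le_pos; [lra|]. left; apply Rinv_0_lt_compat. apply Cmod_gt_0, Cmod_nz_of_lt. lra.
          + replace (f v + -1 * g v) with (f v - g v) by ring. apply G2. lra.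
          + apply Rmult_le_compat_l; [lra|]. apply Rinv_le_contravar; [lra|]. assert (D := Cmod_rev v w). lra. }
      assert (A := G2 w ltac:(lra)).
      assert (Ee : (e1 * (2 * (2 * PI) * k + 2 * PI) = e)%R) by (unfold e1; field; lra). nra.
    + intros v Hv. apply cct_mult; [apply Gc; lra|apply Kc; auto].
    + intros v Hv. apply cct_mult; [|apply Kc; auto]. apply cct_plus; [apply Fc; lra|]. apply cct_mult; [apply cct_const|apply Gc; lra].
  - exists (ps (dcoef c) z). apply (cd_ext_loc (ps c) f z _ (r - Cmod z)); [lra| |apply (ps_cd c (2 * M) r); auto; lra].
    intros w Hw. symmetry. apply Hp. assert (A := Cmod_tri3 w z 0). replace (w - 0) with w in A by ring. replace (z - 0) with z in A by ring. lra.
Qed.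

Lemma unif_lim (f : C -> C) (a : C) (R0 M : R) : (forall z, Cmod (z - a) < R0 -> Cmod (f z) <= M) ->
  (forall e, 0 < e -> exists g, (forall z, Cmod (z - a) < R0 -> exists l, cd g z l) /\ forall z, Cmod (z - a) < R0 -> Cmod (f z - g z) <= e) ->
  bh f a R0 M.
Proof.
  intros HM H z Hz. split; auto.
  assert (S : forall v, a + v - a = v) by (intros; ring).
  destruct (unif_lim0 (fun v => f (a + v)) R0 M) with (z := z - a) as [l Hl]; auto.
  - intros v Hv. apply HM. rewrite S. auto.
  - intros e He. destruct (H e He) as [g [G1 G2]]. exists (fun v => g (a + v)). split.
    + intros v Hv. destruct (G1 (a + v)) as [l Hl]; [rewrite S; auto|]. eexists. apply (cd_comp g (fun v => a + v)); [|exact Hl].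
      apply cd_plus; [apply cd_const|apply cd_id].
    + intros v Hv. apply G2. rewrite S; auto.
  - eexists. apply (cd_ext (fun v => f (a + (v - a)))); [intros; f_equal; ring|].
    apply (cd_comp (fun v => f (a + v)) (fun v => v - a)); [|exact Hl].
    apply cd_minus; [apply cd_id|apply cd_const].
Qed.

(** The Taylor coefficients of f at a, selected for all centres at once: this gives functions of a
    that do not depend on any chosen disc. *)
Definition Tc (f : C -> C) (a : C) : nat -> C :=
  epsilon (inhabits (fun _ => RtoC 0)) (fun c => exists M r, 0 < r /\ cbd c M r /\
    forall w, Cmod (w - a) < r -> f w = ps c (w - a)).

Lemma Tc_eq (f : C -> C) (a : C) c M r : 0 < r -> cbd c M r ->
  (forall w, Cmod (w - a) < r -> f w = ps c (w - a)) -> Tc f a = c.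
Proof.
  intros Hr Hc Hf.
  assert (S : exists M' r', 0 < r' /\ cbd (Tc f a) M' r' /\ forall w, Cmod (w - a) < r' -> f w = ps (Tc f a) (w - a)).
  { unfold Tc. apply epsilon_spec. exists c, M, r. auto. }
  destruct S as [M' [r' [Hr' [Hc' Hf']]]].
  apply functional_extensionality. apply (ps_unique _ _ M' M r' r); auto.
  intros e He. destruct (real_small (Rmin e (Rmin r r'))) as [w [W0 W1]]; [repeat apply Rmin_case; auto|].
  destruct (lt_min W1) as [W2 W3].
  destruct (lt_min W3) as [W4 W5].
  exists w. split; [auto|split; [auto|]].
  assert (E : a + w - a = w) by ring.
  specialize (Hf (a + w)). specialize (Hf' (a + w)). rewrite E in Hf, Hf'. rewrite <- Hf, <- Hf' by auto. reflexivity.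
Qed.

Lemma Tc_spec (f : C -> C) (a : C) (R0 r M : R) : 0 < r < R0 -> bh f a R0 M ->
  cbd (Tc f a) (2 * M) r /\ forall w, Cmod (w - a) < r -> f w = ps (Tc f a) (w - a).
Proof.
  intros Hr Hf. destruct (taylor f a R0 r M Hr Hf) as [c [Hc Hp]].
  rewrite (Tc_eq f a c (2 * M) r); auto. lra.
Qed.

(** * Separately holomorphic functions of two variables *)

(** Neither joint continuity nor joint differentiability is demanded; boundedness is what makes them
    follow. *)
Definition sh (f : C -> C -> C) (a b : C) (r M : R) : Prop :=
  forall u v, Cmod (u - a) < r -> Cmod (v - b) < r ->
    (exists l, cd (fun x => f x v) u l) /\ (exists l, cd (fun y => f u y) v l) /\ Cmod (f u v) <= M.

Definition D1 (f : C -> C -> C) (u v : C) : C := Dc (fun x => f x v) u.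
Definition D2 (f : C -> C -> C) (u v : C) : C := Dc (fun y => f u y) v.

Lemma sh_flip f a b r M : sh f a b r M -> sh (fun u v => f v u) b a r M.
Proof. intros H u v Hu Hv. destruct (H v u Hv Hu) as [H1 [H2 H3]]. auto. Qed.

Lemma sh_shrink f a b r r' M : r' <= r -> sh f a b r M -> sh f a b r' M.
Proof. intros Hr H u v Hu Hv. apply H; lra. Qed.

Lemma sh_bh1 f a b r M v : sh f a b r M -> Cmod (v - b) < r -> bh (fun x => f x v) a r M.
Proof. intros H Hv u Hu. destruct (H u v Hu Hv) as [H1 [_ H3]]. auto. Qed.

Lemma sh_bh2 f a b r M u : sh f a b r M -> Cmod (u - a) < r -> bh (fun y => f u y) b r M.
Proof. intros H Hu v Hv. destruct (H u v Hu Hv) as [_ [H2 H3]]. auto. Qed.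

Lemma sh_recenter f a b r M a' b' r' : sh f a b r M -> Cmod (a' - a) + r' <= r -> Cmod (b' - b) + r' <= r -> sh f a' b' r' M.
Proof.
  intros H Ha Hb u v Hu Hv. apply H.
  - assert (A := Cmod_tri3 u a' a). lra.
  - assert (A := Cmod_tri3 v b' b). lra.
Qed.

(** By [taylor2] the difference quotients in v converge to [D2 f] uniformly in u, and each of them
    is holomorphic in u; so the limit is. *)
Lemma sh_D2 f a b R0 r M : 0 < r < R0 -> sh f a b R0 M -> exists M', sh (D2 f) a b r M'.
Proof.
  intros Hr Hf. destruct (taylor2 R0 r M Hr) as [K [d [HK [Hd T]]]].
  exists K. intros u v Hu Hv.
  assert (Tu : forall u, Cmod (u - a) < r -> forall z, Cmod (z - v) < d ->
     Cmod (f u z - f u v - D2 f u v * (z - v)) <= K * (Cmod (z - v) * Cmod (z - v)) /\ Cmod (D2 f u v) <= K).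
  { intros u' Hu' z Hz. destruct (T (fun y => f u' y) b) with (w := v) (z := z) as [_ [A B]]; auto.
    eapply sh_bh2; eauto; lra. }
  split; [|split].
  - apply (unif_lim (fun x => D2 f x v) a r K); auto.
    + intros x Hx. apply (Tu x Hx v). replace (v - v) with (RtoC 0) by ring. rewrite Cmod_0; auto.
    + intros e He.
      set (h := Rmin (e / K) (Rmin (d / 2) ((R0 - r) / 2))).
      assert (Hh : 0 < h) by (repeat apply Rmin_case; try lra; apply Rdiv_lt_0_compat; lra).
      assert (h1 : h <= e / K) by apply Rmin_l. assert (h' : h <= Rmin (d / 2) ((R0 - r) / 2)) by apply Rmin_r.
      assert (h2 := Rle_trans _ _ _ h' (Rmin_l _ _)). assert (h3 := Rle_trans _ _ _ h' (Rmin_r _ _)).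
      assert (Hn : RtoC h <> 0) by (intros E; apply RtoC_inj in E; lra).
      assert (Ch : Cmod (RtoC h) = h) by (rewrite Cmod_R, Rabs_pos_eq; lra).
      assert (E : v + RtoC h - v = RtoC h) by ring.
      exists (fun x => / RtoC h * (f x (v + RtoC h) - f x v)). split.
      * intros x Hx. destruct (Hf x (v + RtoC h)) as [[l1 L1] _]; [lra| |].
        { assert (A := Cmod_triangle (v - b) (RtoC h)). replace (v - b + RtoC h) with (v + RtoC h - b) in A by ring. lra. }
        destruct (Hf x v) as [[l2 L2] _]; [lra|lra|].
        eexists. apply cd_scal. apply cd_minus; eauto.
      * intros x Hx. destruct (Tu x Hx (v + RtoC h)) as [A _]; [rewrite E, Ch; lra|]. rewrite E, Ch in A.
        replace (D2 f x v - / RtoC h * (f x (v + RtoC h) - f x v)) with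
          (- (/ RtoC h * (f x (v + RtoC h) - f x v - D2 f x v * RtoC h))) by (field; auto).
        rewrite Cmod_opp, Cmod_mult, Cmod_inv, Ch by auto.
        apply Rle_trans with (/ h * (K * (h * h)))%R.
        { apply Rmult_le_compat_l; [left; apply Rinv_0_lt_compat; auto|exact A]. }
        replace (/ h * (K * (h * h)))%R with (K * h)%R by (field; lra).
        apply Rle_trans with (K * (e / K))%R; [apply Rmult_le_compat_l; lra|]. right; field; lra.
  - destruct (bh_Dc (fun y => f u y) b R0 r M) as [M' HM']; auto.
    { eapply sh_bh2; eauto; lra. }
    apply HM'. auto.
  - apply (Tu u Hu v). replace (v - v) with (RtoC 0) by ring. rewrite Cmod_0; auto.
Qed.

Lemma sh_D1 f a b R0 r M : 0 < r < R0 -> sh f a b R0 M -> exists M', sh (D1 f) a b r M'.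
Proof.
  intros Hr Hf. destruct (sh_D2 (fun u v => f v u) b a R0 r M Hr (sh_flip _ _ _ _ _ Hf)) as [M' H].
  exists M'. apply (sh_flip _ _ _ _ _ H).
Qed.

Lemma sh_cd1 f a b r M u v : sh f a b r M -> Cmod (u - a) < r -> Cmod (v - b) < r -> cd (fun x => f x v) u (D1 f u v).
Proof. intros H Hu Hv. apply Dc_spec. apply (H u v Hu Hv). Qed.

Lemma sh_cd2 f a b r M u v : sh f a b r M -> Cmod (u - a) < r -> Cmod (v - b) < r -> cd (fun y => f u y) v (D2 f u v).
Proof. intros H Hu Hv. apply Dc_spec. apply (H u v Hu Hv). Qed.

(** The increment is split into a step in u at height v + k and a step in v. The mismatch between D1
    f at heights v + k and v is O(|k|), since D1 f is holomorphic in v, and is multiplied by h. *)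
Lemma sh_total f a b R0 r M : 0 < r < R0 -> sh f a b R0 M -> exists K d : R, 0 < K /\ 0 < d /\
  forall u v h k, Cmod (u - a) < r -> Cmod (v - b) < r -> Cmod h < d -> Cmod k < d ->
    Cmod (f (u + h) (v + k) - f u v - (D1 f u v * h + D2 f u v * k)) <=
      K * ((Cmod h + Cmod k) * (Cmod h + Cmod k)) /\
    Cmod (f (u + h) (v + k) - f u v) <= K * (Cmod h + Cmod k).
Proof.
  intros Hr Hf. set (r1 := ((r + R0) / 2)%R).
  assert (A1 : r < r1) by (unfold r1; lra). assert (A2 : r1 < R0) by (unfold r1; lra).
  destruct (sh_D1 f a b R0 r1 M ltac:(lra) Hf) as [M1 H1].
  destruct (taylor2 R0 r1 M ltac:(lra)) as [K [d [HK [Hd T]]]].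
  destruct (taylor2 r1 r M1 ltac:(lra)) as [K1 [d1 [HK1 [Hd1 T1]]]].
  exists (K + K1 + K)%R, (Rmin d (Rmin d1 (r1 - r))). split; [lra|].
  split; [repeat apply Rmin_case; lra|]. intros u v h k Hu Hv Hh Hk.
  assert (h1 := proj1 (lt_min Hh)). destruct (lt_min Hk) as [k1 k']. destruct (lt_min k') as [k2 k3].
  assert (Vk : Cmod (v + k - b) < r1).
  { assert (A := Cmod_triangle (v - b) k). replace (v - b + k) with (v + k - b) in A by ring. lra. }
  assert (E1 : u + h - u = h) by ring. assert (E2 : v + k - v = k) by ring.
  destruct (T (fun x => f x (v + k)) a) with (w := u) (z := u + h) as [B0 [B1 _]].
  { eapply sh_bh1; eauto; lra. } { lra. } { rewrite E1; auto. }
  destruct (T (fun y => f u y) b) with (w := v) (z := v + k) as [C0 [C1 _]].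
  { eapply sh_bh2; eauto; lra. } { lra. } { rewrite E2; auto. }
  destruct (T1 (fun y => D1 f u y) b) with (w := v) (z := v + k) as [G1 _].
  { eapply sh_bh2; eauto; lra. } { lra. } { rewrite E2; auto. }
  rewrite E1 in B0, B1. rewrite E2 in C0, C1, G1.
  change (Dc (fun x => f x (v + k)) u) with (D1 f u (v + k)) in B1.
  change (Dc (fun y => f u y) v) with (D2 f u v) in C1.
  assert (H0 := Cmod_ge_0 h). assert (K0 := Cmod_ge_0 k).
  split.
  - replace (f (u + h) (v + k) - f u v - (D1 f u v * h + D2 f u v * k)) with
      ((f (u + h) (v + k) - f u (v + k) - D1 f u (v + k) * h) + (D1 f u (v + k) - D1 f u v) * h + (f u (v + k) - f u v - D2 f u v * k)) by ring.
    eapply Rle_trans; [apply Cmod_triangle|].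
    eapply Rle_trans; [apply Rplus_le_compat_r, Cmod_triangle|]. rewrite Cmod_mult.
    assert (X : (Cmod (D1 f u (v + k) - D1 f u v)%C * Cmod h <= K1 * Cmod k * Cmod h)%R) by (apply Rmult_le_compat_r; auto).
    set (p := Cmod h) in *. set (q := Cmod k) in *.
    assert (pq : (0 <= p * q)%R) by (apply Rmult_le_pos; auto).
    assert (pp : (0 <= p * p)%R) by (apply Rmult_le_pos; auto).
    assert (qq : (0 <= q * q)%R) by (apply Rmult_le_pos; auto). 
    apply Rle_trans with (K * (p * p) + K1 * (p * q) + K * (q * q))%R; [lra|].
    assert (K * (p * p) <= K * ((p + q) * (p + q)))%R by (apply Rmult_le_compat_l; nra).
    assert (K1 * (p * q) <= K1 * ((p + q) * (p + q)))%R by (apply Rmult_le_compat_l; nra).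
    assert (K * (q * q) <= K * ((p + q) * (p + q)))%R by (apply Rmult_le_compat_l; nra). lra.
  - replace (f (u + h) (v + k) - f u v) with ((f (u + h) (v + k) - f u (v + k)) + (f u (v + k) - f u v)) by ring.
    eapply Rle_trans; [apply Cmod_triangle|]. nra.
Qed.

Lemma sh_curve f a b R0 M (p q : C -> C) (z p' q' : C) : sh f a b R0 M ->
  Cmod (p z - a) < R0 -> Cmod (q z - b) < R0 -> cd p z p' -> cd q z q' ->
  cd (fun w => f (p w) (q w)) z (D1 f (p z) (q z) * p' + D2 f (p z) (q z) * q').
Proof.
  intros Hf Hp Hq Cp Cq.
  set (r := ((Rmax (Cmod (p z - a)) (Cmod (q z - b)) + R0) / 2)%R).
  assert (m1 := Rmax_l (Cmod (p z - a)) (Cmod (q z - b))). assert (m2 := Rmax_r (Cmod (p z - a)) (Cmod (q z - b))).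
  assert (m3 : Rmax (Cmod (p z - a)) (Cmod (q z - b)) < R0) by (apply Rmax_case; auto).
  assert (m0 := Cmod_ge_0 (p z - a)).
  destruct (sh_total f a b R0 r M ltac:(unfold r; lra) Hf) as [K [d [HK [Hd T]]]].
  intros e He.
  set (A := Cmod (D1 f (p z) (q z))). set (B := Cmod (D2 f (p z) (q z))).
  assert (A0 : 0 <= A) by apply Cmod_ge_0. assert (B0 : 0 <= B) by apply Cmod_ge_0.
  set (e1 := (e / (2 * (A + B + 1)))%R). assert (He1 : 0 < e1) by (apply Rdiv_lt_0_compat; lra).
  destruct (Cp e1 He1) as [d1 [Hd1 P1]]. destruct (Cq e1 He1) as [d2 [Hd2 P2]].
  set (L := (Cmod p' + Cmod q' + 2 * e1)%R).
  assert (L1 := Cmod_ge_0 p'). assert (L2 := Cmod_ge_0 q').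
  assert (HL : 0 < L) by (unfold L; lra).
  exists (Rmin (Rmin d1 d2) (Rmin (d / L) (e / (2 * K * (L * L))))).
  assert (HD : 0 < e / (2 * K * (L * L))) by (apply Rdiv_lt_0_compat; [auto|]; repeat apply Rmult_lt_0_compat; lra).
  split; [repeat apply Rmin_case; try lra; apply Rdiv_lt_0_compat; lra|].
  intros w Hw. set (t := Cmod (w - z)) in *. assert (t0 : 0 <= t) by apply Cmod_ge_0.
  destruct (lt_min Hw) as [w1 w2].
  destruct (lt_min w1) as [w3 w4].
  destruct (lt_min w2) as [w5 w6].
  specialize (P1 w w3). specialize (P2 w w4). fold t in P1, P2.
  set (h := p w - p z) in *. set (k := q w - q z) in *.
  assert (Hh : Cmod h <= (Cmod p' + e1) * t).
  { assert (X := Cmod_triangle (h - p' * (w - z)) (p' * (w - z))). rewrite Cmod_mult in X. fold t in X.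
    replace (h - p' * (w - z) + p' * (w - z)) with h in X by ring. lra. }
  assert (Hk : Cmod k <= (Cmod q' + e1) * t).
  { assert (X := Cmod_triangle (k - q' * (w - z)) (q' * (w - z))). rewrite Cmod_mult in X. fold t in X.
    replace (k - q' * (w - z) + q' * (w - z)) with k in X by ring. lra. }
  assert (h0 := Cmod_ge_0 h). assert (k0 := Cmod_ge_0 k).
  assert (Lt : L * t < d).
  { apply Rlt_le_trans with (L * (d / L))%R; [apply Rmult_lt_compat_l; lra|]. right; field; lra. }
  assert (HLt : (Cmod h + Cmod k <= L * t)%R) by (unfold L; lra).
  destruct (T (p z) (q z) h k) as [T' _]; try (unfold r; lra); try lra.
  replace (p z + h) with (p w) in T' by (unfold h; ring). replace (q z + k) with (q w) in T' by (unfold k; ring).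
  replace (f (p w) (q w) - f (p z) (q z) - (D1 f (p z) (q z) * p' + D2 f (p z) (q z) * q') * (w - z)) with
    ((f (p w) (q w) - f (p z) (q z) - (D1 f (p z) (q z) * h + D2 f (p z) (q z) * k)) +
     D1 f (p z) (q z) * (h - p' * (w - z)) + D2 f (p z) (q z) * (k - q' * (w - z))) by ring.
  eapply Rle_trans; [apply Cmod_triangle|]. eapply Rle_trans; [apply Rplus_le_compat_r, Cmod_triangle|].
  rewrite !Cmod_mult. fold A B.
  assert (X1 : (A * Cmod (h - p' * (w - z))%C <= A * (e1 * t))%R) by (apply Rmult_le_compat_l; auto).
  assert (X2 : (B * Cmod (k - q' * (w - z))%C <= B * (e1 * t))%R) by (apply Rmult_le_compat_l; auto).
  assert (X3 : (K * ((Cmod h + Cmod k) * (Cmod h + Cmod k)) <= K * ((L * t) * (L * t)))%R).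
  { apply Rmult_le_compat_l; [lra|]. apply Rmult_le_compat; lra. }
  assert (X4 : (K * ((L * t) * (L * t)) <= e / 2 * t)%R).
  { replace (K * (L * t * (L * t)))%R with ((K * (L * L) * t) * t)%R by ring. apply Rmult_le_compat_r; auto.
    assert (KL : 0 < K * (L * L)) by (repeat apply Rmult_lt_0_compat; lra).
    apply Rle_trans with (K * (L * L) * (e / (2 * K * (L * L))))%R; [apply Rmult_le_compat_l; lra|]. right; field; lra. }
  assert (X5 : (e1 * (A + B) <= e / 2)%R).
  { unfold e1. apply Rmult_le_reg_r with (2 * (A + B + 1))%R; [lra|].
    replace (e / (2 * (A + B + 1)) * (A + B) * (2 * (A + B + 1)))%R with (e * (A + B))%R by (field; lra). nra. }
  assert (X6 : (e1 * (A + B) * t <= e / 2 * t)%R) by (apply Rmult_le_compat_r; auto). lra.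
Qed.

Lemma sh_const (c : C) a b r : sh (fun _ _ => c) a b r (Cmod c).
Proof. intros u v _ _. split; [|split]; [exists 0; apply cd_const|exists 0; apply cd_const|lra]. Qed.

Lemma sh_plus f g a b r M N : sh f a b r M -> sh g a b r N -> sh (fun u v => f u v + g u v) a b r (M + N).
Proof.
  intros Hf Hg u v Hu Hv. destruct (Hf u v Hu Hv) as [[l1 F1] [[l2 F2] F3]]. destruct (Hg u v Hu Hv) as [[m1 G1] [[m2 G2] G3]].
  split; [|split].
  - eexists. apply (cd_plus (fun x => f x v) (fun x => g x v)); eauto.
  - eexists. apply (cd_plus (fun x => f u x) (fun x => g u x)); eauto.
  - eapply Rle_trans; [apply Cmod_triangle|]. lra.
Qed.

Lemma sh_mult f g a b r M N : sh f a b r M -> sh g a b r N -> sh (fun u v => f u v * g u v) a b r (M * N).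
Proof.
  intros Hf Hg u v Hu Hv. destruct (Hf u v Hu Hv) as [[l1 F1] [[l2 F2] F3]]. destruct (Hg u v Hu Hv) as [[m1 G1] [[m2 G2] G3]].
  split; [|split].
  - eexists. apply (cd_mult (fun x => f x v) (fun x => g x v)); eauto.
  - eexists. apply (cd_mult (fun x => f u x) (fun x => g u x)); eauto.
  - rewrite Cmod_mult. apply Rmult_le_compat; auto; apply Cmod_ge_0.
Qed.

Lemma sh_of1 g a b r M : bh g a r M -> sh (fun u _ => g u) a b r M.
Proof. intros H u v Hu Hv. destruct (H u Hu) as [H1 H2]. split; [auto|split; auto]. exists 0. apply cd_const. Qed.

Lemma sh_of2 g a b r M : bh g b r M -> sh (fun _ v => g v) a b r M.
Proof. intros H u v Hu Hv. destruct (H v Hv) as [H1 H2]. split; [|split; auto]. exists 0. apply cd_const. Qed.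

Lemma sh_ext f g a b r M : (forall u v, Cmod (u - a) < r -> Cmod (v - b) < r -> f u v = g u v) -> sh f a b r M -> sh g a b r M.
Proof.
  intros E H u v Hu Hv. destruct (H u v Hu Hv) as [[l1 H1] [[l2 H2] H3]]. split; [|split].
  - exists l1. apply (cd_ext_loc (fun x => f x v) _ _ _ (r - Cmod (u - a))); [lra| |auto].
    intros w Hw. apply E; auto. assert (A := Cmod_tri3 w u a). lra.
  - exists l2. apply (cd_ext_loc (fun x => f u x) _ _ _ (r - Cmod (v - b))); [lra| |auto].
    intros w Hw. apply E; auto. assert (A := Cmod_tri3 w v b). lra.
  - rewrite <- E; auto.
Qed.

(** * Osgood's lemma: expansion in a double power series *)

Lemma psum_cd (g : nat -> C -> C) (n : nat) (z : C) : (forall k, (k < n)%nat -> exists l, cd (g k) z l) ->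
  exists l, cd (fun x => psum (fun k => g k x) n) z l.
Proof.
  induction n as [|n IH]; intros H.
  - exists (RtoC 0). apply (cd_ext (fun _ => RtoC 0)); [reflexivity|apply cd_const].
  - destruct IH as [l Hl]; [intros; apply H; lia|]. destruct (H n) as [m Hm]; [lia|].
    eexists. apply (cd_plus (fun x => psum (fun k => g k x) n) (g n)); eauto.
Qed.

(** Induction on m: once the lower coefficients are holomorphic in v, the m-th one is the uniform
    limit, as h tends to 0, of the expansion at a + h with these terms removed, divided by h^m. *)
Lemma coef_hol f a b R0 r M : 0 < r < R0 -> sh f a b R0 M ->
  forall m, bh (fun v => Tc (fun u => f u v) a m) b R0 (2 * M / r ^ m).
Proof.
  intros Hr Hf.
  assert (HT : forall v, Cmod (v - b) < R0 -> cbd (Tc (fun u => f u v) a) (2 * M) r /\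
     forall w, Cmod (w - a) < r -> f w v = ps (Tc (fun u => f u v) a) (w - a)).
  { intros v Hv. apply (Tc_spec (fun u => f u v) a R0 r M Hr). eapply sh_bh1; eauto. }
  set (T := fun v => Tc (fun u => f u v) a) in *.
  intros m. induction m as [m IH] using (well_founded_induction Wf_nat.lt_wf).
  apply unif_lim.
  - intros v Hv. apply (HT v Hv).
  - intros e He. destruct (classic (exists v, Cmod (v - b) < R0)) as [[v0 Hv0]|Hn].
    2:{ exists (fun _ => 0). split; intros z Hz; exfalso; apply Hn; eauto. }
    assert (HM : 0 <= 2 * M) by apply (cbd_nonneg _ _ _ (proj1 (HT v0 Hv0))).
    assert (P : (0 < r ^ S m)%R) by (apply pow_lt; lra).
    set (K := (2 * (2 * M) / r ^ S m * 2)%R).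
    assert (HK : 0 <= K). { unfold K. apply Rmult_le_pos; [|lra]. apply div_nonneg; [lra|auto]. }
    set (h := Rmin (r / 2) (e / (K + 1))).
    assert (Hh : 0 < h) by (apply Rmin_case; [lra|apply Rdiv_lt_0_compat; lra]).
    assert (h1 : h <= r / 2) by apply Rmin_l. assert (h2 : h <= e / (K + 1)) by apply Rmin_r.
    assert (Ch : Cmod (RtoC h) = h) by (rewrite Cmod_R, Rabs_pos_eq; lra).
    assert (Hn : RtoC h <> 0) by (intros E; apply RtoC_inj in E; lra).
    assert (Hnm : RtoC h ^ m <> 0) by (apply Cpow_nz; auto).
    (* The error of this approximation is at most K h, uniformly in v, and h was chosen with K h <=
       e. *)
    exists (fun v => / (RtoC h ^ m) * (f (a + RtoC h) v - psum (fun k => T v k * RtoC h ^ k) m)). split.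
    + intros v Hv. destruct (Hf (a + RtoC h) v) as [_ [[l Hl] _]]; auto.
      { replace (a + RtoC h - a) with (RtoC h) by ring. lra. }
      destruct (psum_cd (fun k v => T v k * RtoC h ^ k) m v) as [l2 Hl2].
      { intros k Hk. destruct (IH k Hk v Hv) as [[l' Hl'] _]. eexists.
        apply (cd_mult (fun v => T v k) (fun _ => RtoC h ^ k)); [exact Hl'|apply cd_const]. }
      eexists. apply cd_scal. apply cd_minus; [exact Hl|exact Hl2].
    + intros v Hv. destruct (HT v Hv) as [H1 H2].
      assert (E : a + RtoC h - a = RtoC h) by ring.
      specialize (H2 (a + RtoC h)). rewrite E in H2. rewrite H2 by lra. fold (T v) in *.
      assert (A := ps_tail (T v) (2 * M) r (RtoC h) (S m) ltac:(lra) H1 ltac:(lra)). rewrite Ch in A. simpl psum in A.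
      change (Tc (fun u => f u v) a m) with (T v m).
      replace (T v m - / (RtoC h ^ m) * (ps (T v) (RtoC h) - psum (fun k => T v k * RtoC h ^ k) m)) with
        (- (/ (RtoC h ^ m) * (ps (T v) (RtoC h) - (psum (fun k => T v k * RtoC h ^ k) m + T v m * RtoC h ^ m)))) by (field; auto).
      rewrite Cmod_opp, Cmod_mult, Cmod_inv, Cmod_pow, Ch by auto.
      assert (hm : (0 < h ^ m)%R) by (apply pow_lt; auto).
      assert (Q : (1 / 2 <= 1 - h / r)%R).
      { assert (h / r <= 1 / 2). { apply Rmult_le_reg_r with r; [lra|]. unfold Rdiv at 1. rewrite Rmult_assoc, Rinv_l; lra. } lra. }
      apply Rle_trans with (/ h ^ m * (2 * (2 * M) * (h / r) ^ S m / (1 - h / r)))%R.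
      { apply Rmult_le_compat_l; [left; apply Rinv_0_lt_compat; auto|exact A]. }
      apply Rle_trans with (/ h ^ m * (2 * (2 * M) * (h / r) ^ S m * 2))%R.
      { apply Rmult_le_compat_l; [left; apply Rinv_0_lt_compat; auto|]. apply Rmult_le_compat_l.
        - apply Rmult_le_pos; [lra|]. apply pow_le. apply div_nonneg; [lra|lra].
        - replace 2%R with (/ (1 / 2))%R by field. apply Rinv_le_contravar; lra. }
      apply Rle_trans with (K * h)%R.
      { right. unfold K, Rdiv. rewrite Rpow_mult_distr, pow_inv. simpl pow. field. repeat split; try (apply pow_nonzero); lra. }
      apply Rle_trans with (K * (e / (K + 1)))%R; [apply Rmult_le_compat_l; lra|].
      apply Rmult_le_reg_r with (K + 1)%R; [lra|]. replace (K * (e / (K + 1)) * (K + 1))%R with (K * e)%R by (field; lra). nra.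
Qed.

(** Expand in u; the coefficients are holomorphic in v with bounds 2M/r^m, and expanding them in v
    doubles the constant again. *)
Lemma osgood f a b R0 r M : 0 < r < R0 -> sh f a b R0 M ->
  exists (c : nat -> nat -> C), (forall m n, (Cmod (c m n) <= 4 * M / (r ^ m * r ^ n))%R) /\
    forall u v, Cmod (u - a) < r -> Cmod (v - b) < r ->
      f u v = ps (fun m => ps (c m) (v - b)) (u - a).
Proof.
  intros Hr Hf. assert (Hm := coef_hol f a b R0 r M Hr Hf).
  set (T := fun m v => Tc (fun u => f u v) a m) in *.
  exists (fun m => Tc (T m) b). 
  assert (Q : forall m, cbd (Tc (T m) b) (2 * (2 * M / r ^ m)) r /\ forall w, Cmod (w - b) < r -> T m w = ps (Tc (T m) b) (w - b)).
  { intros m. apply (Tc_spec (T m) b R0 r); auto. apply Hm. }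
  split.
  - intros m n. eapply Rle_trans; [apply (proj1 (Q m) n)|]. right. field. split; apply pow_nonzero; lra.
  - intros u v Hu Hv. destruct (Tc_spec (fun u => f u v) a R0 r M Hr) as [H1 H2].
    { eapply sh_bh1; eauto; lra. }
    rewrite (H2 u Hu). f_equal. apply functional_extensionality. intros m. apply (proj2 (Q m)); auto.
Qed.

(** * Double power series, and their comparison with the real double series of the definitions *)

Definition cbd2 (c : nat -> nat -> C) (M s : R) : Prop := forall m n, (Cmod (c m n) <= M / (s ^ m * s ^ n))%R.

Definition ps2 (c : nat -> nat -> C) (u v : C) : C := ps (fun m => ps (c m) v) u.

Lemma cbd2_row c M s m : 0 < s -> cbd2 c M s -> cbd (c m) (M / s ^ m) s.
Proof.
  intros Hs H n. eapply Rle_trans; [apply H|]. right. field. split; apply pow_nonzero; lra.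
Qed.

(** In u this is a power series; in v it is a uniform limit of finite sums, because the coefficient
    bounds do not depend on v. *)
Lemma sh_series (c : nat -> C -> C) (b : C) (s r K : R) : 0 < r < s -> (forall m, bh (c m) b r (K / s ^ m)) ->
  exists M', sh (fun u v => ps (fun m => c m v) u) 0 b r M'.
Proof.
  intros Hr Hc.
  assert (A : forall v, Cmod (v - b) < r -> cbd (fun m => c m v) K s) by (intros v Hv m; apply (Hc m v Hv)).
  set (M' := (2 * K / (1 - r / s))%R). exists M'.
  intros u v Hu Hv. replace (u - 0) with u in Hu by ring.
  assert (Bd : forall w, Cmod (w - b) < r -> Cmod (ps (fun m => c m w) u) <= M').
  { intros w Hw. apply (ps_bound _ K s r u); [lra|apply A; auto|lra]. }
  split; [|split]; [| |apply Bd; auto].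
  - eexists. apply (ps_cd (fun m => c m v) K s); [lra|apply A; auto|lra].
  - apply (unif_lim (fun y => ps (fun m => c m y) u) b r M'); auto.
    intros e He. assert (Q : 0 <= Cmod u / s < 1) by (apply quot_lt1; lra).
    destruct (geom_small (2 * K / (1 - Cmod u / s)) (Cmod u / s) e Q He) as [N HN]. specialize (HN N (le_n N)).
    exists (fun w => psum (fun m => c m w * u ^ m) N). split.
    + intros w Hw. apply (psum_cd (fun m w => c m w * u ^ m)). intros k _.
      destruct (Hc k w Hw) as [[l Hl] _]. eexists. apply (cd_mult (c k) (fun _ => u ^ k)); [exact Hl|apply cd_const].
    + intros w Hw. left. eapply Rle_lt_trans; [apply (ps_tail (fun m => c m w) K s u N); [lra|apply A; auto|lra]|].
      eapply Rle_lt_trans; [|exact HN]. right; unfold Rdiv; ring.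
Qed.

Lemma sh_ps2 c M s r : 0 < r < s -> cbd2 c M s -> exists M', sh (ps2 c) 0 0 r M'.
Proof.
  intros Hr Hc. apply (sh_series (fun m v => ps (c m) v) 0 s r (2 * M / (1 - r / s))); auto.
  intros m v Hv. replace (v - 0) with v in Hv by ring.
  assert (Hm : cbd (c m) (M / s ^ m) s) by (apply cbd2_row; auto; lra). split.
  - eexists. apply (ps_cd (c m) (M / s ^ m) s); auto; lra.
  - eapply Rle_trans; [apply (ps_bound (c m) (M / s ^ m) s r v); auto; lra|]. right. unfold Rdiv. ring.
Qed.

Lemma Cpow_R (u : R) n : (RtoC u) ^ n = RtoC (u ^ n).
Proof. symmetry. apply RtoC_pow. Qed.

Lemma Re_ps2 c (u v : R) : Re (ps2 c u v) = Series (fun m => Series (fun n => (Re (c m n) * u ^ m * v ^ n)%R)).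
Proof.
  transitivity (Series (fun m => Re (ps (c m) v * RtoC u ^ m))); [reflexivity|].
  apply Series_ext. intros m. rewrite Cpow_R, re_scal_r.
  change (Re (ps (c m) v)) with (Series (fun n => Re (c m n * RtoC v ^ n))).
  rewrite <- Series_scal_r. apply Series_ext. intros n. rewrite Cpow_R, re_scal_r. ring.
Qed.

Lemma Im_ps2 c (u v : R) : Im (ps2 c u v) = Series (fun m => Series (fun n => (Im (c m n) * u ^ m * v ^ n)%R)).
Proof.
  transitivity (Series (fun m => Im (ps (c m) v * RtoC u ^ m))); [reflexivity|].
  apply Series_ext. intros m. rewrite Cpow_R, im_scal_r.
  change (Im (ps (c m) v)) with (Series (fun n => Im (c m n * RtoC v ^ n))).
  rewrite <- Series_scal_r. apply Series_ext. intros n. rewrite Cpow_R, im_scal_r. ring.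
Qed.

Lemma dseries_geom (b : nat -> nat -> R) (M p q : R) : 0 <= p < 1 -> 0 <= q < 1 ->
  (forall m n, (Rabs (b m n) <= M * p ^ m * q ^ n)%R) -> dseries b (Series (fun m => Series (fun n => b m n))).
Proof.
  intros Hp Hq Hb.
  assert (Gq : forall K, is_series (fun k => K * q ^ k)%R (K * / (1 - q))%R).
  { intros K. apply (is_series_scal K (fun k => q ^ k)%R). apply is_series_geom. rewrite Rabs_pos_eq; lra. }
  assert (Gp : forall K, is_series (fun k => K * p ^ k)%R (K * / (1 - p))%R).
  { intros K. apply (is_series_scal K (fun k => p ^ k)%R). apply is_series_geom. rewrite Rabs_pos_eq; lra. }
  assert (E1 : forall m, ex_series (fun n => Rabs (b m n))).
  { intros m. apply (ex_series_le (V := R_CompleteNormedModule) _ (fun k => (M * p ^ m) * q ^ k)%R).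
    - intros k. change (Rabs (Rabs (b m k)) <= M * p ^ m * q ^ k)%R. rewrite Rabs_Rabsolu. auto.
    - eexists; apply Gq. }
  assert (E2 : forall m, (0 <= Series (fun n => Rabs (b m n)) <= M / (1 - q) * p ^ m)%R).
  { intros m. split.
    - rewrite <- (Rmult_0_l 0). rewrite <- (Rabs_R0) at 1.
      apply Rle_trans with (Rabs (Series (fun n => b m n))); [rewrite Rabs_R0, Rmult_0_l; apply Rabs_pos|apply Series_Rabs; auto].
    - replace (M / (1 - q) * p ^ m)%R with ((M * p ^ m) * / (1 - q))%R by (unfold Rdiv; ring).
      rewrite <- (is_series_unique _ _ (Gq (M * p ^ m)%R)). apply Series_le; [|eexists; apply Gq].
      intros n. split; [apply Rabs_pos|apply Hb]. }
  split; [exact E1|split; [|reflexivity]].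
  apply (ex_series_le (V := R_CompleteNormedModule) _ (fun k => (M / (1 - q)) * p ^ k)%R).
  - intros k. change (Rabs (Series (fun n => Rabs (b k n))) <= M / (1 - q) * p ^ k)%R. rewrite Rabs_pos_eq; apply E2.
  - eexists; apply Gp.
Qed.

Lemma pseries2_of_ps2 c M s (u v : R) : 0 < s -> cbd2 c M s -> Rabs u < s -> Rabs v < s -> pseries2 c u v (ps2 c u v).
Proof.
  intros Hs Hc Hu Hv.
  assert (Qu : 0 <= Rabs u / s < 1) by (rewrite <- Cmod_R; apply quot_lt1; rewrite ?Cmod_R; auto).
  assert (Qv : 0 <= Rabs v / s < 1) by (rewrite <- Cmod_R; apply quot_lt1; rewrite ?Cmod_R; auto).
  assert (T : forall m n x, Rabs x <= Cmod (c m n) -> (Rabs (x * u ^ m * v ^ n) <= M * (Rabs u / s) ^ m * (Rabs v / s) ^ n)%R).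
  { intros m n x Hx. rewrite !Rabs_mult, <- !RPow_abs. unfold Rdiv. rewrite !Rpow_mult_distr, !pow_inv.
    replace (M * (Rabs u ^ m * / s ^ m) * (Rabs v ^ n * / s ^ n))%R with (M / (s ^ m * s ^ n) * Rabs u ^ m * Rabs v ^ n)%R.
    2:{ field. split; apply pow_nonzero; lra. }
    assert (0 <= Rabs u ^ m)%R by (apply pow_le, Rabs_pos). assert (0 <= Rabs v ^ n)%R by (apply pow_le, Rabs_pos).
    apply Rmult_le_compat_r; auto. apply Rmult_le_compat_r; auto. eapply Rle_trans; [exact Hx|apply Hc]. }
  split; [rewrite Re_ps2|rewrite Im_ps2]; apply (dseries_geom _ M _ _ Qu Qv); intros m n; apply T;
  [apply Re_le_Cmod|apply Im_le_Cmod].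
Qed.

Lemma term_le_Series (a : nat -> R) n : (forall k, 0 <= a k)%R -> ex_series a -> (a n <= Series a)%R.
Proof.
  intros Ha He. apply Rle_trans with (sum_n a n).
  - destruct n as [|n]; [rewrite sum_O; lra|]. rewrite sum_Sn.
    assert (0 <= sum_n a n)%R.
    { induction n as [|n IH]; [rewrite sum_O; auto|]. rewrite sum_Sn. specialize (Ha (S n)). unfold plus; simpl. lra. }
    unfold plus; simpl. lra.
  - apply (is_lim_seq_incr_compare (sum_n a)).
    + apply Series_correct in He. exact He.
    + intros k. rewrite sum_Sn. unfold plus; simpl. specialize (Ha (S k)). lra.
Qed.

(** Absolute convergence at the single point (s, s) bounds every term by the total sum of absolute
    values, which is all that is needed to let u and v become complex. *)
Lemma dseries_coef (a : nat -> nat -> R) (s x : R) : 0 < s -> dseries (fun m n => (a m n * s ^ m * s ^ n)%R) x ->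
  exists T, forall m n, (Rabs (a m n) <= T / (s ^ m * s ^ n))%R.
Proof.
  intros Hs [H1 [H2 _]]. exists (Series (fun m => Series (fun n => Rabs (a m n * s ^ m * s ^ n)))).
  intros m n.
  assert (P : forall k, (0 < s ^ k)%R) by (intros; apply pow_lt; auto).
  assert (N : forall m, (0 <= Series (fun n => Rabs (a m n * s ^ m * s ^ n)))%R).
  { intros k. eapply Rle_trans; [apply Rabs_pos|]. apply Series_Rabs. apply H1. }
  assert (A := term_le_Series (fun n => Rabs (a m n * s ^ m * s ^ n)) n (fun k => Rabs_pos _) (H1 m)).
  assert (B := term_le_Series _ m N H2). simpl in A, B.
  rewrite !Rabs_mult, (Rabs_pos_eq (s ^ m)), (Rabs_pos_eq (s ^ n)) in A by (left; auto).
  assert (Pm := P m). assert (Pn := P n).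
  apply Rmult_le_reg_r with (s ^ m * s ^ n)%R; [nra|].
  unfold Rdiv. rewrite Rmult_assoc, Rinv_l by nra. rewrite Rmult_1_r. lra.
Qed.

Lemma ps2_of_pseries2 c rho (g : R -> R -> C) : 0 < rho ->
  (forall u v : R, Rabs u < rho -> Rabs v < rho -> pseries2 c u v (g u v)) ->
  exists M, cbd2 c M (rho / 2) /\ forall u v : R, Rabs u < rho -> Rabs v < rho -> g u v = ps2 c u v.
Proof.
  intros Hr H. destruct (H (rho / 2)%R (rho / 2)%R) as [A B]; try (rewrite Rabs_pos_eq; lra).
  destruct (dseries_coef _ (rho / 2) _ ltac:(lra) A) as [T1 HT1]. destruct (dseries_coef _ (rho / 2) _ ltac:(lra) B) as [T2 HT2].
  exists (T1 + T2)%R. split.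
  - intros m n. eapply Rle_trans; [apply Cmod_le_sum|]. specialize (HT1 m n). specialize (HT2 m n).
    unfold Rdiv in *. rewrite Rmult_plus_distr_r. lra.
  - intros u v Hu Hv. destruct (H u v Hu Hv) as [[_ [_ E1]] [_ [_ E2]]].
    transitivity ((Re (g u v), Im (g u v)) : C); [destruct (g u v); reflexivity|].
    rewrite E1, E2, <- Re_ps2, <- Im_ps2. destruct (ps2 c u v); reflexivity.
Qed.

(** * Functions of z that are holomorphic in z and its conjugate *)

Lemma is_derive_RC_of_cd (f : C -> C) (g : R -> C) (t : R) l (d : R) : 0 < d -> (forall s : R, Rabs (s - t) < d -> g s = f s) -> cd f t l -> is_derive_RC g t l.
Proof.
  intros Hd Hg Hf.
  assert (K : forall p : C -> R, (forall z w : C, p (z - w)%C = (p z - p w)%R) -> (forall (r : R) (z : C), p (RtoC r * z)%C = (r * p z)%R) -> (forall z, Rabs (p z) <= Cmod z) ->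
     is_derive (fun s => p (g s)) t (p l)).
  { intros p P1 P2 P3. apply is_derive_Reals. intros e He.
    destruct (Hf (e / 2)%R ltac:(lra)) as [d1 [Hd1 H1]].
    exists (mkposreal (Rmin d d1) ltac:(apply Rmin_case; lra)). simpl. intros h Hh0 Hh.
    destruct (lt_min Hh) as [h1 h2].
    rewrite !Hg.
    2:{ replace (t - t)%R with 0%R by ring. rewrite Rabs_R0. auto. }
    2:{ replace (t + h - t)%R with h by ring. auto. }
    specialize (H1 (RtoC (t + h))). replace (RtoC (t + h) - RtoC t) with (RtoC h) in H1 by (rewrite RtoC_plus; ring).
    rewrite Cmod_R in H1. specialize (H1 h2).
    replace ((p (f (RtoC (t + h))) - p (f (RtoC t))) / h - p l)%R with (p (f (RtoC (t + h)) - f (RtoC t) - l * RtoC h)%C / h)%R.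
    2:{ rewrite !P1. rewrite (Cmult_comm l), P2. field. auto. }
    unfold Rdiv. rewrite Rabs_mult, Rabs_inv. assert (P := Rabs_pos_lt h Hh0).
    apply Rle_lt_trans with (e / 2 * Rabs h * / Rabs h)%R.
    - apply Rmult_le_compat_r; [left; apply Rinv_0_lt_compat; auto|]. eapply Rle_trans; [apply P3|exact H1].
    - replace (e / 2 * Rabs h * / Rabs h)%R with (e / 2)%R by (field; lra). lra. }
  split.
  - apply (K Re); [reflexivity|intros; apply re_scal_l|apply Re_le_Cmod].
  - apply (K Im); [reflexivity|intros; apply im_scal_l|apply Im_le_Cmod].
Qed.

(** Polarisation: conj z is replaced by an independent second variable. Then d_x corresponds to D1 +
    D2 and d_y to i (D1 - D2). *)
Definition rep (F : C -> C) (Phi : C -> C -> C) (z0 : C) (r : R) : Prop :=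
  forall z, Cmod (z - z0) < r -> F z = Phi z (Cconj z).

Lemma Cmod_conj_sub (z w : C) : Cmod (Cconj z - Cconj w) = Cmod (z - w).
Proof. rewrite <- Cminus_conj. apply Cmod_conj. Qed.

Lemma conj_pair (x y : R) : Cconj (x, y) = RtoC x - Ci * RtoC y.
Proof. unfold Cconj. apply injective_projections; simpl; ring. Qed.

Lemma pair_eta (x y : R) : ((x, y) : C) = RtoC x + Ci * RtoC y.
Proof. apply injective_projections; simpl; ring. Qed.

Lemma rep_pdx F Phi z0 r M : sh Phi z0 (Cconj z0) r M -> rep F Phi z0 r -> forall z, Cmod (z - z0) < r ->
  pdx F z (D1 Phi z (Cconj z) + D2 Phi z (Cconj z)).
Proof.
  intros Hs Hr z Hz. unfold pdx. destruct z as [x y]. change (Re (x, y)) with x. change (Im (x, y)) with y.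
  apply (is_derive_RC_of_cd (fun s => Phi (s + Ci * RtoC y) (s - Ci * RtoC y)) _ x _ (r - Cmod ((x, y) - z0))); [lra| |].
  - intros s Hs'. rewrite Hr, conj_pair, pair_eta; [reflexivity|].
    assert (A := Cmod_tri3 (s, y) (x, y) z0).
    replace ((s, y) - (x, y)) with (RtoC (s - x)) in A by (apply injective_projections; simpl; ring).
    rewrite Cmod_R in A. lra.
  - assert (E1 : ((x, y) : C) = RtoC x + Ci * RtoC y) by apply pair_eta. assert (E2 := conj_pair x y).
    rewrite E2. rewrite E1 in Hz.
    assert (Hz2 : Cmod (RtoC x - Ci * RtoC y - Cconj z0) < r) by (rewrite <- E2, E1, Cmod_conj_sub; auto).
    eapply cd_val; [|apply (sh_curve Phi z0 (Cconj z0) r M (fun s => s + Ci * RtoC y) (fun s => s - Ci * RtoC y) (RtoC x) (1 + 0) (1 - 0)); auto].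
    + rewrite pair_eta. ring.
    + apply cd_plus; [apply cd_id|apply cd_const].
    + apply cd_minus; [apply cd_id|apply cd_const].
Qed.

Lemma rep_pdy F Phi z0 r M : sh Phi z0 (Cconj z0) r M -> rep F Phi z0 r -> forall z, Cmod (z - z0) < r ->
  pdy F z (Ci * (D1 Phi z (Cconj z) - D2 Phi z (Cconj z))).
Proof.
  intros Hs Hr z Hz. unfold pdy. destruct z as [x y]. change (Re (x, y)) with x. change (Im (x, y)) with y.
  apply (is_derive_RC_of_cd (fun s => Phi (RtoC x + Ci * s) (RtoC x - Ci * s)) _ y _ (r - Cmod ((x, y) - z0))); [lra| |].
  - intros s Hs'. rewrite Hr, conj_pair, pair_eta; [reflexivity|].
    assert (A := Cmod_tri3 (x, s) (x, y) z0).
    replace ((x, s) - (x, y)) with (Ci * RtoC (s - y)) in A by (apply injective_projections; simpl; ring).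
    rewrite Cmod_mult, Cmod_Ci, Cmod_R in A. lra.
  - assert (E1 : ((x, y) : C) = RtoC x + Ci * RtoC y) by apply pair_eta. assert (E2 := conj_pair x y).
    rewrite E1 in Hz.
    assert (Hz2 : Cmod (RtoC x - Ci * RtoC y - Cconj z0) < r) by (rewrite <- E2, E1, Cmod_conj_sub; auto).
    eapply cd_val; [|apply (sh_curve Phi z0 (Cconj z0) r M (fun s => RtoC x + Ci * s) (fun s => RtoC x - Ci * s) (RtoC y) (0 + Ci * 1) (0 - Ci * 1)); auto].
    + rewrite E2, pair_eta. ring.
    + apply cd_plus; [apply cd_const|apply cd_scal, cd_id].
    + apply cd_minus; [apply cd_const|apply cd_scal, cd_id].
Qed.

Lemma rep_ccont F Phi z0 r M z : sh Phi z0 (Cconj z0) r M -> rep F Phi z0 r -> Cmod (z - z0) < r -> ccont F z.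
Proof.
  intros Hs Hr Hz. apply cct_ccont. intros e He.
  set (r1 := ((Cmod (z - z0) + r) / 2)%R). assert (Z0 := Cmod_ge_0 (z - z0)).
  destruct (sh_total Phi z0 (Cconj z0) r r1 M ltac:(unfold r1; lra) Hs) as [K [d [HK [Hd T]]]].
  exists (Rmin d (Rmin (r - Cmod (z - z0)) (e / (4 * K)))). split.
  { repeat apply Rmin_case; try lra. apply Rdiv_lt_0_compat; lra. }
  intros w Hw. destruct (lt_min Hw) as [w1 w'].
  destruct (lt_min w') as [w2 w3].
  rewrite !Hr; auto.
  2:{ assert (A := Cmod_tri3 w z z0). lra. }
  destruct (T z (Cconj z) (w - z) (Cconj w - Cconj z)) as [_ H]; auto.
  { unfold r1; lra. } { rewrite Cmod_conj_sub. unfold r1; lra. } { rewrite Cmod_conj_sub; auto. }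
  replace (z + (w - z)) with w in H by ring. replace (Cconj z + (Cconj w - Cconj z)) with (Cconj w) in H by ring.
  rewrite Cmod_conj_sub in H. eapply Rle_lt_trans; [exact H|].
  apply Rlt_le_trans with (K * (2 * (e / (4 * K))))%R; [apply Rmult_lt_compat_l; lra|].
  replace (K * (2 * (e / (4 * K))))%R with (e / 2)%R by (field; lra). lra.
Qed.

(** Total partial derivatives: they provide the witnesses for [r_harmonic] without any gluing, and
    they allow the boundary value to be written as a formula. *)
Definition DX (F : C -> C) (z : C) : C :=
  (Derive (fun t => Re (F (t, Im z))) (Re z), Derive (fun t => Im (F (t, Im z))) (Re z)).
Definition DY (F : C -> C) (z : C) : C :=
  (Derive (fun t => Re (F (Re z, t))) (Im z), Derive (fun t => Im (F (Re z, t))) (Im z)).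

Lemma pdx_DX F z l : pdx F z l -> DX F z = l.
Proof. intros [A B]. apply is_derive_unique in A, B. apply injective_projections; [exact A|exact B]. Qed.

Lemma pdy_DY F z l : pdy F z l -> DY F z = l.
Proof. intros [A B]. apply is_derive_unique in A, B. apply injective_projections; [exact A|exact B]. Qed.

Definition RA (F : C -> C) (z0 : C) : Prop :=
  exists Phi r M, 0 < r /\ sh Phi z0 (Cconj z0) r M /\ rep F Phi z0 r.

Lemma sub_self (z : C) : z - z = 0.
Proof. ring. Qed.

Lemma Cmod_self (z : C) : Cmod (z - z) = 0%R.
Proof. rewrite sub_self. apply Cmod_0. Qed.

Definition Psx (Phi : C -> C -> C) (u v : C) : C := D1 Phi u v + D2 Phi u v.
Definition Psy (Phi : C -> C -> C) (u v : C) : C := Ci * (D1 Phi u v - D2 Phi u v).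

Lemma sh_Psx Phi a b R0 r M : 0 < r < R0 -> sh Phi a b R0 M -> exists M', sh (Psx Phi) a b r M'.
Proof.
  intros Hr H. destruct (sh_D1 _ _ _ _ r _ Hr H) as [M1 H1]. destruct (sh_D2 _ _ _ _ r _ Hr H) as [M2 H2].
  eexists. apply sh_plus; eauto.
Qed.

Lemma sh_Psy Phi a b R0 r M : 0 < r < R0 -> sh Phi a b R0 M -> exists M', sh (Psy Phi) a b r M'.
Proof.
  intros Hr H. destruct (sh_D1 _ _ _ _ r _ Hr H) as [M1 H1]. destruct (sh_D2 _ _ _ _ r _ Hr H) as [M2 H2].
  eexists. apply (sh_ext (fun u v => Ci * (D1 Phi u v + (-1) * D2 Phi u v))).
  - intros; unfold Psy; ring.
  - apply (sh_mult (fun _ _ => Ci)); [apply sh_const|]. apply sh_plus; [eauto|]. apply (sh_mult (fun _ _ => -1)); [apply sh_const|eauto].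
Qed.

Lemma rep_DX F Phi z0 r M : sh Phi z0 (Cconj z0) r M -> rep F Phi z0 r -> rep (DX F) (Psx Phi) z0 r.
Proof. intros Hs Hr z Hz. apply pdx_DX. eapply rep_pdx; eauto. Qed.

Lemma rep_DY F Phi z0 r M : sh Phi z0 (Cconj z0) r M -> rep F Phi z0 r -> rep (DY F) (Psy Phi) z0 r.
Proof. intros Hs Hr z Hz. apply pdy_DY. eapply rep_pdy; eauto. Qed.

Lemma RA_DX F z : RA F z -> RA (DX F) z.
Proof.
  intros [Phi [r [M [Hr [Hs Hp]]]]]. destruct (sh_Psx Phi _ _ r (r / 2) M ltac:(lra) Hs) as [M' H'].
  exists (Psx Phi), (r / 2)%R, M'. split; [lra|split; [auto|]]. intros w Hw. eapply rep_DX; eauto. lra.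
Qed.

Lemma RA_DY F z : RA F z -> RA (DY F) z.
Proof.
  intros [Phi [r [M [Hr [Hs Hp]]]]]. destruct (sh_Psy Phi _ _ r (r / 2) M ltac:(lra) Hs) as [M' H'].
  exists (Psy Phi), (r / 2)%R, M'. split; [lra|split; [auto|]]. intros w Hw. eapply rep_DY; eauto. lra.
Qed.

Lemma RA_facts F z : RA F z -> pdx F z (DX F z) /\ pdy F z (DY F z) /\ ccont F z.
Proof.
  intros [Phi [r [M [Hr [Hs Hp]]]]].
  assert (Hz : Cmod (z - z) < r) by (rewrite Cmod_self; auto).
  split; [|split].
  - rewrite (rep_DX F Phi z r M Hs Hp z Hz). eapply rep_pdx; eauto.
  - rewrite (rep_DY F Phi z r M Hs Hp z Hz). eapply rep_pdy; eauto.
  - eapply rep_ccont; eauto.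
Qed.

Lemma RA_C2 (V : C -> Prop) F : (forall z, V z -> RA F z) ->
  C2_with V F (DX F) (DY F) (DX (DX F)) (DY (DX F)) (DX (DY F)) (DY (DY F)).
Proof.
  intros H z Hz. assert (A := H z Hz).
  assert (X := RA_DX _ _ A). assert (Y := RA_DY _ _ A).
  assert (XX := RA_DX _ _ X). assert (XY := RA_DY _ _ X). assert (YX := RA_DX _ _ Y). assert (YY := RA_DY _ _ Y).
  apply RA_facts in A, X, Y, XX, XY, YX, YY. tauto.
Qed.

Lemma pdx_rep F Phi z r M l : 0 < r -> sh Phi z (Cconj z) r M -> rep F Phi z r -> pdx F z l -> l = Psx Phi z (Cconj z).
Proof. intros Hr Hs Hp H. rewrite <- (pdx_DX _ _ _ H). eapply rep_DX; eauto. rewrite Cmod_self; auto. Qed.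

Lemma pdy_rep F Phi z r M l : 0 < r -> sh Phi z (Cconj z) r M -> rep F Phi z r -> pdy F z l -> l = Psy Phi z (Cconj z).
Proof. intros Hr Hs Hp H. rewrite <- (pdy_DY _ _ _ H). eapply rep_DY; eauto. rewrite Cmod_self; auto. Qed.

Lemma D1_lin f g a b r M N (p q : C) u v : sh f a b r M -> sh g a b r N -> Cmod (u - a) < r -> Cmod (v - b) < r ->
  D1 (fun u v => p * f u v + q * g u v) u v = p * D1 f u v + q * D1 g u v.
Proof.
  intros Hf Hg Hu Hv. apply Dc_eq. apply (cd_plus (fun x => p * f x v) (fun x => q * g x v)); apply cd_scal; eapply sh_cd1; eauto.
Qed.

Lemma D2_lin f g a b r M N (p q : C) u v : sh f a b r M -> sh g a b r N -> Cmod (u - a) < r -> Cmod (v - b) < r ->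
  D2 (fun u v => p * f u v + q * g u v) u v = p * D2 f u v + q * D2 g u v.
Proof.
  intros Hf Hg Hu Hv. apply Dc_eq. apply (cd_plus (fun x => p * f u x) (fun x => q * g u x)); apply cd_scal; eapply sh_cd2; eauto.
Qed.

(** The equation inside [r_harmonic], repeated for bare numbers so that it can be stated at a single
    point. *)
Definition harm_eq (r : C) (z fx fy fxx fxy fyx fyy : C) : Prop :=
      let dzb := Cdiv (Cplus fx (Cmult Ci fy)) (RtoC 2) in
      let dzb_x := Cdiv (Cplus fxx (Cmult Ci fyx)) (RtoC 2) in
      let dzb_y := Cdiv (Cplus fxy (Cmult Ci fyy)) (RtoC 2) in
      let dz_dzb := Cdiv (Cminus dzb_x (Cmult Ci dzb_y)) (RtoC 2) in
      Cplus (Cmult (RtoC (- 4 * (Im z) ^ 2)) dz_dzb)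
            (Cmult (Cmult (Cmult (RtoC 2) Ci) (Cmult r (RtoC (Im z)))) dzb) = RtoC 0.

Lemma two_nz : RtoC 2 <> 0.
Proof. intros E. apply RtoC_inj in E. lra. Qed.

Lemma Ci_sq : Ci * Ci = -1.
Proof. apply injective_projections; simpl; ring. Qed.

(** Under polarisation d_z and d_zbar become D1 and D2. The given first derivatives must agree with
    those of Phi on a whole disc, because they are differentiated once more. *)
Lemma harm_point (V : C -> Prop) F Fx Fy Fxx Fxy Fyx Fyy Phi z r0 M (r : C) :
  @open C_UniformSpace V -> V z -> C2_with V F Fx Fy Fxx Fxy Fyx Fyy ->
  0 < r0 -> sh Phi z (Cconj z) r0 M -> rep F Phi z r0 ->
  (harm_eq r z (Fx z) (Fy z) (Fxx z) (Fxy z) (Fyx z) (Fyy z) <->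
   RtoC (- 4 * (Im z) ^ 2) * D1 (D2 Phi) z (Cconj z) + 2 * Ci * (r * RtoC (Im z)) * D2 Phi z (Cconj z) = 0).
Proof.
  intros HV Hz HC Hr0 Hs Hp.
  destruct (proj1 (open_C V) HV z Hz) as [d [Hd HdV]].
  set (r1 := Rmin d (r0 / 2)). assert (r1d : r1 <= d) by apply Rmin_l. assert (r1r : r1 <= r0 / 2) by apply Rmin_r.
  assert (Hr1 : 0 < r1) by (apply Rmin_case; lra).
  destruct (sh_Psx Phi _ _ r0 (r0 / 2) M ltac:(lra) Hs) as [Mx Sx].
  destruct (sh_Psy Phi _ _ r0 (r0 / 2) M ltac:(lra) Hs) as [My Sy].
  apply (sh_shrink _ _ _ _ r1) in Sx; [|auto]. apply (sh_shrink _ _ _ _ r1) in Sy; [|auto].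
  assert (Rx : rep Fx (Psx Phi) z r1).
  { intros w Hw. destruct (HC w (HdV w ltac:(lra))) as [Px _].
    rewrite <- (pdx_DX _ _ _ Px). eapply rep_DX; eauto. lra. }
  assert (Ry : rep Fy (Psy Phi) z r1).
  { intros w Hw. destruct (HC w (HdV w ltac:(lra))) as [_ [Py _]].
    rewrite <- (pdy_DY _ _ _ Py). eapply rep_DY; eauto. lra. }
  destruct (HC z Hz) as [_ [_ [Pxx [Pxy [Pyx [Pyy _]]]]]].
  assert (Zz : Cmod (z - z) < r1) by (rewrite Cmod_self; auto).
  assert (Zc : Cmod (Cconj z - Cconj z) < r1) by (rewrite Cmod_self; auto).
  rewrite (Rx z Zz), (Ry z Zz).
  rewrite (pdx_rep Fx (Psx Phi) z r1 Mx _ Hr1 Sx Rx Pxx), (pdy_rep Fx (Psx Phi) z r1 Mx _ Hr1 Sx Rx Pxy).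
  rewrite (pdx_rep Fy (Psy Phi) z r1 My _ Hr1 Sy Ry Pyx), (pdy_rep Fy (Psy Phi) z r1 My _ Hr1 Sy Ry Pyy).
  destruct (sh_D1 Phi _ _ r0 (r0 / 2) M ltac:(lra) Hs) as [M1 H1]. destruct (sh_D2 Phi _ _ r0 (r0 / 2) M ltac:(lra) Hs) as [M2 H2].
  apply (sh_shrink _ _ _ _ r1) in H1; [|auto]. apply (sh_shrink _ _ _ _ r1) in H2; [|auto].
  assert (X1 : D1 (Psx Phi) z (Cconj z) = 1 * D1 (D1 Phi) z (Cconj z) + 1 * D1 (D2 Phi) z (Cconj z)).
  { rewrite <- (D1_lin (D1 Phi) (D2 Phi) z (Cconj z) r1 M1 M2) by auto. f_equal. unfold Psx. do 2 (apply functional_extensionality; intro). ring. }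
  assert (X2 : D2 (Psx Phi) z (Cconj z) = 1 * D2 (D1 Phi) z (Cconj z) + 1 * D2 (D2 Phi) z (Cconj z)).
  { rewrite <- (D2_lin (D1 Phi) (D2 Phi) z (Cconj z) r1 M1 M2) by auto. f_equal. unfold Psx. do 2 (apply functional_extensionality; intro). ring. }
  assert (Y1 : D1 (Psy Phi) z (Cconj z) = Ci * D1 (D1 Phi) z (Cconj z) + (- Ci) * D1 (D2 Phi) z (Cconj z)).
  { rewrite <- (D1_lin (D1 Phi) (D2 Phi) z (Cconj z) r1 M1 M2) by auto. f_equal. unfold Psy. do 2 (apply functional_extensionality; intro). ring. }
  assert (Y2 : D2 (Psy Phi) z (Cconj z) = Ci * D2 (D1 Phi) z (Cconj z) + (- Ci) * D2 (D2 Phi) z (Cconj z)).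
  { rewrite <- (D2_lin (D1 Phi) (D2 Phi) z (Cconj z) r1 M1 M2) by auto. f_equal. unfold Psy. do 2 (apply functional_extensionality; intro). ring. }
  unfold harm_eq. cbv zeta. 
  assert (OX : forall P : C -> C -> C, Psx P z (Cconj z) = D1 P z (Cconj z) + D2 P z (Cconj z)) by reflexivity.
  assert (OY : forall P : C -> C -> C, Psy P z (Cconj z) = Ci * (D1 P z (Cconj z) - D2 P z (Cconj z))) by reflexivity.
  rewrite !OX, !OY, X1, X2, Y1, Y2.
  set (a := D1 (D1 Phi) z (Cconj z)). set (b := D1 (D2 Phi) z (Cconj z)). set (c := D2 (D1 Phi) z (Cconj z)). set (e := D2 (D2 Phi) z (Cconj z)).
  set (p := D1 Phi z (Cconj z)). set (q := D2 Phi z (Cconj z)).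
  assert (E1 : (p + q + Ci * (Ci * (p - q))) / 2 = q).
  { replace (p + q + Ci * (Ci * (p - q))) with (p + q + (Ci * Ci) * (p - q)) by ring. rewrite Ci_sq. field. }
  rewrite E1.
  match goal with |- (_ * ?X + _ = _ <-> _) => replace X with b; [tauto|symmetry] end.
  assert (T := two_nz).
  match goal with |- ?L = _ => replace L with
    ((a + b + c + e + (Ci * Ci) * (a - b + c - e) - ((Ci * Ci) * (a + b - c - e) + (Ci * Ci) * (Ci * Ci) * (a - b - c + e))) / 2 / 2) end.
  - rewrite Ci_sq. field.
  - field.
Qed.

(** * Germs of holomorphic functions of one and two variables, and their calculus *)

Definition lbh (f : C -> C) (a : C) : Prop := exists r M, 0 < r /\ bh f a r M.
Definition lsh (f : C -> C -> C) (a b : C) : Prop := exists r M, 0 < r /\ sh f a b r M.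

Lemma lbh_of (f : C -> C) (a : C) (d : R) : 0 < d -> (forall z, Cmod (z - a) < d -> exists l, cd f z l) -> lbh f a.
Proof.
  intros Hd Hf. destruct (Hf a) as [l Hl]; [rewrite Cmod_self; auto|].
  destruct (cd_cct _ _ _ Hl 1%R Rlt_0_1) as [d1 [Hd1 H1]].
  exists (Rmin d d1), (Cmod (f a) + 1)%R. split; [apply Rmin_case; auto|]. intros z Hz.
  destruct (lt_min Hz) as [z1 z2].
  split; auto. specialize (H1 z z2). assert (A := Cmod_rev (f z) (f a)). lra.
Qed.

Lemma sh_joint f a b r M : 0 < r -> sh f a b r M -> forall e, 0 < e -> exists d, 0 < d /\ d <= r /\
  forall u v, Cmod (u - a) < d -> Cmod (v - b) < d -> Cmod (f u v - f a b) < e.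
Proof.
  intros Hr Hs e He. destruct (sh_total f a b r (r / 2) M ltac:(lra) Hs) as [K [d [HK [Hd T]]]].
  exists (Rmin r (Rmin d (e / (4 * K)))). split.
  { repeat apply Rmin_case; try lra. apply Rdiv_lt_0_compat; lra. }
  split; [apply Rmin_l|]. intros u v Hu Hv.
  assert (u' := proj2 (lt_min Hu)). assert (v' := proj2 (lt_min Hv)).
  assert (u1 := proj1 (lt_min u')). assert (v1 := proj1 (lt_min v')).
  assert (u2 := proj2 (lt_min u')). assert (v2 := proj2 (lt_min v')).
  destruct (T a b (u - a) (v - b)) as [_ H]; auto; try (rewrite Cmod_self; lra).
  replace (a + (u - a)) with u in H by ring. replace (b + (v - b)) with v in H by ring.
  eapply Rle_lt_trans; [exact H|].
  apply Rlt_le_trans with (K * (2 * (e / (4 * K))))%R; [apply Rmult_lt_compat_l; lra|].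
  replace (K * (2 * (e / (4 * K))))%R with (e / 2)%R by (field; lra). lra.
Qed.

Lemma lsh_of_sh f c c' d M a b : sh f c c' d M -> Cmod (a - c) < d -> Cmod (b - c') < d -> lsh f a b.
Proof.
  intros H Ha Hb. exists (Rmin (d - Cmod (a - c)) (d - Cmod (b - c'))), M. split; [apply Rmin_case; lra|].
  assert (m1 := Rmin_l (d - Cmod (a - c)) (d - Cmod (b - c'))). assert (m2 := Rmin_r (d - Cmod (a - c)) (d - Cmod (b - c'))).
  apply (sh_recenter f c c' d M); auto; lra.
Qed.

(** Joint continuity of the inner functions keeps their values in the bidisc of f; separate
    differentiability is then the chain rule along curves. *)
Lemma lsh_comp f p q a b : lsh f (p a b) (q a b) -> lsh p a b -> lsh q a b -> lsh (fun u v => f (p u v) (q u v)) a b.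
Proof.
  intros [r [M [Hr Hf]]] [r1 [M1 [Hr1 Hp]]] [r2 [M2 [Hr2 Hq]]].
  destruct (sh_joint p a b r1 M1 Hr1 Hp r Hr) as [d1 [Hd1 [Le1 P1]]].
  destruct (sh_joint q a b r2 M2 Hr2 Hq r Hr) as [d2 [Hd2 [Le2 P2]]].
  exists (Rmin d1 d2), M. split; [apply Rmin_case; auto|]. intros u v Hu Hv.
  assert (u1 := proj1 (lt_min Hu)). assert (v1 := proj1 (lt_min Hv)).
  assert (u2 := proj2 (lt_min Hu)). assert (v2 := proj2 (lt_min Hv)).
  specialize (P1 u v u1 v1). specialize (P2 u v u2 v2).
  destruct (Hp u v ltac:(lra) ltac:(lra)) as [[l1 L1] [[l2 L2] _]].
  destruct (Hq u v ltac:(lra) ltac:(lra)) as [[m1 N1] [[m2 N2] _]].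
  split; [|split].
  - eexists. apply (sh_curve f (p a b) (q a b) r M (fun x => p x v) (fun x => q x v) u l1 m1); auto.
  - eexists. apply (sh_curve f (p a b) (q a b) r M (fun x => p u x) (fun x => q u x) v l2 m2); auto.
  - apply Hf; auto.
Qed.

Lemma lsh_const c a b : lsh (fun _ _ => c) a b.
Proof. exists 1%R, (Cmod c). split; [lra|apply sh_const]. Qed.

Lemma lbh_id a : lbh (fun z => z) a.
Proof. apply (lbh_of _ a 1); [lra|]. intros z _. exists (RtoC 1). apply cd_id. Qed.

Lemma lsh_of1 g a b : lbh g a -> lsh (fun u _ => g u) a b.
Proof. intros [r [M [Hr H]]]. exists r, M. split; auto. apply sh_of1; auto. Qed.

Lemma lsh_of2 g a b : lbh g b -> lsh (fun _ v => g v) a b.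
Proof. intros [r [M [Hr H]]]. exists r, M. split; auto. apply sh_of2; auto. Qed.

Lemma lsh_1 a b : lsh (fun u _ => u) a b.
Proof. apply (lsh_of1 (fun u => u)), lbh_id. Qed.

Lemma lsh_2 a b : lsh (fun _ v => v) a b.
Proof. apply (lsh_of2 (fun u => u)), lbh_id. Qed.

Lemma lsh_common f g a b : lsh f a b -> lsh g a b -> exists r M N, 0 < r /\ sh f a b r M /\ sh g a b r N.
Proof.
  intros [r [M [Hr H]]] [s [N [Hs K]]]. exists (Rmin r s), M, N. split; [apply Rmin_case; auto|].
  split; [apply (sh_shrink f a b r)|apply (sh_shrink g a b s)]; auto; [apply Rmin_l|apply Rmin_r].
Qed.

Lemma lsh_plus f g a b : lsh f a b -> lsh g a b -> lsh (fun u v => f u v + g u v) a b.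
Proof.
  intros H K. destruct (lsh_common f g a b H K) as [r [M [N [Hr [H1 H2]]]]].
  exists r, (M + N)%R. split; auto. apply sh_plus; auto.
Qed.

Lemma lsh_mult f g a b : lsh f a b -> lsh g a b -> lsh (fun u v => f u v * g u v) a b.
Proof.
  intros H K. destruct (lsh_common f g a b H K) as [r [M [N [Hr [H1 H2]]]]].
  exists r, (M * N)%R. split; auto. apply sh_mult; auto.
Qed.

Lemma lsh_ext f g a b : (forall u v, f u v = g u v) -> lsh f a b -> lsh g a b.
Proof. intros E [r [M [Hr H]]]. exists r, M. split; auto. apply (sh_ext f); auto. Qed.

Lemma lsh_minus f g a b : lsh f a b -> lsh g a b -> lsh (fun u v => f u v - g u v) a b.
Proof.
  intros H K. apply (lsh_ext (fun u v => f u v + (-1) * g u v)); [intros; ring|].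
  apply lsh_plus; auto. apply (lsh_mult (fun _ _ => -1)); auto. apply lsh_const.
Qed.

Lemma lsh_comp1 g f a b : lbh g (f a b) -> lsh f a b -> lsh (fun u v => g (f u v)) a b.
Proof. intros Hg Hf. apply (lsh_comp (fun u _ => g u) f f); auto. apply lsh_of1; auto. Qed.

Lemma lbh_inv (a : C) : a <> 0 -> lbh Cinv a.
Proof.
  intros Ha. assert (P := proj1 (Cmod_gt_0 _) Ha). apply (lbh_of _ a (Cmod a)); auto.
  intros z Hz. eexists. apply cd_inv. apply (Cmod_lt_nz z a); auto.
Qed.

Lemma lsh_inv (f : C -> C -> C) a b : f a b <> 0 -> lsh f a b -> lsh (fun u v => / f u v) a b.
Proof. intros Hn Hf. apply (lsh_comp1 Cinv); auto. apply lbh_inv; auto. Qed.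

Lemma lsh_div (f g : C -> C -> C) a b : g a b <> 0 -> lsh f a b -> lsh g a b -> lsh (fun u v => f u v / g u v) a b.
Proof. intros Hn Hf Hg. apply lsh_mult; auto. apply lsh_inv; auto. Qed.

Lemma lsh_near f a b : lsh f a b -> exists d, 0 < d /\ forall u v, Cmod (u - a) < d -> Cmod (v - b) < d -> lsh f u v.
Proof.
  intros [r [M [Hr H]]]. exists (r / 2)%R. split; [lra|]. intros u v Hu Hv. exists (r / 2)%R, M. split; [lra|].
  apply (sh_recenter f a b r M); auto; lra.
Qed.

(** * The complex power on the right half-plane *)

Lemma Cmod_Cexp' w : Cmod (Cexp' w) = exp (Re w).
Proof.
  rewrite <- (hpath_eta w), Cexp'_hpath, Cmod_circ by (left; apply exp_pos). rewrite hpath_eta. reflexivity.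
Qed.

Lemma Cexp'_nz w : Cexp' w <> 0.
Proof. apply Cmod_gt_0. rewrite Cmod_Cexp'. apply exp_pos. Qed.

Lemma Cexp'_log (w : C) : 0 < Re w -> Cexp' (Clog_rhp w) = w.
Proof.
  intros Hw. destruct w as [x y]. change (Re (x, y)) with x in Hw. unfold Cexp', Clog_rhp.
  change (Re (x, y)) with x. change (Im (x, y)) with y.
  change (Re (ln (Cmod (x, y)), atan (y / x))) with (ln (Cmod (x, y))).
  change (Im (ln (Cmod (x, y)), atan (y / x))) with (atan (y / x)).
  assert (P : 0 < Cmod (x, y)).
  { assert (A := Re_le_Cmod (x, y)). change (Re (x, y)) with x in A. rewrite Rabs_pos_eq in A; lra. }
  rewrite exp_ln by auto. rewrite cos_atan, sin_atan.
  assert (S0 : 0 < sqrt (1 + (y / x)²)) by (apply sqrt_lt_R0; assert (A := Rle_0_sqr (y / x)); lra).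
  assert (E : Cmod (x, y) = (x * sqrt (1 + (y / x)²))%R).
  { unfold Cmod. simpl fst. simpl snd. rewrite <- (sqrt_Rsqr x) at 2 by lra. rewrite <- sqrt_mult.
    - f_equal. unfold Rsqr. field. lra.
    - apply Rle_0_sqr.
    - assert (A := Rle_0_sqr (y / x)); lra. }
  rewrite E. f_equal; field; repeat split; lra.
Qed.

Lemma rcont_eps (f : R -> R) x l : is_derive f x l -> forall e, 0 < e -> exists d, 0 < d /\ forall y, Rabs (y - x) < d -> Rabs (f y - f x) < e.
Proof.
  intros H e He.
  assert (Cf : continuous f x) by (apply (ex_derive_continuous (V := R_NormedModule)); eexists; exact H).
  destruct (Cf (fun y => ball (f x) e y)) as [d Hd].
  - exists (mkposreal e He). auto.
  - exists d. split; [apply cond_pos|]. intros y Hy. apply Hd. exact Hy.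
Qed.

Lemma cct_Clog (w : C) : 0 < Re w -> cct Clog_rhp w.
Proof.
  intros Hw e He.
  assert (P : 0 < Cmod w).
  { assert (A := Re_le_Cmod w). rewrite Rabs_pos_eq in A; lra. }
  destruct (rcont_eps ln (Cmod w) (/ Cmod w)%R) with (e := (e / 2)%R) as [d1 [Hd1 L1]]; [apply is_derive_ln; auto|lra|].
  destruct (rcont_eps atan (Im w / Re w)%R (/ (1 + (Im w / Re w)²))%R) with (e := (e / 2)%R) as [d2 [Hd2 L2]]; [apply is_derive_atan|lra|].
  set (Kt := (2 * ((Rabs (Im w) + Re w) / (Re w * Re w)) + 1)%R).
  assert (K3 : 0 <= (Rabs (Im w) + Re w) / (Re w * Re w)).
  { apply Rmult_le_pos; [assert (A := Rabs_pos (Im w)); lra|left; apply Rinv_0_lt_compat; nra]. }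
  exists (Rmin (Re w / 2) (Rmin d1 (d2 / Kt))). split.
  { repeat apply Rmin_case; try lra. apply Rdiv_lt_0_compat; unfold Kt; lra. }
  intros z Hz. destruct (lt_min Hz) as [z1 z'].
  destruct (lt_min z') as [z2 z3].
  eapply Rle_lt_trans; [apply Cmod_le_sum|].
  change (Re (Clog_rhp z - Clog_rhp w)) with (ln (Cmod z) - ln (Cmod w))%R.
  change (Im (Clog_rhp z - Clog_rhp w)) with (atan (Im z / Re z) - atan (Im w / Re w))%R.
  assert (B1 : Rabs (Cmod z - Cmod w) < d1).
  { apply Rabs_lt_between. assert (A := Cmod_rev z w). assert (A2 := Cmod_rev w z). rewrite Cmod_sym in A2. lra. }
  assert (X1 := Re_le_Cmod (z - w)). assert (X2 := Im_le_Cmod (z - w)).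
  change (Re (z - w)) with (Re z - Re w)%R in X1. change (Im (z - w)) with (Im z - Im w)%R in X2.
  assert (Hre : Re w / 2 <= Re z).
  { assert (A := Rle_abs (-(Re z - Re w))). rewrite Rabs_Ropp in A. lra. }
  assert (B2 : Rabs (Im z / Re z - Im w / Re w) < d2).
  { replace (Im z / Re z - Im w / Re w)%R with (((Im z - Im w) * Re w - Im w * (Re z - Re w)) / (Re z * Re w))%R by (field; lra).
    unfold Rdiv. rewrite Rabs_mult.
    assert (N : Rabs ((Im z - Im w) * Re w - Im w * (Re z - Re w)) <= (Rabs (Im w) + Re w) * Cmod (z - w)).
    { unfold Rminus at 1. eapply Rle_trans; [apply Rabs_triang|]. rewrite Rabs_Ropp, !Rabs_mult, (Rabs_pos_eq (Re w)) by lra.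
      assert (A := Rabs_pos (Im w)). assert (A1 := Rabs_pos (Re z - Re w)). nra. }
    assert (D : Rabs (/ (Re z * Re w)) <= 2 / (Re w * Re w)).
    { rewrite Rabs_pos_eq by (left; apply Rinv_0_lt_compat; nra).
      replace (2 / (Re w * Re w))%R with (/ (Re w / 2 * Re w))%R by (field; lra). apply Rinv_le_contravar; nra. }
    eapply Rle_lt_trans; [apply Rmult_le_compat; [apply Rabs_pos|apply Rabs_pos|exact N|exact D]|].
    apply Rle_lt_trans with (Kt * Cmod (z - w))%R.
    - replace ((Rabs (Im w) + Re w) * Cmod (z - w) * (2 / (Re w * Re w)))%R with (2 * ((Rabs (Im w) + Re w) / (Re w * Re w)) * Cmod (z - w))%R by (unfold Rdiv; ring).
      apply Rmult_le_compat_r; [apply Cmod_ge_0|unfold Kt; lra].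
    - apply Rlt_le_trans with (Kt * (d2 / Kt))%R; [apply Rmult_lt_compat_l; [unfold Kt; lra|auto]|]. right; field; unfold Kt; lra. }
  specialize (L1 _ B1). specialize (L2 _ B2). lra.
Qed.

(** Inverse function rule: with s the slope of the exponential at log w, exp(log z) = z gives the
    slope 1/s(log z) for the logarithm, which is continuous at w because log is. *)
Lemma cd_Clog (w : C) : 0 < Re w -> cd Clog_rhp w (/ w).
Proof.
  intros Hw. assert (CL := cct_Clog w Hw).
  assert (E := proj1 (cd_slope _ _ _) (cd_Cexp' (Clog_rhp w))). rewrite Cexp'_log in E by auto.
  destruct E as [s [Hs [Cs Es]]].
  assert (Cc : cct (fun z => s (Clog_rhp z)) w) by (apply (cct_comp s Clog_rhp); auto).
  assert (Hw0 : w <> 0). { intros E. rewrite E in Hw. unfold RtoC, Re in Hw; simpl in Hw. lra. }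
  destruct (Cc (Cmod w)) as [d [Hd H]]; [apply Cmod_gt_0; auto|].
  assert (Hm : 0 < Rmin d (Re w)) by (apply Rmin_case; auto).
  assert (Q : forall z, Cmod (z - w) < Rmin d (Re w) -> s (Clog_rhp z) <> 0 /\ Clog_rhp z = Clog_rhp w + / s (Clog_rhp z) * (z - w)).
  { intros z Hz. destruct (lt_min Hz) as [z1 z2].
    specialize (H z z1). rewrite Hs in H. assert (N := Cmod_lt_nz _ _ H). split; auto.
    assert (X1 := Re_le_Cmod (z - w)). change (Re (z - w)) with (Re z - Re w)%R in X1.
    assert (A := Rle_abs (-(Re z - Re w))). rewrite Rabs_Ropp in A.
    specialize (Es (Clog_rhp z)). rewrite Cexp'_log in Es by lra.
    replace (z - w) with (s (Clog_rhp z) * (Clog_rhp z - Clog_rhp w)) by (rewrite Es at 3; ring). field. auto. }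
  intros e He. destruct (cct_comp Cinv (fun z => s (Clog_rhp z)) w Cc) with (eps := e) as [d' [Hd' H']]; auto.
  { apply cct_inv. rewrite Hs. auto. }
  rewrite Hs in H'.
  exists (Rmin d' (Rmin d (Re w))). split; [apply Rmin_case; auto|]. intros z Hz.
  destruct (lt_min Hz) as [z1 z2].
  destruct (Q z z2) as [N ->]. specialize (H' z z1).
  replace (Clog_rhp w + / s (Clog_rhp z) * (z - w) - Clog_rhp w - / w * (z - w)) with ((/ s (Clog_rhp z) - / w) * (z - w)) by ring.
  rewrite Cmod_mult. apply Rmult_le_compat_r; [apply Cmod_ge_0|lra].
Qed.

Lemma cd_Cpow (w s : C) : 0 < Re w -> cd (fun w => Cpow_rhp w s) w (s * Cpow_rhp w s / w).
Proof.
  intros Hw. unfold Cpow_rhp. apply cd_val with (Cexp' (s * Clog_rhp w) * (s * / w)); [unfold Cdiv; ring|].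
  apply (cd_comp Cexp' (fun w => s * Clog_rhp w)); [|apply cd_Cexp'].
  apply cd_scal, cd_Clog, Hw.
Qed.

Lemma lbh_Cpow (w s : C) : 0 < Re w -> lbh (fun w => Cpow_rhp w s) w.
Proof.
  intros Hw. apply (lbh_of _ w (Re w)); auto. intros z Hz. eexists. apply cd_Cpow.
  assert (X1 := Re_le_Cmod (z - w)). change (Re (z - w)) with (Re z - Re w)%R in X1.
  assert (A := Rle_abs (-(Re z - Re w))). rewrite Rabs_Ropp in A. lra.
Qed.

(** * The factor f_r with an independent second variable in place of conj z *)

Definition qf (z zt : C) : C := (zt - Ci) / (zt - z).
Definition fhat (r z zt : C) : C := (2 * Ci) / (z - Ci) * Cpow_rhp (qf z zt) (r - 1).

Lemma f_r_fhat r z : f_r r z = fhat r z (Cconj z).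
Proof. reflexivity. Qed.

Lemma conj_sub_nz z : 0 < Im z -> Cconj z - z <> 0.
Proof.
  intros H E. assert (A : Im (Cconj z - z) = 0%R) by (rewrite E; reflexivity).
  change (Im (Cconj z - z)) with (- Im z - Im z)%R in A. lra.
Qed.

Lemma conj_sub_i_nz z : 0 < Im z -> Cconj z - Ci <> 0.
Proof.
  intros H E. assert (A : Im (Cconj z - Ci) = 0%R) by (rewrite E; reflexivity).
  change (Im (Cconj z - Ci)) with (- Im z - 1)%R in A. lra.
Qed.

Lemma div_eq_of_mult (a d n : C) : d <> 0 -> a * d = n -> n / d = a.
Proof. intros H <-. field. auto. Qed.

Lemma qf_Re z : 0 < Im z -> 0 < Re (qf z (Cconj z)).
Proof.
  intros H. unfold qf. destruct z as [x y]. change (Im (x, y)) with y in H.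
  replace ((Cconj (x, y) - Ci) / (Cconj (x, y) - (x, y))) with (((y + 1) / (2 * y), x / (2 * y))%R : C).
  - change (0 < (y + 1) / (2 * y)). apply Rdiv_lt_0_compat; lra.
  - assert (N := conj_sub_nz (x, y) H).
    assert (E : (((y + 1) / (2 * y), x / (2 * y))%R : C) * (Cconj (x, y) - (x, y)) = Cconj (x, y) - Ci).
    { unfold Cconj. apply injective_projections; simpl; field; lra. }
    symmetry. apply (div_eq_of_mult _ _ _ N E).
Qed.

Lemma fhat_nz r z zt : z <> Ci -> fhat r z zt <> 0.
Proof.
  intros H. unfold fhat. apply Cmult_neq_0; [|apply Cexp'_nz]. apply Cmult_neq_0.
  - apply Cmult_neq_0; [apply two_nz|apply Ci_nz].
  - intros E. apply C1_nz. assert (N : z - Ci <> 0) by (apply Cminus_eq_contra; auto).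
    rewrite <- (Cinv_r (z - Ci) N), E. ring.
Qed.

Lemma f_r_nz r z : z <> Ci -> f_r r z <> 0.
Proof. rewrite f_r_fhat. apply fhat_nz. Qed.

Lemma fhat_cd2 r z zt : zt <> z -> 0 < Re (qf z zt) -> 
  cd (fun y => fhat r z y) zt (fhat r z zt * ((r - 1) * (/ (zt - Ci) - / (zt - z)))).
Proof.
  intros Hz Hq. assert (N1 : zt - z <> 0) by (apply Cminus_eq_contra; auto).
  assert (N2 : zt - Ci <> 0).
  { intros E. unfold qf in Hq. rewrite E in Hq. replace (0 / (zt - z)) with (RtoC 0) in Hq by (field; auto). change (0 < 0) in Hq. lra. }
  assert (Nq : qf z zt <> 0) by (unfold qf; apply Cmult_neq_0; auto; apply Cmod_gt_0; rewrite Cmod_inv by auto; apply Rinv_0_lt_compat, Cmod_gt_0; auto).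
  unfold fhat. eapply cd_val; [|apply cd_scal; apply (cd_comp (fun w => Cpow_rhp w (r - 1)) (fun y => qf z y)); [|apply cd_Cpow; auto]].
  2:{ unfold qf. apply cd_mult; [apply cd_minus; [apply cd_id|apply cd_const]|].
      apply cd_invf; auto. apply cd_minus; [apply cd_id|apply cd_const]. }
  set (P := Cpow_rhp (qf z zt) (r - 1)). unfold qf. 
  set (c := 2 * Ci / (z - Ci)). field. auto.
Qed.

Lemma fhat_cd1 r z zt : z <> Ci -> zt <> z -> 0 < Re (qf z zt) -> 
  cd (fun x => fhat r x zt) z (fhat r z zt * (- / (z - Ci) + (r - 1) * / (zt - z))).
Proof.
  intros Hi Hz Hq. assert (N1 : zt - z <> 0) by (apply Cminus_eq_contra; auto).
  assert (N0 : z - Ci <> 0) by (apply Cminus_eq_contra; auto).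
  assert (N2 : zt - Ci <> 0).
  { intros E. unfold qf in Hq. rewrite E in Hq. replace (0 / (zt - z)) with (RtoC 0) in Hq by (field; auto). change (0 < 0) in Hq. lra. }
  unfold fhat. eapply cd_val; [|apply cd_mult].
  2:{ apply cd_scal. apply cd_invf; auto. apply cd_minus; [apply cd_id|apply cd_const]. }
  2:{ apply (cd_comp (fun w => Cpow_rhp w (r - 1)) (fun x => qf x zt)); [|apply cd_Cpow; auto].
      unfold qf. apply cd_mult; [apply cd_const|].
      apply cd_invf; auto. apply cd_minus; [apply cd_const|apply cd_id]. }
  set (P := Cpow_rhp (qf z zt) (r - 1)). unfold qf. field. auto.
Qed.

Lemma lsh_fhat r z : 0 < Im z -> z <> Ci -> lsh (fhat r) z (Cconj z).
Proof.
  intros Hz Hi. unfold fhat. apply lsh_mult.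
  - apply (lsh_div (fun _ _ => 2 * Ci) (fun u _ => u - Ci)); [apply Cminus_eq_contra; auto|apply lsh_const|].
    apply (lsh_minus (fun u _ => u) (fun _ _ => Ci)); [apply lsh_1|apply lsh_const].
  - apply (lsh_comp1 (fun w => Cpow_rhp w (r - 1)) qf); [apply lbh_Cpow, qf_Re, Hz|].
    unfold qf. apply (lsh_div (fun _ v => v - Ci) (fun u v => v - u)).
    + apply conj_sub_nz; auto.
    + apply (lsh_minus (fun _ v => v) (fun _ _ => Ci)); [apply lsh_2|apply lsh_const].
    + apply (lsh_minus (fun _ v => v) (fun u _ => u)); [apply lsh_2|apply lsh_1].
Qed.

(** * The coordinates a = 1/(z - i) and b = 1/(conj z - i) on the sphere *)

Definition Ac (q : P1C) : C := match q with Some z => / (z - Ci) | None => 0 end.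
Definition Bc (q : P1C) : C := match q with Some z => / (Cconj z - Ci) | None => 0 end.
(** The common value of a and b at a real point; the real points lie on the diagonal a = b. *)
Definition tp (p : P1R) : C := match p with Some t => / (RtoC t - Ci) | None => 0 end.

(* phi p is the chart at p, psi p is the coordinate a in this chart, and chi p inverts psi p. *)
Definition phi (p : P1R) (w : C) : P1C :=
  match p with Some t => Some (RtoC t + w) | None => chart_inf w end.
Definition psi (p : P1R) (w : C) : C :=
  match p with Some t => / (RtoC t + w - Ci) | None => w / (1 - Ci * w) end.
Definition chi (p : P1R) (a : C) : C :=
  match p with Some t => / a - (RtoC t - Ci) | None => a / (1 + Ci * a) end.

Lemma Some_inj (z w : C) : @Some C z = Some w -> z = w.
Proof. congruence. Qed.

Lemma Cconj_R (x : R) : Cconj (RtoC x) = RtoC x.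
Proof. unfold Cconj, RtoC; simpl. f_equal. ring. Qed.

Lemma Cconj_Ci : Cconj Ci = - Ci.
Proof. unfold Cconj, Ci; apply injective_projections; simpl; ring. Qed.

Lemma Cconj_plus (a b : C) : Cconj (a + b) = Cconj a + Cconj b.
Proof. unfold Cconj; apply injective_projections; simpl; ring. Qed.

Lemma t_sub_i (t : R) : 1 <= Cmod (RtoC t - Ci).
Proof.
  assert (A := Im_le_Cmod (RtoC t - Ci)). change (Im (RtoC t - Ci)) with (0 - 1)%R in A.
  rewrite Rabs_left in A; lra.
Qed.

Lemma t_sub_i_nz (t : R) : RtoC t - Ci <> 0.
Proof. apply Cmod_gt_0. assert (A := t_sub_i t). lra. Qed.

Lemma psi_den_some (t : R) (w : C) : Cmod w < 1 -> RtoC t + w - Ci <> 0.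
Proof.
  intros H. apply (Cmod_lt_nz _ (RtoC t - Ci)). replace (RtoC t + w - Ci - (RtoC t - Ci)) with w by ring.
  assert (A := t_sub_i t). lra.
Qed.

Lemma psi_den_none (w : C) : Cmod w < 1 -> 1 - Ci * w <> 0.
Proof.
  intros H. apply (Cmod_lt_nz _ 1). replace (1 - Ci * w - 1) with (- (Ci * w)) by ring.
  rewrite Cmod_opp, Cmod_mult, Cmod_Ci, Cmod_1. lra.
Qed.

Lemma chi_den_none (w : C) : Cmod w < 1 -> 1 + Ci * w <> 0.
Proof.
  intros H. apply (Cmod_lt_nz _ 1). replace (1 + Ci * w - 1) with (Ci * w) by ring.
  rewrite Cmod_mult, Cmod_Ci, Cmod_1. lra.
Qed.

Lemma chart_inf_nz (w : C) : w <> 0 -> chart_inf w = Some (/ w).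
Proof. intros H. unfold chart_inf. destruct (C_eq_dec w 0); [contradiction|reflexivity]. Qed.

Lemma chart_inf_0 : chart_inf 0 = None.
Proof. unfold chart_inf. destruct (C_eq_dec 0 0); [reflexivity|contradiction]. Qed.

Lemma inv_sub_i (w : C) : w <> 0 -> 1 - Ci * w <> 0 -> / (/ w - Ci) = w / (1 - Ci * w).
Proof.
  intros H1 H2. assert (/ w - Ci <> 0).
  { intros E. apply H2. replace (1 - Ci * w) with (w * (/ w - Ci)) by (field; auto). rewrite E. ring. }
  replace (/ w - Ci) with ((1 - Ci * w) / w) by (field; auto). field. auto.
Qed.

Lemma Ac_phi p (w : C) : Cmod w < 1 -> Ac (phi p w) = psi p w.
Proof.
  intros H. destruct p as [t|]; [reflexivity|]. simpl.
  destruct (C_eq_dec w 0) as [->|n].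
  - rewrite chart_inf_0. simpl. unfold Cdiv. ring.
  - rewrite chart_inf_nz by auto. simpl. apply inv_sub_i; auto. apply psi_den_none; auto.
Qed.

Lemma Bc_phi p (w : C) : Cmod w < 1 -> Bc (phi p w) = psi p (Cconj w).
Proof.
  intros H. destruct p as [t|].
  - simpl. rewrite Cconj_plus, Cconj_R. reflexivity.
  - simpl. destruct (C_eq_dec w 0) as [->|n].
    + rewrite chart_inf_0. simpl. rewrite Cconj_R. unfold Cdiv. ring.
    + rewrite chart_inf_nz by auto. simpl. rewrite Cinv_conj by auto.
      apply inv_sub_i; [apply Cmod_gt_0; rewrite Cmod_conj; apply Cmod_gt_0; auto|].
      apply psi_den_none. rewrite Cmod_conj; auto.
Qed.

Lemma chi_psi p (w : C) : Cmod w < 1 -> chi p (psi p w) = w.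
Proof.
  intros H. destruct p as [t|]; simpl.
  - assert (N := psi_den_some t w H). field. auto.
  - assert (N := psi_den_none w H).
    replace (w / (1 - Ci * w) / (1 + Ci * (w / (1 - Ci * w)))) with (w / (1 - Ci * w) / (/ (1 - Ci * w))).
    + field. auto.
    + f_equal. field. auto.
Qed.

Lemma psi_0 p : psi p 0 = tp p.
Proof. destruct p as [t|]; simpl; [f_equal; ring|]. unfold Cdiv. ring. Qed.

Lemma chi_tp p : chi p (tp p) = 0.
Proof. rewrite <- psi_0. apply chi_psi. rewrite Cmod_0; lra. Qed.

(** The distance from [tp p] to the pole of [chi p], which is 0 for finite p and i for infinity;
    closer than this, [psi p] and [chi p] are inverse to each other. *)
Definition rtp (p : P1R) : R := match p with Some t => Cmod (tp (Some t)) | None => 1 end.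

Lemma tp_nz (t : R) : tp (Some t) <> 0.
Proof. simpl. apply Cmod_gt_0. rewrite Cmod_inv by apply t_sub_i_nz. apply Rinv_0_lt_compat. assert (A := t_sub_i t). lra. Qed.

Lemma rtp_pos p : 0 < rtp p.
Proof. destruct p as [t|]; unfold rtp; [|lra]. apply Cmod_gt_0, tp_nz. Qed.

Lemma psi_chi p (a : C) : Cmod (a - tp p) < rtp p -> psi p (chi p a) = a.
Proof.
  intros H. destruct p as [t|]; simpl in *.
  - assert (a <> 0) by (apply (Cmod_lt_nz a _ H)). replace (RtoC t + (/ a - (RtoC t - Ci)) - Ci) with (/ a) by ring. field. auto.
  - replace (a - 0) with a in H by ring. assert (N := chi_den_none a H).
    replace (1 - Ci * (a / (1 + Ci * a))) with (/ (1 + Ci * a)) by (field; auto). field. auto.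
Qed.

Lemma lbh_chi p : lbh (chi p) (tp p).
Proof.
  apply (lbh_of _ _ (rtp p)); [apply rtp_pos|]. intros z Hz. destruct p as [t|].
  - unfold chi. eexists. apply cd_minus; [apply cd_inv, (Cmod_lt_nz _ _ Hz)|apply cd_const].
  - unfold chi. simpl in Hz. replace (z - 0) with z in Hz by ring. eexists. apply cd_mult; [apply cd_id|].
    apply cd_invf; [apply chi_den_none; auto|]. apply cd_plus; [apply cd_const|apply cd_scal, cd_id].
Qed.

Lemma lbh_psi p : lbh (psi p) 0.
Proof.
  apply (lbh_of _ _ 1); [lra|]. intros z Hz. replace (z - 0) with z in Hz by ring. destruct p as [t|].
  - unfold psi. eexists. apply (cd_invf (fun z => RtoC t + z - Ci)); [apply psi_den_some; auto|].
    apply cd_minus; [apply cd_plus; [apply cd_const|apply cd_id]|apply cd_const].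
  - unfold psi. eexists. apply cd_mult; [apply cd_id|]. apply cd_invf; [apply psi_den_none; auto|].
    apply cd_minus; [apply cd_const|apply cd_scal, cd_id].
Qed.

Lemma lbh_cct f a : lbh f a -> cct f a.
Proof. intros [r [M [Hr H]]]. eapply bh_cct; eauto. rewrite Cmod_self; auto. Qed.

Lemma phi_chi p (q : P1C) : q <> Some Ci -> Cmod (Ac q - tp p) < rtp p -> phi p (chi p (Ac q)) = q.
Proof.
  intros Hi H. destruct p as [t|]; destruct q as [z|]; unfold phi.
  - unfold chi. simpl. assert (z - Ci <> 0) by (apply Cminus_eq_contra; congruence). f_equal. field. auto.
  - exfalso. change (Ac None) with (RtoC 0) in H. unfold rtp in H. rewrite Cmod_sym in H.
    replace (tp (Some t) - 0) with (tp (Some t)) in H by ring. lra.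
  - assert (Nz : z - Ci <> 0) by (apply Cminus_eq_contra; congruence).
    simpl in *. replace (/ (z - Ci) - 0) with (/ (z - Ci)) in H by ring.
    assert (N := chi_den_none _ H).
    assert (z0 : z <> 0). { intros ->. apply N. replace (1 + Ci * / (0 - Ci)) with ((0 - Ci + Ci) / (0 - Ci)) by (field; first [exact Ci_nz | auto]). unfold Cdiv. ring. }
    replace (/ (z - Ci) / (1 + Ci * / (z - Ci))) with (/ z).
    + rewrite chart_inf_nz by (apply Cmod_gt_0; rewrite Cmod_inv by auto; apply Rinv_0_lt_compat, Cmod_gt_0; auto).
      f_equal. field. auto.
    + replace (1 + Ci * / (z - Ci)) with (z / (z - Ci)) by (field; auto). field. auto.
  - simpl. replace (0 / (1 + Ci * 0)) with (RtoC 0); [apply chart_inf_0|]. unfold Cdiv. ring.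
Qed.

(* The exclusion of i and -i discards the junk values of Ac and Bc at their poles. *)
Definition Nb (p : P1R) (d : R) (q : P1C) : Prop :=
  q <> Some Ci /\ q <> Some (- Ci) /\ Cmod (Ac q - tp p) < d /\ Cmod (Bc q - tp p) < d.

Lemma Nb_self p d : 0 < d -> Nb p d (P1R_to_P1C p).
Proof.
  intros Hd. destruct p as [t|]; simpl.
  - split; [|split; [|split]].
    + intros E. injection E as E1 E2. lra.
    + intros E. injection E as E1 E2. lra.
    + unfold Ac, tp. rewrite Cmod_self; auto.
    + unfold Bc, tp. rewrite Cconj_R, Cmod_self; auto.
  - split; [discriminate|split; [discriminate|]]. unfold Ac, Bc, tp. rewrite Cmod_self; auto.
Qed.

Lemma open_phi U p : open_P1C U -> U (P1R_to_P1C p) -> exists d, 0 < d /\ forall w, Cmod w < d -> U (phi p w).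
Proof.
  intros [O1 O2] HU. destruct p as [t|]; simpl in HU.
  - destruct (proj1 (open_C _) O1 (RtoC t) HU) as [d [Hd H]]. exists d. split; auto. intros w Hw. simpl. apply H.
    replace (RtoC t + w - RtoC t) with w by ring. auto.
  - destruct (O2 HU) as [M HM]. exists (/ (Rabs M + 1))%R. assert (P := Rabs_pos M).
    split; [apply Rinv_0_lt_compat; lra|]. intros w Hw. simpl. destruct (C_eq_dec w 0) as [->|n].
    + rewrite chart_inf_0. auto.
    + rewrite chart_inf_nz by auto. apply HM. rewrite Cmod_inv by auto.
      assert (Pw := proj1 (Cmod_gt_0 _) n). assert (A := Rle_abs M).
      apply Rlt_le_trans with (Rabs M + 1)%R; [lra|]. rewrite <- (Rinv_inv (Rabs M + 1)). apply Rinv_le_contravar; lra.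
Qed.

Lemma Nb_small U p : open_P1C U -> U (P1R_to_P1C p) -> exists d, 0 < d /\ forall q, Nb p d q -> U q.
Proof.
  intros HO HU. destruct (open_phi U p HO HU) as [d [Hd H]].
  destruct (lbh_cct _ _ (lbh_chi p) d Hd) as [d1 [Hd1 H1]].
  exists (Rmin d1 (rtp p)). split; [apply Rmin_case; [auto|apply rtp_pos]|].
  intros q [Hi [_ [HA _]]].
  destruct (lt_min HA) as [A1 A2].
  rewrite <- (phi_chi p q Hi A2). apply H. specialize (H1 _ A1). rewrite chi_tp in H1.
  replace (chi p (Ac q)) with (chi p (Ac q) - 0) by ring. auto.
Qed.

Lemma Nb_mono p d d' q : d <= d' -> Nb p d q -> Nb p d' q.
Proof. intros H [A [B [D E]]]. repeat split; auto; lra. Qed.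

Lemma conj_ne_i (z : C) : z <> - Ci -> Cconj z - Ci <> 0.
Proof.
  intros H E. apply H. apply Ceq_minus in E. rewrite <- (Cconj_conj z), E. apply Cconj_Ci.
Qed.

Lemma cct_lt (f : C -> C) (z c : C) (d : R) : cct f z -> Cmod (f z - c) < d -> exists e, 0 < e /\ forall w, Cmod (w - z) < e -> Cmod (f w - c) < d.
Proof.
  intros H Hd. destruct (H (d - Cmod (f z - c))%R ltac:(lra)) as [e [He K]]. exists e. split; auto.
  intros w Hw. specialize (K w Hw). assert (A := Cmod_tri3 (f w) (f z) c). lra.
Qed.

Lemma Cmod_inv_far (z : C) (e : R) : 0 < e -> / e + 1 < Cmod z -> Cmod (/ (z - Ci)) < e.
Proof.
  intros He Hz. assert (A := Cmod_rev z Ci). rewrite Cmod_Ci in A. assert (P := Rinv_0_lt_compat e He).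
  assert (N : z - Ci <> 0) by (apply Cmod_gt_0; lra).
  rewrite Cmod_inv by auto. rewrite <- (Rinv_inv e). apply Rinv_lt_contravar; [apply Rmult_lt_0_compat; lra|lra].
Qed.

Lemma Nb_open p d : open_P1C (Nb p d).
Proof.
  split.
  - apply open_C. intros z [H1 [H2 [H3 H4]]].
    assert (N1 : z <> Ci) by congruence. assert (N2 : z <> - Ci) by congruence.
    assert (N1' : z - Ci <> 0) by (apply Cminus_eq_contra; auto).
    assert (N2' : z - - Ci <> 0) by (apply Cminus_eq_contra; auto).
    assert (C1 : cct (fun w => / (w - Ci)) z).
    { eapply cd_cct. apply (cd_invf (fun w => w - Ci)); auto. apply cd_minus; [apply cd_id|apply cd_const]. }
    assert (C2 : cct (fun w => / (w - Ci)) (Cconj z)).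
    { eapply cd_cct. apply (cd_invf (fun w => w - Ci)); [apply conj_ne_i; auto|]. apply cd_minus; [apply cd_id|apply cd_const]. }
    destruct (cct_lt _ _ _ _ C1 H3) as [e1 [He1 K1]]. destruct (cct_lt _ _ _ _ C2 H4) as [e2 [He2 K2]].
    exists (Rmin (Rmin e1 e2) (Rmin (Cmod (z - Ci)) (Cmod (z - - Ci)))). split.
    { repeat apply Rmin_case; auto; apply Cmod_gt_0; auto. }
    intros w Hw. destruct (lt_min Hw) as [w1 w2].
    split; [|split; [|split]].
    + intros E. injection E as ->. assert (A := proj1 (lt_min w2)). rewrite Cmod_sym in A. lra.
    + intros E. injection E as ->. assert (A := proj2 (lt_min w2)). rewrite Cmod_sym in A. lra.
    + apply K1. exact (proj1 (lt_min w1)).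
    + apply K2. rewrite Cmod_conj_sub. exact (proj2 (lt_min w1)).
  - intros [_ [_ [H3 H4]]]. simpl in H3, H4. rewrite Cmod_sym in H3.
    replace (tp p - 0) with (tp p) in H3 by ring.
    set (e := (d - Cmod (tp p))%R). assert (He : 0 < e) by (unfold e; lra).
    exists (/ e + 1)%R. intros z Hz. assert (Pe := Rinv_0_lt_compat e He).
    split; [|split; [|split]].
    + intros E. injection E as ->. rewrite Cmod_Ci in Hz. lra.
    + intros E. injection E as ->. rewrite Cmod_opp, Cmod_Ci in Hz. lra.
    + simpl. eapply Rle_lt_trans; [apply Cmod_sub_le|]. assert (A := Cmod_inv_far z e He Hz). unfold e in A. lra.
    + simpl. eapply Rle_lt_trans; [apply Cmod_sub_le|].
      assert (A := Cmod_inv_far (Cconj z) e He). rewrite Cmod_conj in A. specialize (A Hz). unfold e in A. lra.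
Qed.

Lemma open_P1C_union (A : Type) (P : A -> Prop) (U : A -> P1C -> Prop) : (forall a, P a -> open_P1C (U a)) ->
  open_P1C (fun q => exists a, P a /\ U a q).
Proof.
  intros H. split.
  - apply open_C. intros z [a [Ha Hu]]. destruct (H a Ha) as [O _].
    destruct (proj1 (open_C _) O z Hu) as [d [Hd K]]. exists d. split; auto. intros w Hw. exists a. split; [exact Ha|apply K; auto].
  - intros [a [Ha Hu]]. destruct (H a Ha) as [_ O]. destruct (O Hu) as [M HM]. exists M. intros z Hz. exists a. split; auto.
Qed.

(* Neighbourhoods of I are assembled from local ones; no compatibility between them is needed because Q is pointwise. *)
Lemma nbhd_assemble (I : P1R -> Prop) (Q : P1C -> Prop) :
  (forall p, I p -> exists d, 0 < d /\ forall q, Nb p d q -> Q q) ->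
  exists U, nbhd U I /\ (forall q, U q -> Q q) /\ (forall q, U q -> q <> Some Ci).
Proof.
  intros H.
  exists (fun q => exists pd : P1R * R, (I (fst pd) /\ 0 < snd pd /\ forall q, Nb (fst pd) (snd pd) q -> Q q) /\ Nb (fst pd) (snd pd) q).
  split; [split|split].
  - apply (open_P1C_union (P1R * R) (fun pd => I (fst pd) /\ 0 < snd pd /\ forall q, Nb (fst pd) (snd pd) q -> Q q) (fun pd => Nb (fst pd) (snd pd))).
    intros [p d] _. apply Nb_open.
  - intros p Hp. destruct (H p Hp) as [d [Hd K]]. exists (p, d). simpl. split; [auto|apply Nb_self; auto].
  - intros q [[p d] [[_ [_ K]] N]]. apply K; auto.
  - intros q [[p d] [_ N]]. apply N.
Qed.

(** * Real analyticity in the charts and separate holomorphy in (a, b) *)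

Definition repG (G : P1C -> C) (Gam : C -> C -> C) (p : P1R) (d : R) : Prop :=
  forall q, Nb p d q -> G q = Gam (Ac q) (Bc q).

Lemma half_sum (w : C) : (w + Cconj w) / 2 = RtoC (Re w).
Proof. symmetry. apply re_alt. Qed.

Lemma half_diff (w : C) : (w - Cconj w) / (2 * Ci) = RtoC (Im w).
Proof. symmetry. apply im_alt. Qed.

Lemma lsh_pair_in (f : C -> C) a b : lbh f a -> lbh f b ->
  lsh (fun u v => (f u + f v) / 2) a b /\ lsh (fun u v => (f u - f v) / (2 * Ci)) a b.
Proof.
  intros Ha Hb. split.
  - apply (lsh_div (fun u v => f u + f v) (fun _ _ => 2)); [apply two_nz| |apply lsh_const].
    apply (lsh_plus (fun u _ => f u) (fun _ v => f v)); [apply lsh_of1|apply lsh_of2]; auto.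
  - apply (lsh_div (fun u v => f u - f v) (fun _ _ => 2 * Ci)); [apply Cmult_neq_0; [apply two_nz|apply Ci_nz]| |apply lsh_const].
    apply (lsh_minus (fun u _ => f u) (fun _ v => f v)); [apply lsh_of1|apply lsh_of2]; auto.
Qed.

(** The power series in the chart is evaluated at complex u and v computed from chi(a) and chi(b) in
    place of w and conj w. At an actual point q near p one has chi(b) = conj w, since the chart has
    real coefficients, and the original values come back. *)
Lemma R2S (U : P1C -> Prop) (G : P1C -> C) (p : P1R) : real_analytic_P1 U G -> U (P1R_to_P1C p) ->
  exists Gam d, 0 < d /\ lsh Gam (tp p) (tp p) /\ repG G Gam p d.
Proof.
  intros [H1 H2] HU.
  assert (Hra : ra_chart G (phi p)) by (destruct p as [t|]; [apply H1|apply H2]; auto).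
  destruct Hra as [rho [c [Hrho Hc]]].
  destruct (ps2_of_pseries2 c rho (fun u v => G (phi p (u, v))) Hrho Hc) as [M [Hb HG]].
  destruct (sh_ps2 c M (rho / 2) (rho / 4) ltac:(lra) Hb) as [M' Hs].
  assert (Lc := lbh_chi p).
  exists (fun a b => ps2 c ((chi p a + chi p b) / 2) ((chi p a - chi p b) / (2 * Ci))).
  destruct (lbh_cct _ _ Lc (Rmin 1 rho)) as [d [Hd K]]; [apply Rmin_case; lra|]. rewrite chi_tp in K.
  exists (Rmin d (rtp p)). split; [apply Rmin_case; [auto|apply rtp_pos]|]. split.
  - destruct (lsh_pair_in _ _ _ Lc Lc) as [L1 L2].
    apply (lsh_comp (ps2 c)); auto. rewrite chi_tp.
    replace ((0 + 0) / 2) with (RtoC 0) by field. replace ((0 - 0) / (2 * Ci)) with (RtoC 0) by (field; apply Ci_nz).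
    exists (rho / 4)%R, M'. split; [lra|auto].
  - intros q [Hi [_ [HA HB]]].
    destruct (lt_min HA) as [A1 A2].
    specialize (K _ A1). set (w := chi p (Ac q)) in *. replace (w - 0) with w in K by ring.
    destruct (lt_min K) as [K1 K2].
    assert (Eq : phi p w = q) by (apply phi_chi; auto).
    assert (EB : chi p (Bc q) = Cconj w).
    { rewrite <- Eq, Bc_phi by auto. apply chi_psi. rewrite Cmod_conj; auto. }
    rewrite EB, half_sum, half_diff.
    rewrite <- HG.
    + rewrite <- Eq at 1. destruct w; reflexivity.
    + eapply Rle_lt_trans; [apply Re_le_Cmod|auto].
    + eapply Rle_lt_trans; [apply Im_le_Cmod|auto].
Qed.

Lemma ra_of_lsh (G : P1C -> C) (ph : C -> P1C) f (d : R) : 0 < d -> lsh f 0 0 ->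
  (forall u v : R, Rabs u < d -> Rabs v < d -> G (ph (u, v)) = f u v) -> ra_chart G ph.
Proof.
  intros Hd [r [M [Hr Hs]]] HG.
  destruct (osgood f 0 0 r (r / 2) M ltac:(lra) Hs) as [c [Hc Hf]].
  exists (Rmin d (r / 2)), c. split; [apply Rmin_case; lra|]. intros u v Hu Hv.
  destruct (lt_min Hu) as [u1 u2].
  destruct (lt_min Hv) as [v1 v2].
  rewrite HG by auto. assert (E : forall x : R, RtoC x - 0 = RtoC x) by (intros; ring).
  rewrite Hf, !E by (rewrite E, Cmod_R; auto).
  apply (pseries2_of_ps2 c (4 * M) (r / 2)); auto; lra.
Qed.

(** The analogue of [Nb] around an arbitrary point, whose coordinates a and b need not coincide. *)
Definition near2 (q0 : P1C) (d : R) (q : P1C) : Prop :=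
  q <> Some Ci /\ q <> Some (- Ci) /\ Cmod (Ac q - Ac q0) < d /\ Cmod (Bc q - Bc q0) < d.

Definition ra_at (G : P1C -> C) (q : P1C) : Prop :=
  match q with Some z => ra_chart G (fun w => Some (Cplus z w)) | None => ra_chart G chart_inf end.

Lemma uv_conj (u v : R) : RtoC u - Ci * RtoC v = Cconj (u, v).
Proof. symmetry. apply conj_pair. Qed.

Lemma lsh_lin (z : C) (s : C) : lsh (fun u v => z + (u + s * v) - Ci) 0 0.
Proof.
  apply (lsh_minus (fun u v => z + (u + s * v)) (fun _ _ => Ci)); [|apply lsh_const].
  apply (lsh_plus (fun _ _ => z) (fun u v => u + s * v)); [apply lsh_const|].
  apply (lsh_plus (fun u _ => u) (fun _ v => s * v)); [apply lsh_1|].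
  apply (lsh_mult (fun _ _ => s) (fun _ v => v)); [apply lsh_const|apply lsh_2].
Qed.

Lemma lsh_lin0 (s : C) : lsh (fun u v => (u + s * v)) 0 0.
Proof.
  apply (lsh_plus (fun u _ => u) (fun _ v => s * v)); [apply lsh_1|].
  apply (lsh_mult (fun _ _ => s) (fun _ v => v)); [apply lsh_const|apply lsh_2].
Qed.

Lemma Cmod_uv (u v d : R) : Rabs u < d / 2 -> Rabs v < d / 2 -> Cmod (u, v) < d.
Proof. intros Hu Hv. eapply Rle_lt_trans; [apply Cmod_le_sum|]. change (Rabs u + Rabs v < d). lra. Qed.

(** The centre is any point other than i and -i, not only a real one: a continuation has to be
    real-analytic on a full open set. In the chart, a and b are holomorphic in u + iv and u - iv,
    and Osgood's lemma supplies the double series. *)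
Lemma S2R (G : P1C -> C) Gam q0 d : 0 < d -> q0 <> Some Ci -> q0 <> Some (- Ci) -> lsh Gam (Ac q0) (Bc q0) ->
  (forall q, near2 q0 d q -> G q = Gam (Ac q) (Bc q)) -> ra_at G q0.
Proof.
  intros Hd Hi Hmi HG Hq. destruct q0 as [z|].
  - simpl. assert (N1 : z <> Ci) by congruence. assert (N2 : z <> - Ci) by congruence.
    assert (N1' : z - Ci <> 0) by (apply Cminus_eq_contra; auto).
    assert (N3 : z - - Ci <> 0) by (apply Cminus_eq_contra; auto).
    assert (N2' := conj_ne_i z N2).
    assert (C1 : cct (fun w => / (w - Ci)) z).
    { eapply cd_cct. apply (cd_invf (fun w => w - Ci)); auto. apply cd_minus; [apply cd_id|apply cd_const]. }
    assert (C2 : cct (fun w => / (w - Ci)) (Cconj z)).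
    { eapply cd_cct. apply (cd_invf (fun w => w - Ci)); auto. apply cd_minus; [apply cd_id|apply cd_const]. }
    destruct (C1 d Hd) as [e1 [He1 K1]]. destruct (C2 d Hd) as [e2 [He2 K2]].
    set (e := Rmin (Rmin e1 e2) (Rmin (Cmod (z - Ci)) (Cmod (z - - Ci)))).
    assert (He : 0 < e) by (repeat apply Rmin_case; auto; apply Cmod_gt_0; auto).
    apply (ra_of_lsh G _ (fun u v => Gam (/ (z + (u + Ci * v) - Ci)) (/ (Cconj z + (u + (- Ci) * v) - Ci))) (e / 2)); [lra| |].
    + apply (lsh_comp Gam (fun u v => / (z + (u + Ci * v) - Ci)) (fun u v => / (Cconj z + (u + (- Ci) * v) - Ci))).
      * replace (z + (0 + Ci * 0) - Ci) with (z - Ci) by ring. replace (Cconj z + (0 + - Ci * 0) - Ci) with (Cconj z - Ci) by ring. exact HG.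
      * apply (lsh_inv (fun u v => z + (u + Ci * v) - Ci)); [|apply lsh_lin]. replace (z + (0 + Ci * 0) - Ci) with (z - Ci) by ring. auto.
      * apply (lsh_inv (fun u v => Cconj z + (u + - Ci * v) - Ci)); [|apply lsh_lin]. replace (Cconj z + (0 + - Ci * 0) - Ci) with (Cconj z - Ci) by ring. auto.
    + intros u v Hu Hv. assert (W := Cmod_uv u v e Hu Hv).
      destruct (lt_min W) as [W1 W2].
      assert (S1 : forall x : C, x + (u, v) - x = (u, v)) by (intros; ring).
      rewrite Hq.
      * unfold Ac, Bc. rewrite Cconj_plus, <- uv_conj, pair_eta. f_equal. f_equal. ring.
      * split; [|split; [|split]].
        -- intros E. apply Some_inj in E. assert (A := proj1 (lt_min W2)).
           rewrite <- E, Cmod_sym, S1 in A. lra.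
        -- intros E. apply Some_inj in E. assert (A := proj2 (lt_min W2)).
           rewrite <- E, Cmod_sym, S1 in A. lra.
        -- unfold Ac. apply K1. rewrite S1. exact (proj1 (lt_min W1)).
        -- unfold Bc. apply K2. rewrite Cmod_conj_sub, S1. exact (proj2 (lt_min W1)).
  - simpl. assert (Lp := lbh_psi None).
    destruct (lbh_cct _ _ Lp d Hd) as [e [He K]]. rewrite psi_0 in K. change (tp None) with (RtoC 0) in K.
    set (e' := Rmin e 1). assert (He' : 0 < e') by (apply Rmin_case; lra).
    apply (ra_of_lsh G _ (fun u v => Gam (psi None (u + Ci * v)) (psi None (u + (- Ci) * v))) (e' / 2)); [lra| |].
    + apply (lsh_comp Gam (fun u v => psi None (u + Ci * v)) (fun u v => psi None (u + (- Ci) * v))).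
      * replace (0 + Ci * 0) with (RtoC 0) by ring. replace (0 + - Ci * 0) with (RtoC 0) by ring. rewrite psi_0. exact HG.
      * apply (lsh_comp1 (psi None) (fun u v => u + Ci * v)); [|apply lsh_lin0]. replace (0 + Ci * 0) with (RtoC 0) by ring. auto.
      * apply (lsh_comp1 (psi None) (fun u v => u + - Ci * v)); [|apply lsh_lin0]. replace (0 + - Ci * 0) with (RtoC 0) by ring. auto.
    + intros u v Hu Hv. assert (W := Cmod_uv u v e' Hu Hv).
      destruct (lt_min W) as [W1 W2].
      change (chart_inf (u, v)) with (phi None (u, v)).
      assert (Z : forall x : C, x - 0 = x) by (intros; ring).
      assert (HA : Ac (phi None (u, v)) = psi None (u, v)) by (apply Ac_phi; auto).
      assert (HB : Bc (phi None (u, v)) = psi None (Cconj (u, v))) by (apply Bc_phi; auto).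
      rewrite Hq.
      * rewrite HA, HB, <- uv_conj, pair_eta. f_equal. f_equal. ring.
      * assert (Far : forall x : C, Cmod x = 1%R -> phi None (u, v) <> Some x).
        { intros x Hx E. simpl in E. destruct (C_eq_dec (u, v) 0) as [E0|n].
          - rewrite E0, chart_inf_0 in E. discriminate.
          - rewrite chart_inf_nz in E by auto. apply Some_inj in E.
            assert (A : Cmod (/ (u, v)) = 1%R) by (rewrite <- Hx; f_equal; exact E).
            rewrite Cmod_inv in A by auto. assert (P := proj1 (Cmod_gt_0 _) n).
            assert (B : (Cmod (u, v) * / Cmod (u, v) = 1)%R) by (apply Rinv_r; lra). rewrite A in B. lra. }
        split; [apply Far, Cmod_Ci|]. split; [apply Far; rewrite Cmod_opp; apply Cmod_Ci|].
        change (Ac None) with (RtoC 0). change (Bc None) with (RtoC 0). split.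
        -- rewrite HA. apply K. rewrite Z; auto.
        -- rewrite HB. apply K. rewrite Z, Cmod_conj; auto.
Qed.

(** * The first order expression in b and its relation to r-harmonicity *)

Definition Ef (r : C) (Gam : C -> C -> C) (a b : C) : C := (b - a) * D2 Gam a b + (1 - r) * Gam a b.

Lemma sh_Ef r Gam p q R0 s M : 0 < s < R0 -> sh Gam p q R0 M -> exists M', sh (Ef r Gam) p q s M'.
Proof.
  intros Hs H. destruct (sh_D2 Gam p q R0 s M Hs H) as [M2 H2].
  assert (H0 : sh (fun a b => b - a) p q s (Cmod q + s + (Cmod p + s))%R).
  { intros u v Hu Hv. split; [|split].
    + eexists. apply cd_minus; [apply cd_const|apply cd_id].
    + eexists. apply cd_minus; [apply cd_id|apply cd_const].
    + eapply Rle_trans; [apply Cmod_sub_le|].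
      assert (A := Cmod_rev u p). assert (B := Cmod_rev v q). lra. }
  assert (H1 : sh Gam p q s M) by (apply (sh_shrink Gam p q R0); auto; lra).
  eexists. apply sh_plus; [apply (sh_mult _ _ _ _ _ _ _ H0 H2)|apply (sh_mult _ _ _ _ _ _ _ (sh_const (1 - r) p q s) H1)].
Qed.

Lemma lsh_Ef r Gam p q : lsh Gam p q -> lsh (Ef r Gam) p q.
Proof.
  intros [s [M [Hs H]]]. destruct (sh_Ef r Gam p q s (s / 2) M ltac:(lra) H) as [M' H'].
  exists (s / 2)%R, M'. split; [lra|auto].
Qed.

Lemma lsh_cd1 f a b : lsh f a b -> cd (fun x => f x b) a (D1 f a b).
Proof. intros [r [M [Hr H]]]. eapply sh_cd1; eauto; rewrite Cmod_self; auto. Qed.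

Lemma lsh_cd2 f a b : lsh f a b -> cd (fun y => f a y) b (D2 f a b).
Proof. intros [r [M [Hr H]]]. eapply sh_cd2; eauto; rewrite Cmod_self; auto. Qed.

Lemma cd_Cinv_shift (z : C) : z - Ci <> 0 -> cd (fun z => / (z - Ci)) z (- (/ (z - Ci) * / (z - Ci))).
Proof.
  intros H. eapply cd_val; [|apply (cd_invf (fun z => z - Ci)); [auto|apply cd_minus; [apply cd_id|apply cd_const]]].
  field. auto.
Qed.

Lemma lsh_ab Gam (z zt : C) : z - Ci <> 0 -> zt - Ci <> 0 -> lsh Gam (/ (z - Ci)) (/ (zt - Ci)) ->
  lsh (fun u v => Gam (/ (u - Ci)) (/ (v - Ci))) z zt.
Proof.
  intros H1 H2 HG. apply (lsh_comp Gam (fun u _ => / (u - Ci)) (fun _ v => / (v - Ci))); [exact HG| |].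
  - apply (lsh_inv (fun u _ => u - Ci)); auto. apply (lsh_minus (fun u _ => u) (fun _ _ => Ci)); [apply lsh_1|apply lsh_const].
  - apply (lsh_inv (fun _ v => v - Ci)); auto. apply (lsh_minus (fun _ v => v) (fun _ _ => Ci)); [apply lsh_2|apply lsh_const].
Qed.

Lemma im_sub_conj (z : C) : z - Cconj z = 2 * Ci * RtoC (Im z).
Proof. apply im_alt'. Qed.

(* With Phi(z,zt) = fhat(z,zt) Gam(a,b), a = 1/(z-i), b = 1/(zt-i) and E = (b-a) Gam_b + (1-r) Gam:
   Phi_zt = - fhat b^2/(b-a) E  and  (z-zt) Phi_(z zt) + r Phi_zt = fhat a b E_a. *)
Lemma harm_iff (r : C) (V : C -> Prop) F Fx Fy Fxx Fxy Fyx Fyy Gam (z : C) (d : R) :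
  @open C_UniformSpace V -> V z -> C2_with V F Fx Fy Fxx Fxy Fyx Fyy -> 0 < Im z -> z <> Ci ->
  lsh Gam (Ac (Some z)) (Bc (Some z)) -> 0 < d ->
  (forall w, Cmod (w - z) < d -> F w = f_r r w * Gam (Ac (Some w)) (Bc (Some w))) ->
  (harm_eq r z (Fx z) (Fy z) (Fxx z) (Fxy z) (Fyx z) (Fyy z) <-> D1 (Ef r Gam) (Ac (Some z)) (Bc (Some z)) = 0).
Proof.
  intros HV Hz HC Him Hi HG Hd HF.
  assert (Ni : z - Ci <> 0) by (apply Cminus_eq_contra; auto).
  assert (Nc := conj_sub_i_nz z Him). assert (Nz := conj_sub_nz z Him).
  set (Phi := fun u v => fhat r u v * Gam (/ (u - Ci)) (/ (v - Ci))).
  set (zt := Cconj z) in *.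
  assert (LA : lbh (fun u => / (u - Ci)) z).
  { apply (lbh_of _ z (Cmod (z - Ci))); [apply Cmod_gt_0; auto|]. intros w Hw. eexists. apply cd_Cinv_shift.
    apply (Cmod_lt_nz _ (z - Ci)). replace (w - Ci - (z - Ci)) with (w - z) by ring. auto. }
  assert (LG : lsh (fun u v => Gam (/ (u - Ci)) (/ (v - Ci))) z zt) by (apply lsh_ab; auto).
  assert (LPhi : lsh Phi z zt) by (apply lsh_mult; [apply lsh_fhat; auto|exact LG]).
  destruct LPhi as [s [M [Hs SPhi]]].
  set (s' := Rmin s d). assert (Hs' : 0 < s') by (apply Rmin_case; auto).
  assert (SPhi' : sh Phi z zt s' M) by (apply (sh_shrink Phi z zt s); auto; apply Rmin_l).
  assert (RP : rep F Phi z s').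
  { intros w Hw. rewrite HF; [reflexivity|]. exact (proj2 (lt_min Hw)). }
  rewrite (harm_point V F Fx Fy Fxx Fxy Fyx Fyy Phi z s' M r HV Hz HC Hs' SPhi' RP). fold zt.
  set (b := / (zt - Ci)).
  (* The formula for Phi_zt is needed for all x near z with zt fixed, because it is then
     differentiated in x. There x and zt are no longer conjugate, so the half-plane condition on
     [qf] has to be preserved by continuity. *)
  assert (F1 : exists e, 0 < e /\ forall x, Cmod (x - z) < e ->
     x - Ci <> 0 /\ x - zt <> 0 /\
     D2 Phi x zt = - (fhat r x zt * ((x - Ci) / ((zt - Ci) * (x - zt))) * Ef r Gam (/ (x - Ci)) b)).
  { assert (Cq : cct (fun x => qf x zt) z).
    { eapply cd_cct. unfold qf. apply cd_mult; [apply cd_const|]. apply cd_invf; auto. apply cd_minus; [apply cd_const|apply cd_id]. }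
    destruct (Cq (Re (qf z zt)) (qf_Re z Him)) as [e1 [He1 K1]].
    destruct (lsh_near _ _ _ HG) as [e2 [He2 K2]].
    destruct (lbh_cct _ _ LA e2 He2) as [e3 [He3 K3]].
    assert (Pn : 0 < Cmod (zt - z)) by (apply Cmod_gt_0; auto). assert (Pi : 0 < Cmod (z - Ci)) by (apply Cmod_gt_0; auto).
    exists (Rmin (Rmin e1 e3) (Rmin (Cmod (z - Ci)) (Cmod (zt - z)))). split; [repeat apply Rmin_case; auto|].
    intros x Hx. destruct (lt_min Hx) as [x1 x2].
    destruct (lt_min x1) as [x3 x4].
    destruct (lt_min x2) as [x5 x6].
    assert (N1 : x - Ci <> 0). { apply (Cmod_lt_nz _ (z - Ci)). replace (x - Ci - (z - Ci)) with (x - z) by ring. auto. }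
    assert (N2 : zt - x <> 0). { apply (Cmod_lt_nz _ (zt - z)). replace (zt - x - (zt - z)) with (- (x - z)) by ring. rewrite Cmod_opp; auto. }
    assert (N3 : x - zt <> 0). { intros E. apply N2. replace (zt - x) with (- (x - zt)) by ring. rewrite E. ring. }
    split; [auto|split; [auto|]].
    assert (Hq : 0 < Re (qf x zt)).
    { specialize (K1 x x3). assert (A := Re_le_Cmod (qf x zt - qf z zt)).
      change (Re (qf x zt - qf z zt)) with (Re (qf x zt) - Re (qf z zt))%R in A.
      assert (A2 := Rle_abs (-(Re (qf x zt) - Re (qf z zt)))). rewrite Rabs_Ropp in A2. lra. }
    assert (LGx : lsh Gam (/ (x - Ci)) b).
    { apply K2; [apply K3; auto|]. unfold b, Bc. fold zt. rewrite Cmod_self. auto. }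
    apply Dc_eq. eapply cd_val; [|apply cd_mult].
    2:{ apply fhat_cd2; [|exact Hq]. intros E. apply N2. rewrite E. ring. }
    2:{ apply (cd_comp (fun y => Gam (/ (x - Ci)) y) (fun v => / (v - Ci))); [apply cd_Cinv_shift; auto|]. fold b. apply lsh_cd2. exact LGx. }
    unfold Ef. fold b. set (g := Gam (/ (x - Ci)) b). set (g2 := D2 Gam (/ (x - Ci)) b). unfold b. field. auto. }
  destruct F1 as [e [He F1]].
  destruct (F1 z) as [_ [Nzz E2]]; [rewrite Cmod_self; auto|].
  assert (LE : lsh (Ef r Gam) (/ (z - Ci)) b) by (apply lsh_Ef; exact HG).
  assert (E21 : D1 (D2 Phi) z zt = - (
     (fhat r z zt * (- / (z - Ci) + (r - 1) * / (zt - z)) * ((z - Ci) / ((zt - Ci) * (z - zt))) +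
      fhat r z zt * (/ ((zt - Ci) * (z - zt)) - (z - Ci) / ((zt - Ci) * ((z - zt) * (z - zt))))) * Ef r Gam (/ (z - Ci)) b +
      fhat r z zt * ((z - Ci) / ((zt - Ci) * (z - zt))) * (D1 (Ef r Gam) (/ (z - Ci)) b * (- (/ (z - Ci) * / (z - Ci)))))).
  { apply Dc_eq.
    apply (cd_ext_loc (fun x => - (fhat r x zt * ((x - Ci) / ((zt - Ci) * (x - zt))) * Ef r Gam (/ (x - Ci)) b)) _ z _ e He).
    { intros x Hx. destruct (F1 x Hx) as [_ [_ E]]. auto. }
    apply cd_opp. apply (cd_mult (fun x => fhat r x zt * ((x - Ci) / ((zt - Ci) * (x - zt)))) (fun x => Ef r Gam (/ (x - Ci)) b)).
    - apply (cd_mult (fun x => fhat r x zt) (fun x => (x - Ci) / ((zt - Ci) * (x - zt)))).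
      + apply fhat_cd1; [auto| |apply qf_Re; auto]. intros E. apply Nz. rewrite E. ring.
      + apply cd_val with ((1 - 0) * / ((zt - Ci) * (z - zt)) +
          (z - Ci) * (- ((zt - Ci) * (1 - 0)) / ((zt - Ci) * (z - zt) * ((zt - Ci) * (z - zt))))); [field; auto|].
        apply (cd_mult (fun x => x - Ci) (fun x => / ((zt - Ci) * (x - zt)))).
        * apply cd_minus; [apply cd_id|apply cd_const].
        * apply (cd_invf (fun x => (zt - Ci) * (x - zt))); [apply Cmult_neq_0; auto|].
          apply cd_scal. apply cd_minus; [apply cd_id|apply cd_const].
    - apply (cd_comp (fun x => Ef r Gam x b) (fun v => / (v - Ci))); [apply cd_Cinv_shift; auto|]. apply lsh_cd1. exact LE. }
  assert (I1 : RtoC (-4 * (Im z) ^ 2) = (z - zt) * (z - zt)).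
  { unfold zt. rewrite im_sub_conj. replace (2 * Ci * RtoC (Im z) * (2 * Ci * RtoC (Im z))) with ((Ci * Ci) * 4 * (RtoC (Im z) * RtoC (Im z))) by ring.
    rewrite Ci_sq. rewrite <- !RtoC_mult. f_equal. ring. }
  assert (I2 : 2 * Ci * (r * RtoC (Im z)) = (z - zt) * r) by (unfold zt; rewrite im_sub_conj; ring).
  rewrite I1, I2, E2, E21.
  change (Ac (Some z)) with (/ (z - Ci)). change (Bc (Some z)) with b.
  set (X := D1 (Ef r Gam) (/ (z - Ci)) b). set (Y := Ef r Gam (/ (z - Ci)) b). set (f := fhat r z zt).
  assert (Nf : f <> 0) by (apply fhat_nz; auto).
  (* All terms containing E itself cancel; what remains is E_a times a factor that does not
     vanish. *)
  match goal with |- (?L = RtoC 0 <-> _) => replace L with ((z - zt) * f / ((z - Ci) * (zt - Ci)) * X : C) end.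
  2:{ field. repeat split; auto. }
  split.
  - intros H. replace X with (((z - Ci) * (zt - Ci)) / ((z - zt) * f) * ((z - zt) * f / ((z - Ci) * (zt - Ci)) * X)) by (field; auto).
    rewrite H. ring.
  - intros ->. ring.
Qed.

(** * Uniqueness from the upper half-plane, and the equation near a real point *)

Lemma Im_inv (w : C) : w <> 0 -> Im (/ w) = (- Im w / (Re w ^ 2 + Im w ^ 2))%R.
Proof. intros _. destruct w; reflexivity. Qed.

Lemma phi_far p (w : C) : Cmod w < 1 -> phi p w <> Some Ci /\ phi p w <> Some (- Ci).
Proof.
  intros H. assert (Far : forall x : C, Cmod x = 1%R -> (forall t : R, 1 <= Cmod (RtoC t - x)) -> phi p w <> Some x).
  { intros x Hx Ht E. destruct p as [t|]; simpl in E.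
    - apply Some_inj in E. specialize (Ht t). rewrite <- E in Ht.
      replace (RtoC t - (RtoC t + w)) with (- w) in Ht by ring. rewrite Cmod_opp in Ht. lra.
    - destruct (C_eq_dec w 0) as [E0|n].
      + rewrite E0, chart_inf_0 in E. discriminate.
      + rewrite chart_inf_nz in E by auto. apply Some_inj in E. rewrite <- E, Cmod_inv in Hx by auto.
        assert (P := proj1 (Cmod_gt_0 _) n).
        assert (B : (Cmod w * / Cmod w = 1)%R) by (apply Rinv_r; lra). rewrite Hx in B. lra. }
  split; apply Far.
  - apply Cmod_Ci.
  - apply t_sub_i.
  - rewrite Cmod_opp; apply Cmod_Ci.
  - intros t. replace (RtoC t - - Ci) with (- (RtoC (- t) - Ci)) by (rewrite RtoC_opp; ring). rewrite Cmod_opp. apply t_sub_i.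
Qed.

Lemma Nb_phi p d : 0 < d -> exists e, 0 < e /\ e <= 1 /\ forall w, Cmod w < e -> Nb p d (phi p w).
Proof.
  intros Hd. destruct (lbh_cct _ _ (lbh_psi p) d Hd) as [e [He K]]. rewrite psi_0 in K.
  exists (Rmin e 1). split; [apply Rmin_case; lra|]. split; [apply Rmin_r|]. intros w Hw.
  destruct (lt_min Hw) as [w1 w2].
  destruct (phi_far p w w2) as [F1 F2]. assert (Z : forall x : C, x - 0 = x) by (intros; ring).
  split; [auto|split; [auto|]]. rewrite Ac_phi, Bc_phi by auto. split; apply K; rewrite Z; auto. rewrite Cmod_conj; auto.
Qed.

(** The side of the real axis that corresponds to the upper half-plane in the chart at p: w = 1/z
    exchanges the half-planes. *)
Definition sgp (p : P1R) : R := match p with Some _ => 1 | None => -1 end.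

Lemma sgp_sq p : (sgp p * sgp p = 1)%R.
Proof. destruct p; simpl; ring. Qed.

Lemma Rabs_sgp p : Rabs (sgp p) = 1%R.
Proof. destruct p; simpl; [apply Rabs_R1|rewrite Rabs_left; lra]. Qed.

Lemma phi_Im p (u v : R) : 0 < sgp p * v -> exists z, phi p (u, v) = Some z /\ 0 < Im z.
Proof.
  intros Hv. destruct p as [t|]; unfold sgp in Hv.
  - exists (RtoC t + (u, v)). split; [reflexivity|]. change (0 < 0 + v). lra.
  - assert (n : ((u, v) : C) <> 0). { intros E. injection E as E1 E2. lra. }
    exists (/ (u, v)). split; [apply chart_inf_nz; auto|]. rewrite Im_inv by auto.
    change (Im (u, v)) with v. change (Re (u, v)) with u. apply Rdiv_lt_0_compat; [lra|]. nra.
Qed.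

(* The points (a(z), b(z)) with z in the upper half-plane form a set of uniqueness. *)
Lemma totally_real_zero e p d : lsh e (tp p) (tp p) -> 0 < d ->
  (forall z, Nb p d (Some z) -> 0 < Im z -> e (Ac (Some z)) (Bc (Some z)) = 0) ->
  exists d', 0 < d' /\ forall a b, Cmod (a - tp p) < d' -> Cmod (b - tp p) < d' -> e a b = 0.
Proof.
  intros Le Hd He.
  (* In the chart coordinates, now complex, g vanishes for real u and real v of one sign. The
     identity theorem frees first u, then v. *)
  set (g := fun u v => e (psi p (u + Ci * v)) (psi p (u + (- Ci) * v))).
  assert (Z0 : 0 + Ci * 0 = 0) by ring. assert (Z1 : 0 + - Ci * 0 = 0) by ring.
  assert (Lg : lsh g 0 0).
  { apply (lsh_comp e (fun u v => psi p (u + Ci * v)) (fun u v => psi p (u + (- Ci) * v))).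
    - rewrite Z0, Z1, psi_0. exact Le.
    - apply (lsh_comp1 (psi p) (fun u v => u + Ci * v)); [rewrite Z0; apply lbh_psi|apply lsh_lin0].
    - apply (lsh_comp1 (psi p) (fun u v => u + - Ci * v)); [rewrite Z1; apply lbh_psi|apply lsh_lin0]. }
  destruct Lg as [s0 [M [Hs0 Sg0]]].
  destruct (Nb_phi p d Hd) as [e1 [He1 [He1' K1]]].
  set (s := Rmin s0 (e1 / 2)). assert (Hs : 0 < s) by (apply Rmin_case; lra).
  assert (Sg : sh g 0 0 s M) by (apply (sh_shrink g 0 0 s0); auto; apply Rmin_l).
  assert (s1 : s <= e1 / 2) by apply Rmin_r.
  assert (Z : forall x : C, x - 0 = x) by (intros; ring).
  assert (G1 : forall u v : R, Rabs u < s -> Rabs v < s -> 0 < sgp p * v -> g u v = 0).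
  { intros u v Hu Hv Hsv. destruct (phi_Im p u v Hsv) as [z [Ez Hz]].
    assert (W : Cmod (u, v) < e1) by (apply Cmod_uv; lra).
    assert (N := K1 _ W). rewrite Ez in N. specialize (He z N Hz). rewrite <- Ez in He.
    rewrite Ac_phi, Bc_phi in He by lra. unfold g.
    replace (RtoC u + - Ci * RtoC v) with (Cconj (u, v)) by (rewrite conj_pair; ring).
    rewrite <- pair_eta. exact He. }
  assert (G2 : forall (u : C) (v : R), Cmod u < s -> Rabs v < s -> 0 < sgp p * v -> g u v = 0).
  { intros u v Hu Hv Hsv. apply (identity_thm (fun x => g x v) 0 s M); [apply (sh_bh1 g 0 0 s M v Sg); rewrite Z, Cmod_R; auto| |rewrite Z; auto].
    intros ep Hep. set (x := (Rmin ep s / 2)%R). assert (P : 0 < Rmin ep s) by (apply Rmin_case; auto).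
    assert (x1 := Rmin_l ep s). assert (x2 := Rmin_r ep s).
    assert (Cx : Cmod (RtoC x) = x) by (rewrite Cmod_R, Rabs_pos_eq; unfold x; lra).
    exists (RtoC x). split; [apply Cmod_gt_0; rewrite Cx; unfold x; lra|]. rewrite Z, Cx. split; [unfold x; lra|].
    apply G1; auto. rewrite Rabs_pos_eq; unfold x; lra. }
  assert (G3 : forall (u v : C), Cmod u < s -> Cmod v < s -> g u v = 0).
  { intros u v Hu Hv. apply (identity_thm (fun y => g u y) 0 s M); [apply (sh_bh2 g 0 0 s M u Sg); rewrite Z; auto| |rewrite Z; auto].
    intros ep Hep. set (x := (Rmin ep s / 2)%R). assert (P : 0 < Rmin ep s) by (apply Rmin_case; auto).
    assert (x1 := Rmin_l ep s). assert (x2 := Rmin_r ep s).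
    assert (Cx : Rabs (sgp p * x) = x) by (rewrite Rabs_mult, Rabs_sgp, Rabs_pos_eq; unfold x; lra).
    exists (RtoC (sgp p * x)). split; [apply Cmod_gt_0; rewrite Cmod_R, Cx; unfold x; lra|]. rewrite Z, Cmod_R, Cx. split; [unfold x; lra|].
    apply G2; auto; [rewrite Cx; unfold x; lra|]. rewrite <- Rmult_assoc, sgp_sq. unfold x; lra. }
  destruct (lbh_cct _ _ (lbh_chi p) (s / 2)%R ltac:(lra)) as [d1 [Hd1 Kc]]. rewrite chi_tp in Kc.
  exists (Rmin d1 (rtp p)). split; [apply Rmin_case; [auto|apply rtp_pos]|]. intros a b Ha Hb.
  destruct (lt_min Ha) as [a1 a2].
  destruct (lt_min Hb) as [b1 b2].
  assert (A := Kc a a1). assert (B := Kc b b1). rewrite Z in A, B.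
  set (x := chi p a) in *. set (y := chi p b) in *.
  assert (E : g ((x + y) / 2) ((x - y) / (2 * Ci)) = 0).
  { assert (C2 : Cmod 2 = 2%R) by (rewrite Cmod_R, Rabs_pos_eq; lra).
    apply G3.
    - rewrite Cmod_div, C2 by apply two_nz. assert (T := Cmod_triangle x y). lra.
    - rewrite Cmod_div, Cmod_mult, C2, Cmod_Ci by (apply Cmult_neq_0; [apply two_nz|apply Ci_nz]). assert (T := Cmod_sub_le x y). lra. }
  unfold g in E.
  replace ((x + y) / 2 + Ci * ((x - y) / (2 * Ci))) with x in E by (field; apply Ci_nz).
  replace ((x + y) / 2 + - Ci * ((x - y) / (2 * Ci))) with y in E by (field; apply Ci_nz).
  unfold x, y in E. rewrite !psi_chi in E by auto. exact E.
Qed.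

Lemma const_of_Dc0 (f : C -> C) a R0 M : bh f a R0 M -> (forall z, Cmod (z - a) < R0 -> Dc f z = 0) ->
  forall z, Cmod (z - a) < R0 -> f z = f a.
Proof.
  intros Hf HD z Hz. assert (Z0 := Cmod_ge_0 (z - a)). set (r := ((Cmod (z - a) + R0) / 2)%R).
  destruct (Tc_spec f a R0 r M ltac:(unfold r; lra) Hf) as [Hc Hp]. set (c := Tc f a) in *.
  assert (Hr : 0 < r) by (unfold r; lra).
  destruct (dcoef_cbd c (2 * M) r (r / 2) ltac:(lra) Hc) as [M' Hd].
  assert (D0 : forall n, dcoef c n = 0).
  { apply (ps_zero (dcoef c) M' (r / 2)); auto; [lra|]. intros e He.
    destruct (real_small (Rmin e r)) as [w [W0 W1]]; [apply Rmin_case; auto|].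
    destruct (lt_min W1) as [w1 w2].
    exists w. split; [auto|split; [auto|]]. assert (E : a + w - a = w) by ring.
    rewrite <- E at 1. rewrite <- (HD (a + w)); [|rewrite E; unfold r in w2; lra].
    symmetry. apply Dc_eq. apply (cd_ps_at f a c (2 * M) r); auto. rewrite E; auto. }
  assert (C0 : forall n, c (S n) = 0).
  { intros n. specialize (D0 n). unfold dcoef in D0.
    assert (N : RtoC (INR (S n)) <> 0) by (intros E; apply RtoC_inj in E; apply (not_0_INR (S n)); auto).
    replace (c (S n)) with (/ RtoC (INR (S n)) * (RtoC (INR (S n)) * c (S n))) by (field; auto). rewrite D0. ring. }
  assert (V : forall w, Cmod (w - a) < r -> f w = c O).
  { intros w Hw. rewrite Hp by auto. rewrite (ps_shift c (2 * M) r) by auto.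
    rewrite (ps_null (fun k => c (S k))) by auto. ring. }
  rewrite !V; auto; [rewrite Cmod_self; auto|unfold r; lra].
Qed.

(** Harmonicity gives E_a = 0 at the points of the upper half-plane, hence on a full bidisc by
    [totally_real_zero]. So E(a, b) = E(b, b), where the term with b - a disappears. *)
Lemma structure_thm (r : C) (U : P1C -> Prop) F G p : open_P1C U -> U (P1R_to_P1C p) ->
  r_harmonic r (UH U) F -> continuation r U F G ->
  exists Gam d M, 0 < d /\ sh Gam (tp p) (tp p) d M /\ repG G Gam p d /\ (forall q, Nb p d q -> U q) /\
    forall a b, Cmod (a - tp p) < d -> Cmod (b - tp p) < d -> Ef r Gam a b = (1 - r) * Gam b b.
Proof.
  intros HO HU [HV [_ [Fx [Fy [Fxx [Fxy [Fyx [Fyy [HC HP]]]]]]]]] [HR HG].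
  destruct (R2S U G p HR HU) as [Gam [d0 [Hd0 [LG HGam]]]].
  destruct LG as [s [M [Hs SG]]].
  destruct (Nb_small U p HO HU) as [d1 [Hd1 K1]].
  set (d := Rmin (s / 4) (Rmin d0 d1)). assert (Hd : 0 < d) by (repeat apply Rmin_case; lra).
  assert (ds : d <= s / 4) by apply Rmin_l. assert (d' : d <= Rmin d0 d1) by apply Rmin_r.
  assert (dd0 := Rle_trans _ _ _ d' (Rmin_l _ _)). assert (dd1 := Rle_trans _ _ _ d' (Rmin_r _ _)).
  destruct (sh_Ef r Gam _ _ s (s / 2) M ltac:(lra) SG) as [ME SE].
  assert (LD : lsh (D1 (Ef r Gam)) (tp p) (tp p)).
  { destruct (sh_D1 (Ef r Gam) (tp p) (tp p) (s / 2) (s / 4) ME ltac:(lra) SE) as [M1 H1].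
    exists (s / 4)%R, M1. split; [lra|auto]. }
  destruct (totally_real_zero (D1 (Ef r Gam)) p d LD Hd) as [d2 [Hd2 K2]].
  { intros z Nz Hz.
    assert (Uz : UH U z) by (split; auto; apply K1; apply (Nb_mono p d); auto).
    assert (Zi : z <> Ci) by (intros ->; apply (proj1 Nz); auto).
    destruct (proj1 (open_C _) (proj1 (Nb_open p d)) z Nz) as [e1 [He1 L1]].
    destruct (proj1 (open_C _) HV z Uz) as [e2 [He2 L2]].
    apply (harm_iff r (UH U) F Fx Fy Fxx Fxy Fyx Fyy Gam z (Rmin e1 e2)); auto.
    - exists (s / 2)%R, M. split; [lra|]. destruct Nz as [_ [_ [Na Nb']]]. apply (sh_recenter Gam (tp p) (tp p) s M); auto; lra.
    - apply Rmin_case; auto.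
    - intros w Hw. destruct (lt_min Hw) as [w1 w2].
      assert (Nw := L1 w w1). assert (Uw := L2 w w2).
      assert (Wi : w <> Ci) by (intros ->; apply (proj1 Nw); auto).
      rewrite <- (HGam (Some w)) by (apply (Nb_mono p d); auto).
      rewrite HG by auto. field. apply f_r_nz; auto.
    - apply (HP z Uz). }
  set (d3 := Rmin d d2). assert (Hd3 : 0 < d3) by (apply Rmin_case; auto).
  assert (dd2 : d3 <= d) by apply Rmin_l. assert (dd3 : d3 <= d2) by apply Rmin_r.
  exists Gam, d3, M. split; [auto|]. split; [apply (sh_shrink Gam _ _ s); auto; lra|].
  split; [intros q Hq; apply HGam; apply (Nb_mono p d3); auto; lra|].
  split; [intros q Hq; apply K1; apply (Nb_mono p d3); auto; lra|].
  intros a b Ha Hb.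
  assert (BE : bh (fun x => Ef r Gam x b) (tp p) d3 ME).
  { apply (sh_bh1 (Ef r Gam) (tp p) (tp p) d3 ME b); auto. apply (sh_shrink _ _ _ (s / 2)); auto; lra. }
  assert (Cst : forall x, Cmod (x - tp p) < d3 -> Ef r Gam x b = Ef r Gam (tp p) b).
  { apply (const_of_Dc0 (fun x => Ef r Gam x b) (tp p) d3 ME BE). intros z Hz. apply (K2 z b); lra. }
  rewrite (Cst a Ha), <- (Cst b Hb). unfold Ef. ring.
Qed.

(** * Holomorphy on the sphere in the coordinate a *)

(** The inverse of the coordinate [Ac] on the sphere without i. *)
Definition pt (a : C) : P1C := if C_eq_dec a 0 then None else Some (Ci + / a).

Lemma Ac_pt a : Ac (pt a) = a.
Proof.
  unfold pt. destruct (C_eq_dec a 0) as [->|n]; [reflexivity|]. simpl.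
  replace (Ci + / a - Ci) with (/ a) by ring. field. auto.
Qed.

Lemma Cinv_nz (a : C) : a <> 0 -> / a <> 0.
Proof. intros H E. apply C1_nz. rewrite <- (Cinv_r a H), E. ring. Qed.

Lemma pt_ne_i a : pt a <> Some Ci.
Proof.
  unfold pt. destruct (C_eq_dec a 0) as [->|n]; [discriminate|]. intros E. apply Some_inj in E.
  apply (Cinv_nz a n). replace (/ a) with (Ci + / a - Ci) by ring. rewrite E. ring.
Qed.

Lemma pt_Ac q : q <> Some Ci -> pt (Ac q) = q.
Proof.
  intros H. unfold pt. destruct q as [z|]; unfold Ac.
  - assert (N : z - Ci <> 0) by (apply Cminus_eq_contra; congruence).
    destruct (C_eq_dec (/ (z - Ci)) 0) as [E|_]; [exfalso; apply (Cinv_nz _ N E)|].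
    apply (f_equal (@Some C)). field. auto.
  - destruct (C_eq_dec 0 0); [reflexivity|contradiction].
Qed.

Definition hol_at (h : P1C -> C) (q : P1C) : Prop :=
  match q with
  | Some z => @ex_derive C_AbsRing C_NormedModule (fun w => h (Some w)) z
  | None => @ex_derive C_AbsRing C_NormedModule (fun w => h (chart_inf w)) (RtoC 0)
  end.

Lemma holo_P1_at U h : holo_P1 U h <-> forall q, U q -> hol_at h q.
Proof.
  split.
  - intros [H1 H2] [z|] Hq; [apply H1|apply H2]; auto.
  - intros H. split; [intros z Hz; apply (H (Some z) Hz)|intros Hz; apply (H None Hz)].
Qed.

Lemma holo_phi U h p : open_P1C U -> holo_P1 U h -> U (P1R_to_P1C p) -> lbh (fun w => h (phi p w)) 0.
Proof.
  intros HO HH HU. destruct (open_phi U p HO HU) as [d [Hd K]].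
  apply (lbh_of _ 0 d Hd). intros w Hw. replace (w - 0) with w in Hw by ring. specialize (K w Hw).
  destruct p as [t|].
  - destruct HH as [H1 _]. simpl in K. destruct (proj1 (ex_derive_cd _ _) (H1 _ K)) as [l Hl].
    exists (l * (0 + 1)). apply (cd_comp (fun z => h (Some z)) (fun w => RtoC t + w)); auto. apply cd_plus; [apply cd_const|apply cd_id].
  - destruct HH as [H1 H2]. destruct (C_eq_dec w 0) as [->|n].
    + apply ex_derive_cd, H2. exact HU.
    + change (U (chart_inf w)) in K. rewrite chart_inf_nz in K by auto.
      destruct (proj1 (ex_derive_cd _ _) (H1 _ K)) as [l Hl].
      exists (l * - / (w * w)). apply (cd_ext_loc (fun w => h (Some (/ w))) _ w _ (Cmod w)).
      * apply Cmod_gt_0; auto.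
      * intros x Hx. simpl. rewrite chart_inf_nz; [reflexivity|]. apply (Cmod_lt_nz _ _ Hx).
      * apply (cd_comp (fun z => h (Some z)) Cinv); auto. apply cd_inv; auto.
Qed.

Lemma lbh_comp f g a : lbh f (g a) -> lbh g a -> lbh (fun x => f (g x)) a.
Proof.
  intros [r [M [Hr Hf]]] Hg. destruct (lbh_cct _ _ Hg r Hr) as [d [Hd K]]. destruct Hg as [s [N [Hs Hg]]].
  apply (lbh_of _ a (Rmin d s)); [apply Rmin_case; auto|]. intros z Hz.
  destruct (Hf (g z)) as [[l Hl] _]; [apply K; exact (proj1 (lt_min Hz))|].
  destruct (Hg z (proj2 (lt_min Hz))) as [[m Hm] _].
  eexists. apply (cd_comp f g); eauto.
Qed.

Lemma lbh_ext_loc f g a (d : R) : 0 < d -> (forall x, Cmod (x - a) < d -> f x = g x) -> lbh f a -> lbh g a.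
Proof.
  intros Hd E [r [M [Hr H]]]. apply (lbh_of _ a (Rmin d r)); [apply Rmin_case; auto|].
  intros z Hz. destruct (lt_min Hz) as [z1 z2].
  destruct (H z z2) as [[l Hl] _]. exists l. apply (cd_ext_loc f g z l (d - Cmod (z - a))); auto; [lra|].
  intros w Hw. apply E. assert (A := Cmod_tri3 w z a). lra.
Qed.

Lemma holo_eta U h p : open_P1C U -> holo_P1 U h -> U (P1R_to_P1C p) -> lbh (fun a => h (pt a)) (tp p).
Proof.
  intros HO HH HU. apply (lbh_ext_loc (fun a => h (phi p (chi p a))) _ _ (rtp p) (rtp_pos p)).
  - intros a Ha. f_equal. rewrite <- (Ac_pt a) at 1. apply phi_chi; [apply pt_ne_i|rewrite Ac_pt; auto].
  - apply (lbh_comp (fun w => h (phi p w)) (chi p)); [|apply lbh_chi]. rewrite chi_tp. apply (holo_phi U); auto.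
Qed.

(** The converse of [holo_eta]; on V the point i is avoided, so that a is a genuine coordinate. *)
Lemma holo_at_of_eta (V : P1C -> Prop) (h : P1C -> C) (eta : C -> C) q : open_P1C V -> V q ->
  (forall q', V q' -> q' <> Some Ci) -> (forall q', V q' -> h q' = eta (Ac q')) -> (exists l, cd eta (Ac q) l) -> hol_at h q.
Proof.
  intros HO Hq Hi E [l Hl]. assert (qi := Hi q Hq). destruct q as [z|]; simpl.
  - apply ex_derive_cd. destruct (proj1 (open_C _) (proj1 HO) z Hq) as [d [Hd K]].
    assert (N : z - Ci <> 0) by (apply Cminus_eq_contra; congruence).
    eexists. apply (cd_ext_loc (fun w => eta (/ (w - Ci))) _ z _ d Hd).
    + intros w Hw. rewrite E by (apply K; auto). reflexivity.
    + apply (cd_comp eta (fun w => / (w - Ci))); [apply cd_Cinv_shift; auto|exact Hl].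
  - apply ex_derive_cd. destruct (open_phi V None HO Hq) as [d [Hd K]].
    destruct (lbh_psi None) as [s [M [Hs HP]]]. destruct (HP 0) as [[m Hm] _]; [rewrite Cmod_self; auto|].
    eexists. apply (cd_ext_loc (fun w => eta (psi None w)) _ 0 _ (Rmin d 1)); [apply Rmin_case; lra| |].
    + intros w Hw. replace (w - 0) with w in Hw by ring.
      change (chart_inf w) with (phi None w). rewrite E by (apply K; exact (proj1 (lt_min Hw))).
      rewrite Ac_phi; [reflexivity|exact (proj2 (lt_min Hw))].
    + apply (cd_comp eta (psi None)); [exact Hm|]. rewrite psi_0. exact Hl.
Qed.

(** * The Euler-type equation (b - a) y' + s y = H in terms of Taylor coefficients *)

Lemma cbd_euler c M r r' : 0 < r' < r -> cbd c M r -> exists M', cbd (fun k => RtoC (INR k) * c k) M' r'.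
Proof.
  intros Hr Hc. destruct (dcoef_cbd c M r r' Hr Hc) as [M' H]. assert (HM := cbd_nonneg _ _ _ H).
  exists (M' * r')%R. intros [|k].
  - replace (RtoC (INR 0) * c O) with (RtoC 0) by (simpl; ring). rewrite Cmod_0. simpl. unfold Rdiv. rewrite Rinv_1. nra.
  - eapply Rle_trans; [apply (H k)|]. right. simpl. field. split; [apply pow_nonzero; lra|lra].
Qed.

(** The operator w d/dw multiplies w^k by k, so the equation becomes diagonal in the
    coefficients. *)
Lemma ode_ps c M r r' (s w : C) : 0 < r' < r -> cbd c M r -> Cmod w < r' ->
  w * ps (dcoef c) w + s * ps c w = ps (fun k => (RtoC (INR k) + s) * c k) w.
Proof.
  intros Hr Hc Hw. destruct (cbd_euler c M r r' Hr Hc) as [M' H].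
  assert (Hc' : cbd c M r') by (apply (cbd_shrink c M r); auto; lra).
  assert (E1 : w * ps (dcoef c) w = ps (fun k => RtoC (INR k) * c k) w).
  { rewrite (ps_shift (fun k => RtoC (INR k) * c k) M' r' w) by (auto; lra). unfold dcoef. change (INR 0) with 0%R. ring. }
  rewrite E1, <- (ps_scal s c M r' w) by (auto; lra).
  rewrite <- (ps_plus _ _ M' (Cmod s * M) r' w); [|lra|auto|apply cbd_scal; auto|auto].
  f_equal. apply functional_extensionality. intros k. ring.
Qed.

Lemma ode_coef (y H : C -> C) (a s : C) (R0 M N : R) : 0 < R0 -> bh y a R0 M -> bh H a R0 N ->
  (forall b, Cmod (b - a) < R0 -> (b - a) * Dc y b + s * y b = H b) ->
  forall k, (RtoC (INR k) + s) * Tc y a k = Tc H a k.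
Proof.
  intros HR Hy HH E.
  destruct (Tc_spec y a R0 (R0 / 2) M ltac:(lra) Hy) as [C1 P1]. destruct (Tc_spec H a R0 (R0 / 2) N ltac:(lra) HH) as [C2 P2].
  set (c := Tc y a) in *. set (hc := Tc H a) in *.
  destruct (cbd_euler c _ (R0 / 2) (R0 / 4) ltac:(lra) C1) as [M' H'].
  assert (C1' : cbd c (2 * M) (R0 / 4)) by (apply (cbd_shrink c _ (R0 / 2)); auto; lra).
  assert (C3 : cbd (fun k => (RtoC (INR k) + s) * c k) (M' + Cmod s * (2 * M)) (R0 / 4)).
  { assert (A := cbd_plus _ _ _ _ _ H' (cbd_scal s _ _ _ C1')). intros k. specialize (A k).
    replace ((RtoC (INR k) + s) * c k) with (RtoC (INR k) * c k + s * c k) by ring. exact A. }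
  apply (ps_unique (fun k => (RtoC (INR k) + s) * c k) hc (M' + Cmod s * (2 * M)) (2 * N) (R0 / 4) (R0 / 2)); auto; try lra.
  intros e He. destruct (real_small (Rmin e (R0 / 4))) as [w [W0 W1]]; [apply Rmin_case; lra|].
  destruct (lt_min W1) as [w1 w2].
  exists w. split; [auto|split; [auto|]]. assert (Ew : a + w - a = w) by ring.
  rewrite <- (ode_ps c (2 * M) (R0 / 2) (R0 / 4) s w) by (auto; lra).
  rewrite <- Ew at 4. rewrite <- P2 by (rewrite Ew; lra). rewrite <- E by (rewrite Ew; lra).
  rewrite Ew, P1, Ew by (rewrite Ew; lra). f_equal. f_equal. symmetry. apply Dc_eq.
  rewrite <- Ew at 2. apply (cd_ps_at y a c (2 * M) (R0 / 2)); auto; [lra|]. rewrite Ew; lra.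
Qed.

Lemma Tc_zero (a : C) : forall k, Tc (fun _ => 0) a k = 0.
Proof.
  intros k. rewrite (Tc_eq (fun _ => 0) a (fun _ => 0) 0 1); auto; [lra| |].
  - intros n. rewrite Cmod_0. unfold Rdiv. lra.
  - intros w _. symmetry. apply ps_null. auto.
Qed.

Lemma bh_zero a r : bh (fun _ => 0) a r 0.
Proof. intros z _. split; [exists 0; apply cd_const|rewrite Cmod_0; lra]. Qed.

Lemma Tc_0 (f : C -> C) a R0 M : 0 < R0 -> bh f a R0 M -> Tc f a 0%nat = f a.
Proof.
  intros HR Hf. destruct (Tc_spec f a R0 (R0 / 2) M ltac:(lra) Hf) as [H1 H2].
  rewrite (H2 a) by (rewrite Cmod_self; lra). rewrite sub_self. symmetry. apply (ps_at0 _ (2 * M) (R0 / 2)); auto. lra.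
Qed.

Lemma ps_single (c : nat -> C) (n : nat) : (forall k, k <> n -> c k = 0) -> forall M r w, 0 < r -> cbd c M r -> Cmod w < r -> ps c w = c n * w ^ n.
Proof.
  revert c. induction n as [|n IH]; intros c H M r w Hr Hc Hw; rewrite (ps_shift c M r) by auto.
  - rewrite (ps_null (fun k => c (S k))) by (intros; apply H; lia). simpl. ring.
  - rewrite (H O) by lia.
    assert (E : ps (fun k => c (S k)) w = c (S n) * w ^ n).
    { assert (HH : forall k, k <> n -> c (S k) = 0) by (intros k Hk; apply H; lia).
      exact (IH (fun k => c (S k)) HH _ r w Hr (cbd_shift c M r Hr Hc) Hw). }
    rewrite E. simpl. ring.
Qed.

(** The coefficients satisfy (k - n) y_k = 0, so only k = n survives. *)
Lemma ode_power (y : C -> C) (a : C) (R0 M : R) (n : nat) : 0 < R0 -> bh y a R0 M ->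
  (forall b, Cmod (b - a) < R0 -> (b - a) * Dc y b + (- RtoC (INR n)) * y b = 0) ->
  forall b, Cmod (b - a) < R0 -> y b = Tc y a n * (b - a) ^ n.
Proof.
  intros HR Hy E b Hb.
  assert (A := ode_coef y (fun _ => 0) a (- RtoC (INR n)) R0 M 0 HR Hy (bh_zero a R0) E).
  assert (B0 := Cmod_ge_0 (b - a)).
  destruct (Tc_spec y a R0 ((Cmod (b - a) + R0) / 2) M ltac:(lra) Hy) as [H1 H2].
  rewrite H2 by lra. apply (ps_single (Tc y a) n) with (M := (2 * M)%R) (r := ((Cmod (b - a) + R0) / 2)%R); auto; try lra.
  intros k Hk. specialize (A k). rewrite Tc_zero in A.
  assert (N : RtoC (INR k) + - RtoC (INR n) <> 0).
  { intros F. apply Hk. apply INR_eq. apply RtoC_inj. apply Ceq_minus. exact F. }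
  replace (Tc y a k) with (/ (RtoC (INR k) + - RtoC (INR n)) * ((RtoC (INR k) + - RtoC (INR n)) * Tc y a k)) by (field; auto).
  rewrite A. ring.
Qed.

Lemma power_sol Gam (c : C) (d M : R) (n : nat) : 0 < d -> sh Gam c c d M ->
  (forall a b, Cmod (a - c) < d -> Cmod (b - c) < d -> (b - a) * D2 Gam a b = RtoC (INR n) * Gam a b) ->
  exists df d', 0 < d' /\ lbh df c /\ forall a b, Cmod (a - c) < d' -> Cmod (b - c) < d' -> Gam a b = df a * (b - a) ^ n.
Proof.
  intros Hd HG E.
  (* Evaluation at the fixed point b1 exhibits the coefficient of (b - a)^n as a holomorphic function of a. *)
  set (b1 := c + RtoC (d / 4)).
  assert (B1 : Cmod (b1 - c) = (d / 4)%R).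
  { unfold b1. replace (c + RtoC (d / 4) - c) with (RtoC (d / 4)) by ring. rewrite Cmod_R, Rabs_pos_eq; lra. }
  assert (Nz : forall a, Cmod (a - c) < d / 4 -> b1 - a <> 0).
  { intros a Ha E0. apply Ceq_minus in E0. rewrite <- E0 in Ha. lra. }
  exists (fun a => Gam a b1 / (b1 - a) ^ n), (d / 4)%R. split; [lra|]. split.
  - apply (lbh_of _ c (d / 4)); [lra|]. intros a Ha.
    destruct (HG a b1 ltac:(lra) ltac:(lra)) as [[l Hl] _].
    eexists. apply (cd_mult (fun a => Gam a b1) (fun a => / (b1 - a) ^ n)); [exact Hl|].
    apply (cd_invf (fun a => (b1 - a) ^ n)); [apply Cpow_nz; auto|].
    apply (cd_comp (fun w => w ^ n) (fun a => b1 - a)); [apply cd_minus; [apply cd_const|apply cd_id]|apply cd_pow].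
  - intros a b Ha Hb.
    assert (Hy : bh (fun y => Gam a y) a (d / 2) M).
    { intros z Hz. destruct (HG a z ltac:(lra)) as [_ [H1 H2]]; [|auto]. assert (A := Cmod_tri3 z a c). lra. }
    assert (P := ode_power (fun y => Gam a y) a (d / 2) M n ltac:(lra) Hy).
    assert (Q : forall b, Cmod (b - a) < d / 2 -> Gam a b = Tc (fun y => Gam a y) a n * (b - a) ^ n).
    { apply P. intros y Hy'. change (Dc (fun y => Gam a y) y) with (D2 Gam a y).
      rewrite E; [ring|lra|]. assert (A := Cmod_tri3 y a c). lra. }
    rewrite (Q b), (Q b1).
    + field. apply Cpow_nz; auto.
    + assert (A := Cmod_tri3 b1 c a). rewrite (Cmod_sym c a) in A. lra.
    + assert (A := Cmod_tri3 b c a). rewrite (Cmod_sym c a) in A. lra.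
Qed.

(** * Solving the boundary value problem *)

(* For k + 1 = r the value 0 is arbitrary: the coefficient it multiplies is assumed to vanish. *)
Definition kap (r : C) (k : nat) : C :=
  if Nat.eq_dec k 0 then 1 else if C_eq_dec (RtoC (INR k) + (1 - r)) 0 then 0 else (1 - r) / (RtoC (INR k) + (1 - r)).

Lemma finite_bound (f : nat -> R) (N : nat) : exists K, forall k, (k < N)%nat -> (f k <= K)%R.
Proof.
  induction N as [|N [K HK]]; [exists 0%R; lia|]. exists (Rmax K (f N)). intros k Hk.
  destruct (Nat.eq_dec k N) as [->|n]; [apply Rmax_r|]. eapply Rle_trans; [apply HK; lia|apply Rmax_l].
Qed.

(** For large k the denominator has modulus at least 1; the finitely many other values are bounded
    separately. Hence multiplication by [kap] keeps the radius of convergence. *)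
Lemma kap_bound r : exists K, 0 < K /\ forall k, Cmod (kap r k) <= K.
Proof.
  destruct (INR_unbounded (Cmod (1 - r) + 1)) as [N HN].
  destruct (finite_bound (fun k => Cmod (kap r k)) N) as [K HK].
  assert (R0 := Cmod_ge_0 (1 - r)). assert (KA := Rle_abs K). assert (KB := Rabs_pos K).
  exists (Rabs K + Cmod (1 - r) + 1)%R. split; [lra|]. intros k.
  destruct (Compare_dec.le_lt_dec N k) as [L|L]; [|specialize (HK k L); lra].
  unfold kap. destruct (Nat.eq_dec k 0); [rewrite Cmod_1; lra|].
  destruct (C_eq_dec (RtoC (INR k) + (1 - r)) 0) as [E|E]; [rewrite Cmod_0; lra|].
  assert (G : (INR N <= INR k)%R) by (apply le_INR; auto).
  assert (P : 1 <= Cmod (RtoC (INR k) + (1 - r))).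
  { assert (A := Cmod_rev (RtoC (INR k)) (- (1 - r))). rewrite Cmod_opp, Cmod_R, Rabs_pos_eq in A by apply pos_INR.
    replace (RtoC (INR k) - - (1 - r)) with (RtoC (INR k) + (1 - r)) in A by ring. lra. }
  rewrite Cmod_div by auto. apply Rle_trans with (Cmod (1 - r) / 1)%R; [|unfold Rdiv; rewrite Rinv_1; lra].
  apply Rmult_le_compat_l; [lra|]. apply Rinv_le_contravar; lra.
Qed.

(** The solution G with diagonal value eta, expanded at a in powers of b - a with coefficients kap_k
    eta_k(a). The choice kap_0 = 1 fixes the diagonal value also for r = 1. Since [Tc] is defined at
    every centre, the formula is the same near all points of I. *)
Definition bvp (r : C) (eta : C -> C) (a b : C) : C := ps (fun k => kap r k * Tc eta a k) (b - a).

Lemma bvp_sol (r : C) (eta : C -> C) (c : C) (d0 : R) : lbh eta c -> 0 < d0 ->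
  (forall a k, Cmod (a - c) < d0 -> k <> 0%nat -> RtoC (INR k) + (1 - r) = 0 -> Tc eta a k = 0) ->
  exists d M, 0 < d /\ sh (bvp r eta) c c d M /\
    forall a b, Cmod (a - c) < d -> Cmod (b - c) < d -> Ef r (bvp r eta) a b = (1 - r) * eta b /\ bvp r eta a a = eta a.
Proof.
  intros [R0 [M [HR Heta]]] Hd0 Hres.
  (* For |a - c| < 2s the disc of radius 2s around a stays inside the disc of radius 4s = R0. *)
  set (s := (R0 / 4)%R). set (s0 := Rmin (s / 4) d0).
  assert (Hs : 0 < s) by (unfold s; lra). assert (Hs0 : 0 < s0) by (apply Rmin_case; lra).
  assert (ss : s0 <= s / 4) by apply Rmin_l. assert (sd : s0 <= d0) by apply Rmin_r.
  assert (ba : forall a, Cmod (a - c) < 2 * s -> bh eta a (2 * s) M).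
  { intros a Ha z Hz. apply Heta. assert (A := Cmod_tri3 z a c). unfold s in *. lra. }
  (* The coefficients at the moving centre a are those of eta(a + x) at the fixed centre x = 0, so
     [coef_hol] shows that they are holomorphic in a. *)
  assert (SH : sh (fun x a => eta (a + x)) 0 c (2 * s) M).
  { intros x a Hx Ha. replace (x - 0) with x in Hx by ring. destruct (ba a Ha (a + x)) as [[l Hl] Hm]; [replace (a + x - a) with x by ring; auto|].
    split; [|split; [|auto]].
    - eexists. apply (cd_comp eta (fun x => a + x)); [apply cd_plus; [apply cd_const|apply cd_id]|exact Hl].
    - eexists. apply (cd_comp eta (fun a => a + x)); [apply cd_plus; [apply cd_id|apply cd_const]|exact Hl]. }
  assert (TE : forall a, Cmod (a - c) < 2 * s -> Tc (fun x => eta (a + x)) 0 = Tc eta a).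
  { intros a Ha. destruct (Tc_spec eta a (2 * s) s M ltac:(lra) (ba a Ha)) as [H1 H2].
    apply (Tc_eq _ 0 (Tc eta a) (2 * M) s); auto. intros w Hw. rewrite H2 by (replace (a + w - a) with (w - 0) by ring; auto). f_equal. ring. }
  assert (TH := coef_hol (fun x a => eta (a + x)) 0 c (2 * s) s M ltac:(lra) SH).
  destruct (kap_bound r) as [K [HK KB]].
  assert (CB : forall a, Cmod (a - c) < 2 * s -> cbd (fun k => kap r k * Tc eta a k) (K * (2 * M)) s).
  { intros a Ha k. rewrite Cmod_mult. unfold Rdiv. rewrite Rmult_assoc. apply Rmult_le_compat; try apply Cmod_ge_0; auto.
    destruct (Tc_spec eta a (2 * s) s M ltac:(lra) (ba a Ha)) as [H1 _]. apply H1. }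
  destruct (sh_series (fun m a => kap r m * Tc (fun x => eta (a + x)) 0 m) c s (s / 2) (K * (2 * M)) ltac:(lra)) as [M' HS].
  { intros m a Ha. destruct (TH m a ltac:(lra)) as [[l Hl] Hb]. split.
    - eexists. apply cd_scal. exact Hl.
    - rewrite Cmod_mult. unfold Rdiv. rewrite Rmult_assoc. apply Rmult_le_compat; try apply Cmod_ge_0; auto. }
  exists s0, M'. split; [auto|].
  assert (BE : forall a b, Cmod (a - c) < s0 -> Cmod (b - c) < s0 -> Cmod (b - a) < s / 2).
  { intros a b Ha Hb. assert (A := Cmod_tri3 b c a). rewrite (Cmod_sym c a) in A. lra. }
  assert (SB : sh (bvp r eta) c c s0 M').
  { assert (SB1 : sh (fun a b => ps (fun m => kap r m * Tc (fun x => eta (a + x)) 0 m) (b - a)) c c s0 M').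
    { intros a b Ha Hb. assert (Hx : Cmod (b - a - 0) < s / 2) by (replace (b - a - 0) with (b - a) by ring; auto).
      set (f := fun u v => ps (fun m => kap r m * Tc (fun x => eta (v + x)) 0 m) u) in *.
      split; [|split].
      - eexists. apply (sh_curve f 0 c (s / 2) M' (fun a => b - a) (fun a => a) a (0 - 1) 1); auto; [lra| |apply cd_id].
        apply cd_minus; [apply cd_const|apply cd_id].
      - eexists. apply (sh_curve f 0 c (s / 2) M' (fun b => b - a) (fun _ => a) b (1 - 0) 0); auto; [lra| |apply cd_const].
        apply cd_minus; [apply cd_id|apply cd_const].
      - apply (HS (b - a) a Hx). lra. }
    apply (sh_ext (fun a b => ps (fun m => kap r m * Tc (fun x => eta (a + x)) 0 m) (b - a))); [|exact SB1].
    intros a b Ha Hb. rewrite (TE a) by lra. reflexivity. }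
  split; [exact SB|]. intros a b Ha Hb. 
  destruct (Tc_spec eta a (2 * s) s M ltac:(lra) (ba a ltac:(lra))) as [TB TP].
  assert (CBa := CB a ltac:(lra)). assert (Bab := BE a b Ha Hb). split.
  - unfold Ef. replace (D2 (bvp r eta) a b) with (ps (dcoef (fun k => kap r k * Tc eta a k)) (b - a)).
    2:{ symmetry. apply Dc_eq. apply (cd_ps_at _ a (fun k => kap r k * Tc eta a k) (K * (2 * M)) s); try lra; auto; reflexivity. }
    unfold bvp. rewrite (ode_ps _ (K * (2 * M)) s (s / 2)) by (auto; lra).
    rewrite (TP b) by lra. rewrite <- (ps_scal (1 - r) (Tc eta a) (2 * M) s) by (auto; lra).
    f_equal. apply functional_extensionality. intros k. unfold kap.
    destruct (Nat.eq_dec k 0) as [->|n]; [simpl; ring|].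
    destruct (C_eq_dec (RtoC (INR k) + (1 - r)) 0) as [E|E].
    + rewrite (Hres a k) by (auto; lra). ring.
    + field. auto.
  - unfold bvp. rewrite sub_self, (ps_at0 _ (K * (2 * M)) s) by auto. unfold kap. simpl.
    rewrite (Tc_0 eta a (2 * s) M); [ring|lra|apply ba; lra].
Qed.

(** * Accumulation of real points *)

(** Excluding u = 0 makes the chart point finite even when p is infinity, so that conditions on
    finite t suffice in [diag_zero]. *)
Lemma open_phiR (I : P1R -> Prop) p : open_P1R I -> I p -> exists d, 0 < d /\ forall u : R, u <> 0%R -> Rabs u < d ->
  exists t : R, I (Some t) /\ phi p (RtoC u) = Some (RtoC t) /\ tp (Some t) = psi p (RtoC u).
Proof.
  intros [O1 O2] HI. destruct p as [t|].
  - destruct (O1 t HI) as [d Hd]. exists d. split; [apply cond_pos|]. intros u _ Hu. exists (t + u)%R.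
    split; [|split].
    + apply Hd. change (Rabs (t + u - t) < d). replace (t + u - t)%R with u by ring. auto.
    + simpl. rewrite RtoC_plus. reflexivity.
    + simpl. rewrite RtoC_plus. reflexivity.
  - destruct (O2 HI) as [M HM]. assert (P := Rabs_pos M). exists (Rmin 1 (/ (Rabs M + 1))).
    split; [apply Rmin_case; [lra|apply Rinv_0_lt_compat; lra]|]. intros u Hn Hu.
    destruct (lt_min Hu) as [u1 u2].
    assert (Nu : RtoC u <> 0) by (intros E; apply RtoC_inj in E; auto).
    assert (Ph : phi None (RtoC u) = Some (RtoC (/ u))) by (simpl; rewrite chart_inf_nz, RtoC_inv by auto; reflexivity).
    exists (/ u)%R. split; [|split].
    + apply HM. rewrite Rabs_inv. assert (Pu := Rabs_pos_lt u Hn). assert (A := Rle_abs M).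
      apply Rlt_le_trans with (Rabs M + 1)%R; [lra|]. rewrite <- (Rinv_inv (Rabs M + 1)). apply Rinv_le_contravar; lra.
    + exact Ph.
    + rewrite <- Ac_phi by (rewrite Cmod_R; auto). rewrite Ph. reflexivity.
Qed.

(** Finite real points of I other than p accumulate at p, and on them e vanishes: the identity
    theorem applies. *)
Lemma diag_zero (I : P1R -> Prop) p (e : C -> C) (d0 : R) : open_P1R I -> I p -> lbh e (tp p) -> 0 < d0 ->
  (forall t : R, I (Some t) -> Nb p d0 (Some (RtoC t)) -> e (tp (Some t)) = 0) ->
  exists d, 0 < d /\ forall a, Cmod (a - tp p) < d -> e a = 0.
Proof.
  intros HI Hp [r [M [Hr He]]] Hd0 H. exists r. split; auto. apply (identity_thm e (tp p) r M He).
  intros ep Hep. destruct (open_phiR I p HI Hp) as [d1 [Hd1 K1]]. destruct (Nb_phi p d0 Hd0) as [d2 [Hd2 [Hd2' K2]]].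
  destruct (lbh_cct _ _ (lbh_psi p) ep Hep) as [d3 [Hd3 K3]]. rewrite psi_0 in K3.
  set (u := (Rmin d1 (Rmin d2 d3) / 2)%R). assert (Pm : 0 < Rmin d1 (Rmin d2 d3)) by (repeat apply Rmin_case; auto).
  assert (m1 := Rmin_l d1 (Rmin d2 d3)). assert (m' := Rmin_r d1 (Rmin d2 d3)).
  assert (m2 := Rle_trans _ _ _ m' (Rmin_l _ _)). assert (m3 := Rle_trans _ _ _ m' (Rmin_r _ _)).
  assert (Au : Rabs u = u) by (apply Rabs_pos_eq; unfold u; lra).
  destruct (K1 u) as [t [T1 [T2 T3]]]; [unfold u; lra|rewrite Au; unfold u; lra|].
  exists (psi p (RtoC u)). split; [|split].
  - intros E. rewrite <- psi_0 in E. apply (f_equal (chi p)) in E.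
    rewrite !chi_psi in E; [apply RtoC_inj in E; unfold u in E; lra|rewrite Cmod_0; lra|rewrite Cmod_R, Au; unfold u; lra].
  - apply K3. replace (RtoC u - 0) with (RtoC u) by ring. rewrite Cmod_R, Au. unfold u; lra.
  - rewrite <- T3. apply H; auto. rewrite <- T2. apply K2. rewrite Cmod_R, Au. unfold u; lra.
Qed.

Lemma lbh_diag Gam c : lsh Gam c c -> lbh (fun x => Gam x x) c.
Proof.
  intros [r [M [Hr H]]]. apply (lbh_of _ c r Hr). intros z Hz. eexists.
  apply (sh_curve Gam c c r M (fun x => x) (fun x => x) z 1 1); auto; apply cd_id.
Qed.

Lemma Ac_real t : Ac (Some (RtoC t)) = tp (Some t).
Proof. reflexivity. Qed.

Lemma Bc_real t : Bc (Some (RtoC t)) = tp (Some t).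
Proof. simpl. rewrite Cconj_R. reflexivity. Qed.

(** * Sections built from local representatives *)

Lemma UH_open U : open_P1C U -> @open C_UniformSpace (UH U).
Proof.
  intros [O _]. apply open_C. intros z [H1 H2]. destruct (proj1 (open_C _) O z H1) as [d [Hd K]].
  exists (Rmin d (Im z)). split; [apply Rmin_case; auto|]. intros w Hw. split.
  - apply K. exact (proj1 (lt_min Hw)).
  - assert (A := Im_le_Cmod (w - z)). change (Im (w - z)) with (Im w - Im z)%R in A.
    assert (B := proj2 (lt_min Hw)). assert (C0 := Rle_abs (- (Im w - Im z))). rewrite Rabs_Ropp in C0. lra.
Qed.

Lemma Hb_restrict r U U' F : Hb r U F -> open_P1C U' -> (forall q, U' q -> U q) -> Hb r U' F.
Proof.
  intros [HO [[HV [HI [Fx [Fy [Fxx [Fxy [Fyx [Fyy [HC HP]]]]]]]]] [G [[G1 G2] G3]]]] HO' Hs.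
  assert (S : forall z, UH U' z -> UH U z) by (intros z [A B]; split; auto).
  split; [auto|split].
  - split; [apply UH_open; auto|split; [intros z Hz; apply HI; auto|]].
    exists Fx, Fy, Fxx, Fxy, Fyx, Fyy. split; [intros z Hz; apply HC; auto|intros z Hz; apply HP; auto].
  - exists G. split; [split; [intros z Hz; apply G1; auto|intros HN; apply G2; auto]|]. intros z Hz; apply G3; auto.
Qed.

Lemma real_analytic_at U G : real_analytic_P1 U G <-> forall q, U q -> ra_at G q.
Proof.
  split.
  - intros [H1 H2] [z|] Hq; [apply H1|apply H2]; auto.
  - intros H. split; [intros z Hz; apply (H (Some z) Hz)|intros Hz; apply (H None Hz)].
Qed.

Lemma Nb_near2 p d q : Nb p d q -> exists e, 0 < e /\ forall q', near2 q e q' -> Nb p d q'.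
Proof.
  intros [H1 [H2 [H3 H4]]]. exists (Rmin (d - Cmod (Ac q - tp p)) (d - Cmod (Bc q - tp p))).
  split; [apply Rmin_case; lra|]. intros q' [K1 [K2 [K3 K4]]].
  assert (A := proj1 (lt_min K3)). assert (B := proj2 (lt_min K4)).
  split; [auto|split; [auto|split]].
  - assert (T := Cmod_tri3 (Ac q') (Ac q) (tp p)). lra.
  - assert (T := Cmod_tri3 (Bc q') (Bc q) (tp p)). lra.
Qed.

(** The representative Gam and the radius may change with p; G, F and the total derivatives [DX],
    [DY] do not. Real analyticity and the equation are therefore checked point by point, on the
    union of the local neighbourhoods. *)
Lemma Hb_build (r : C) (I : P1R -> Prop) (G : P1C -> C) :
  (forall p, I p -> exists Gam d M, 0 < d /\ sh Gam (tp p) (tp p) d M /\ repG G Gam p d /\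
     forall a b, Cmod (a - tp p) < d -> Cmod (b - tp p) < d -> D1 (Ef r Gam) a b = 0) ->
  cont_germ r I (fun z => f_r r z * G (Some z)) G.
Proof.
  intros H. set (F := fun z => f_r r z * G (Some z)).
  set (harm := fun z => harm_eq r z (DX F z) (DY F z) (DX (DX F) z) (DY (DX F) z) (DX (DY F) z) (DY (DY F) z)).
  destruct (nbhd_assemble I (fun q => ra_at G q /\ forall z, q = Some z -> 0 < Im z -> RA F z /\ harm z)) as [U [HU [HQ Hi]]].
  { intros p Hp. destruct (H p Hp) as [Gam [d [M [Hd [SG [RG HE]]]]]]. exists d. split; auto.
    assert (LGq : forall q, Nb p d q -> lsh Gam (Ac q) (Bc q)).
    { intros q [_ [_ [A B]]]. apply (lsh_of_sh Gam (tp p) (tp p) d M); auto. }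
    assert (Loc : forall z, Nb p d (Some z) -> exists e, 0 < e /\ forall w, Cmod (w - z) < e ->
       F w = f_r r w * Gam (Ac (Some w)) (Bc (Some w))).
    { intros z Nz. destruct (proj1 (open_C _) (proj1 (Nb_open p d)) z Nz) as [e [He K]]. exists e. split; auto.
      intros w Hw. unfold F. rewrite (RG (Some w)) by (apply K; auto). reflexivity. }
    assert (RAz : forall z, UH (Nb p d) z -> RA F z).
    { intros z [Nz Hz]. assert (zi : z <> Ci) by (intros ->; apply (proj1 Nz); auto).
      assert (LG := LGq _ Nz). destruct (Loc z Nz) as [e [He K]].
      assert (LP : lsh (fun u v => fhat r u v * Gam (/ (u - Ci)) (/ (v - Ci))) z (Cconj z)).
      { apply lsh_mult; [apply lsh_fhat; auto|]. apply lsh_ab; auto; [apply Cminus_eq_contra; auto|apply conj_sub_i_nz; auto]. }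
      destruct LP as [s [M' [Hs SP]]].
      exists (fun u v => fhat r u v * Gam (/ (u - Ci)) (/ (v - Ci))), (Rmin s e), M'.
      split; [apply Rmin_case; auto|]. split; [apply (sh_shrink _ _ _ s); auto; apply Rmin_l|].
      intros w Hw. rewrite K; [reflexivity|exact (proj2 (lt_min Hw))]. }
    assert (C2 := RA_C2 (UH (Nb p d)) F RAz).
    intros q Nq. split.
    - destruct (Nb_near2 p d q Nq) as [e [He K]].
      apply (S2R G Gam q e He (proj1 Nq) (proj1 (proj2 Nq)) (LGq q Nq)). intros q' Hq'. apply RG; auto.
    - intros z -> Hz. assert (UHz : UH (Nb p d) z) by (split; auto). split; [apply RAz; auto|].
      assert (zi : z <> Ci) by (intros ->; apply (proj1 Nq); auto).
      destruct (Loc z Nq) as [e [He K]].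
      apply (harm_iff r (UH (Nb p d)) F _ _ _ _ _ _ Gam z e (UH_open _ (Nb_open p d)) UHz C2 Hz zi (LGq _ Nq) He K).
      destruct Nq as [_ [_ [A B]]]. apply HE; auto. }
  assert (Cont : continuation r U F G).
  { split.
    - apply real_analytic_at. intros q Hq. apply HQ; auto.
    - intros z [Uz _] zi. unfold F. field. apply f_r_nz; auto. }
  exists U. split; [auto|split; [|auto]]. destruct HU as [HO HI]. split; [auto|split].
  - split; [apply UH_open; auto|split; [intros z [_ Hz]; auto|]].
    exists (DX F), (DY F), (DX (DX F)), (DY (DX F)), (DX (DY F)), (DY (DY F)). split.
    + apply RA_C2. intros z [Uz Hz]. apply (proj2 (HQ (Some z) Uz) z eq_refl Hz).
    + intros z [Uz Hz]. exact (proj2 (proj2 (HQ (Some z) Uz) z eq_refl Hz)).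
  - exists G. auto.
Qed.

Lemma D1_Ef_of_indep (r : C) Gam (H : C -> C) c d M : sh Gam c c d M ->
  (forall a b, Cmod (a - c) < d -> Cmod (b - c) < d -> Ef r Gam a b = H b) ->
  forall a b, Cmod (a - c) < d -> Cmod (b - c) < d -> D1 (Ef r Gam) a b = 0.
Proof.
  intros _ E a b Ha Hb. apply Dc_eq. apply (cd_ext_loc (fun _ => H b) _ a _ (d - Cmod (a - c))); [lra| |apply cd_const].
  intros w Hw. symmetry. apply E; auto. assert (A := Cmod_tri3 w a c). lra.
Qed.

(** * The isomorphism of sheaves *)

Lemma structure_of_cont_germ r I F G : cont_germ r I F G -> forall p, I p ->
  exists Gam d M, 0 < d /\ sh Gam (tp p) (tp p) d M /\ repG G Gam p d /\
    (forall z, Nb p d (Some z) -> 0 < Im z -> F z = f_r r z * Gam (Ac (Some z)) (Bc (Some z))) /\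
    forall a b, Cmod (a - tp p) < d -> Cmod (b - tp p) < d -> Ef r Gam a b = (1 - r) * Gam b b.
Proof.
  intros [U [[HO HN] [HB HC]]] p Hp.
  destruct HB as [_ [Hh _]].
  destruct (structure_thm r U F G p HO (HN p Hp) Hh HC) as [Gam [d [M [Hd [SG [RG [Sub E]]]]]]].
  exists Gam, d, M. split; [auto|split; [auto|split; [auto|split; [|auto]]]].
  intros z Nz Hz. assert (zi : z <> Ci) by (intros ->; apply (proj1 Nz); auto).
  rewrite <- RG by auto. destruct HC as [_ HC]. rewrite HC; [|split; auto|auto].
  field. apply f_r_nz; auto.
Qed.

Lemma one_sub_nz (r : C) : r <> 1 -> 1 - r <> 0.
Proof. intros H E. apply H. apply Ceq_minus in E. auto. Qed.

Lemma Wsec_cont_germ r I F : Wsec r I F -> exists G, cont_germ r I F G.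
Proof.
  intros [U [HU HB]]. assert (HB' := HB). destruct HB' as [_ [_ [G HG]]]. exists G, U. auto.
Qed.

Definition flip (q : P1C) : P1C := match q with Some z => Some (Cconj z) | None => None end.

Lemma Ac_flip q : Ac (flip q) = Bc q.
Proof. destruct q; reflexivity. Qed.

Lemma Bc_flip q : Bc (flip q) = Ac q.
Proof. destruct q as [z|]; [|reflexivity]. simpl. rewrite Cconj_conj. reflexivity. Qed.

Lemma Nb_flip p d q : Nb p d q -> Nb p d (flip q).
Proof.
  intros [H1 [H2 [H3 H4]]]. split; [|split; [|rewrite Ac_flip, Bc_flip; auto]].
  - destruct q as [z|]; [|discriminate]. intros E. apply H2. f_equal. apply Some_inj in E.
    rewrite <- (Cconj_conj z), E. apply Cconj_Ci.
  - destruct q as [z|]; [|discriminate]. intros E. apply H1. f_equal. apply Some_inj in E.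
    rewrite <- (Cconj_conj z), E, Copp_conj, Cconj_Ci. ring.
Qed.

(* The boundary value (1-r)^-1 ((b-a) G_b + (1-r) G), a function of b only, written in the variable z and
   evaluated at the conjugate point, where b becomes 1/(z-i). This avoids any gluing of local extensions. *)
Definition bdry (r : C) (G : P1C -> C) (q : P1C) : C :=
  match q with
  | None => G None
  | Some z => G (Some (Cconj z)) + / (1 - r) * ((z - Cconj z) * (z - Ci) / (Cconj z - Ci)) *
      ((DX (fun w => G (Some w)) (Cconj z) + Ci * DY (fun w => G (Some w)) (Cconj z)) / 2)
  end.

Lemma bdry_local (r : C) G Gam p d M : r <> 1 -> 0 < d -> sh Gam (tp p) (tp p) d M -> repG G Gam p d ->
  (forall a b, Cmod (a - tp p) < d -> Cmod (b - tp p) < d -> Ef r Gam a b = (1 - r) * Gam b b) ->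
  forall q, Nb p d q -> bdry r G q = Gam (Ac q) (Ac q).
Proof.
  intros Hr Hd SG RG E q Nq. assert (Nr := one_sub_nz r Hr). destruct q as [z|].
  2:{ unfold bdry. apply (RG None Nq). }
  assert (Nf := Nb_flip p d _ Nq). simpl in Nf.
  assert (Ni : z - Ci <> 0) by (apply Cminus_eq_contra; intros ->; apply (proj1 Nq); auto).
  assert (Nc : Cconj z - Ci <> 0) by (apply Cminus_eq_contra; intros E0; apply (proj1 Nf); rewrite E0; auto).
  set (w := Cconj z) in *. assert (cw : Cconj w = z) by apply Cconj_conj.
  destruct Nf as [F1 [F2 [F3 F4]]]. simpl in F3, F4. rewrite cw in F4.
  set (a := / (w - Ci)) in *. set (b := / (z - Ci)) in *.
  assert (Lab : lsh Gam a b).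
  { apply (lsh_of_sh Gam (tp p) (tp p) d M); auto. }
  set (Phi := fun u v => Gam (/ (u - Ci)) (/ (v - Ci))).
  assert (LP : lsh Phi w z).
  { apply lsh_ab; auto. }
  destruct LP as [s [M' [Hs SP]]].
  assert (Nw : Nb p d (Some w)) by (split; [auto|split; [auto|simpl; rewrite cw; auto]]).
  destruct (proj1 (open_C _) (proj1 (Nb_open p d)) w Nw) as [e [He K]].
  set (s' := Rmin s e). assert (Hs' : 0 < s') by (apply Rmin_case; auto).
  assert (SP' : sh Phi w (Cconj w) s' M') by (rewrite cw; apply (sh_shrink Phi w z s); auto; apply Rmin_l).
  assert (RP : rep (fun w => G (Some w)) Phi w s').
  { intros x Hx. rewrite RG; [reflexivity|]. apply K. exact (proj2 (lt_min Hx)). }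
  assert (W0 : Cmod (w - w) < s') by (rewrite Cmod_self; auto).
  assert (EX := rep_DX _ _ _ _ _ SP' RP w W0). assert (EY := rep_DY _ _ _ _ _ SP' RP w W0).
  unfold bdry. fold w. rewrite EX, EY, cw. unfold Psx, Psy.
  (* The chain rule for b = 1/(zt - i). The factor -b^2 explains the rational coefficient in
     [bdry]. *)
  assert (E2 : D2 Phi w z = D2 Gam a b * (- (b * b))).
  { apply Dc_eq. apply (cd_comp (fun y => Gam a y) (fun v => / (v - Ci))); [apply cd_Cinv_shift; auto|]. apply lsh_cd2. exact Lab. }
  replace ((D1 Phi w z + D2 Phi w z + Ci * (Ci * (D1 Phi w z - D2 Phi w z))) / 2) with (D2 Phi w z).
  2:{ replace (Ci * (Ci * (D1 Phi w z - D2 Phi w z))) with ((Ci * Ci) * (D1 Phi w z - D2 Phi w z)) by ring. rewrite Ci_sq. field. }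
  rewrite E2. change (Ac (Some z)) with b.
  assert (EE := E a b F3 F4). unfold Ef in EE.
  assert (GG : G (Some w) = Gam a b) by (rewrite (RG _ Nw); simpl; rewrite cw; reflexivity).
  rewrite GG. replace (Gam b b) with (/ (1 - r) * ((b - a) * D2 Gam a b + (1 - r) * Gam a b)) by (rewrite EE; field; auto).
  unfold a, b. field. auto.
Qed.

Lemma bdry_real (r : C) G p : bdry r G (P1R_to_P1C p) = G (P1R_to_P1C p).
Proof. destruct p as [t|]; simpl; [|reflexivity]. rewrite Cconj_R, sub_self. unfold Cdiv. ring. Qed.

(** At r = 1 the equation reduces to (b - a) G_b = 0, the case n = 0 of [power_sol]. *)
Lemma D2_zero_of_r1 Gam c d M : 0 < d -> sh Gam c c d M ->
  (forall a b, Cmod (a - c) < d -> Cmod (b - c) < d -> Ef 1 Gam a b = (1 - 1) * Gam b b) ->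
  forall a b, Cmod (a - c) < d -> Cmod (b - c) < d -> (b - a) * D2 Gam a b = RtoC (INR 0) * Gam a b.
Proof.
  intros Hd SG E a b Ha Hb. assert (EE := E a b Ha Hb). unfold Ef in EE. simpl.
  replace ((b - a) * D2 Gam a b) with ((b - a) * D2 Gam a b + (1 - 1) * Gam a b) by ring. rewrite EE. ring.
Qed.

Lemma lbh_near f c : lbh f c -> exists d, 0 < d /\ forall a, Cmod (a - c) < d -> exists l, cd f a l.
Proof. intros [r [M [Hr H]]]. exists r. split; auto. intros a Ha. apply H; auto. Qed.

Lemma hol_at_Nb h eta p d : lbh eta (tp p) -> 0 < d -> (forall q, Nb p d q -> h q = eta (Ac q)) ->
  exists d', 0 < d' /\ d' <= d /\ forall q, Nb p d' q -> hol_at h q.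
Proof.
  intros Le Hd E. destruct (lbh_near _ _ Le) as [e [He K]].
  exists (Rmin d e). split; [apply Rmin_case; auto|]. split; [apply Rmin_l|]. intros q Nq.
  apply (holo_at_of_eta (Nb p (Rmin d e)) h eta q (Nb_open _ _) Nq).
  - intros q' N'. apply (proj1 N').
  - intros q' N'. apply E. apply (Nb_mono p (Rmin d e)); auto. apply Rmin_l.
  - apply K. destruct Nq as [_ [_ [A _]]]. exact (proj2 (lt_min A)).
Qed.

Lemma rho_well_defined (r : C) I F : Wsec r I F -> exists h, Vsec I h /\ rho_eq r I F h.
Proof.
  intros HW. destruct (Wsec_cont_germ r I F HW) as [G HG].
  assert (Str := structure_of_cont_germ r I F G HG).
  (* For r = 1 the division by 1 - r in [bdry] is impossible; instead G = d(a) is itself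
     holomorphic. *)
  destruct (C_eq_dec r 1) as [->|Hr].
  - exists G. split.
    + destruct (nbhd_assemble I (hol_at G)) as [U [HU [HQ _]]].
      { intros p Hp. destruct (Str p Hp) as [Gam [d [M [Hd [SG [RG [_ E]]]]]]].
        destruct (power_sol Gam (tp p) d M 0 Hd SG (D2_zero_of_r1 Gam (tp p) d M Hd SG E)) as [df [d' [Hd' [Ldf Pw]]]].
        destruct (hol_at_Nb G df p (Rmin d d') Ldf) as [d'' [Hd'' [_ K]]]; [apply Rmin_case; auto| |exists d''; auto].
        intros q Nq. rewrite (RG q) by (apply (Nb_mono p (Rmin d d')); auto; apply Rmin_l).
        destruct Nq as [_ [_ [A B]]]. rewrite Pw by (eapply Rlt_le_trans; eauto; apply Rmin_r). simpl. ring. }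
      exists U. split; auto. apply holo_P1_at. auto.
    + exists G. split; auto.
  - exists (bdry r G). split.
    + destruct (nbhd_assemble I (hol_at (bdry r G))) as [U [HU [HQ _]]].
      { intros p Hp. destruct (Str p Hp) as [Gam [d [M [Hd [SG [RG [_ E]]]]]]].
        destruct (hol_at_Nb (bdry r G) (fun x => Gam x x) p d) as [d' [Hd' [_ K]]]; auto.
        - apply lbh_diag. exists d, M. auto.
        - apply (bdry_local r G Gam p d M); auto.
        - exists d'. auto. }
      exists U. split; auto. apply holo_P1_at. auto.
    + exists G. split; auto. intros p _. symmetry. apply bdry_real.
Qed.

(** The constant term vanishes because y(a) = 0, and for k >= 1 the factor k + 1 - r vanishes only
    if r is the integer k + 1 >= 2. *)
Lemma ode_unique (y : C -> C) (a r : C) (R0 M : R) : (forall n : nat, (2 <= n)%nat -> r <> RtoC (INR n)) ->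
  0 < R0 -> bh y a R0 M -> y a = 0 -> (forall b, Cmod (b - a) < R0 -> (b - a) * Dc y b + (1 - r) * y b = 0) ->
  forall b, Cmod (b - a) < R0 -> y b = 0.
Proof.
  intros Hr HR Hy Hya E b Hb. assert (A := ode_coef y (fun _ => 0) a (1 - r) R0 M 0 HR Hy (bh_zero a R0) E).
  assert (B0 := Cmod_ge_0 (b - a)).
  destruct (Tc_spec y a R0 ((Cmod (b - a) + R0) / 2) M ltac:(lra) Hy) as [H1 H2].
  rewrite H2 by lra. apply ps_null. intros [|k].
  - rewrite (Tc_0 y a R0 M); auto.
  - specialize (A (S k)). rewrite Tc_zero in A.
    assert (N : RtoC (INR (S k)) + (1 - r) <> 0).
    { intros F. apply (Hr (S (S k))); [lia|]. rewrite (S_INR (S k)), RtoC_plus. symmetry. apply Ceq_minus. rewrite <- F. ring. }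
    replace (Tc y a (S k)) with (/ (RtoC (INR (S k)) + (1 - r)) * ((RtoC (INR (S k)) + (1 - r)) * Tc y a (S k))) by (field; auto).
    rewrite A. ring.
Qed.

Lemma sh_minus f g a b r M N : sh f a b r M -> sh g a b r N -> sh (fun u v => f u v - g u v) a b r (M + N).
Proof.
  intros Hf Hg u v Hu Hv. destruct (Hf u v Hu Hv) as [[l1 F1] [[l2 F2] F3]]. destruct (Hg u v Hu Hv) as [[m1 G1] [[m2 G2] G3]].
  split; [|split].
  - eexists. apply (cd_minus (fun x => f x v) (fun x => g x v)); eauto.
  - eexists. apply (cd_minus (fun x => f u x) (fun x => g u x)); eauto.
  - eapply Rle_trans; [apply Cmod_sub_le|]. lra.
Qed.

(** The difference of the two representatives vanishes on the diagonal by [diag_zero], so it solves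
    the homogeneous equation in b for each fixed a, with value 0 at b = a. *)
Lemma rho_injective (r : C) I F1 F2 h : (forall n : nat, (2 <= n)%nat -> r <> RtoC (INR n)) -> open_P1R I ->
  rho_eq r I F1 h -> rho_eq r I F2 h -> Wgerm_eq I F1 F2.
Proof.
  intros Hr HI [G1 [HG1 E1]] [G2 [HG2 E2]].
  destruct (nbhd_assemble I (fun q => forall z, q = Some z -> 0 < Im z -> F1 z = F2 z)) as [U [HU [HQ _]]].
  { intros p Hp.
    destruct (structure_of_cont_germ r I F1 G1 HG1 p Hp) as [Ga1 [d1 [M1 [Hd1 [SG1 [RG1 [FF1 Eq1]]]]]]].
    destruct (structure_of_cont_germ r I F2 G2 HG2 p Hp) as [Ga2 [d2 [M2 [Hd2 [SG2 [RG2 [FF2 Eq2]]]]]]].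
    set (d := Rmin d1 d2). assert (Hd : 0 < d) by (apply Rmin_case; auto).
    assert (m1 : d <= d1) by apply Rmin_l. assert (m2 : d <= d2) by apply Rmin_r.
    apply (sh_shrink _ _ _ _ d) in SG1; auto. apply (sh_shrink _ _ _ _ d) in SG2; auto.
    set (Del := fun a b => Ga1 a b - Ga2 a b).
    assert (SD : sh Del (tp p) (tp p) d (M1 + M2)) by (apply sh_minus; auto).
    assert (D2D : forall a b, Cmod (a - tp p) < d -> Cmod (b - tp p) < d -> D2 Del a b = D2 Ga1 a b - D2 Ga2 a b).
    { intros a b Ha Hb. apply Dc_eq. apply (cd_minus (fun x => Ga1 a x) (fun x => Ga2 a x)); eapply sh_cd2; eauto. }
    assert (ED : forall a b, Cmod (a - tp p) < d -> Cmod (b - tp p) < d -> (b - a) * D2 Del a b + (1 - r) * Del a b = (1 - r) * Del b b).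
    { intros a b Ha Hb. rewrite D2D by auto. assert (A1 := Eq1 a b ltac:(lra) ltac:(lra)). assert (A2 := Eq2 a b ltac:(lra) ltac:(lra)).
      unfold Ef in A1, A2. unfold Del.
      replace ((b - a) * (D2 Ga1 a b - D2 Ga2 a b) + (1 - r) * (Ga1 a b - Ga2 a b)) with
        (((b - a) * D2 Ga1 a b + (1 - r) * Ga1 a b) - ((b - a) * D2 Ga2 a b + (1 - r) * Ga2 a b)) by ring.
      rewrite A1, A2. ring. }
    destruct (diag_zero I p (fun x => Del x x) d HI Hp) as [d3 [Hd3 Z]]; auto.
    { apply lbh_diag. exists d, (M1 + M2)%R. auto. }
    { intros t It Nt. unfold Del. assert (A1 := E1 (Some t) It). assert (A2 := E2 (Some t) It). simpl in A1, A2.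
      rewrite RG1 in A1 by (apply (Nb_mono p d); auto). rewrite RG2 in A2 by (apply (Nb_mono p d); auto).
      rewrite Ac_real, Bc_real in A1, A2. rewrite A1, A2. ring. }
    (* For a within d4 of the centre the disc of radius 2 d4 around a contains b and stays within
       distance 3 d4, where the equation and the vanishing on the diagonal both hold. *)
    set (d4 := (Rmin d d3 / 3)%R). assert (Pm : 0 < Rmin d d3) by (apply Rmin_case; auto).
    assert (m3 := Rmin_l d d3). assert (m4 := Rmin_r d d3).
    exists d4. split; [unfold d4; lra|]. intros q Nq z -> Hz.
    assert (Nq' : Nb p d (Some z)) by (apply (Nb_mono p d4); auto; unfold d4; lra).
    rewrite FF1, FF2 by (auto; apply (Nb_mono p d); auto).
    destruct Nq as [_ [_ [A B]]]. set (a := Ac (Some z)) in *. set (b := Bc (Some z)) in *.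
    f_equal. apply Ceq_minus. change (Del a b = 0).
    apply (ode_unique (fun y => Del a y) a r (2 * d4) (M1 + M2) Hr); [unfold d4; lra| | | |].
    - intros y Hy. destruct (SD a y) as [_ [H1 H2]]; [unfold d4 in *; lra| |auto].
      assert (T := Cmod_tri3 y a (tp p)). unfold d4 in *; lra.
    - apply Z. unfold d4 in *; lra.
    - intros y Hy. assert (T := Cmod_tri3 y a (tp p)).
      change (Dc (fun y => Del a y) y) with (D2 Del a y).
      rewrite ED by (unfold d4 in *; lra). rewrite Z by (unfold d4 in *; lra). ring.
    - assert (T := Cmod_tri3 b (tp p) a). rewrite (Cmod_sym (tp p) a) in T. lra. }
  exists U. split; auto. intros z [Uz Hz]. apply (HQ (Some z) Uz z eq_refl Hz).
Qed.

Lemma rho_surjective (r : C) I h : (forall n : nat, (2 <= n)%nat -> r <> RtoC (INR n)) -> Vsec I h ->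
  exists F, Wsec r I F /\ rho_eq r I F h.
Proof.
  intros Hr [U [[HO HN] Hh]]. set (eta := fun a => h (pt a)).
  set (G := fun q => bvp r eta (Ac q) (Bc q)).
  assert (Loc : forall p, I p -> exists d M, 0 < d /\ sh (bvp r eta) (tp p) (tp p) d M /\
    forall a b, Cmod (a - tp p) < d -> Cmod (b - tp p) < d -> Ef r (bvp r eta) a b = (1 - r) * eta b /\ bvp r eta a a = eta a).
  { intros p Hp. apply (bvp_sol r eta (tp p) 1); [|lra|].
    - apply (holo_eta U); auto.
    (* A resonance at k >= 1 would mean r = k + 1, an excluded integer. *)
    - intros a k _ Hk E. exfalso. destruct k as [|k]; [auto|]. apply (Hr (S (S k))); [lia|].
      rewrite (S_INR (S k)), RtoC_plus. symmetry. apply Ceq_minus. rewrite <- E. ring. }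
  assert (CG : cont_germ r I (fun z => f_r r z * G (Some z)) G).
  { apply Hb_build. intros p Hp. destruct (Loc p Hp) as [d [M [Hd [SB E]]]].
    exists (bvp r eta), d, M. split; [auto|split; [auto|split; [intros q _; reflexivity|]]].
    apply (D1_Ef_of_indep r (bvp r eta) (fun b => (1 - r) * eta b) (tp p) d M); auto.
    intros a b Ha Hb. apply E; auto. }
  exists (fun z => f_r r z * G (Some z)). split.
  - destruct CG as [V [HV [HB _]]]. exists V. auto.
  - exists G. split; auto. intros p Hp. destruct (Loc p Hp) as [d [M [Hd [SB E]]]].
    assert (EA : Ac (P1R_to_P1C p) = tp p) by (destruct p; reflexivity).
    assert (EB : Bc (P1R_to_P1C p) = tp p) by (destruct p; [apply Bc_real|reflexivity]).
    unfold G. rewrite EA, EB. destruct (E (tp p) (tp p)) as [_ E2]; try (rewrite Cmod_self; auto).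
    rewrite E2. unfold eta. rewrite <- EA, pt_Ac; auto.
    apply (proj1 (Nb_self p 1 Rlt_0_1)).
Qed.

(** * Holomorphic sections and residues *)

Lemma Cexp'_nat (n : nat) (w : C) : Cexp' (RtoC (INR n) * w) = Cexp' w ^ n.
Proof.
  induction n as [|n IH].
  - simpl INR. replace (0 * w) with (RtoC 0) by ring. apply Cexp'_0.
  - rewrite S_INR, RtoC_plus. replace ((RtoC (INR n) + 1) * w) with (w + RtoC (INR n) * w) by ring.
    rewrite Cexp'_plus, IH. reflexivity.
Qed.

Lemma Cpow_rhp_nat (w : C) (n : nat) : 0 < Re w -> Cpow_rhp w (RtoC (INR n)) = w ^ n.
Proof. intros H. unfold Cpow_rhp. rewrite Cexp'_nat, Cexp'_log; auto. Qed.

(** f_r for r = n + 1, written with an integer power; unlike the principal branch it is also the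
    right formula in the lower half-plane, where [hext] needs it. *)
Definition frn (n : nat) (z : C) : C := (2 * Ci) / (z - Ci) * (qf z (Cconj z)) ^ n.

Lemma f_r_nat (n : nat) (z : C) : 0 < Im z -> f_r (RtoC (INR (S n))) z = frn n z.
Proof.
  intros Hz. rewrite f_r_fhat. unfold fhat, frn. f_equal.
  replace (RtoC (INR (S n)) - 1) with (RtoC (INR n)) by (rewrite S_INR, RtoC_plus; ring).
  apply Cpow_rhp_nat, qf_Re, Hz.
Qed.

Lemma Cpow_mult (a b : C) n : (a * b) ^ n = a ^ n * b ^ n.
Proof. induction n as [|n IH]; simpl; [ring|]. rewrite IH. ring. Qed.

(* For nonreal z, (conj z - i)/(conj z - z) = - a / (b - a). *)
Lemma frn_cancel (n : nat) (z c : C) : Im z <> 0%R -> z - Ci <> 0 -> Cconj z - Ci <> 0 ->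
  frn n z * (c * (Bc (Some z) - Ac (Some z)) ^ n) = 2 * Ci * Ac (Some z) * (- Ac (Some z)) ^ n * c.
Proof.
  intros Hz N1 N2. assert (N3 : Cconj z - z <> 0).
  { intros E. assert (A : Im (Cconj z - z) = 0%R) by (rewrite E; reflexivity). change (- Im z - Im z = 0)%R in A. lra. }
  unfold frn, Ac, Bc, qf. unfold Cdiv at 1.
  transitivity (2 * Ci * / (z - Ci) * (((Cconj z - Ci) / (Cconj z - z)) ^ n * (/ (Cconj z - Ci) - / (z - Ci)) ^ n) * c); [ring|].
  rewrite <- Cpow_mult. f_equal. f_equal. f_equal. field. auto.
Qed.

(** The limit of F at q from the upper half-plane, measured in the coordinates a and b so that
    infinity is included. *)
Definition vlim (F : C -> C) (q : P1C) (l : C) : Prop :=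
  forall e, 0 < e -> exists d, 0 < d /\ forall z, near2 q d (Some z) -> 0 < Im z -> Cmod (F z - l) < e.

Lemma near2_Nb p d q : near2 (P1R_to_P1C p) d q <-> Nb p d q.
Proof.
  unfold near2, Nb. destruct p as [t|]; simpl P1R_to_P1C; [rewrite Ac_real, Bc_real|]; reflexivity.
Qed.

Lemma vlim_unique F p l l' : vlim F (P1R_to_P1C p) l -> vlim F (P1R_to_P1C p) l' -> l = l'.
Proof.
  intros H1 H2. apply C_eq_lim. intros e He.
  destruct (H1 (e / 2)%R ltac:(lra)) as [d1 [Hd1 K1]]. destruct (H2 (e / 2)%R ltac:(lra)) as [d2 [Hd2 K2]].
  destruct (Nb_phi p (Rmin d1 d2)) as [s [Hs [_ K]]]; [apply Rmin_case; auto|].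
  destruct (phi_Im p 0 (sgp p * (s / 4))) as [z [Ez Hz]]; [rewrite <- Rmult_assoc, sgp_sq; lra|].
  assert (N : Nb p (Rmin d1 d2) (Some z)).
  { rewrite <- Ez. apply K. apply Cmod_uv; [rewrite Rabs_R0; lra|]. rewrite Rabs_mult, Rabs_sgp, Rabs_pos_eq; lra. }
  specialize (K1 z). specialize (K2 z).
  assert (A1 := K1 (proj2 (near2_Nb p d1 _) (Nb_mono p _ _ _ (Rmin_l d1 d2) N)) Hz).
  assert (A2 := K2 (proj2 (near2_Nb p d2 _) (Nb_mono p _ _ _ (Rmin_r d1 d2) N)) Hz).
  assert (T := Cmod_tri3 l (F z) l'). rewrite (Cmod_sym l (F z)) in T. lra.
Qed.

(** The candidate for the holomorphic extension of F: f_r G on both sides of the real line, and on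
    the line itself, where this formula breaks down, the limit of F from above. *)
Definition hext (n : nat) (F : C -> C) (G : P1C -> C) (q : P1C) : C :=
  let lim := epsilon (inhabits (RtoC 0)) (vlim F q) in
  match q with
  | Some z => if Req_dec_T (Im z) 0 then lim else frn n z * G q
  | None => lim
  end.

Lemma Nb_upper_lim F eta p d q : Nb p d q -> (exists p', q = P1R_to_P1C p') -> cct eta (Ac q) ->
  (forall z, Nb p d (Some z) -> 0 < Im z -> F z = eta (Ac (Some z))) ->
  epsilon (inhabits (RtoC 0)) (vlim F q) = eta (Ac q).
Proof.
  intros Nq [p' Eq] Ce E.
  assert (V : vlim F q (eta (Ac q))).
  { intros e He. destruct (Ce e He) as [d1 [Hd1 K1]]. destruct (Nb_near2 p d q Nq) as [d2 [Hd2 K2]].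
    exists (Rmin d1 d2). split; [apply Rmin_case; auto|]. intros z [H1 [H2 [H3 H4]]] Hz.
    rewrite E; [apply K1; exact (proj1 (lt_min H3))| |auto].
    apply K2. split; [auto|split; [auto|split]]; eapply Rlt_le_trans; eauto; apply Rmin_r. }
  rewrite Eq in *. apply (vlim_unique F p'); auto. apply epsilon_spec. eauto.
Qed.

(** By [power_sol], G = d(a) (b - a)^n; the last factor cancels the denominator of f_r, so that F is
    a holomorphic function of a alone up to and across the real line. *)
Lemma hol_part (n : nat) (I : P1R -> Prop) F G : cont_germ (RtoC (INR (S n))) I F G ->
  (forall p, I p -> exists Gam d M, 0 < d /\ sh Gam (tp p) (tp p) d M /\ repG G Gam p d /\
    (forall z, Nb p d (Some z) -> 0 < Im z -> F z = f_r (RtoC (INR (S n))) z * Gam (Ac (Some z)) (Bc (Some z))) /\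
    forall a b, Cmod (a - tp p) < d -> Cmod (b - tp p) < d -> (b - a) * D2 Gam a b = RtoC (INR n) * Gam a b) ->
  Wholsec (RtoC (INR (S n))) I F.
Proof.
  intros [U0 [[HO0 HN0] [HB0 HC0]]] H.
  destruct (nbhd_assemble I (fun q => U0 q /\ hol_at (hext n F G) q /\
     forall z, q = Some z -> 0 < Im z -> (exists l, cd F z l) /\ hext n F G q = F z)) as [U [HU [HQ _]]].
  { intros p Hp. destruct (H p Hp) as [Gam [d [M [Hd [SG [RG [FF E]]]]]]].
    destruct (power_sol Gam (tp p) d M n Hd SG E) as [df [d1 [Hd1 [Ldf Pw]]]].
    destruct (Nb_small U0 p HO0 (HN0 p Hp)) as [d2 [Hd2 K2]].
    (* The product f_r G after the cancellation in [frn_cancel], as a function of a. *)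
    set (theta := fun a => 2 * Ci * a * (- a) ^ n * df a).
    assert (Lt : lbh theta (tp p)).
    { destruct Ldf as [s [M' [Hs Hdf]]]. apply (lbh_of _ _ s Hs). intros a Ha. destruct (Hdf a Ha) as [[l Hl] _].
      eexists. apply (cd_mult (fun a => 2 * Ci * a * (- a) ^ n) df); [|exact Hl].
      apply (cd_mult (fun a => 2 * Ci * a) (fun a => (- a) ^ n)); [apply cd_scal, cd_id|].
      apply (cd_comp (fun w => w ^ n) (fun a => - a)); [apply cd_opp, cd_id|apply cd_pow]. }
    destruct (lbh_near _ _ Lt) as [d3 [Hd3 Th]].
    set (dd := Rmin (Rmin d d1) (Rmin d2 d3)). assert (Hdd : 0 < dd) by (repeat apply Rmin_case; auto).
    assert (l1 : dd <= d) by (eapply Rle_trans; [apply Rmin_l|apply Rmin_l]).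
    assert (l2 : dd <= d1) by (eapply Rle_trans; [apply Rmin_l|apply Rmin_r]).
    assert (l3 : dd <= d2) by (eapply Rle_trans; [apply Rmin_r|apply Rmin_l]).
    assert (l4 : dd <= d3) by (eapply Rle_trans; [apply Rmin_r|apply Rmin_r]).
    assert (Gq : forall q, Nb p dd q -> G q = df (Ac q) * (Bc q - Ac q) ^ n).
    { intros q Nq. rewrite (RG q) by (apply (Nb_mono p dd); auto). destruct Nq as [_ [_ [A B]]]. apply Pw; lra. }
    assert (Fr : forall z, Nb p dd (Some z) -> Im z <> 0%R -> frn n z * G (Some z) = theta (Ac (Some z))).
    { intros z Nz Hz. assert (Nf := Nb_flip p dd _ Nz). rewrite Gq by auto. rewrite frn_cancel; auto.
      - apply Cminus_eq_contra. intros ->. apply (proj1 Nz); auto.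
      - apply Cminus_eq_contra. intros E0. apply (proj1 Nf). simpl. rewrite E0. auto. }
    assert (Fu : forall z, Nb p dd (Some z) -> 0 < Im z -> F z = theta (Ac (Some z))).
    { intros z Nz Hz. rewrite FF by (auto; apply (Nb_mono p dd); auto). rewrite f_r_nat by auto.
      rewrite <- (RG (Some z)) by (apply (Nb_mono p dd); auto). apply Fr; auto. lra. }
    assert (Ct : forall q, Nb p dd q -> cct theta (Ac q)).
    { intros q [_ [_ [A _]]]. destruct (Th (Ac q)) as [l Hl]; [lra|]. eapply cd_cct; eauto. }
    assert (He : forall q, Nb p dd q -> hext n F G q = theta (Ac q)).
    { intros q Nq. destruct q as [z|]; unfold hext.
      - destruct (Req_dec_T (Im z) 0) as [Z|Z]; [|apply Fr; auto].
        apply (Nb_upper_lim F theta p dd); auto. exists (Some (Re z)). simpl. f_equal. destruct z as [x y]. simpl in *. unfold RtoC. f_equal. exact Z.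
      - apply (Nb_upper_lim F theta p dd); auto. exists None. reflexivity. }
    destruct (hol_at_Nb (hext n F G) theta p dd Lt Hdd He) as [d4 [Hd4 [l5 K4]]].
    exists d4. split; auto. intros q Nq. split; [apply K2; apply (Nb_mono p d4); auto; lra|split; [apply K4; auto|]].
    intros z -> Hz. assert (Nz : Nb p dd (Some z)) by (apply (Nb_mono p d4); auto).
    split.
    - destruct (proj1 (open_C _) (proj1 (Nb_open p dd)) z Nz) as [e [Hpe Ke]].
      assert (Ni : z - Ci <> 0) by (apply Cminus_eq_contra; intros ->; apply (proj1 Nz); auto).
      destruct (Th (Ac (Some z))) as [l Hl]; [destruct Nz as [_ [_ [A _]]]; lra|].
      eexists. apply (cd_ext_loc (fun w => theta (/ (w - Ci))) F z _ (Rmin e (Im z))); [apply Rmin_case; auto| |].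
      + intros w Hw. symmetry. apply (Fu w).
        * apply Ke. exact (proj1 (lt_min Hw)).
        * assert (A := Im_le_Cmod (w - z)). change (Im (w - z)) with (Im w - Im z)%R in A.
          assert (B := proj2 (lt_min Hw)). assert (C0 := Rle_abs (- (Im w - Im z))). rewrite Rabs_Ropp in C0. lra.
      + apply (cd_comp theta (fun w => / (w - Ci))); [apply cd_Cinv_shift; auto|exact Hl].
    - rewrite He by auto. symmetry. apply Fu; auto. }
  exists U. split; auto. destruct HU as [HO HN]. split; [|split].
  - apply (Hb_restrict _ U0); auto. intros q Hq. apply HQ; auto.
  - intros z [Uz Hz]. apply ex_derive_cd. destruct (HQ _ Uz) as [_ [_ K]]. apply (K z eq_refl Hz).
  - exists (hext n F G). split.
    + apply holo_P1_at. intros q Hq. apply HQ; auto.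
    + intros z [Uz Hz]. destruct (HQ _ Uz) as [_ [_ K]]. apply (K z eq_refl Hz).
Qed.

Lemma Wgerm_eq_refl r I F : Wsec r I F -> Wgerm_eq I F F.
Proof. intros [U [HU _]]. exists U. auto. Qed.

Lemma hol_r1 I F : Wsec (RtoC 1) I F -> exists F', Wholsec (RtoC 1) I F' /\ Wgerm_eq I F F'.
Proof.
  intros HW. exists F. split; [|apply (Wgerm_eq_refl 1 I F HW)].
  destruct (Wsec_cont_germ 1 I F HW) as [G HG].
  change (RtoC 1) with (RtoC (INR 1)) in *. apply (hol_part 0 I F G HG).
  intros p Hp. destruct (structure_of_cont_germ _ I F G HG p Hp) as [Gam [d [M [Hd [SG [RG [FF E]]]]]]].
  exists Gam, d, M. split; [auto|split; [auto|split; [auto|split; [auto|]]]].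
  apply (D2_zero_of_r1 Gam (tp p) d M); auto.
Qed.

Lemma Cpown_pow (z : C) n : Cpown z n = z ^ n.
Proof. induction n as [|n IH]; simpl; [reflexivity|rewrite IH; reflexivity]. Qed.

Lemma res_val_zero (n : nat) G t : res_val n G t = 0 -> G (Some (RtoC t)) = 0.
Proof.
  unfold res_val. rewrite Cpown_pow. intros H. assert (N : (Ci - RtoC t) ^ (n - 2) <> 0).
  { apply Cpow_nz. replace (Ci - RtoC t) with (- (RtoC t - Ci)) by ring. intros E. apply (t_sub_i_nz t).
    replace (RtoC t - Ci) with (- - (RtoC t - Ci)) by ring. rewrite E. ring. }
  replace (G (Some (RtoC t))) with (/ (Ci - RtoC t) ^ (n - 2) * ((Ci - RtoC t) ^ (n - 2) * G (Some (RtoC t)))) by (field; auto).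
  rewrite H. ring.
Qed.

(** Vanishing of the residue on finite real points makes the diagonal values vanish near each p; the
    equation becomes (b - a) G_b = n G with n = r - 1, which is the hypothesis of [hol_part]. *)
Lemma kernel_hol (n : nat) I F G : open_P1R I -> cont_germ (RtoC (INR (S n))) I F G ->
  (forall t : R, I (Some t) -> res_val (S n) G t = 0) -> Wholsec (RtoC (INR (S n))) I F.
Proof.
  intros HI HG Hres. apply (hol_part n I F G HG). intros p Hp.
  destruct (structure_of_cont_germ _ I F G HG p Hp) as [Gam [d [M [Hd [SG [RG [FF E]]]]]]].
  destruct (diag_zero I p (fun x => Gam x x) d HI Hp) as [d1 [Hd1 Z]]; auto.
  { apply lbh_diag. exists d, M. auto. }
  { intros t It Nt. specialize (Hres t It). apply res_val_zero in Hres. rewrite RG in Hres by auto.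
    rewrite Ac_real, Bc_real in Hres. exact Hres. }
  exists Gam, (Rmin d d1), M. assert (m1 := Rmin_l d d1). assert (m2 := Rmin_r d d1).
  split; [apply Rmin_case; auto|]. split; [apply (sh_shrink _ _ _ d); auto|].
  split; [intros q Nq; apply RG; apply (Nb_mono p (Rmin d d1)); auto|].
  split; [intros z Nz; apply FF; apply (Nb_mono p (Rmin d d1)); auto|].
  intros a b Ha Hb. assert (EE := E a b ltac:(lra) ltac:(lra)). unfold Ef in EE. rewrite (Z b) in EE by lra.
  rewrite S_INR, RtoC_plus in EE.
  replace ((b - a) * D2 Gam a b) with ((b - a) * D2 Gam a b + (1 - (RtoC (INR n) + 1)) * Gam a b + RtoC (INR n) * Gam a b) by ring.
  rewrite EE. ring.
Qed.

(* F is bounded near t while f_r blows up there: compare both sides of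
   (conj z - z)^n (z - i) F = 2i (conj z - i)^n G along z = t + i y, y -> 0. *)
Lemma hol_in_kernel (n : nat) I F G : Wholsec (RtoC (INR (S (S n)))) I F -> cont_germ (RtoC (INR (S (S n)))) I F G ->
  forall t : R, I (Some t) -> res_val (S (S n)) G t = 0.
Proof.
  intros [U1 [[HO1 HN1] [_ [_ [Fh [HFh EFh]]]]]] HG t It.
  destruct (structure_of_cont_germ _ I F G HG (Some t) It) as [Gam [d [M [Hd [SG [RG [FF _]]]]]]].
  unfold res_val. cut (G (Some (RtoC t)) = 0); [intros ->; ring|].
  set (N := S n). set (z := fun y : C => RtoC t + Ci * y). set (zc := fun y : C => RtoC t - Ci * y).
  set (D := fun y : C => (2 * Ci * (zc y - Ci) ^ N * Gam (/ (z y - Ci)) (/ (zc y - Ci))) - ((zc y - z y) ^ N * (z y - Ci)) * Fh (Some (z y))).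
  assert (z0 : z 0 = RtoC t) by (unfold z; ring). assert (zc0 : zc 0 = RtoC t) by (unfold zc; ring).
  assert (Cz : cd z 0 (0 + Ci * 1)) by (apply cd_plus; [apply cd_const|apply cd_scal, cd_id]).
  assert (Czc : cd zc 0 (0 - Ci * 1)) by (apply cd_minus; [apply cd_const|apply cd_scal, cd_id]).
  assert (Nt := t_sub_i_nz t).
  assert (CD : cct D 0).
  { destruct HFh as [HF1 _]. destruct (proj1 (ex_derive_cd _ _) (HF1 (RtoC t) (HN1 (Some t) It))) as [lF HlF].
    eapply cd_cct. apply cd_minus.
    - apply (cd_mult (fun y => 2 * Ci * (zc y - Ci) ^ N) (fun y => Gam (/ (z y - Ci)) (/ (zc y - Ci)))).
      + apply cd_scal. apply (cd_comp (fun w => w ^ N) (fun y => zc y - Ci)); [apply cd_minus; [exact Czc|apply cd_const]|apply cd_pow].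
      + apply (sh_curve Gam (tp (Some t)) (tp (Some t)) d M (fun y => / (z y - Ci)) (fun y => / (zc y - Ci))); auto.
        * rewrite z0. simpl. rewrite Cmod_self; auto.
        * rewrite zc0. simpl. rewrite Cmod_self; auto.
        * apply (cd_invf (fun y => z y - Ci)); [rewrite z0; auto|]. apply cd_minus; [exact Cz|apply cd_const].
        * apply (cd_invf (fun y => zc y - Ci)); [rewrite zc0; auto|]. apply cd_minus; [exact Czc|apply cd_const].
    - apply (cd_mult (fun y => (zc y - z y) ^ N * (z y - Ci)) (fun y => Fh (Some (z y)))).
      + apply (cd_mult (fun y => (zc y - z y) ^ N) (fun y => z y - Ci)).
        * apply (cd_comp (fun w => w ^ N) (fun y => zc y - z y)); [apply cd_minus; [exact Czc|exact Cz]|apply cd_pow].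
        * apply cd_minus; [exact Cz|apply cd_const].
      + apply (cd_comp (fun w => Fh (Some w)) z); [exact Cz|]. rewrite z0. exact HlF. }
  destruct (Nb_small U1 (Some t) HO1 (HN1 (Some t) It)) as [d1 [Hd1 K1]].
  destruct (Nb_phi (Some t) (Rmin d d1)) as [s [Hs [_ K]]]; [apply Rmin_case; auto|].
  assert (DZ : forall y : R, 0 < y < s -> D (RtoC y) = 0).
  { intros y Hy. assert (N1 : Nb (Some t) (Rmin d d1) (Some (z (RtoC y)))).
    { apply (K (Ci * RtoC y)). rewrite Cmod_mult, Cmod_Ci, Cmod_R, Rabs_pos_eq; lra. }
    assert (Im1 : 0 < Im (z (RtoC y))) by (unfold z; simpl; lra).
    assert (Ec : Cconj (z (RtoC y)) = zc (RtoC y)).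
    { unfold z, zc. rewrite Cconj_plus, Cmult_conj, Cconj_Ci, !Cconj_R. ring. }
    assert (FE := FF _ (Nb_mono _ _ _ _ (Rmin_l d d1) N1) Im1).
    assert (UE : Fh (Some (z (RtoC y))) = F (z (RtoC y))).
    { apply EFh. split; auto. apply K1. apply (Nb_mono _ _ _ _ (Rmin_r d d1) N1). }
    unfold D. rewrite UE, FE, f_r_nat by auto. unfold frn, Ac, Bc, qf. rewrite Ec. fold N.
    assert (Ni : z (RtoC y) - Ci <> 0) by (apply Cminus_eq_contra; intros E0; apply (proj1 N1); rewrite E0; auto).
    assert (Nn : zc (RtoC y) - z (RtoC y) <> 0) by (rewrite <- Ec; apply conj_sub_nz; auto).
    set (g := Gam (/ (z (RtoC y) - Ci)) (/ (zc (RtoC y) - Ci))).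
    replace ((zc (RtoC y) - Ci) ^ N) with ((zc (RtoC y) - z (RtoC y)) ^ N * ((zc (RtoC y) - Ci) / (zc (RtoC y) - z (RtoC y))) ^ N).
    - field. auto.
    - rewrite <- Cpow_mult. f_equal. field. auto. }
  assert (D0 : D 0 = 0).
  { apply C_eq_lim. intros e He. destruct (CD e He) as [d2 [Hd2 K2]].
    set (y := (Rmin s d2 / 2)%R). assert (Py : 0 < Rmin s d2) by (apply Rmin_case; auto).
    assert (y1 := Rmin_l s d2). assert (y2 := Rmin_r s d2).
    specialize (K2 (RtoC y)). rewrite DZ in K2 by (unfold y; lra). left. rewrite Cmod_sym. apply K2.
    replace (RtoC y - 0) with (RtoC y) by ring. rewrite Cmod_R, Rabs_pos_eq; unfold y; lra. }
  unfold D in D0. rewrite z0, zc0, sub_self in D0.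
  (* Here r >= 2 enters: N = r - 1 is positive, so the term with F disappears in the limit. *)
  replace (0 ^ N) with (RtoC 0) in D0 by (unfold N; simpl; ring).
  rewrite RG by (apply (Nb_self (Some t)); auto). rewrite Ac_real, Bc_real. change (tp (Some t)) with (/ (RtoC t - Ci)).
  set (g := Gam (/ (RtoC t - Ci)) (/ (RtoC t - Ci))) in *.
  assert (N2 : 2 * Ci * (RtoC t - Ci) ^ N <> 0).
  { apply Cmult_neq_0; [apply Cmult_neq_0; [apply two_nz|apply Ci_nz]|apply Cpow_nz; auto]. }
  replace g with (/ (2 * Ci * (RtoC t - Ci) ^ N) * (2 * Ci * (RtoC t - Ci) ^ N * g)).
  - replace (2 * Ci * (RtoC t - Ci) ^ N * g) with (2 * Ci * (RtoC t - Ci) ^ N * g - 0 * (RtoC t - Ci) * Fh (Some (RtoC t))) by ring.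
    rewrite D0. ring.
  - set (k := 2 * Ci * (RtoC t - Ci) ^ N) in *. field. auto.
Qed.

(** * Boundary values that are polynomials *)

Fixpoint horner (c : nat -> C) (m : nat) (w : C) : C :=
  match m with O => 0 | S k => c O + w * horner (fun j => c (S j)) k w end.

Lemma ps_horner (m : nat) : forall c M r w, 0 < r -> cbd c M r -> Cmod w < r -> (forall k, (m <= k)%nat -> c k = 0) -> ps c w = horner c m w.
Proof.
  induction m as [|m IH]; intros c M r w Hr Hc Hw H.
  - apply ps_null. intros k. apply H. lia.
  - simpl. rewrite (ps_shift c M r) by auto. f_equal. f_equal.
    apply (IH _ (M / r)%R r); auto; [apply cbd_shift; auto|]. intros k Hk. apply H. lia.
Qed.

(** If the m-th coefficient vanishes at every centre near c, then the m-th derivative is 0 there and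
    f is a polynomial of degree below m. The induction passes from f to its derivative. *)
Lemma Tc_vanish (m : nat) : forall (f : C -> C) (c : C) (d M : R), 0 < d -> bh f c d M ->
  (forall a, Cmod (a - c) < d -> Tc f a m = 0) -> forall k, (m <= k)%nat -> Tc f c k = 0.
Proof.
  induction m as [|m IH]; intros f c d M Hd Hf H k Hk.
  - assert (Z : forall a, Cmod (a - c) < d -> f a = 0).
    { intros a Ha. rewrite <- (H a Ha). symmetry. apply (Tc_0 f a (d - Cmod (a - c)) M); [lra|].
      intros z Hz. apply Hf. assert (T := Cmod_tri3 z a c). lra. }
    rewrite (Tc_eq f c (fun _ => 0) 0 d Hd); [reflexivity| |].
    + intros j. rewrite Cmod_0. unfold Rdiv. lra.
    + intros w Hw. rewrite Z by auto. symmetry. apply ps_null. auto.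
  - destruct k as [|k]; [lia|].
    assert (TD : forall a, Cmod (a - c) < d -> Tc (Dc f) a = dcoef (Tc f a)).
    { intros a Ha. assert (Hfa : bh f a (d - Cmod (a - c)) M) by (intros z Hz; apply Hf; assert (T := Cmod_tri3 z a c); lra).
      set (e := (d - Cmod (a - c))%R) in *. assert (He : 0 < e) by (unfold e; lra).
      destruct (Tc_spec f a e (e / 2) M ltac:(lra) Hfa) as [T1 T2].
      destruct (dcoef_cbd _ _ (e / 2) (e / 4) ltac:(lra) T1) as [M' T3].
      apply (Tc_eq _ a _ M' (e / 4)); auto; [lra|]. intros w Hw. apply Dc_eq. apply (cd_ps_at f a (Tc f a) (2 * M) (e / 2)); auto; lra. }
    destruct (bh_Dc f c d (d / 2) M ltac:(lra) Hf) as [M' HD].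
    assert (A : Tc (Dc f) c k = 0).
    { apply (IH (Dc f) c (d / 2)%R M'); auto; [lra| |lia]. intros a Ha. rewrite TD by lra. unfold dcoef. rewrite H by lra. ring. }
    rewrite TD in A by (rewrite Cmod_self; auto). unfold dcoef in A.
    assert (N : RtoC (INR (S k)) <> 0) by (intros E; apply RtoC_inj in E; apply (not_0_INR (S k)); auto).
    replace (Tc f c (S k)) with (/ RtoC (INR (S k)) * (RtoC (INR (S k)) * Tc f c (S k))) by (field; auto). rewrite A. ring.
Qed.

Definition ispoly (n : nat) (f : R -> C) : Prop := exists c, forall t, f t = peval c n t.

Lemma peval_ext c c' n t : (forall k, (k <= n)%nat -> c k = c' k) -> peval c n t = peval c' n t.
Proof.
  induction n as [|n IH]; intros H; simpl; [apply H; lia|]. rewrite IH by (intros; apply H; lia). rewrite H by lia. reflexivity.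
Qed.

Lemma ispoly_plus n f g : ispoly n f -> ispoly n g -> ispoly n (fun t => f t + g t).
Proof.
  intros [c Hc] [e He]. exists (fun k => c k + e k). intros t. rewrite Hc, He. clear Hc He.
  induction n as [|n IH]; simpl; [reflexivity|]. rewrite <- IH. ring.
Qed.

Lemma ispoly_scal n (a : C) f : ispoly n f -> ispoly n (fun t => a * f t).
Proof.
  intros [c Hc]. exists (fun k => a * c k). intros t. rewrite Hc. clear Hc.
  induction n as [|n IH]; simpl; [reflexivity|]. rewrite <- IH. ring.
Qed.

Lemma ispoly_S n f : ispoly n f -> ispoly (S n) f.
Proof.
  intros [c Hc]. set (e := fun k => if Nat.eq_dec k (S n) then RtoC 0 else c k). exists e. intros t. rewrite Hc.
  change (peval e (S n) t) with (peval e n t + e (S n) * Cpown (RtoC t) (S n)).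
  replace (e (S n)) with (RtoC 0) by (unfold e; destruct (Nat.eq_dec (S n) (S n)); [reflexivity|contradiction]).
  rewrite (peval_ext c e n t); [ring|]. intros k Hk. unfold e. destruct (Nat.eq_dec k (S n)); [lia|reflexivity].
Qed.

Lemma ispoly_mulX n f : ispoly n f -> ispoly (S n) (fun t => RtoC t * f t).
Proof.
  intros [c Hc]. exists (fun k => match k with O => RtoC 0 | S j => c j end). intros t. rewrite Hc. clear Hc.
  induction n as [|n IH]; [simpl; ring|].
  change (peval c (S n) t) with (peval c n t + c (S n) * Cpown (RtoC t) (S n)).
  rewrite Cmult_plus_distr_l, IH.
  change (peval (fun k => match k with O => RtoC 0 | S j => c j end) (S (S n)) t) with
    (peval (fun k => match k with O => RtoC 0 | S j => c j end) (S n) t + c (S n) * Cpown (RtoC t) (S (S n))).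
  simpl Cpown. ring.
Qed.

Lemma ispoly_ext n f g : (forall t, f t = g t) -> ispoly n f -> ispoly n g.
Proof. intros E [c H]. exists c. intros t. rewrite <- E. auto. Qed.

Lemma ispoly_lin n (a b : C) f : ispoly n f -> ispoly (S n) (fun t => (a * RtoC t + b) * f t).
Proof.
  intros H. apply (ispoly_ext _ (fun t => a * (RtoC t * f t) + b * f t)); [intros; ring|].
  apply ispoly_plus; [apply ispoly_scal, ispoly_mulX, H|apply ispoly_S, ispoly_scal, H].
Qed.

Lemma ispoly_pow n : ispoly n (fun t => (RtoC t - Ci) ^ n).
Proof.
  induction n as [|n IH]; [exists (fun _ => 1); reflexivity|].
  apply (ispoly_ext _ (fun t => (1 * RtoC t + (- Ci)) * (RtoC t - Ci) ^ n)); [intros; simpl; ring|]. apply ispoly_lin, IH.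
Qed.

(** Each Horner step is paid for with one factor t - i: (t - i)(1/(t - i) - k) = 1 - k (t - i) is
    affine in t, so the degree grows by one per step. *)
Lemma horner_ispoly (k : C) (n : nat) : forall c, ispoly n (fun t => (RtoC t - Ci) ^ n * horner c (S n) (/ (RtoC t - Ci) - k)).
Proof.
  induction n as [|n IH]; intros c.
  - exists c. intros t. simpl. ring.
  - apply (ispoly_ext _ (fun t => c O * (RtoC t - Ci) ^ S n + ((- k) * RtoC t + (1 + k * Ci)) *
      ((RtoC t - Ci) ^ n * horner (fun j => c (S j)) (S n) (/ (RtoC t - Ci) - k)))).
    + intros t. assert (N := t_sub_i_nz t).
      change (horner c (S (S n)) (/ (RtoC t - Ci) - k)) with (c O + (/ (RtoC t - Ci) - k) * horner (fun j => c (S j)) (S n) (/ (RtoC t - Ci) - k)).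
      set (h := horner (fun j => c (S j)) (S n) (/ (RtoC t - Ci) - k)). rewrite Cpow_S'. set (p := (RtoC t - Ci) ^ n). field. auto.
    + apply ispoly_plus; [apply ispoly_scal, ispoly_pow|apply ispoly_lin, IH].
Qed.

Lemma pow_neg_sub (t : R) n : (Ci - RtoC t) ^ n = (-1) ^ n * (RtoC t - Ci) ^ n.
Proof. rewrite <- Cpow_mult. f_equal. ring. Qed.

Lemma open_P1R_of U I : open_P1C U -> open_P1R I -> open_P1R (fun q => I q /\ U (P1R_to_P1C q)).
Proof.
  intros [O1 O2] [O3 O4]. split.
  - intros x [Hx Ux]. destruct (O3 x Hx) as [d Hd]. destruct (proj1 (open_C _) O1 (RtoC x) Ux) as [e [He K]].
    assert (P : 0 < Rmin d e) by (apply Rmin_case; [apply cond_pos|auto]).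
    exists (mkposreal _ P). intros y Hy. change (Rabs (y - x) < Rmin d e) in Hy. split.
    + apply Hd. exact (proj1 (lt_min Hy)).
    + apply K. rewrite <- RtoC_minus, Cmod_R. exact (proj2 (lt_min Hy)).
  - intros [H1 H2]. destruct (O4 H1) as [M HM]. destruct (O2 H2) as [N HN]. exists (Rmax M N). intros x Hx. split.
    + apply HM. eapply Rle_lt_trans; [apply Rmax_l|exact Hx].
    + apply HN. rewrite Cmod_R. eapply Rle_lt_trans; [apply Rmax_r|exact Hx].
Qed.

(** The resonant coefficient k = r - 1 = n + 1 is compared at every centre a near [tp p], not only
    at one: vanishing on an open set of centres is what makes the diagonal value a polynomial in a.
    The factor (i - t)^(r-2) of the residue then turns it into a polynomial in t. *)
Lemma res_poly (n : nat) I F G : open_P1R I -> cont_germ (RtoC (INR (S (S n)))) I F G -> forall p, I p ->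
  exists (J : P1R -> Prop) (c : nat -> C), open_P1R J /\ J p /\ (forall q, J q -> I q) /\
    forall t : R, J (Some t) -> res_val (S (S n)) G t = peval c n t.
Proof.
  intros HI HG p Hp.
  destruct (structure_of_cont_germ _ I F G HG p Hp) as [Gam [d [M [Hd [SG [RG [_ E]]]]]]].
  set (r := RtoC (INR (S (S n)))) in *. set (eta := fun x => Gam x x).
  assert (Le : lbh eta (tp p)) by (apply (lbh_diag Gam); exists d, M; auto).
  destruct Le as [d1 [M1 [Hd1 He]]].
  set (d2 := (Rmin d d1 / 2)%R). assert (Pm : 0 < Rmin d d1) by (apply Rmin_case; auto).
  assert (m1 := Rmin_l d d1). assert (m2 := Rmin_r d d1). assert (Hd2 : 0 < d2) by (unfold d2; lra).
  assert (Nr : 1 - r <> 0).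
  { unfold r. intros E0. apply (not_0_INR (S n)); [lia|]. apply RtoC_inj.
    replace (RtoC (INR (S n))) with (- (1 - RtoC (INR (S (S n))))) by (rewrite (S_INR (S n)), RtoC_plus; ring). rewrite E0. ring. }
  assert (bha : forall a, Cmod (a - tp p) < d2 -> bh eta a d2 M1).
  { intros a Ha z Hz. apply He. assert (T := Cmod_tri3 z a (tp p)). unfold d2 in *; lra. }
  assert (TV : forall a, Cmod (a - tp p) < d2 -> Tc eta a (S n) = 0).
  { intros a Ha.
    assert (Hy : bh (fun y => Gam a y) a d2 M).
    { intros z Hz. destruct (SG a z) as [_ [H1 H2]]; [unfold d2 in *; lra| |auto]. assert (T := Cmod_tri3 z a (tp p)). unfold d2 in *; lra. }
    assert (HH : bh (fun y => (1 - r) * eta y) a d2 (Cmod (1 - r) * M1)).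
    { intros z Hz. destruct (bha a Ha z Hz) as [[l Hl] Hb]. split; [eexists; apply cd_scal; exact Hl|].
      rewrite Cmod_mult. apply Rmult_le_compat_l; [apply Cmod_ge_0|auto]. }
    assert (OC := ode_coef (fun y => Gam a y) (fun y => (1 - r) * eta y) a (1 - r) d2 M (Cmod (1 - r) * M1) Hd2 Hy HH).
    assert (OC' : (RtoC (INR (S n)) + (1 - r)) * Tc (fun y => Gam a y) a (S n) = Tc (fun y => (1 - r) * eta y) a (S n)).
    { apply OC. intros b Hb. apply E; [unfold d2 in *; lra|]. assert (T := Cmod_tri3 b a (tp p)). unfold d2 in *; lra. }
    (* At k = n + 1 the factor k + 1 - r is 0, so the right-hand side (1 - r) eta_k(a) must
       vanish. *)
    replace (RtoC (INR (S n)) + (1 - r)) with (RtoC 0) in OC' by (unfold r; rewrite (S_INR (S n)), RtoC_plus; ring).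
    destruct (Tc_spec eta a d2 (d2 / 2) M1 ltac:(lra) (bha a Ha)) as [T1 T2].
    rewrite (Tc_eq (fun y => (1 - r) * eta y) a (fun k => (1 - r) * Tc eta a k) (Cmod (1 - r) * (2 * M1)) (d2 / 2)) in OC'.
    - replace (Tc eta a (S n)) with (/ (1 - r) * ((1 - r) * Tc eta a (S n))) by (field; auto). rewrite <- OC'. ring.
    - lra.
    - apply cbd_scal; auto.
    - intros w Hw. rewrite (ps_scal (1 - r) (Tc eta a) (2 * M1) (d2 / 2)) by (auto; lra). rewrite T2; auto. }
  assert (bh0 : bh eta (tp p) d2 M1) by (apply bha; rewrite Cmod_self; auto).
  assert (CV := Tc_vanish (S n) eta (tp p) d2 M1 Hd2 bh0 TV).
  destruct (Tc_spec eta (tp p) d2 (d2 / 2) M1 ltac:(lra) bh0) as [T1 T2].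
  destruct (ispoly_scal n ((-1) ^ n) _ (horner_ispoly (tp p) n (Tc eta (tp p)))) as [c Hc].
  exists (fun q => I q /\ Nb p (d2 / 2) (P1R_to_P1C q)), c.
  split; [apply open_P1R_of; auto; apply Nb_open|]. split; [split; auto; apply Nb_self; lra|]. split; [intros q [H _]; auto|].
  intros t [_ Nt]. rewrite <- Hc. unfold res_val. rewrite Cpown_pow. replace (S (S n) - 2)%nat with n by lia.
  simpl P1R_to_P1C in Nt. rewrite (RG (Some (RtoC t))) by (apply (Nb_mono p (d2 / 2)); auto; unfold d2; lra).
  rewrite pow_neg_sub, Ac_real, Bc_real. destruct Nt as [_ [_ [A _]]]. rewrite Ac_real in A.
  change (Gam (tp (Some t)) (tp (Some t))) with (eta (tp (Some t))). rewrite (T2 _ A).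
  rewrite (ps_horner (S n) _ (2 * M1) (d2 / 2)) by (auto; lra). change (tp (Some t)) with (/ (RtoC t - Ci)). ring.
Qed.

(* f is a polynomial of degree at most N; all its Taylor expansions are recorded. *)
Definition PT (N : nat) (f : C -> C) : Prop := forall a, exists (c : nat -> C) (M : R),
  (forall k, (N < k)%nat -> c k = 0) /\ cbd c M 1 /\ forall x, Cmod (x - a) < 1 -> f x = ps c (x - a).

Lemma PT_Tc N f a k : PT N f -> (N < k)%nat -> Tc f a k = 0.
Proof. intros H Hk. destruct (H a) as [c [M [H1 [H2 H3]]]]. rewrite (Tc_eq f a c M 1); auto. lra. Qed.

Lemma PT_lbh N f a : PT N f -> lbh f a.
Proof.
  intros H. destruct (H a) as [c [M [H1 [H2 H3]]]]. apply (lbh_of _ a 1); [lra|]. intros z Hz.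
  eexists. apply (cd_ps_at f a c M 1); auto. lra.
Qed.

Lemma PT_plus N f g : PT N f -> PT N g -> PT N (fun x => f x + g x).
Proof.
  intros Hf Hg a. destruct (Hf a) as [c [M [H1 [H2 H3]]]]. destruct (Hg a) as [e [K [G1 [G2 G3]]]].
  exists (fun k => c k + e k), (M + K)%R. split; [intros k Hk; rewrite H1, G1 by auto; ring|].
  split; [apply cbd_plus; auto|]. intros x Hx. rewrite H3, G3 by auto. symmetry. apply (ps_plus c e M K 1); auto. lra.
Qed.

Lemma PT_scal N (s : C) f : PT N f -> PT N (fun x => s * f x).
Proof.
  intros Hf a. destruct (Hf a) as [c [M [H1 [H2 H3]]]]. exists (fun k => s * c k), (Cmod s * M)%R.
  split; [intros k Hk; rewrite H1 by auto; ring|]. split; [apply cbd_scal; auto|].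
  intros x Hx. rewrite H3 by auto. symmetry. apply (ps_scal s c M 1); auto. lra.
Qed.

Lemma PT_S N f : PT N f -> PT (S N) f.
Proof. intros Hf a. destruct (Hf a) as [c [M [H1 H2]]]. exists c, M. split; auto. intros k Hk. apply H1. lia. Qed.

Lemma PT_mulX N f : PT N f -> PT (S N) (fun x => x * f x).
Proof.
  intros Hf a. destruct (Hf a) as [c [M [H1 [H2 H3]]]].
  set (s := fun k => match k with O => RtoC 0 | S j => c j end).
  assert (Hs : cbd s M 1).
  { intros [|k]; simpl s.
    - rewrite Cmod_0. assert (A := cbd_nonneg _ _ _ H2). simpl. unfold Rdiv. rewrite Rinv_1. lra.
    - assert (A := H2 k). rewrite pow1 in *. exact A. }
  exists (fun k => a * c k + s k), (Cmod a * M + M)%R.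
  split; [intros [|k] Hk; [lia|]; simpl s; rewrite !H1 by lia; ring|].
  split; [apply cbd_plus; [apply cbd_scal; auto|auto]|].
  intros x Hx. rewrite (ps_plus (fun k => a * c k) s (Cmod a * M) M 1); auto; [|lra|apply cbd_scal; auto].
  rewrite (ps_scal a c M 1) by (auto; lra). rewrite (ps_shift s M 1) by (auto; lra). simpl s.
  change (fun k => c k) with c. rewrite <- H3 by auto. ring.
Qed.

Lemma PT_const (s : C) : PT 0 (fun _ => s).
Proof.
  intros a. exists (fun k => match k with O => s | S _ => 0 end), (Cmod s).
  assert (Hc : cbd (fun k => match k with O => s | S _ => 0 end) (Cmod s) 1).
  { intros [|k]; rewrite pow1; unfold Rdiv; rewrite Rinv_1; [lra|]. rewrite Cmod_0. assert (A := Cmod_ge_0 s). lra. }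
  split; [intros [|k] Hk; [lia|reflexivity]|]. split; [auto|].
  intros x Hx. rewrite (ps_shift _ (Cmod s) 1) by (auto; lra). rewrite (ps_null (fun _ => 0)) by auto. ring.
Qed.

Lemma PT_pow n : PT n (fun x => (Ci * x + 1) ^ n).
Proof.
  induction n as [|n IH]; [apply (PT_const 1)|].
  replace (fun x => (Ci * x + 1) ^ S n) with (fun x => Ci * (x * (Ci * x + 1) ^ n) + (Ci * x + 1) ^ n)
    by (apply functional_extensionality; intros x; simpl; ring).
  apply PT_plus; [apply PT_scal, PT_mulX, IH|apply PT_S, IH].
Qed.

(* The polynomial a^n c(i + 1/a). *)
Fixpoint revpoly (c : nat -> C) (n : nat) (a : C) : C :=
  match n with O => c O | S k => a * revpoly c k a + c (S k) * (Ci * a + 1) ^ S k end.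

Lemma PT_revpoly c n : PT n (revpoly c n).
Proof.
  induction n as [|n IH]; [apply PT_const|]. simpl revpoly.
  apply (PT_plus (S n) (fun a => a * revpoly c n a) (fun a => c (S n) * (Ci * a + 1) ^ S n)); [apply PT_mulX, IH|].
  apply PT_scal, PT_pow.
Qed.

Lemma revpoly_eval c n (t : R) : (RtoC t - Ci) ^ n * revpoly c n (/ (RtoC t - Ci)) = peval c n t.
Proof.
  assert (N := t_sub_i_nz t). induction n as [|n IH]; [simpl; ring|].
  transitivity ((RtoC t - Ci) ^ n * revpoly c n (/ (RtoC t - Ci)) + c (S n) * RtoC t ^ S n); [|rewrite IH, <- Cpown_pow; reflexivity].
  change (revpoly c (S n) (/ (RtoC t - Ci))) with (/ (RtoC t - Ci) * revpoly c n (/ (RtoC t - Ci)) + c (S n) * (Ci * / (RtoC t - Ci) + 1) ^ S n).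
  (* This is t = (t - i)(i/(t - i) + 1), raised to the power n + 1. *)
  assert (E : RtoC t ^ S n = (RtoC t - Ci) ^ S n * (Ci * / (RtoC t - Ci) + 1) ^ S n).
  { rewrite <- Cpow_mult. f_equal. field. auto. }
  rewrite E. set (h := revpoly c n (/ (RtoC t - Ci))). set (q := (Ci * / (RtoC t - Ci) + 1) ^ S n). rewrite Cpow_S'.
  set (p := (RtoC t - Ci) ^ n). field. auto.
Qed.

(** The polynomial is carried to the coordinate a as eta = (-a)^n c(i + 1/a), again of degree at
    most n. Its Taylor coefficient of index n + 1 is 0 at every centre, so the resonance in
    [bvp_sol] is harmless. The sign (-1)^n compensates for (i - t)^n in the residue. *)
Lemma res_surjective (n : nat) (p : P1R) (c : nat -> C) : exists I : P1R -> Prop, open_P1R I /\ I p /\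
  exists F G, cont_germ (RtoC (INR (S (S n)))) I F G /\ forall t : R, I (Some t) -> res_val (S (S n)) G t = peval c n t.
Proof.
  set (r := RtoC (INR (S (S n)))). set (eta := fun a => (-1) ^ n * revpoly c n a).
  assert (HP : PT n eta) by (apply PT_scal, PT_revpoly).
  destruct (bvp_sol r eta (tp p) 1) as [d [M [Hd [SB E]]]]; [apply (PT_lbh n); auto|lra| |].
  { intros a k _ _ E0. apply (PT_Tc n); auto.
    assert (K : k = S n).
    { apply INR_eq, RtoC_inj. apply Ceq_minus. rewrite <- E0. unfold r. rewrite (S_INR (S n)), RtoC_plus. ring. }
    lia. }
  set (G := fun q => bvp r eta (Ac q) (Bc q)).
  (* The conjunct [True] is the whole real projective line, intersected with the neighbourhood in
     the form that [open_P1R_of] expects. Half the radius leaves room to recentre the bidisc at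
     every point of I. *)
  set (I := fun q => True /\ Nb p (d / 2) (P1R_to_P1C q)).
  exists I. split.
  { apply open_P1R_of; [apply Nb_open|]. split; [intros x _; exists (mkposreal 1 Rlt_0_1); auto|]. intros _. exists 0%R. auto. }
  split; [split; [auto|apply Nb_self; lra]|].
  exists (fun z => f_r r z * G (Some z)), G. split.
  - apply Hb_build. intros q [_ Nq].
    assert (Tq : Cmod (tp q - tp p) < d / 2).
    { destruct Nq as [_ [_ [A _]]]. destruct q; simpl P1R_to_P1C in A; [rewrite Ac_real in A|]; exact A. }
    exists (bvp r eta), (d / 2)%R, M. split; [lra|].
    assert (S2 : sh (bvp r eta) (tp q) (tp q) (d / 2) M) by (apply (sh_recenter _ (tp p) (tp p) d); auto; lra).
    split; [auto|split; [intros x _; reflexivity|]].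
    apply (D1_Ef_of_indep r (bvp r eta) (fun b => (1 - r) * eta b) (tp q) (d / 2) M); auto.
    intros a b Ha Hb. assert (T1 := Cmod_tri3 a (tp q) (tp p)). assert (T2 := Cmod_tri3 b (tp q) (tp p)).
    apply E; lra.
  - intros t [_ Nt]. simpl P1R_to_P1C in Nt. unfold res_val, G. rewrite Cpown_pow, Ac_real, Bc_real.
    destruct Nt as [_ [_ [A _]]]. rewrite Ac_real in A.
    destruct (E (tp (Some t)) (tp (Some t))) as [_ ->]; try lra.
    replace (S (S n) - 2)%nat with n by lia. unfold eta. rewrite pow_neg_sub, <- (revpoly_eval c n t).
    change (tp (Some t)) with (/ (RtoC t - Ci)).
    replace ((-1) ^ n * (RtoC t - Ci) ^ n * ((-1) ^ n * revpoly c n (/ (RtoC t - Ci)))) with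
      (((-1) ^ n * (-1) ^ n) * ((RtoC t - Ci) ^ n * revpoly c n (/ (RtoC t - Ci)))) by ring.
    rewrite <- Cpow_mult. replace ((-1 * -1 : C) ^ n) with (RtoC 1); [ring|].
    replace (-1 * -1 : C) with (RtoC 1) by ring. symmetry. apply Cpow_1_l.
Qed.

Close Scope C_scope.
Open Scope R_scope.

Theorem theorem6p14 :
  (* (i) rho_r : W^omega_r -> V^omega_{2-r} is an isomorphism of sheaves, r in C \ Z_{>=2} *)
  (forall r : C, (forall n : nat, (2 <= n)%nat -> r <> RtoC (INR n)) ->
   forall I : P1R -> Prop, open_P1R I ->
     (* rho_r is well defined with values in V^omega_{2-r}(I) *)
     (forall F, Wsec r I F -> exists h, Vsec I h /\ rho_eq r I F h) /\
     (* injective *)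
     (forall F1 F2 h, Wsec r I F1 -> Wsec r I F2 ->
        rho_eq r I F1 h -> rho_eq r I F2 h -> Wgerm_eq I F1 F2) /\
     (* surjective *)
     (forall h, Vsec I h -> exists F, Wsec r I F /\ rho_eq r I F h)) /\
  (* (ii)(a) W^{omega,hol}_1 = W^omega_1 *)
  (forall I : P1R -> Prop, open_P1R I ->
     forall F, Wsec (RtoC 1) I F ->
       exists F', Wholsec (RtoC 1) I F' /\ Wgerm_eq I F F') /\
  (* (ii)(b) 0 -> W^{omega,hol}_r -> W^omega_r -> D^pol_{2-r} -> 0 exact, r >= 2 *)
  (forall r : nat, (2 <= r)%nat ->
     (forall I : P1R -> Prop, open_P1R I ->
        (* res_r is a morphism into the constant sheaf of polynomials of degree <= r-2 *)
        (forall F G, cont_germ (RtoC (INR r)) I F G ->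
           forall p, I p -> exists (J : P1R -> Prop) (c : nat -> C),
             open_P1R J /\ J p /\ (forall q, J q -> I q) /\
             forall t : R, J (Some t) -> res_val r G t = peval c (r - 2) t) /\
        (* W^{omega,hol}_r lies in the kernel of res_r *)
        (forall F G, Wholsec (RtoC (INR r)) I F -> cont_germ (RtoC (INR r)) I F G ->
           forall t : R, I (Some t) -> res_val r G t = RtoC 0) /\
        (* the kernel of res_r is W^{omega,hol}_r *)
        (forall F G, cont_germ (RtoC (INR r)) I F G ->
           (forall t : R, I (Some t) -> res_val r G t = RtoC 0) ->
           exists F', Wholsec (RtoC (INR r)) I F' /\ Wgerm_eq I F F')) /\
     (* res_r is surjective on stalks *)
     (forall (p : P1R) (c : nat -> C), exists I : P1R -> Prop,
        open_P1R I /\ I p /\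
        exists F G, cont_germ (RtoC (INR r)) I F G /\
          forall t : R, I (Some t) -> res_val r G t = peval c (r - 2) t)).
Proof.
  split; [|split].
  - intros r Hr I HI. split; [|split].
    + intros F HF. apply rho_well_defined; auto.
    + intros F1 F2 h _ _ H1 H2. apply (rho_injective r I F1 F2 h); auto.
    + intros h Hh. apply rho_surjective; auto.
  - intros I _ F HF. apply hol_r1; auto.
  - intros r Hr. destruct r as [|[|n]]; [lia|lia|].
    replace (S (S n) - 2)%nat with n by lia. split.
    + intros I HI. split; [|split].
      * intros F G HG p Hp. apply (res_poly n I F G HI HG p Hp).
      * intros F G HF HG t It. apply (hol_in_kernel n I F G HF HG t It).
      * intros F G HG Hres. exists F. split; [apply (kernel_hol (S n) I F G); auto|].
        destruct HG as [U [HU [HB _]]]. apply (Wgerm_eq_refl (RtoC (INR (S (S n))))). exists U. auto.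
    + intros p c. apply (res_surjective n p c).
Qed.
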